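(* Let $m,n,e,X,\omega(x;z),W,\Sigma^+,\Sigma_s^+,\Sigma_\ell^+$ be as in the context, and assume $e\le 1$ if $m$ is odd. Then for every $\sigma\in W$ and $x\in X$, $$\omega(x;z)=\Gamma_\sigma^{(e)}(z)\,\omega(x;\sigma(z)),\qquad \Gamma^{(e)}_\sigma(z)=\prod_{\alpha\in\Sigma^+(\sigma)}\gamma_\alpha^{(e)}(z),$$ where $\Sigma^+(\sigma)=\{\alpha\in\Sigma^+:-\sigma(\alpha)\in\Sigma^+\}$ and $\gamma_\alpha^{(e)}(z)=\dfrac{1-q^{-1+\langle\alpha,z\rangle}}{q^{\langle\alpha,z\rangle}-q^{-1}}$ if $\alpha\in\Sigma_s^+$; $\gamma_\alpha^{(e)}(z)=q^{e\langle\alpha,z\rangle}$ if $\alpha\in\Sigma_\ell^+$ and $m=2n$; $\gamma_\alpha^{(e)}(z)=\dfrac{q^{e\langle\alpha,z\rangle}(1-q^{-1+\langle\alpha,z\rangle})}{q^{\langle\alpha,z\rangle}-q^{-1}}$ if $\alpha\in\Sigma_\ell^+$ and $m=2n+1$.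
   Context: Let $k$ be a finite extension of $\mathbb{Q}_p$ with ring of integers $\mathcal{O}_k$, prime element $\pi$, residue field of cardinality $q$, valuation $v_\pi$ and absolute value $|\cdot|$ with $|\pi|=q^{-1}$; put $e=v_\pi(2)$. Let $k'$ be the unramified quadratic extension with ring of integers $\mathcal{O}_{k'}$ and $a^*$ the conjugate transpose of a matrix over $k'$. Let $m\ge2$, $n=\lfloor m/2\rfloor$, $j_m$ the $m\times m$ anti-diagonal matrix with entries $1$, $G=\{g\in GL_m(k'):g^*j_mg=j_m\}$, $X=\{x\in G:x^*=x,\ \det(t1_m-xj_m)=\det(t1_m-j_m)\}$ with action $g\cdot x=gxg^*$, $K=G\cap M_m(\mathcal{O}_{k'})$ with Haar measure $dk$ of mass $1$. For $y\in X$ let $d_i(y)$ ($1\le i\le n$) be the determinant of the lower right $i\times i$ block. For $x\in X$, $s\in\mathbb{C}^n$, $\omega(x;s)=\int_K\prod_i|d_i(k\cdot x)|^{s_i}dk$ (integrand $0$ if some $d_i(k\cdot x)=0$), continued from $\mathrm{Re}(s_i)\ge0$ to a rational function of the $q^{s_i}$; $\omega(x;z):=\omega(x;s)$ where $s_i=-z_i+z_{i+1}-1+\frac{\pi\sqrt{-1}}{\log q}$ ($1\le i<n$), $s_n=-z_n-\frac12$ ($m=2n$) or $s_n=-z_n-1+\frac{\pi\sqrt{-1}}{2\log q}$ ($m=2n+1$), with $\pi=3.14\ldots$ in exponents. $W$ is the group of signed permutations acting on $\mathbb{C}^n$ and on $\mathbb{Z}^n$, generated by permutations of coordinates and $\tau(z)=(z_1,\dots,z_{n-1},-z_n)$;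 $\langle\alpha,z\rangle=\sum_i\alpha_iz_i$. With $e_i$ the $i$-th unit vector of $\mathbb{Z}^n$: $\Sigma_s^+=\{e_i+e_j,\ e_i-e_j:1\le i<j\le n\}$, $\Sigma_\ell^+=\{2e_i:1\le i\le n\}$, $\Sigma^+=\Sigma_s^+\cup\Sigma_\ell^+$. *)

(* Defs.v *)
From HB Require Import structures.
From mathcomp Require Import all_boot all_order all_fingroup all_algebra all_field.
From mathcomp Require Import complex.
From mathcomp Require Import all_classical all_reals all_analysis.
From mathcomp Require Import -(notations) mpoly.
Set Implicit Arguments.
Unset Strict Implicit.
Unset Printing Implicit Defensive.
Import Order.TTheory GRing.Theory Num.Theory.
Local Open Scope classical_set_scope.
Local Open Scope ring_scope.

Definition padic_abs (R : realType) (p : nat) (r : rat) : R :=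
  if r == 0 then 0
  else p%:R ^ ((logn p `|denq r|)%:Z - (logn p `|numq r|)%:Z).

(* [(F, absF)] is the completion of the rationals for the p-adic absolute
   value, which determines it up to a unique isometric isomorphism. *)
Record is_padic_field (R : realType) (p : nat) (F : fieldType) (absF : F -> R)
    : Prop := IsPadicField {
  padic_prime : prime p;
  padic_ge0 : forall x, 0 <= absF x;
  padic_eq0 : forall x, absF x = 0 <-> x = 0;
  padicM : forall x y, absF (x * y) = absF x * absF y;
  padicD : forall x y, absF (x + y) <= absF x + absF y;
  padic_rat : forall r : rat, absF (ratr r) = padic_abs R p r;
  padic_dense : forall x (eps : R), 0 < eps ->
    exists r : rat, absF (x - ratr r) < eps;
  padic_complete : forall u : nat -> F,
    (forall eps : R, 0 < eps ->
      exists N, forall i j, (N <= i)%N -> (N <= j)%N -> absF (u i - u j) < eps) ->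
    exists l, forall eps : R, 0 < eps ->
      exists N, forall i, (N <= i)%N -> absF (u i - l) < eps
}.

Definition integral_closure (F : fieldType) (A : set F) (L : fieldExtType F)
    : set L :=
  [set x | exists P : {poly F},
     [/\ P \is monic, forall i, A P`_i & root (map_poly (in_alg L) P) x]].
Arguments integral_closure {F} A L _.

Definition ring_of_integers (R : realType) (F : fieldType) (absF : F -> R)
    (k : fieldExtType F) : set k :=
  integral_closure [set a : F | absF a <= 1] k.
Arguments ring_of_integers {R F} absF k _.

Definition unit_set (L : fieldType) (O : set L) : set L :=
  [set x | [/\ x != 0, O x & O x^-1]].

Definition nonunit_set (L : fieldType) (O : set L) : set L :=
  [set x | O x /\ ~ unit_set O x].

Definition prime_element (L : fieldType) (O : set L) (w : L) : Prop :=
  w != 0 /\ nonunit_set O = [set w * y | y in O].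

Definition residue_field (L : fieldType) (O : set L) : set (set L) :=
  [set [set y | O y /\ nonunit_set O (y - x)] | x in O].

(* Only meaningful for [x != 0]. *)
Definition valuation (L : fieldType) (O : set L) (w x : L) : int :=
  xget 0 [set n : int | unit_set O (x / w ^ n)].

(* On a quadratic unramified extension, with [q] the cardinality of the smaller
   residue field, this is the extension of the absolute value. *)
Definition nabs (R : realType) (L : fieldType) (O : set L) (w : L) (q : nat)
    (x : L) : R :=
  if x == 0 then 0 else q%:R ^ (- valuation O w x).

(* [Ok] is the ring of integers of [k] and [w] a prime element of it; the
   extension is unramified when [w] remains prime. *)
Definition unramified_quadratic (k : fieldType) (Ok : set k) (w : k)
    (k' : fieldExtType k) : Prop :=
  \dim {:k'} = 2%N /\ prime_element (integral_closure Ok k') w%:A.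

Definition antidiag (L : fieldType) (m : nat) : 'M[L]_m :=
  \matrix_(i, j) (j == rev_ord i)%:R.

Definition conj_trmx (L : fieldType) (c : L -> L) (m : nat) (a : 'M[L]_m)
    : 'M[L]_m :=
  map_mx c a^T.

Definition unitary_group (L : fieldType) (c : L -> L) (m : nat) : set 'M[L]_m :=
  [set g | g \in unitmx /\ conj_trmx c g *m antidiag L m *m g = antidiag L m].

Definition hermitian_space (L : fieldType) (c : L -> L) (m : nat)
    : set 'M[L]_m :=
  [set x | [/\ unitary_group c x, conj_trmx c x = x &
     char_poly (x *m antidiag L m) = char_poly (antidiag L m)]].

Definition act_mx (L : fieldType) (c : L -> L) (m : nat) (g x : 'M[L]_m)
    : 'M[L]_m :=
  g *m x *m conj_trmx c g.

Definition max_compact (L : fieldType) (O : set L) (c : L -> L) (m : nat)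
    : set 'M[L]_m :=
  [set g | unitary_group c g /\ forall i j, O (g i j)].
Arguments max_compact {L} O c m _.

Lemma half_ord_lt (m : nat) (i : 'I_m./2) : (i.+1 <= m)%N.
Proof.
by apply: leq_trans (ltn_ord i) _; rewrite -{2}[m]odd_double_half -addnn addnCA leq_addr.
Qed.

(* Position [a] in a block of size [i.+1] is sent to position
   [m - i.+1 + a], so that [corner_det y i] is the determinant of the lower
   right block of size [i.+1], i.e. d_(i+1)(y): indices start at 0. *)
Definition corner_ord (m : nat) (i : 'I_m./2) (a : 'I_i.+1) : 'I_m :=
  rev_ord (widen_ord (half_ord_lt i) (rev_ord a)).

Definition corner_det (L : fieldType) (m : nat) (y : 'M[L]_m) (i : 'I_m./2)
    : L :=
  \det (mxsub (@corner_ord m i) (@corner_ord m i) y).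

Definition open_mx (L : fieldType) (O : set L) (w : L) (m : nat)
    : set (set 'M[L]_m) :=
  [set U | forall x : 'M[L]_m, U x -> exists N : nat,
     forall y : 'M[L]_m, (forall i j, O ((y i j - x i j) / w ^+ N)) -> U y].

Definition pointed_mx (L : fieldType) (m : nat) : Type := 'M[L]_m.
HB.instance Definition _ (L : fieldType) (m : nat) :=
  Choice.on (pointed_mx L m).
HB.instance Definition _ (L : fieldType) (m : nat) :=
  isPointed.Build (pointed_mx L m) (0 : 'M[L]_m).

Definition borel_mx (L : fieldType) (O : set L) (w : L) (m : nat) :=
  g_sigma_algebraType (open_mx O w (m := m) : set (set (pointed_mx L m))).

(* The Haar measure of [K] of total mass 1, seen as a Borel measure on all
   matrices that is concentrated on [K]. *)
Definition is_haar (R : realType) (L : fieldType) (O : set L) (w : L) (m : nat)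
    (K : set 'M[L]_m) (mu : {measure set (borel_mx O w m) -> \bar R}) : Prop :=
  [/\ mu K = 1%E, mu (~` K) = 0%E &
      forall (g : 'M[L]_m) (A : set 'M[L]_m), K g ->
        measurable (A : set (borel_mx O w m)) ->
        mu [set g *m h | h in A] = mu A].

Local Open Scope complex_scope.

Definition cexp (R : realType) (s : R[i]) : R[i] :=
  (expR (complex.Re s) * cos (complex.Im s)) +i*
  (expR (complex.Re s) * sin (complex.Im s)).

(* [a ^ s] for [0 < a]. *)
Definition cpow (R : realType) (a : R) (s : R[i]) : R[i] :=
  cexp ((ln a)%:C * s).

Definition cintegral (R : realType) (d : measure_display)
    (T : measurableType d) (mu : {measure set T -> \bar R}) (D : set T)
    (f : T -> R[i]) : R[i] :=
  Rintegral mu D (fun t => complex.Re (f t)) +i*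
  Rintegral mu D (fun t => complex.Im (f t)).

Definition omega_integrand (R : realType) (L : fieldType) (O : set L) (w : L)
    (q m : nat) (y : 'M[L]_m) (s : 'rV[R[i]]_(m./2)) : R[i] :=
  if [forall i, corner_det y i != 0]
  then \prod_i cpow (nabs R O w q (corner_det y i)) (s 0 i) else 0.

Definition omega_integral (R : realType) (L : fieldType) (O : set L) (w : L)
    (c : L -> L) (q m : nat) (mu : {measure set (borel_mx O w m) -> \bar R})
    (x : 'M[L]_m) (s : 'rV[R[i]]_(m./2)) : R[i] :=
  cintegral mu (max_compact O c m)
    (fun h : 'M[L]_m => omega_integrand O w q (act_mx c h x) s).

(* Rational functions of the [q ^ s_i] are given by a numerator [P] and a
   denominator [Q]. *)
Definition eval_qpow (R : realType) (q n : nat) (Q : mpoly n R[i])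
    (s : 'rV[R[i]]_n) : R[i] :=
  meval (fun i => cpow q%:R (s 0 i)) Q.

Definition ratfun (R : realType) (q n : nat) (P Q : mpoly n R[i])
    (s : 'rV[R[i]]_n) : R[i] :=
  eval_qpow q P s / eval_qpow q Q s.

(* [P / Q] is the continuation of [omega(x; s)] from [Re s_i >= 0]; it is
   unique as a rational function. *)
Definition is_omega (R : realType) (L : fieldType) (O : set L) (w : L)
    (c : L -> L) (q m : nat) (mu : {measure set (borel_mx O w m) -> \bar R})
    (x : 'M[L]_m) (P Q : mpoly m./2 R[i]) : Prop :=
  Q != 0 /\
  forall s : 'rV[R[i]]_(m./2), (forall i, 0 <= complex.Re (s 0 i)) ->
    eval_qpow q Q s != 0 -> omega_integral c q mu x s = ratfun q P Q s.

(* [ordS i] is the index following [i]. *)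
Definition s_of_z (R : realType) (q m : nat) (z : 'rV[R[i]]_(m./2))
    : 'rV[R[i]]_(m./2) :=
  \row_i
    if (i.+1 < m./2)%N then
      - z 0 i + z 0 (ordS i) - 1 + (0 +i* (pi / ln q%:R))
    else if odd m then - z 0 i - 1 + (0 +i* (pi / (2 * ln q%:R)))
    else - z 0 i - 2^-1.

(* The pairs (permutation, signs) act as all the elements of the group generated
   by the permutations of the coordinates and the sign change of the last one. *)
Definition signed_perm (n : nat) : Type := ('S_n * {ffun 'I_n -> bool})%type.

Definition act_signed (V : pzRingType) (n : nat) (u : signed_perm n)
    (z : 'rV[V]_n) : 'rV[V]_n :=
  \row_i ((-1) ^+ u.2 i * z 0 (u.1 i)).

Definition unit_row (n : nat) (i : 'I_n) : 'rV[int]_n := delta_mx 0 i.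

Definition lt_pairs (n : nat) : seq ('I_n * 'I_n) :=
  [seq t : 'I_n * 'I_n <- enum {: 'I_n * 'I_n} | (t.1 < t.2)%N].

Definition short_roots (n : nat) : seq 'rV[int]_n :=
  [seq unit_row t.1 + unit_row t.2 | t <- lt_pairs n] ++
  [seq unit_row t.1 - unit_row t.2 | t <- lt_pairs n].

Definition long_roots (n : nat) : seq 'rV[int]_n :=
  [seq unit_row i *+ 2 | i <- enum 'I_n].

Definition pos_roots (n : nat) : seq 'rV[int]_n := short_roots n ++ long_roots n.

Definition pos_roots_of (n : nat) (u : signed_perm n) : seq 'rV[int]_n :=
  [seq a <- pos_roots n | - act_signed u a \in pos_roots n].

Definition pairing (R : realType) (n : nat) (a : 'rV[int]_n) (z : 'rV[R[i]]_n)
    : R[i] :=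
  \sum_i (a 0 i)%:~R * z 0 i.

Definition gamma_den (R : realType) (q n : nat) (a : 'rV[int]_n)
    (z : 'rV[R[i]]_n) : R[i] :=
  cpow q%:R (pairing a z) - (q%:R)^-1.

Definition gamma_factor (R : realType) (q e m : nat) (a : 'rV[int]_(m./2))
    (z : 'rV[R[i]]_(m./2)) : R[i] :=
  let r := (1 - cpow q%:R (- 1 + pairing a z)) / gamma_den q a z in
  if a \in short_roots m./2 then r
  else if odd m then cpow q%:R (e%:R * pairing a z) * r
  else cpow q%:R (e%:R * pairing a z).

Definition Gamma_factor (R : realType) (q e m : nat) (u : signed_perm m./2)
    (z : 'rV[R[i]]_(m./2)) : R[i] :=
  \prod_(a <- pos_roots_of u) gamma_factor q e a z.

(* [z] is not a pole of any factor of [Gamma_factor]: the denominator does not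
   occur for the long roots when [m] is even. *)
Definition Gamma_defined (R : realType) (q m : nat) (u : signed_perm m./2)
    (z : 'rV[R[i]]_(m./2)) : Prop :=
  forall a, a \in pos_roots_of u ->
    (a \in short_roots m./2) || odd m -> gamma_den q a z != 0.

(* Main.v *)
(* The idea is to let each simple reflection be produced by averaging over a
   compact rank-one subgroup of [K] that changes only the minor d_i: a copy of
   GL_2 for i < n, of U_2 or U_3 for i = n.  By left invariance of the Haar
   measure, the mass of a level set of the valuations of d_1(kx), ..., d_n(kx)
   is spanned by the local densities of binary hermitian forms, resp. of linear
   forms on isotropic lines, for which the generating series in q^(-s_i),
   multiplied by a fixed polynomial, is a polynomial that satisfies the
   functional equation of the reflection.  The integral converges only when all
   q^(-s_i) are in the unit disc, so this functional equation is transferred to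
   the rational function P/Q through its expansion in the other variables, whose
   coefficients are rational in q^(-s_i).  Finally the reflections are composed:
   cross-multiplied identities are between Laurent polynomials in the q^(z_i),
   which allows one to cancel Q at the intermediate points, and a descent of a
   Weyl group element removes exactly one root from Sigma^+(sigma). *)
Require Import Defs.
From HB Require Import structures.
From mathcomp Require Import all_boot all_order all_fingroup all_algebra all_field.
From mathcomp Require Import complex.
From mathcomp Require Import all_classical all_reals all_analysis.
From mathcomp Require Import -(notations) mpoly.
From mathcomp Require Import zify ring lra.
Import Order.TTheory GRing.Theory Num.Theory.
Local Open Scope classical_set_scope.
Local Open Scope ring_scope.
Local Open Scope complex_scope.
Set Implicit Arguments.
Unset Strict Implicit.
Unset Printing Implicit Defensive.

(** * Valuations of the quadratic extension *)

(** The orbits of K on X are never classified. While the other minors stay fixed, d_i(hkx) runs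
    through the values of a binary hermitian form if i < n, and through values t N(l) with l a
    linear form on isotropic lines if i = n. The parameters (A, r) of these local problems depend on
    kx in an unknown way, but one combination, 2A + r resp. A + r, is determined by the neighbouring
    minors and by e. It is the only one that the functional equation contains, so the equation is
    the same throughout the span and passes to the masses by linearity. For i = n the relevant Schur
    complement Y satisfies (YJ)^2 = 1, and the trace of YJ is its size minus 2; hence Y = J - (2/a)
    xi xi*, and this 2 is the origin of the powers q^(e<alpha,z>). The local counts use an element
    of trace 1 in place of 1/2. A reflection sends every point with |q^(-s_i)| <= 1 to one with
    |q^(-s_i)| > 1, so an integral is never compared with its image. What is compared are two
    expansions in the remaining variables, along lines on which q^(-s_i) is constant. *)

(** What the local computations use of the extension: [O] is the ring of integers of k', [c] the
    conjugation, [rho] lists representatives, fixed by [c], of the residue field with [q] elements,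
    and [th] generates [O] over its fixed elements because th - c(th) is a unit. The last condition
    is how unramifiedness enters. *)
Record unramified_pair (L : fieldType) (O : set L) (w : L) (c : L -> L)
    (q : nat) (rho : 'I_q -> L) (th : L) : Prop := UnramifiedPair {
  up_one : O 1;
  up_sub : forall x y, O x -> O y -> O (x - y);
  up_mul : forall x y, O x -> O y -> O (x * y);
  up_w0 : w != 0;
  up_w : O w;
  up_wV : ~ O w^-1;
  up_val : forall x, x != 0 -> exists j : int, unit_set O (x / w ^ j);
  up_cD : forall x y, c (x - y) = c x - c y;
  up_cM : forall x y, c (x * y) = c x * c y;
  up_c1 : c 1 = 1;
  up_cK : forall x, c (c x) = x;
  up_cw : c w = w;
  up_cO : forall x, O x -> O (c x);
  up_th : O th;
  up_disc : unit_set O (th - c th);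
  up_rhoO : forall i, O (rho i);
  up_rhoc : forall i, c (rho i) = rho i;
  up_rho_ex : forall x, O x -> c x = x -> exists i, O ((x - rho i) / w);
  up_rho_inj : forall i j, O ((rho i - rho j) / w) -> i = j
}.

(** Valuation at least [j], stated without [valuation] so that 0 satisfies it for every [j],
    whatever the default value of [valuation] at 0. *)
Definition vg (L : fieldType) (O : set L) (w : L) (j : int) (x : L) : Prop :=
  O (x / w ^ j).

Section Valuation.
Variables (L : fieldType) (O : set L) (w : L) (c : L -> L).
Variables (q : nat) (rho : 'I_q -> L) (th : L).
Hypothesis H : unramified_pair O w c rho th.
Notation vg := (vg O w).
Notation v := (valuation O w).
Implicit Types (x y : L) (i j : int).

Let w0 : w != 0 := up_w0 H.
Let wj0 j : w ^ j != 0. Proof. exact: expfz_neq0. Qed.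

Lemma O_zero : O 0.
Proof. by rewrite -(subrr 1); apply: (up_sub H); apply: (up_one H). Qed.
Lemma O_opp x : O x -> O (- x).
Proof. by move=> Ox; rewrite -sub0r; apply: (up_sub H) => //; exact: O_zero. Qed.
Lemma O_add x y : O x -> O y -> O (x + y).
Proof. by move=> Ox Oy; rewrite -[y]opprK; apply: (up_sub H) => //; apply: O_opp. Qed.
Lemma O_wexp n : O (w ^+ n).
Proof.
elim: n => [|n IH]; first by rewrite expr0; apply: (up_one H).
by rewrite exprS; apply: (up_mul H) => //; apply: (up_w H).
Qed.

Lemma vgE0 x : vg 0 x <-> O x.
Proof. by rewrite /vg expr0z divr1. Qed.
Lemma vg1E x : vg 1 x <-> O (x / w).
Proof. by rewrite /vg expr1z. Qed.
Lemma vg_zero j : vg j 0.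
Proof. by rewrite /vg mul0r; exact: O_zero. Qed.
Lemma vgN j x : vg j x -> vg j (- x).
Proof. by rewrite /vg mulNr; exact: O_opp. Qed.
Lemma vgD j x y : vg j x -> vg j y -> vg j (x + y).
Proof. by rewrite /vg mulrDl; exact: O_add. Qed.
Lemma vgB j x y : vg j x -> vg j y -> vg j (x - y).
Proof. by move=> hx hy; apply: vgD => //; apply: vgN. Qed.
Lemma vg_sum (I : Type) (r : seq I) (P : pred I) (F : I -> L) j :
  (forall k, P k -> vg j (F k)) -> vg j (\sum_(k <- r | P k) F k).
Proof.
move=> hF; elim/big_ind: _ => //; first exact: vg_zero.
by move=> x y; apply: vgD.
Qed.
Lemma vgM i j x y : vg i x -> vg j y -> vg (i + j) (x * y).
Proof.
rewrite /vg => hx hy; rewrite expfzDr // invfM mulrACA; exact: (up_mul H).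
Qed.
Lemma vg_le i j x : i <= j -> vg j x -> vg i x.
Proof.
rewrite /vg => ij hx.
have -> : x / w ^ i = (x / w ^ j) * w ^+ `|j - i|.
  have -> : w ^+ `|j - i| = w ^ (j - i) by rewrite exprnP; congr (_ ^ _); lia.
  by rewrite expfzDr // -invr_expz; field; rewrite !wj0.
by apply: (up_mul H) => //; exact: O_wexp.
Qed.
Lemma c_add x y : c (x + y) = c x + c y.
Proof.
have c0 : c 0 = 0 by rewrite -{1}(subrr 1) (up_cD H) subrr.
by rewrite -{1}[y]opprK (up_cD H) -[- y]sub0r (up_cD H) c0 sub0r opprK.
Qed.
Lemma c_zero : c 0 = 0.
Proof. by rewrite -{1}(subrr 1) (up_cD H) subrr. Qed.
Lemma c_opp x : c (- x) = - c x.
Proof. by rewrite -sub0r (up_cD H) c_zero sub0r. Qed.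
Lemma c_eq0 x : (c x == 0) = (x == 0).
Proof.
apply/eqP/eqP => [h|->]; last exact: c_zero.
by rewrite -[x](up_cK H) h c_zero.
Qed.
Lemma c_inv x : c x^-1 = (c x)^-1.
Proof.
have [->|x0] := eqVneq x 0; first by rewrite invr0 c_zero invr0.
have cx0 : c x != 0 by rewrite c_eq0.
by apply: (mulIf cx0); rewrite -(up_cM H) !mulVf // (up_c1 H).
Qed.
Lemma c_wexp j : c (w ^ j) = w ^ j.
Proof.
have aux n : c (w ^+ n) = w ^+ n.
  by elim: n => [|n IH]; rewrite ?expr0 ?(up_c1 H) // exprS (up_cM H) IH (up_cw H).
by case: j => n; rewrite ?NegzE -?exprnN -?exprnP ?c_inv ?aux.
Qed.
Lemma vg_c j x : vg j x -> vg j (c x).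
Proof.
rewrite /vg => h; move/(up_cO H): h; rewrite (up_cM H) c_inv c_wexp //.
Qed.
Lemma vg_cE j x : vg j (c x) <-> vg j x.
Proof. by split => [/vg_c|]; rewrite ?(up_cK H) //; apply: vg_c. Qed.

Lemma vg_wexp i j : vg i (w ^ j) <-> i <= j.
Proof.
split => [|ij].
  case: (leP i j) => // ji; rewrite /vg invr_expz -expfzDr // => h.
  have: O (w ^ (j - i) * w ^+ (absz (i - j - 1)%R)).
    by apply: (up_mul H) => //; apply: O_wexp.
  rewrite exprnP -expfzDr //.
  have -> : (j - i + absz (i - j - 1)%R) = -1 :> int by lia.
  by rewrite exprN1 => /(up_wV H).
by apply: (vg_le ij); rewrite /vg divff //; exact: (up_one H).
Qed.

Lemma valuation_unit x : x != 0 -> unit_set O (x / w ^ v x).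
Proof.
move=> x0; have [j hj] := up_val H x0.
exact: (@xgetPex _ 0 [set n : int | unit_set O (x / w ^ n)] (ex_intro _ j hj)).
Qed.
Lemma vgP j x : x != 0 -> vg j x <-> j <= v x.
Proof.
move=> x0; have [u0 Ou OV] := valuation_unit x0.
set y := x / w ^ v x in u0 Ou OV.
have xE : x = y * w ^ v x by rewrite /y mulfVK.
have VE : w ^ v x = y^-1 * x by rewrite /y; field; rewrite wj0 x0.
split => [h|h].
  by apply/vg_wexp; rewrite VE -[j]add0r; apply: vgM => //; apply/vgE0.
by rewrite xE -[j]add0r; apply: vgM; [apply/vgE0|apply/vg_wexp].
Qed.
Lemma val_unique x j : x != 0 -> vg j x -> ~ vg (j + 1) x -> v x = j.
Proof. by move=> x0 /(vgP _ x0) h1 h2; case: (ltP j (v x)) => h; [case: h2; apply/(vgP _ x0)|]; lia. Qed.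
Lemma val_unit x : unit_set O x -> v x = 0.
Proof.
move=> [x0 Ox OV]; apply: val_unique => //; first exact/vgE0.
move=> h; have := vgM h ((vgE0 _).2 OV); rewrite divff // -(expr0z w) => /vg_wexp; lia.
Qed.
Lemma valM x y : x != 0 -> y != 0 -> v (x * y) = v x + v y.
Proof.
move=> x0 y0; have [u0 Ou OuV] := valuation_unit x0; have [t0 Ot OtV] := valuation_unit y0.
have xy0 : x * y != 0 by rewrite mulf_neq0.
have h : vg (v x + v y) (x * y) by apply: vgM; [apply/vgP|apply/vgP].
apply: val_unique => // hh.
have := vgM (vgM hh ((vgE0 _).2 OuV)) ((vgE0 _).2 OtV).
have -> : x * y * (x / w ^ v x)^-1 * (y / w ^ v y)^-1 = w ^ (v x + v y).
  by rewrite expfzDr //; field; rewrite !wj0 x0 y0.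
by move/vg_wexp; lia.
Qed.
Lemma val1 : v 1 = 0.
Proof. by apply: val_unit; split; rewrite ?oner_neq0 ?invr1 //; exact: (up_one H). Qed.
Lemma val_w j : v (w ^ j) = j.
Proof.
apply: val_unique => //; first exact/vg_wexp.
by move/vg_wexp; lia.
Qed.
Lemma valV x : x != 0 -> v x^-1 = - v x.
Proof.
move=> x0; have := valM x0 (invr_neq0 x0); rewrite divff // val1; lia.
Qed.
Lemma val_c x : x != 0 -> v (c x) = v x.
Proof.
move=> x0; have cx0 : c x != 0 by rewrite c_eq0.
apply: val_unique => //; first by apply/vg_cE/vgP.
by move/vg_cE/(vgP _ x0); lia.
Qed.
Lemma valN x : v (- x) = v x.
Proof.
have [->|x0] := eqVneq x 0; first by rewrite oppr0.
have nx0 : - x != 0 by rewrite oppr_eq0.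
apply: val_unique => //; first by apply: vgN; apply/vgP.
by move/vgN; rewrite opprK => /(vgP _ x0); lia.
Qed.
Lemma vg_mull i j x y : x != 0 -> v x = j -> vg (j + i) (x * y) <-> vg i y.
Proof.
move=> x0 vx; have [->|y0] := eqVneq y 0.
  by rewrite mulr0; split=> _; apply: vg_zero.
have xy0 : x * y != 0 by rewrite mulf_neq0.
by rewrite (vgP _ xy0) (vgP _ y0) valM // vx lerD2l.
Qed.
Lemma vgMr j x y : vg j x -> O y -> vg j (x * y).
Proof. by move=> hx Oy; rewrite -[j]addr0; apply: vgM => //; apply/vgE0. Qed.
Lemma vg_unit j x y : unit_set O x -> vg j (x * y) <-> vg j y.
Proof. by move=> hx; have [x0 _ _] := hx; have := vg_mull j y x0 (val_unit hx); rewrite add0r. Qed.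
Lemma vg_all x : (forall n : nat, vg n%:Z x) -> x = 0.
Proof.
move=> h; apply/eqP/negPn/negP => x0.
by have /(vgP _ x0) := h (absz (v x)).+1; lia.
Qed.
Lemma unit_setP x : unit_set O x <-> x != 0 /\ v x = 0.
Proof.
split => [h|[x0 vx]]; first by split; [case: h|exact: val_unit].
split=> //; first by apply/vgE0/vgP; rewrite ?vx.
by apply/vgE0/vgP; rewrite ?invr_neq0 // valV // vx.
Qed.
Lemma unit_setN x : O x -> ~ unit_set O x <-> vg 1 x.
Proof.
move=> Ox; have [->|x0] := eqVneq x 0.
  by split => [_|_ [/eqP]//]; apply: vg_zero.
rewrite (vgP _ x0) unit_setP; have := (vgP 0 x0).1 ((vgE0 _).2 Ox) => h0.
by split => [h|h [_ h2]]; [case: (ltP 0 (v x)) => // h1; case: h; split => //; lia | lia].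
Qed.
Lemma vg_cancel j x y : vg (j + 1) y -> x != 0 -> v x = j -> x + y != 0 /\ v (x + y) = j.
Proof.
move=> hy x0 vx.
have nh : ~ vg (j + 1) (x + y).
  move=> h; have := vgB h hy; rewrite addrK => /(vgP _ x0); lia.
have xy0 : x + y != 0 by apply/eqP => e; apply: nh; rewrite e; apply: vg_zero.
split=> //; apply: val_unique => //.
by apply: vgD; [apply/vgP; rewrite ?vx|apply: vg_le hy; lia].
Qed.
End Valuation.
Arguments vgE0 {L O w} x.
Arguments vg1E {L O w} x.

(** * Counting along transversals of an equivalence relation *)

Definition transversal (T : Type) (A : T -> Prop) (E : T -> T -> Prop)
    (I : finType) (f : I -> T) : Prop :=
  [/\ forall i, A (f i), forall x, A x -> exists i, E x (f i)
    & forall i j, E (f i) (f j) -> i = j].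

Definition cnt (I : finType) (P : I -> Prop) : nat := \sum_i `[< P i >].

Lemma cnt_card (I : finType) (P : I -> Prop) :
  cnt P = #|[pred i | `[< P i >]]|.
Proof.
by rewrite /cnt -sum1_card [RHS]big_mkcond; apply: eq_bigr => i _; rewrite inE; case: asboolP.
Qed.

Lemma eq_cnt (I : finType) (P Q : I -> Prop) :
  (forall i, P i <-> Q i) -> cnt P = cnt Q.
Proof. by move=> h; apply: eq_bigr => i _; congr nat_of_bool; apply/asboolP/asboolP => /h. Qed.

Lemma cnt_true (I : finType) (P : I -> Prop) : (forall i, P i) -> cnt P = #|I|.
Proof. by move=> h; rewrite cnt_card; apply: eq_card => i; rewrite !inE; apply/asboolP. Qed.

Lemma cnt_false (I : finType) (P : I -> Prop) : (forall i, ~ P i) -> cnt P = 0%N.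
Proof. by move=> h; rewrite cnt_card; apply: eq_card0 => i; rewrite !inE; apply/asboolP. Qed.

Lemma cnt_pair (I J : finType) (P : I -> Prop) (Q : I -> J -> Prop) m :
  (forall i, P i -> cnt (Q i) = m) ->
  cnt (fun t : I * J => P t.1 /\ Q t.1 t.2) = (cnt P * m)%N.
Proof.
move=> h; rewrite /cnt big_distrl /=.
rewrite -(pair_bigA _ (fun i j => nat_of_bool `[< P i /\ Q i j >])) /=.
apply: eq_bigr => i _; have [Pi|nPi] := boolP `[< P i >].
  rewrite mul1n -(h i (asboolW Pi)); apply: eq_bigr => j _; congr nat_of_bool.
  by apply/asboolP/asboolP => [[]|] //; move/asboolP: Pi.
rewrite mul0n big1 // => j _; apply/eqP; rewrite eqb0; apply/asboolP => -[].
by move/asboolP: nPi.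
Qed.

Lemma cnt_sum (I J : finType) (P : I + J -> Prop) :
  cnt P = (cnt (fun i => P (inl i)) + cnt (fun j => P (inr j)))%N.
Proof. by rewrite /cnt big_sumType. Qed.

Lemma cnt_inj_le (I J : finType) (P : I -> Prop) (Q : J -> Prop) (R : I -> J -> Prop) :
  (forall i, P i -> exists2 j, Q j & R i j) ->
  (forall i i' j, P i -> P i' -> R i j -> R i' j -> i = i') -> (cnt P <= cnt Q)%N.
Proof.
move=> hex hinj; rewrite !cnt_card.
pose d (i : I) : option J := [pick j | `[< Q j /\ R i j >]].
have dP i : P i -> exists2 j, d i = Some j & Q j /\ R i j.
  move=> Pi; rewrite /d; case: pickP => [j /asboolP hj|h]; first by exists j.
  by have [j Qj Rj] := hex i Pi; have /asboolP[] := h j.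
have dinj : {in [pred i | `[< P i >]] &, injective d}.
  move=> i i' /asboolP Pi /asboolP Pi' e.
  have [j e1 [_ R1]] := dP i Pi; have [j' e2 [_ R2]] := dP i' Pi'.
  by apply: (hinj i i' j) => //; move: R2; have -> // : j' = j by move: e2; rewrite -e e1 => -[].
have sinj : injective (@Some J) by move=> x y [].
rewrite -(card_in_image dinj) -(fintype.card_image sinj).
apply/subset_leq_card/fintype.subsetP => o /fintype.imageP[i /asboolP Pi ->].
have [j -> [Qj _]] := dP i Pi; apply: fintype.image_f.
by rewrite unfold_in /=; apply/asboolP.
Qed.

(** The number of classes on which an invariant property holds does not depend on the
    representatives. The two sets may differ outside of [P], which allows one to count the classes
    of a coset inside a larger ring. *)
Lemma cnt_transversal (T : Type) (A B : T -> Prop) (E : T -> T -> Prop)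
    (I J : finType) (f : I -> T) (g : J -> T) (P : T -> Prop) :
  (forall x y, E x y -> E y x) -> (forall x y z, E x y -> E y z -> E x z) ->
  transversal A E f -> transversal B E g ->
  (forall x, P x -> A x <-> B x) ->
  (forall x y, (A x \/ B x) -> (A y \/ B y) -> E x y -> P x -> P y) ->
  cnt (fun i => P (f i)) = cnt (fun j => P (g j)).
Proof.
move=> Es Et.
suff le (I1 J1 : finType) (f1 : I1 -> T) (g1 : J1 -> T) (A1 B1 : T -> Prop) :
  transversal A1 E f1 -> transversal B1 E g1 ->
  (forall x, P x -> A1 x -> B1 x) ->
  (forall x y, (A1 x \/ B1 x) -> (A1 y \/ B1 y) -> E x y -> P x -> P y) ->
  (cnt (fun i => P (f1 i)) <= cnt (fun j => P (g1 j)))%N.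
  move=> tf tg AB PE; apply/eqP; rewrite eqn_leq (le _ _ _ _ _ _ tf tg) //=.
    apply: (le _ _ _ _ _ _ tg tf) => // [x Px /(AB _ Px)//|x y hx hy].
    by apply: PE; [case: hx; [right|left]|case: hy; [right|left]].
  by move=> x Px /(AB _ Px).
move=> [fA _ finj] [gB gex _] AB PE.
apply: (@cnt_inj_le _ _ _ _ (fun i j => E (f1 i) (g1 j))) => [i Pi|i i' j _ _ e1 e2].
  have [j hj] := gex _ (AB _ Pi (fA i)).
  by exists j => //; apply: PE hj Pi; [left|right].
by apply: finj; apply: Et e1 (Es _ _ e2).
Qed.

(** * Residues of the rings of integers modulo powers of the prime *)

Section ResidueSystems.
Variables (L : fieldType) (O : set L) (w : L) (c : L -> L).
Variables (q : nat) (rho : 'I_q -> L) (th : L).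
Hypothesis H : unramified_pair O w c rho th.
Notation vg := (vg O w).
Notation v := (valuation O w).

Let w0 : w != 0 := up_w0 H.
Let wj0 (j : int) : w ^ j != 0. Proof. exact: expfz_neq0. Qed.

Definition Ok (x : L) : Prop := O x /\ c x = x.
Definition eqmod (j : int) (x y : L) : Prop := vg j (x - y).
Definition residue_system (A : L -> Prop) (N : nat) (I : finType) (f : I -> L) :=
  transversal A (eqmod N) f.

Lemma eqmod_sym j x y : eqmod j x y -> eqmod j y x.
Proof. by move/(vgN H); rewrite opprB. Qed.
Lemma eqmod_trans j x y z : eqmod j x y -> eqmod j y z -> eqmod j x z.
Proof. by move=> h1 h2; have := vgD H h1 h2; rewrite addrA subrK. Qed.

(** The last condition, saturation, makes the elements of [A] in a congruence class modulo w^j again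
    a copy of [A], after translation and division by w^j. The instances are [O], its elements fixed
    by [c], and its elements x with c(x) = -x. *)
Definition lattice (A : L -> Prop) : Prop :=
  [/\ A 0 /\ (forall x, A x -> O x), forall x y, A x -> A y -> A (x + y), forall x, A x -> A (- x),
    forall x (j : nat), A x -> A (w ^ j * x)
    & forall x (j : nat), A x -> vg j x -> A (x / w ^ j)].

Lemma lattice_O : lattice O.
Proof.
split => //; first (split=> //; exact: (O_zero H)); first exact: (O_add H); first exact: (O_opp H).
by move=> x j Ox; apply: (up_mul H) => //; apply: (O_wexp H).
Qed.

Lemma lattice_Ok : lattice Ok.
Proof.
rewrite /Ok; split => [|x y [Ox cx] [Oy cy]|x [Ox cx]|x j [Ox cx]|x j [Ox cx] vx].
- by split=> [|x []//]; split; [exact: (O_zero H)|exact: (c_zero H)].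
- by split; [exact: (O_add H)|rewrite (c_add H) cx cy].
- by split; [exact: (O_opp H)|rewrite (c_opp H) cx].
- by split; [apply: (up_mul H) => //; apply: (O_wexp H)|rewrite (up_cM H) (c_wexp H) cx].
- by split => //; rewrite (up_cM H) (c_inv H) (c_wexp H) cx.
Qed.

Section Lattice.
Variable A : L -> Prop.
Hypothesis hA : lattice A.

Lemma residue_system_sub (N j : nat) (I : finType) (g : I -> L) t :
  residue_system A N g -> A t ->
  transversal (fun x => A x /\ vg j (x - t)) (eqmod (j + N)%N)
    (fun i => t + w ^ j * g i).
Proof.
case: hA => [[A0 AO] AD AN Aw AV] [gA gex ginj] At; split => [i|x [Ax vx]|i i'].
- split; first by apply: AD => //; apply: Aw.
  by rewrite addrC addKr; apply: (vgMr H); [apply/(vg_wexp H)|apply: AO].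
- have [|i hi] := gex ((x - t) / w ^ j); first by apply: AV => //; apply: AD => //; apply: AN.
  exists i; rewrite /eqmod.
  have -> : x - (t + w ^ j * g i) = w ^ j * ((x - t) / w ^ j - g i) by field.
  by rewrite PoszD; apply: (vgM H) => //; apply/(vg_wexp H).
- rewrite /eqmod opprD addrACA subrr add0r -mulrBr PoszD => h.
  by apply: ginj; move: h => /(vg_mull H (N : int) (g i - g i') (wj0 j) (val_w H j)).
Qed.

Lemma cnt_residue (N j : nat) (I J : finType) (f : I -> L) (g : J -> L) t (P : L -> Prop) :
  residue_system A (j + N) f -> residue_system A N g -> A t ->
  (forall x y, A x -> A y -> eqmod (j + N)%N x y -> P x -> P y) ->
  cnt (fun i => vg j (f i - t) /\ P (f i)) = cnt (fun i => P (t + w ^ j * g i)).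
Proof.
move=> hf hg At hP.
have hg' := residue_system_sub j hg At.
transitivity (cnt (fun i => vg j ((t + w ^ j * g i) - t) /\ P (t + w ^ j * g i))).
  have Es := @eqmod_sym (j + N)%N; have Et := @eqmod_trans (j + N)%N.
  apply: (cnt_transversal (P := fun x => vg j (x - t) /\ P x) Es Et hf hg').
    by move=> x [h _]; split => [|[]].
  move=> x y hx hy exy [h1 h2]; have Ax : A x by case: hx => [|[]].
  have Ay : A y by case: hy => [|[]].
  split; last exact: hP exy h2.
  have -> : y - t = (y - x) + (x - t) by ring.
  apply: (vgD H) => //; apply: (vg_le H _ (eqmod_sym exy)).
  by rewrite PoszD lerDl.
apply: eq_cnt => i; split => [[]//|h]; split => //.
by case: hg' => /(_ i)[].
Qed.

Lemma cnt_vg (N j : nat) (I J : finType) (f : I -> L) (g : J -> L) t :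
  residue_system A (j + N) f -> residue_system A N g -> A t ->
  cnt (fun i => vg j (f i - t)) = #|J|.
Proof.
move=> hf hg At; rewrite -(@cnt_true J (fun=> True)) //.
by rewrite -(cnt_residue (P := fun=> True) hf hg At) //; apply: eq_cnt => i; split => [|[]].
Qed.

Lemma residue_system_prod (N j : nat) (I J : finType) (f : I -> L) (g : J -> L) :
  residue_system A j f -> residue_system A N g ->
  residue_system A (j + N) (fun t : I * J => f t.1 + w ^ j * g t.2).
Proof.
move=> [fA fex finj] hg; have [[A0 AO] AD AN Aw AV] := hA.
split => [[i k]|x Ax|[i k] [i' k'] /= h].
- by case: (residue_system_sub j hg (fA i)) => /(_ k)[].
- have [i hi] := fex _ Ax.
  have [_ /(_ x)[//|k hk] _] := residue_system_sub j hg (fA i).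
  by exists (i, k).
- have [ht _ hinj] := residue_system_sub j hg (fA i).
  have ii : i = i'.
    apply: finj; rewrite /eqmod.
    have -> : f i - f i' = (f i + w ^ j * g k - (f i' + w ^ j * g k')) -
       ((f i + w ^ j * g k) - f i) + ((f i' + w ^ j * g k') - f i') by ring.
    apply: (vgD H); first apply: (vgB H).
    - by apply: (vg_le H _ h); rewrite PoszD lerDl.
    - by case: (ht k).
    - by have [ht' _ _] := residue_system_sub j hg (fA i'); case: (ht' k').
  by rewrite -ii in h *; congr pair; apply: hinj.
Qed.

Lemma residue_system_card (N : nat) (I J : finType) (f : I -> L) (g : J -> L) :
  residue_system A N f -> residue_system A N g -> #|I| = #|J|.
Proof.
move=> hf hg; rewrite -(@cnt_true I (fun=> True)) // -(@cnt_true J (fun=> True)) //.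
exact: (cnt_transversal (P := fun=> True) (@eqmod_sym N) (@eqmod_trans N) hf hg).
Qed.

Lemma eq_cnt_residue (N : nat) (I J : finType) (f : I -> L) (g : J -> L) (P : L -> Prop) :
  residue_system A N f -> residue_system A N g ->
  (forall x y, A x -> A y -> eqmod N x y -> P x -> P y) ->
  cnt (fun i => P (f i)) = cnt (fun i => P (g i)).
Proof.
move=> hf hg hP.
apply: (cnt_transversal (P := P) (@eqmod_sym N) (@eqmod_trans N) hf hg) => //.
by move=> x y; case=> hx; case=> hy; apply: hP.
Qed.

Lemma residue_system_add (N : nat) (I : finType) (f : I -> L) t :
  residue_system A N f -> A t -> residue_system A N (fun i => f i + t).
Proof.
case: hA => [[A0 AO] AD AN Aw AV] [fA fex finj] At; split => [i|x Ax|i i'].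
- exact: AD.
- have [|i hi] := fex (x - t); first by apply: AD => //; apply: AN.
  by exists i; rewrite /eqmod opprD [- f i - t]addrC addrA.
- by rewrite /eqmod opprD addrACA subrr addr0; apply: finj.
Qed.
End Lattice.

(** Digit expansion: a representative modulo w^(N+1) is a digit from [rho] plus w times a
    representative modulo w^N. *)
Lemma residue_system_Ok (N : nat) :
  exists (I : finType) (f : I -> L), residue_system Ok N f /\ #|I| = (q ^ N)%N.
Proof.
elim: N => [|N [I [f [hf cI]]]].
  exists unit, (fun=> 0); split; last by rewrite card_unit.
  split => [_|x [Ox _]|[] []//]; first by split; [exact: (O_zero H)|exact: (c_zero H)].
  by exists tt; rewrite /eqmod subr0; apply/vgE0.
exists ('I_q * I)%type, (fun t => rho t.1 + w ^ 1%N * f t.2); split; last first.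
  by rewrite card_prod card_ord cI expnS.
apply: (residue_system_prod lattice_Ok (j := 1%N)) => //; split => [i|x [Ox cx]|i j].
- by split; [exact: (up_rhoO H)|exact: (up_rhoc H)].
- exact: (up_rho_ex H).
- exact: (up_rho_inj H).
Qed.

Let eta := th - c th.
Lemma c_eta : c eta = - eta.
Proof. by rewrite /eta (up_cD H) (up_cK H) opprB. Qed.
Lemma eta_unit : eta != 0 /\ v eta = 0.
Proof. by apply/(unit_setP H); exact: (up_disc H). Qed.

(* the coefficients of x on the basis (1, th) *)
Definition coef_th (x : L) := (x - c x) / eta.
Definition coef_1 (x : L) := x - coef_th x * th.
Lemma coefE x : x = coef_1 x + coef_th x * th.
Proof. by rewrite /coef_1 subrK. Qed.
Lemma c_coef_th x : c (coef_th x) = coef_th x.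
Proof.
have [e0 _] := eta_unit.
by rewrite /coef_th (up_cM H) (c_inv H) c_eta (up_cD H) (up_cK H) invrN mulrN -mulNr opprB.
Qed.
Lemma c_coef_1 x : c (coef_1 x) = coef_1 x.
Proof.
have [e0 _] := eta_unit.
rewrite {1}/coef_1 (up_cD H) (up_cM H) c_coef_th /coef_1 /coef_th.
have -> : c th = th - eta by rewrite /eta; ring.
by field.
Qed.
Lemma vg_coef_th j x : vg j x -> vg j (coef_th x).
Proof.
have [e0 ve] := eta_unit.
move=> h; rewrite /coef_th; apply: (vgMr H); first by apply: (vgB H) => //; apply: (vg_c H).
by case: (up_disc H).
Qed.
Lemma vg_coef_1 j x : vg j x -> vg j (coef_1 x).
Proof.
move=> h; apply: (vgB H) => //; apply: (vgMr H); first exact: vg_coef_th.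
exact: (up_th H).
Qed.
Lemma vg_coef j a b : c a = a -> c b = b -> vg j (a + b * th) -> vg j a /\ vg j b.
Proof.
move=> ca cb h; have [e0 _] := eta_unit.
have bE : coef_th (a + b * th) = b.
  rewrite /coef_th (c_add H) (up_cM H) ca cb /eta; field; exact: e0.
have aE : coef_1 (a + b * th) = a by rewrite /coef_1 bE addrK.
by split; [rewrite -aE; apply: vg_coef_1|rewrite -bE; apply: vg_coef_th].
Qed.

(** (1, th) is a basis of [O] over its fixed elements, and the coordinates of an element divisible
    by w^N are divisible by w^N because th - c(th) is a unit. *)
Lemma residue_system_O (N : nat) (I : finType) (f : I -> L) :
  residue_system Ok N f ->
  residue_system O N (fun t : I * I => f t.1 + f t.2 * th).
Proof.
move=> [fA fex finj]; split => [[i j]|x Ox|[i j] [i' j'] /=].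
- apply: (O_add H); first by case: (fA i).
  by apply: (up_mul H); [case: (fA j)|exact: (up_th H)].
- have h := (vgE0 x).2 Ox.
  have [|i hi] := fex (coef_1 x); first by split; [apply/vgE0/vg_coef_1|exact: c_coef_1].
  have [|j hj] := fex (coef_th x); first by split; [apply/vgE0/vg_coef_th|exact: c_coef_th].
  exists (i, j); rewrite /eqmod /= {1}[x]coefE.
  have -> : coef_1 x + coef_th x * th - (f i + f j * th) = (coef_1 x - f i) + (coef_th x - f j) * th by ring.
  by apply: (vgD H) => //; apply: (vgMr H) => //; exact: (up_th H).
- rewrite /eqmod => h.
  have [] := @vg_coef N (f i - f i') (f j - f j').
  + by rewrite (up_cD H); case: (fA i) => _ ->; case: (fA i') => _ ->.
  + by rewrite (up_cD H); case: (fA j) => _ ->; case: (fA j') => _ ->.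
  + by move: h; congr (vg _ _); ring.
  + by move=> /finj -> /finj ->.
Qed.

Lemma card_Ok N (I : finType) (f : I -> L) : residue_system Ok N f -> #|I| = (q ^ N)%N.
Proof.
move=> hf; have [J [g [hg <-]]] := residue_system_Ok N.
exact: residue_system_card hf hg.
Qed.
Lemma card_O N (I : finType) (f : I -> L) : residue_system O N f -> #|I| = (q ^ N.*2)%N.
Proof.
move=> hf; have [J [g [hg cJ]]] := residue_system_Ok N.
rewrite (residue_system_card hf (residue_system_O hg)) card_prod cJ.
by rewrite -expnD addnn.
Qed.
Lemma residue_system_O_ex (N : nat) :
  exists (I : finType) (f : I -> L), residue_system O N f.
Proof.
have [J [g [hg cJ]]] := residue_system_Ok N.
by do 2!eexists; apply: residue_system_O hg.
Qed.
Lemma cnt_vg_Ok (N j : nat) (I : finType) (f : I -> L) t :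
  residue_system Ok N f -> Ok t -> (j <= N)%N ->
  cnt (fun i => vg j (f i - t)) = (q ^ (N - j))%N.
Proof.
move=> hf Ot jN; have [J [g [hg <-]]] := residue_system_Ok (N - j).
have hf' : residue_system Ok (j + (N - j)) f by rewrite subnKC.
exact: (cnt_vg lattice_Ok hf' hg Ot).
Qed.
Lemma cnt_vg_O (N j : nat) (I : finType) (f : I -> L) t :
  residue_system O N f -> O t -> (j <= N)%N ->
  cnt (fun i => vg j (f i - t)) = (q ^ (N - j).*2)%N.
Proof.
move=> hf Ot jN; have [J [g hg]] := residue_system_O_ex (N - j).
rewrite -(card_O hg).
have hf' : residue_system O (j + (N - j)) f by rewrite subnKC.
exact: (cnt_vg lattice_O hf' hg Ot).
Qed.
Lemma q_gt1 : (1 < q)%N.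
Proof.
have [i hi] := up_rho_ex H (O_zero H) (c_zero H).
have [j hj] := up_rho_ex H (up_one H) (up_c1 H).
have ij : i != j.
  apply/eqP => e; rewrite e in hi; have := vgB H (j := 1) hj hi.
  have -> : 1 - rho j - (0 - rho j) = w ^ 0 by rewrite expr0z; ring.
  by move/(vg_wexp H).
by rewrite -[q]card_ord; apply/card_gt1P; exists i, j.
Qed.
End ResidueSystems.

(** * Counting norms *)

Lemma cnt_compl (I : finType) (P : I -> Prop) :
  (cnt P + cnt (fun i => ~ P i) = #|I|)%N.
Proof.
rewrite /cnt -big_split -sum1_card /=; apply: eq_bigr => i _.
by have [h|h] := asboolP (P i); case: asboolP.
Qed.

Lemma cnt_fibre (I K : finType) (P : I -> Prop) (Q : I -> K -> Prop) :
  (forall i, P i -> exists k, Q i k) -> (forall i k, Q i k -> P i) ->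
  (forall i k k', Q i k -> Q i k' -> k = k') ->
  cnt P = \sum_k cnt (fun i => Q i k).
Proof.
move=> ex QP uni; rewrite /cnt exchange_big /=; apply: eq_bigr => i _.
have [Pi|nPi] := asboolP (P i).
  have [k Qk] := ex i Pi; rewrite (bigD1 k) //= asboolT // big1 // => k' /eqP kk'.
  by rewrite asboolF // => Qk'; apply: kk'; apply: uni Qk' Qk.
by rewrite big1 // => k _; rewrite asboolF // => /QP.
Qed.

Lemma sum_le_eq (I : finType) (x y : I -> nat) :
  (forall i, (x i <= y i)%N) -> (\sum_i x i = \sum_i y i)%N -> forall i, x i = y i.
Proof.
move=> le e i.
have [_] := leqif_sum (P := xpredT) (fun i _ => leqif_eq (le i)).
by rewrite e eqxx => /esym/forallP /(_ i) /eqP.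
Qed.

Section NormCounts.
Variables (L : fieldType) (O : set L) (w : L) (c : L -> L).
Variables (q : nat) (rho : 'I_q -> L) (th : L).
Hypothesis H : unramified_pair O w c rho th.
Notation vg := (vg O w).
Notation v := (valuation O w).
Notation Ok := (Ok O c).

Let w0 : w != 0 := up_w0 H.
Let wj0 (j : int) : w ^ j != 0. Proof. exact: expfz_neq0. Qed.

Definition nrm (c' : L -> L) (x : L) := x * c' x.
Notation nm := (nrm c).

Lemma c_nrm x : c (nm x) = nm x.
Proof. by rewrite /nrm (up_cM H) (up_cK H) mulrC. Qed.
Lemma nrmM x y : nm (x * y) = nm x * nm y.
Proof. by rewrite /nrm (up_cM H) mulrACA. Qed.
Lemma nrm_w j : nm (w ^ j) = w ^ (j + j).
Proof. by rewrite /nrm (c_wexp H) expfzDr. Qed.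
Lemma nrm_eq0 x : (nm x == 0) = (x == 0).
Proof. by rewrite /nrm mulf_eq0 (c_eq0 H) orbb. Qed.
Lemma O_nrm x : O x -> O (nm x).
Proof. by move=> Ox; apply: (up_mul H) => //; apply: (up_cO H). Qed.
Lemma val_nrm x : x != 0 -> v (nm x) = v x + v x.
Proof. by move=> x0; rewrite (valM H) ?(c_eq0 H) // (val_c H). Qed.
Lemma vg_nrm j x : vg (j + j) (nm x) <-> vg j x.
Proof.
have [->|x0] := eqVneq x 0; first by rewrite /nrm mul0r; split=> _; exact: (vg_zero H).
rewrite (vgP H) ?nrm_eq0 // (vgP H) // val_nrm //; lia.
Qed.
Lemma eqmod_nrm j x y : O x -> O y -> vg j (x - y) -> vg j (nm x - nm y).
Proof.
move=> Ox Oy h; have -> : nm x - nm y = (c x - c y) * x + (x - y) * c y by rewrite /nrm; ring.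
apply: (vgD H); apply: (vgMr H) => //; last exact: (up_cO H).
by rewrite -(up_cD H); apply: (vg_c H).
Qed.

Lemma unitM x y : unit_set O x -> unit_set O y -> unit_set O (x * y).
Proof.
move=> [x0 Ox OVx] [y0 Oy OVy]; split; rewrite ?mulf_neq0 ?invfM //; exact: (up_mul H).
Qed.
Lemma unitV x : unit_set O x -> unit_set O x^-1.
Proof. by move=> [x0 Ox OVx]; split; rewrite ?invr_eq0 ?invrK. Qed.
Lemma unit_c x : unit_set O x -> unit_set O (c x).
Proof. by move=> [x0 Ox OVx]; split; rewrite ?(c_eq0 H) // -?(c_inv H); apply: (up_cO H). Qed.
Lemma unit_nrm x : unit_set O x -> unit_set O (nm x).
Proof. by move=> u; apply: unitM => //; apply: unit_c. Qed.
Lemma unit_vg x : O x -> ~ vg 1 x -> unit_set O x.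
Proof. by move=> Ox h; apply: contrapT => /(unit_setN H Ox). Qed.
Lemma unit_not_vg x : unit_set O x -> ~ vg 1 x.
Proof. by move=> u; have [_ Ox _] := u => /(unit_setN H Ox). Qed.
Lemma unit_O x : unit_set O x -> O x. Proof. by case. Qed.
Lemma unit_neq0 x : unit_set O x -> x != 0. Proof. by case. Qed.
Lemma unit_eqmod x y : unit_set O x -> vg 1 (y - x) -> O y -> unit_set O y.
Proof.
move=> ux h Oy; apply: unit_vg => // vy; apply: (unit_not_vg ux).
by have := vgB H vy h; rewrite opprB addrC subrK.
Qed.

Lemma unit_add_th s : Ok s -> unit_set O (s + th).
Proof.
move=> [Os cs]; apply: unit_vg => [|h]; first by apply: (O_add H) => //; exact: (up_th H).
apply: (unit_not_vg (up_disc H)); have := vgB H h (vg_c H h).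
by rewrite (c_add H) cs; congr (vg _ _); ring.
Qed.

(** The q + 1 points of the projective line over the residue field, mapped by y to y / c(y). By
    Hilbert's theorem 90 this gives the elements of norm 1 in the quadratic extension of the residue
    field. *)
Definition norm_one_rep (o : option 'I_q) : L :=
  if o is Some k then (rho k + th) / c (rho k + th) else 1.

Lemma norm_one_quot z y : O z -> unit_set O y -> vg 1 (z - y / c y) ->
  exists o, vg 1 (z - norm_one_rep o).
Proof.
move=> Oz uy hz.
suff: exists o, vg 1 (y / c y - norm_one_rep o).
  by case=> o ho; exists o; have := vgD H hz ho; rewrite addrA subrK.
have Oy := unit_O uy; have ucy := unit_c uy.
have [hb|hb] := pselect (vg 1 (coef_th c th y)).
  exists None; have -> : y / c y - norm_one_rep None = (y - c y) / c y.
    by rewrite /= mulrBl divff // (unit_neq0 ucy).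
  apply: (vgMr H); last by case: ucy.
  have -> : y - c y = coef_th c th y * (th - c th).
    by rewrite /coef_th mulfVK // (unit_neq0 (up_disc H)).
  by apply: (vgMr H) => //; apply: unit_O (up_disc H).
have Ob : O (coef_th c th y) by apply/vgE0/(vg_coef_th H)/vgE0.
have ub := unit_vg Ob hb.
set s := coef_1 c th y / coef_th c th y.
have cs : c s = s by rewrite /s (up_cM H) (c_inv H) (c_coef_th H) (c_coef_1 H).
have Os : O s.
  apply: (up_mul H); last by case: ub.
  by apply/vgE0/(vg_coef_1 H)/vgE0.
have us := unit_add_th (conj Os cs).
have yE : y = coef_th c th y * (s + th).
  by rewrite {1}(coefE c th y) /s; field; exact: unit_neq0 ub.
have -> : y / c y = (s + th) / c (s + th).
  rewrite yE (up_cM H) (c_coef_th H); field.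
  by rewrite (unit_neq0 ub) (unit_neq0 (unit_c us)).
have [k hk] := up_rho_ex H Os cs; exists (Some k) => /=.
have uk := unit_add_th (conj (up_rhoO H k) (up_rhoc H k)).
have -> : (s + th) / c (s + th) - (rho k + th) / c (rho k + th) =
    (s - rho k) * ((c th - th) / (c (s + th) * c (rho k + th))).
  rewrite !(c_add H) cs (up_rhoc H); field.
  have := unit_neq0 (unit_c us); have := unit_neq0 (unit_c uk).
  by rewrite !(c_add H) cs (up_rhoc H) => -> ->.
apply: (vgMr H); first exact/vg1E.
apply: (up_mul H); first by rewrite -opprB; apply: (O_opp H); apply: unit_O (up_disc H).
by case: (unitM (unit_c us) (unit_c uk)).
Qed.

(** Hilbert 90 modulo w with an explicit solution: z is congruent to y / c(y) for y = 1 + z, unless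
    z is congruent to -1, in which case y = th - c(th) serves, since c changes its sign. *)
Lemma norm_one_rep_ex z : O z -> vg 1 (nm z - 1) ->
  exists o, vg 1 (z - norm_one_rep o).
Proof.
move=> Oz hz; have [h|h] := pselect (vg 1 (1 + z)).
  apply: (norm_one_quot Oz (up_disc H)).
  rewrite (c_eta H) invrN mulrN divff ?(unit_neq0 (up_disc H)) // opprK addrC //.
have O1z : O (1 + z) by apply: (O_add H) => //; exact: (up_one H).
have u := unit_vg O1z h; apply: (norm_one_quot Oz u).
have -> : z - (1 + z) / c (1 + z) = (nm z - 1) / c (1 + z).
  have := unit_neq0 (unit_c u); rewrite (c_add H) (up_c1 H) /nrm => n0.
  by field.
by apply: (vgMr H) => //; case: (unit_c u).
Qed.

Lemma norm_fibre_le (I : finType) (f : I -> L) a :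
  residue_system O w O 1 f -> unit_set O a ->
  (cnt (fun i => vg 1 (nm (f i) - a)) <= q.+1)%N.
Proof.
move=> [fO _ finj] ua.
have [[i0 h0]|h] := pselect (exists i0, vg 1 (nm (f i0) - a)); last first.
  by rewrite cnt_false // => i hi; apply: h; exists i.
have un0 : unit_set O (nm (f i0)) by apply: unit_eqmod ua h0 _; exact: O_nrm.
have u0 : unit_set O (f i0).
  apply: unit_vg => // h; apply: (unit_not_vg un0).
  by rewrite /nrm; apply: (vgMr H) => //; apply: (up_cO H).
have -> : q.+1 = cnt (fun _ : option 'I_q => True) by rewrite cnt_true // card_option card_ord.
apply: (@cnt_inj_le _ _ _ _ (fun i o => vg 1 (f i / f i0 - norm_one_rep o))).
  move=> i hi; have [||o ho] := @norm_one_rep_ex (f i / f i0); last by exists o.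
    by apply: (up_mul H) => //; case: u0.
  have -> : nm (f i / f i0) - 1 = ((nm (f i) - a) - (nm (f i0) - a)) / nm (f i0).
    rewrite nrmM [nm _^-1]/nrm (c_inv H) -invfM -/(nm (f i0)); field; exact: unit_neq0 un0.
  by apply: (vgMr H); [exact: (vgB H)|case: un0].
move=> i i' o _ _ h1 h2; apply: finj.
have := vgMr H (vgB H h1 h2) (fO i0); congr (vg _ _).
by field; exact: unit_neq0 u0.
Qed.

Lemma eqmod_rho_unit k a : vg 1 (a - rho k) -> O a -> unit_set O a -> unit_set O (rho k).
Proof. by move=> h Oa ua; apply: unit_eqmod ua _ (up_rhoO H k); rewrite -opprB; apply: (vgN H). Qed.

(** Each of the q - 1 unit classes of the small residue field has at most q + 1 preimages under the
    norm, and there are q^2 - 1 = (q - 1)(q + 1) unit classes above; so equality holds in every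
    fibre. *)
Lemma norm_fibre_rho (I : finType) (f : I -> L) k :
  residue_system O w O 1 f -> unit_set O (rho k) ->
  cnt (fun i => vg 1 (nm (f i) - rho k)) = q.+1.
Proof.
move=> hf uk; have [fO fex finj] := hf.
pose x (l : 'I_q) := cnt (fun i => unit_set O (rho l) /\ vg 1 (nm (f i) - rho l)).
pose y (l : 'I_q) := (nat_of_bool `[< unit_set O (rho l) >] * q.+1)%N.
have q1 := q_gt1 H.
have O0 := O_zero H.
have xy : forall l, x l = y l.
  apply: sum_le_eq => [l|].
    rewrite /x /y; have [ul|nul] := asboolP (unit_set O (rho l)); last first.
      by rewrite cnt_false // => i [].
    rewrite mul1n; apply: leq_trans (norm_fibre_le hf ul).
    by apply: (@cnt_inj_le _ _ _ _ (fun i j => i = j)) => [i []|i i' j _ _ -> ->] //; exists i.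
  rewrite /x /y -(cnt_fibre (P := fun i => ~ vg 1 (f i))).
  - have := cnt_compl (fun i => vg 1 (f i)).
    have -> : cnt (fun i => vg 1 (f i)) = 1%N.
      rewrite (@eq_cnt _ _ (fun i => vg 1%N (f i - 0))) => [|i]; last by rewrite subr0.
      by rewrite (cnt_vg_O H hf) // subnn expn0.
    rewrite (card_O H hf) /= => e.
    have -> : (\sum_l `[< unit_set O (rho l) >] * q.+1 = (q - 1) * q.+1)%N.
      rewrite -big_distrl /=; congr (_ * _)%N.
      have := cnt_compl (fun l => vg 1 (rho l)).
      have -> : cnt (fun l => vg 1 (rho l)) = 1%N.
        have hr : residue_system O w Ok 1 rho.
          split=> [l|z [Oz cz]|l l'].
          - by split; [exact: (up_rhoO H)|exact: (up_rhoc H)].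
          - exact: (up_rho_ex H).
          - exact: (up_rho_inj H).
        rewrite (@eq_cnt _ _ (fun i => vg 1%N (rho i - 0))) => [|i]; last by rewrite subr0.
        by rewrite (cnt_vg_Ok H hr) // ?subnn //; split => //; exact: (c_zero H).
      rewrite card_ord => e'.
      have -> : (\sum_i `[< unit_set O (rho i) >])%N = cnt (fun l => ~ vg 1 (rho l)).
        apply: eq_bigr => l _; congr nat_of_bool; apply/asboolP/asboolP.
          exact: unit_not_vg.
        by apply: unit_vg; exact: (up_rhoO H).
      lia.
    move: e; rewrite -[1.*2%N]/2%N; nia.
  - move=> i hi; have ui := unit_vg (fO i) hi.
    have [l hl] := up_rho_ex H (O_nrm (fO i)) (c_nrm _).
    have hl' : vg 1 (nm (f i) - rho l) by apply/vg1E.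
    exists l; split => //.
    by apply: eqmod_rho_unit hl' (O_nrm (fO i)) (unit_nrm ui).
  - move=> i l [ul hl] hi; apply: (unit_not_vg ul).
    have hn : vg 1 (nm (f i)) by rewrite /nrm; apply: (vgMr H) => //; apply: (up_cO H).
    by have := vgB H hn hl; rewrite opprB addrC subrK.
  - move=> i l l' [_ h1] [_ h2]; apply: (up_rho_inj H).
    by apply/vg1E; have := vgB H h2 h1; congr (vg _ _); ring.
have := xy k; rewrite /x /y asboolT // mul1n => <-.
by apply: eq_cnt => i; split => [|[]].
Qed.
End NormCounts.

(** The number of x modulo w^N whose norm is congruent modulo w^j to a given fixed element of
    valuation r. For j <= r the condition is 2 v(x) >= j; for j > r it forces 2 v(x) = r, so r must
    be even. *)
Definition norm_count (q N r j : nat) : nat :=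
  if (j <= r)%N then (q ^ (N - uphalf j).*2)%N
  else if odd r then 0%N else (q.+1 * q ^ (N.*2 - j.+1))%N.

Section NormCounts2.
Variables (L : fieldType) (O : set L) (w : L) (c : L -> L).
Variables (q : nat) (rho : 'I_q -> L) (th : L).
Hypothesis H : unramified_pair O w c rho th.
Notation vg := (vg O w).
Notation v := (valuation O w).
Notation Ok := (Ok O c).
Notation nm := (nrm c).

Let w0 : w != 0 := up_w0 H.
Let wj0 (j : int) : w ^ j != 0. Proof. exact: expfz_neq0. Qed.

(** An integral element of trace 1. It plays the role of 1/2 and is available in every residue
    characteristic. *)
Definition th1 := th / (th - c th).
Lemma th1_O : O th1.
Proof. by apply: (up_mul H); [exact: (up_th H)|case: (up_disc H)]. Qed.
Lemma th1_tr : th1 + c th1 = 1.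
Proof.
have [d0 _ _] := up_disc H.
rewrite /th1 (up_cM H) (c_inv H) (c_eta H) invrN mulrN -mulrBl divff //.
Qed.

Lemma residue_system_mulunit N (I : finType) (f : I -> L) u :
  residue_system O w O N f -> unit_set O u -> residue_system O w O N (fun i => f i * u).
Proof.
move=> [fO fex finj] uu; have [u0 Ou OuV] := uu.
have uV := unitV uu.
split => [i|x Ox|i i'].
- exact: (up_mul H).
- have [|i hi] := fex (x / u); first exact: (up_mul H).
  exists i; apply/(vg_unit H N _ uV); move: hi; rewrite /eqmod; congr (vg _ _).
  by field.
- by rewrite /eqmod -mulrBl mulrC => /(vg_unit H) h; apply: finj; apply: h.
Qed.

Lemma nm_eqmod_iff (N j : nat) x y a : (j <= N)%N -> O x -> O y -> vg N (x - y) ->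
  vg j (nm x - a) -> vg j (nm y - a).
Proof.
move=> jN Ox Oy hxy h.
have := vgD H (vg_le H (i := j) _ (eqmod_nrm H Oy Ox (eqmod_sym H hxy))) h.
by rewrite addrA subrK; apply; lia.
Qed.

Lemma norm_cnt_one (N : nat) (I : finType) (f : I -> L) a :
  residue_system O w O N.+1 f -> Ok a -> unit_set O a ->
  cnt (fun i => vg 1 (nm (f i) - a)) = (q.+1 * q ^ N.*2)%N.
Proof.
move=> hf [Oa ca] ua; have [k hk] := up_rho_ex H Oa ca; move/vg1E in hk.
have urk := eqmod_rho_unit H hk Oa ua.
rewrite (@eq_cnt _ _ (fun i => vg 1%N (nm (f i) - rho k))); last first.
  move=> i; split=> h; first by have := vgD H h hk; rewrite addrA subrK.
  by have := vgB H h hk; rewrite opprB addrA subrK.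
have [I1 [f1 hf1]] := residue_system_O_ex H 1.
have [I2 [f2 hf2]] := residue_system_O_ex H N.
have hp := residue_system_prod H (lattice_O H) hf1 hf2.
have f1O i : O (f1 i) by case: hf1.
rewrite (eq_cnt_residue H (P := fun x => vg 1%N (nm x - rho k)) hf hp); last first.
  by move=> x y Ox Oy; apply: nm_eqmod_iff.
rewrite (@eq_cnt _ _ (fun t => vg 1%N (nm (f1 t.1) - rho k) /\ True)); last first.
  move=> t; have Ot : O (f1 t.1 + w ^ 1%N * f2 t.2) by case: hp => /(_ t).
  have h1 : vg 1%N (f1 t.1 + w ^ 1%N * f2 t.2 - f1 t.1).
    rewrite addrC addKr; apply: (vgMr H); first exact/(vg_wexp H).
    by case: hf2.
  split=> [h|[h _]].
    by split => //; apply: (@nm_eqmod_iff 1 1 _ _ _ _ Ot (f1O _) h1).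
  by apply: (@nm_eqmod_iff 1 1 _ _ _ _ (f1O _) Ot (eqmod_sym H h1)).
rewrite (@cnt_pair _ _ (fun i => vg 1%N (nm (f1 i) - rho k)) (fun _ _ => True) #|I2|) => [|i _]; last exact: cnt_true.
by rewrite (card_O H hf2) (norm_fibre_rho H hf1).
Qed.

(** The q lifts a(1 + w^j r) of a modulo w^(j+1) have equally many solutions: since [th1] has trace
    1, multiplication by u = 1 + w^j th1 r multiplies norms by 1 + w^j r modulo w^(2j), and it
    permutes the residue classes. *)
Lemma norm_cnt_lift (N j : nat) (I : finType) (f : I -> L) a :
  residue_system O w O N f -> Ok a -> unit_set O a -> (0 < j)%N -> (j < N)%N ->
  cnt (fun i => vg j (nm (f i) - a)) = (q * cnt (fun i => vg j.+1 (nm (f i) - a)))%N.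
Proof.
move=> hf [Oa ca] ua j0 jN; have a0 := unit_neq0 ua; have [fO _ _] := hf.
have wV : v (w ^ j) = j by apply: (val_w H).
rewrite (cnt_fibre (Q := fun i k => vg j.+1 (nm (f i) - a * (1 + w ^ j * rho k)))).
- rewrite (eq_bigr (fun=> cnt (fun i => vg j.+1 (nm (f i) - a)))).
    by rewrite sum_nat_const card_ord.
  move=> k _; set r := rho k.
  have Or : O r := up_rhoO H k.
  pose u := 1 + w ^ j * (th1 * r).
  have nuE : nm u = 1 + w ^ j * r + w ^ (j + j) * (nm th1 * (r * r)).
    rewrite /u /nrm (c_add H) (up_c1 H) (up_cM H (w ^ j)) (up_cM H th1) (c_wexp H) (up_rhoc H) -/r PoszD expfzDr //.
    have -> : w ^ j * r = w ^ j * r * (th1 + c th1) by rewrite th1_tr mulr1.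
    by ring.
  have uu : unit_set O u.
    apply: (unit_eqmod H (x := 1)); first by split; rewrite ?oner_neq0 ?invr1 //; exact: (up_one H).
      rewrite /u addrC addKr; apply: (vgMr H); first by apply/(vg_wexp H); lia.
      by apply: (up_mul H) => //; exact: th1_O.
    apply: (O_add H); first exact: (up_one H).
    by apply: (up_mul H); [apply: (O_wexp H)|apply: (up_mul H) => //; exact: th1_O].
  rewrite (eq_cnt_residue H (P := fun x => vg j.+1 (nm x - a * (1 + w ^ j * r))) hf
    (residue_system_mulunit hf uu)); last by move=> x y Ox Oy; apply: nm_eqmod_iff.
  apply: eq_cnt => i.
  have -> : nm (f i * u) - a * (1 + w ^ j * r) =
     nm u * (nm (f i) - a) + w ^ (j + j) * (a * (nm th1 * (r * r))).
    by rewrite (nrmM H) nuE; ring.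
  have hs : vg j.+1 (w ^ (j + j) * (a * (nm th1 * (r * r)))).
    apply: (vgMr H); first by apply/(vg_wexp H); lia.
    apply: (up_mul H) => //; apply: (up_mul H); last exact: (up_mul H).
    by apply: (O_nrm H); exact: th1_O.
  have un := unit_nrm H uu.
  split => h; last by apply: (vgD H) => //; apply/(vg_unit H).
  by apply/(vg_unit H j.+1 _ un); have := vgB H h hs; rewrite addrK.
- move=> i hi.
  have hai : vg j ((nm (f i) - a) / a).
    by apply: (vgMr H) => //; case: ua.
  have [||k hk] := @up_rho_ex _ _ _ _ _ _ _ H ((nm (f i) - a) / a / w ^ j).
  + exact: hai.
  + by rewrite !(up_cM H) !(c_inv H) (c_wexp H) (up_cD H) (c_nrm H) ca.
  exists k; move/vg1E in hk.
  have -> : nm (f i) - a * (1 + w ^ j * rho k) = a * (w ^ j * ((nm (f i) - a) / a / w ^ j - rho k)).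
    by field; rewrite wj0 a0.
  apply/(vg_unit H) => //; have -> : Posz j.+1 = Posz j + 1 by lia.
  by apply/(vg_mull H).
- move=> i k hk; have -> : nm (f i) - a = (nm (f i) - a * (1 + w ^ j * rho k)) + w ^ j * (a * rho k) by ring.
  apply: (vgD H); first by apply: (vg_le H _ hk); lia.
  by apply: (vgMr H); [apply/(vg_wexp H)|apply: (up_mul H) => //; exact: (up_rhoO H)].
- move=> i k k' hk hk'; apply: (up_rho_inj H); apply/vg1E.
  have := vgB H hk' hk.
  have -> : nm (f i) - a * (1 + w ^ j * rho k') - (nm (f i) - a * (1 + w ^ j * rho k)) =
     a * (w ^ j * (rho k - rho k')) by ring.
  move/(vg_unit H _ _ ua); have -> : Posz j.+1 = Posz j + 1 by lia.
  by move/(vg_mull H _ _ (wj0 j) wV).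
Qed.

Lemma norm_cnt_unit (N j : nat) (I : finType) (f : I -> L) a :
  residue_system O w O N f -> Ok a -> unit_set O a -> (0 < j)%N -> (j <= N)%N ->
  cnt (fun i => vg j (nm (f i) - a)) = (q.+1 * q ^ (N.*2 - j.+1))%N.
Proof.
move=> hf oa ua; elim: j => // j IH _ jN.
have [j0|j0] := posnP j.
  rewrite j0; case: N hf jN {IH} => // N hf _.
  rewrite (norm_cnt_one hf) //; congr (_ * q ^ _)%N; lia.
have := IH j0 (ltnW jN); rewrite (norm_cnt_lift hf) // => e.
have q1 := q_gt1 H.
apply/eqP; rewrite -(eqn_pmul2l (m := q)); last lia.
rewrite e mulnCA -expnS; apply/eqP; congr (_ * q ^ _)%N; lia.
Qed.

Lemma norm_cnt (N r j : nat) (I : finType) (f : I -> L) a :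
  residue_system O w O N f -> Ok a -> a != 0 -> v a = r -> (j <= N)%N ->
  cnt (fun i => vg j (nm (f i) - a)) = norm_count q N r j.
Proof.
move=> hf [Oa ca] a0 va jN; have [fO _ _] := hf; rewrite /norm_count.
have [jr|rj] := leqP j r.
  have ha : vg j a by apply/(vgP H) => //; rewrite va.
  rewrite -(cnt_vg_O H hf (O_zero H)); last by rewrite leq_uphalf_double; lia.
  apply: eq_cnt => i; rewrite subr0; set u := uphalf j.
  have hj : (j <= u + u)%N /\ (u + u <= j.+1)%N.
    by rewrite /u; have := odd_double_half j; rewrite uphalf_half; case: odd; lia.
  have [e|x0] := eqVneq (f i) 0.
    rewrite e /nrm mul0r sub0r; split=> _; first exact: (vg_zero H).
    exact: (vgN H).
  split => h.
    have := vgD H h ha; rewrite subrK => /(vgP H _); rewrite (nrm_eq0 H) x0 => /(_ isT).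
    by rewrite (val_nrm H) // => h'; apply/(vgP H) => //; lia.
  apply: (vgB H) => //; apply: (vg_le H (j := Posz u + Posz u)); first by lia.
  by apply/(vg_nrm H).
(* The valuation of a norm is even, hence different from r, so the difference has valuation at most
   r < j. *)
have [odr|evr] := boolP (odd r).
  rewrite cnt_false // => i h.
  have [e|x0] := eqVneq (f i) 0.
    move: h; rewrite e /nrm mul0r sub0r => /(vgN H); rewrite opprK => /(vgP H _ a0).
    by rewrite va; lia.
  have n0 : nm (f i) != 0 by rewrite (nrm_eq0 H).
  have vn := val_nrm H x0.
  have [lt|lt|e] := ltgtP (v (nm (f i))) r.
  - have h2 : vg (v (nm (f i)) + 1) (- a) by apply: (vgN H); apply/(vgP H) => //; lia.
    have [s0 vs] := vg_cancel H h2 n0 erefl.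
    by move/(vgP H _ s0): h; rewrite vs; lia.
  - have na0 : - a != 0 by rewrite oppr_eq0.
    have h2 : vg (r%:Z + 1) (nm (f i)) by apply/(vgP H) => //; lia.
    have := vg_cancel H h2 na0 _; rewrite (valN H) addrC => /(_ va)[s0 vs].
    by move/(vgP H _ s0): h; rewrite vs; lia.
  - by move: odr; rewrite -[r]/(absz r) -e vn; lia.
have [k rk] : exists k, r = (k + k)%N by exists r./2; rewrite addnn; rewrite -[LHS]odd_double_half (negPf evr).
have [I2 [f2 hf2]] := residue_system_O_ex H (N - k).
have hf' : residue_system O w O (k + (N - k)) f by rewrite subnKC //; lia.
have [f2O _ _] := hf2.
transitivity (cnt (fun i => vg k (f i - 0) /\ vg j (nm (f i) - a))).
  apply: eq_cnt => i; rewrite subr0; split => [h|[]//]; split => //.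
  apply/(vg_nrm H); rewrite -[nm _](subrK a); apply: (vgD H).
    by apply: (vg_le H _ h); lia.
  by apply/(vgP H) => //; lia.
rewrite (cnt_residue H (lattice_O H) (P := fun x => vg j (nm x - a)) hf' hf2 (O_zero H)); last first.
  by move=> x y Ox Oy; apply: (@nm_eqmod_iff (k + (N - k))%N) => //; lia.
have wr0 := wj0 r.
have oa' : Ok (a / w ^ r).
  split; last by rewrite (up_cM H) ca (c_inv H) (c_wexp H).
  by apply/(vgP H _ a0); rewrite va.
have ua' : unit_set O (a / w ^ r).
  apply/(unit_setP H); split; first by rewrite mulf_neq0 // invr_eq0.
  by rewrite (valM H) ?invr_eq0 // (valV H) // va (val_w H); lia.
rewrite (@eq_cnt _ _ (fun i => vg (j - r)%N (nm (f2 i) - a / w ^ r))).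
  rewrite (norm_cnt_unit hf2) //; try lia.
  by congr (_ * q ^ _)%N; lia.
move=> i; rewrite add0r.
have -> : nm (w ^ k * f2 i) - a = w ^ r * (nm (f2 i) - a / w ^ r).
  rewrite (nrmM H) (nrm_w H) rk PoszD; field; exact: wj0.
have -> : Posz j = r%:Z + (j - r)%N by lia.
by apply: (vg_mull H) => //; apply: (val_w H).
Qed.
End NormCounts2.

(** * Counting values of forms modulo powers of the prime *)

Lemma transversal_map (T : Type) (A : T -> Prop) (E : T -> T -> Prop)
    (I : finType) (f : I -> T) (phi : T -> T) :
  (forall x y z, E x y -> E y z -> E x z) ->
  (forall x, A x -> A (phi x)) -> (forall x, A x -> exists2 y, A y & phi y = x) ->
  (forall x y, E x y -> E (phi x) (phi y)) ->
  (forall x y, E (phi x) (phi y) -> E x y) ->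
  transversal A E f -> transversal A E (fun i => phi (f i)).
Proof.
move=> Et phA phS phE phE' [fA fex finj]; split => [i|x Ax|i j].
- exact: phA.
- have [y Ay <-] := phS x Ax; have [i hi] := fex y Ay.
  by exists i; apply: phE.
- by move/phE'; apply: finj.
Qed.

Section LocalCounts2.
Variables (L : fieldType) (O : set L) (w : L) (c : L -> L).
Variables (q : nat) (rho : 'I_q -> L) (th : L).
Hypothesis H : unramified_pair O w c rho th.
Notation vg := (vg O w).
Notation v := (valuation O w).
Notation Ok := (Ok O c).
Notation nm := (nrm c).
Notation eta := (th - c th).
Notation th1 := (th1 c th).
Implicit Types (x y : L * L) (N : nat).

Let w0 : w != 0 := up_w0 H.
Let wj0 (j : int) : w ^ j != 0. Proof. exact: expfz_neq0. Qed.

(** Equality of points of the projective line modulo w^N. *)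
Definition proj_eq2 N x y : Prop :=
  exists l, [/\ unit_set O l, vg N (x.1 - l * y.1) & vg N (x.2 - l * y.2)].

Lemma proj_eq2_sym N x y : proj_eq2 N x y -> proj_eq2 N y x.
Proof.
move=> [l [ul h1 h2]]; exists l^-1; split; first exact: unitV.
  apply/(vg_unit H N _ ul); move/(vgN H): h1; congr (vg _ _).
  by field; exact: unit_neq0 ul.
apply/(vg_unit H N _ ul); move/(vgN H): h2; congr (vg _ _).
by field; exact: unit_neq0 ul.
Qed.

Lemma proj_eq2_trans N x y z : proj_eq2 N x y -> proj_eq2 N y z -> proj_eq2 N x z.
Proof.
move=> [l [ul h1 h2]] [m [um k1 k2]]; exists (l * m); split; first exact: (unitM H).
  have := vgD H h1 ((vg_unit H N _ ul).2 k1); congr (vg _ _); ring.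
have := vgD H h2 ((vg_unit H N _ ul).2 k2); congr (vg _ _); ring.
Qed.

(** Two charts of the projective line. The second one is restricted to the points that reduce to (1
    : 0) modulo w, so that no point is listed twice. *)
Definition lines2 (I J : finType) (f : I -> L) (g : J -> L) (s : I + J) : L * L :=
  match s with inl i => (f i, 1) | inr j => (1, w * g j) end.

(** With [A] equal to [O] these are all primitive vectors of the plane; with [A] the anti-invariant
    integers they are the isotropic primitive vectors of the hyperbolic plane. *)
Definition prim2 (A : L -> Prop) x : Prop :=
  [/\ O x.1 /\ O x.2, unit_set O x.1 \/ unit_set O x.2,
      unit_set O x.2 -> A (x.1 / x.2) & unit_set O x.1 -> A (x.2 / x.1)].

Lemma unit1 : unit_set O 1.
Proof. by split; rewrite ?oner_neq0 ?invr1 //; exact: (up_one H). Qed.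
Lemma w_not_unit t : O t -> ~ unit_set O (w * t).
Proof.
move=> Ot; apply/(unit_setN H); first by apply: (up_mul H) => //; exact: (up_w H).
by apply: (vgMr H) => //; rewrite -{2}[w]expr1z; apply/(vg_wexp H).
Qed.
Lemma vg1w t : O t -> vg 1 (w * t).
Proof. by move=> Ot; apply: (vgMr H) => //; rewrite -{2}[w]expr1z; apply/(vg_wexp H). Qed.

Lemma lines2_transversal (A : L -> Prop) N (I J : finType) (f : I -> L) (g : J -> L) :
  lattice O w A -> residue_system O w A N.+1 f -> residue_system O w A N g ->
  (forall t, unit_set O t -> A t -> A t^-1) ->
  transversal (prim2 A) (proj_eq2 N.+1) (lines2 f g).
Proof.
move=> [[A0 AO] AD AN Aw AV] [fA fex finj] [gA gex ginj] Ainv.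
have O1 := up_one H.
split => [[i|j]|[a b] [/= [Oa Ob] hab Aab Aba]|[i|j] [i'|j'] [l [ul /= h1 h2]]].
- split => //=; first by split=> //; apply: AO.
  + by right; exact: unit1.
  + by rewrite divr1.
  + by move=> u; rewrite div1r; apply: Ainv.
- split => //=; first by split=> //; apply: (up_mul H); [exact: (up_w H)|exact: AO].
  + by left; exact: unit1.
  + by move/w_not_unit; case; apply: AO.
  + by move=> _; rewrite divr1; have := Aw _ 1%N (gA j); rewrite expr1z.
- have [ub|nub] := pselect (unit_set O b).
    have [i hi] := fex _ (Aab ub); exists (inl i), b; split => //=; last first.
      by rewrite mulr1 subrr; exact: (vg_zero H).
    have := (vg_unit H N.+1 _ ub).2 hi; congr (vg _ _); field; exact: unit_neq0 ub.
  have ua : unit_set O a by case: hab.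
  have hb : vg 1 b by apply/(unit_setN H).
  have hba : vg 1%N (b / a) by apply: (vgMr H) => //; case: ua.
  have [j hj] := gex _ (AV _ 1%N (Aba ua) hba).
  exists (inr j), a; split => //=; first by rewrite mulr1 subrr; exact: (vg_zero H).
  have hw : vg 1 w by rewrite -{2}[w]expr1z; apply/(vg_wexp H).
  have := vgM H hw ((vg_unit H N _ ua).2 hj); have -> : Posz 1 + N = N.+1 by lia.
  congr (vg _ _); rewrite expr1z; field; rewrite w0; exact: unit_neq0 ua.
- congr inl; apply: finj; rewrite /eqmod.
  have -> : f i - f i' = (f i - l * f i') - (1 - l * 1) * f i' by ring.
  by apply: (vgB H) => //; apply: (vgMr H) => //; apply: AO.
- exfalso; apply: (unit_not_vg H unit1).
  rewrite -[X in vg _ X](subrK (l * (w * g j'))); apply: (vgD H); first by apply: (vg_le H _ h2); lia.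
  by rewrite mulrCA; apply: vg1w; apply: (up_mul H); [case: ul|exact: AO].
- exfalso; apply: (unit_not_vg H ul).
  have -> : l = w * g j - (w * g j - l * 1) by ring.
  by apply: (vgB H); [apply: vg1w; exact: AO|apply: (vg_le H _ h2); lia].
- congr inr; apply: ginj; rewrite /eqmod.
  have hw : v w = 1 by rewrite -[X in v X]expr1z (val_w H).
  apply/(vg_mull H N _ w0 hw); have -> : 1 + Posz N = N.+1 by lia.
  have -> : w * (g j - g j') = (w * g j - l * (w * g j')) - (1 - l * 1) * (w * g j') by ring.
  apply: (vgB H) => //; apply: (vgMr H) => //; apply: (up_mul H); [exact: (up_w H)|exact: AO].
Qed.

Definition swap2 x : L * L := (x.2, x.1).
Lemma transversal_swap2 (A : L -> Prop) N (I : finType) (f : I -> L * L) :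
  transversal (prim2 A) (proj_eq2 N) f ->
  transversal (prim2 A) (proj_eq2 N) (fun i => swap2 (f i)).
Proof.
apply: (transversal_map (phi := swap2)) => [x y z|[a b]|[a b]|x y|x y].
- exact: proj_eq2_trans.
- by move=> [[Oa Ob] h h1 h2]; split => //=; case: h; [right|left].
- by move=> [[Oa Ob] h h1 h2]; exists (b, a) => //; split => //=; case: h; [right|left].
- by move=> [l [ul h1 h2]]; exists l.
- by move=> [l [ul h1 h2]]; exists l.
Qed.

Definition hform (al be de : L) x : L :=
  nm x.1 * al + x.1 * c x.2 * be + c x.1 * x.2 * c be + nm x.2 * de.

Definition shear2 (t : L) x : L * L := (x.1, x.2 + t * x.1).

Lemma prim2_O x : prim2 O x <-> (O x.1 /\ O x.2) /\ (unit_set O x.1 \/ unit_set O x.2).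
Proof.
split => [[h1 h2 _ _] //|[[h1 h2] h3]]; split => // -[_ _ h].
  exact: (up_mul H).
exact: (up_mul H).
Qed.

Lemma prim2_shear t x : O t -> prim2 O x -> prim2 O (shear2 t x).
Proof.
move=> Ot; rewrite !prim2_O /= => -[[h1 h2] h3].
have O2 : O (x.2 + t * x.1) by apply: (O_add H) => //; exact: (up_mul H).
split => //; have [u1|n1] := pselect (unit_set O x.1); [by left|right].
have u2 : unit_set O x.2 by case: h3.
apply: (unit_eqmod H u2) => //; rewrite addrC addKr mulrC; apply: (vgMr H) => //.
exact/(unit_setN H).
Qed.

Lemma transversal_shear2 N t (I : finType) (f : I -> L * L) : O t ->
  transversal (prim2 O) (proj_eq2 N) f ->
  transversal (prim2 O) (proj_eq2 N) (fun i => shear2 t (f i)).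
Proof.
move=> Ot; have ON : O (- t) by exact: (O_opp H).
have E (s : L) x y : O s -> proj_eq2 N x y -> proj_eq2 N (shear2 s x) (shear2 s y).
  move=> Os [l [ul h1 h2]]; exists l; split => //=.
  have -> : x.2 + s * x.1 - l * (y.2 + s * y.1) = (x.2 - l * y.2) + (x.1 - l * y.1) * s by ring.
  by apply: (vgD H) => //; apply: (vgMr H).
have K x : shear2 (- t) (shear2 t x) = x by case: x => a b; rewrite /shear2 /=; congr pair; ring.
have K' x : shear2 t (shear2 (- t) x) = x by case: x => a b; rewrite /shear2 /=; congr pair; ring.
apply: (transversal_map (phi := shear2 t)) => [x y z|x|x hx|x y|x y].
- exact: proj_eq2_trans.
- exact: prim2_shear.
- by exists (shear2 (- t) x) => //; apply: prim2_shear.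
- exact: E.
- by move/(E _ _ _ ON); rewrite !K.
Qed.

Lemma hform_scale al be de l x : hform al be de (l * x.1, l * x.2) = nm l * hform al be de x.
Proof. by rewrite /hform /nrm /= !(up_cM H); ring. Qed.

Lemma hform_cong (A M : int) al be de x y : vg A al -> vg A be -> vg A de ->
  O x.1 -> O x.2 -> O y.1 -> O y.2 -> vg M (x.1 - y.1) -> vg M (x.2 - y.2) ->
  vg (A + M) (hform al be de x - hform al be de y).
Proof.
move=> ha hb hd Ox1 Ox2 Oy1 Oy2 h1 h2.
have hb' := vg_c H hb.
have k1 : vg M (c x.1 - c y.1) by rewrite -(up_cD H); apply: (vg_c H).
have k2 : vg M (c x.2 - c y.2) by rewrite -(up_cD H); apply: (vg_c H).
have Oc := up_cO H.
have -> : hform al be de x - hform al be de y =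
    al * ((x.1 - y.1) * c x.1 + (c x.1 - c y.1) * y.1)
  + be * ((x.1 - y.1) * c x.2 + (c x.2 - c y.2) * y.1)
  + c be * ((x.2 - y.2) * c x.1 + (c x.1 - c y.1) * y.2)
  + de * ((x.2 - y.2) * c x.2 + (c x.2 - c y.2) * y.2) by rewrite /hform /nrm; ring.
by do ![apply: (vgD H)]; apply: (vgM H) => //; apply: (vgD H); apply: (vgMr H) => //; exact: Oc.
Qed.

(** Divisibility of the value by w^l depends only on the point modulo w^N as long as l exceeds the
    valuation A of the coefficients by at most N; this is what limits the levels that a finite set
    of points can detect. *)
Lemma hform_inv (A l : int) N al be de x y : vg A al -> vg A be -> vg A de ->
  l <= A + N -> prim2 O x -> prim2 O y -> proj_eq2 N x y ->
  vg l (hform al be de x) -> vg l (hform al be de y).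
Proof.
move=> ha hb hd lN; rewrite !prim2_O => -[[Ox1 Ox2] _] [[Oy1 Oy2] _] [m [um h1 h2]] h.
have Om := unit_O um.
have := @hform_cong A N al be de (m * y.1, m * y.2) x ha hb hd.
rewrite hform_scale /= => /(_ (up_mul H Om Oy1) (up_mul H Om Oy2) Ox1 Ox2).
move=> /(_ (eqmod_sym H h1) (eqmod_sym H h2)) /(vg_le H lN) h'.
by have := vgD H h' h; rewrite subrK => /(vg_unit H _ _ (unit_nrm H um)).
Qed.

(** The level j is counted from the minimal valuation of the coefficients. For j <= 0 there is no
    condition, and all q^(2N) + q^(2N-2) points of the projective line modulo w^N are counted. *)
Definition hform_count N (r : nat) (j : int) : nat :=
  if j <= 0 then (q ^ N.*2 + q ^ N.-1.*2)%N else norm_count q N r `|j|.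

Section Herm.
Variables (N : nat) (I J : finType) (f : I -> L) (g : J -> L).
Hypothesis hf : residue_system O w O N.+1 f.
Hypothesis hg : residue_system O w O N g.

Let tl : transversal (prim2 O) (proj_eq2 N.+1) (lines2 f g).
Proof. by apply: lines2_transversal => //; [exact: (lattice_O H)|move=> t []]. Qed.

(** Completing the square: at (x, 1) the form equals al (N(x + c(be)/al) - a) with a = -(al de -
    N(be))/al^2 of valuation r, so the count is one of norms. At the points (1, w g) the value has
    valuation exactly A, and they contribute nothing for l > A. *)
Lemma hform_cnt_case1 (A l : int) (r : nat) al be de :
  c al = al -> c de = de ->
  al != 0 -> v al = A -> vg A be -> vg A de -> al * de - nm be != 0 ->
  v (al * de - nm be) = A + A + r -> l <= A + N.+1 ->
  cnt (fun s => vg l (hform al be de (lines2 f g s))) = hform_count N.+1 r (l - A).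
Proof.
move=> ca cd al0 va hb hd D0 vD lN.
have ha : vg A al by apply/(vgP H); rewrite ?va.
have [fO _ _] := hf; have [gO _ _] := hg.
rewrite /hform_count; have [lA|lA] := leP (l - A) 0.
  rewrite cnt_true => [|s]; first by rewrite card_sum (card_O H hf) (card_O H hg).
  apply: (vg_le H (j := A)); first lia.
  have : prim2 O (lines2 f g s) by case: tl.
  move/prim2_O => [[k1 k2] _].
  have Oc := up_cO H; have := vg_c H hb => hcb; rewrite /hform /nrm.
  by do ![apply: (vgD H)]; rewrite mulrC; apply: (vgMr H) => //; apply: (up_mul H) => //; exact: Oc.
pose j := `|l - A|%N; have lE : l = A + j by rewrite /j; lia.
have jN : (j <= N.+1)%N by lia.
rewrite cnt_sum -[X in norm_count _ _ _ X]/j.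
rewrite [X in (_ + X)%N]cnt_false ?addn0 => [|k]; last first.
  rewrite lE; have -> : hform al be de (lines2 f g (inr k)) = al +
    (w * g k) * (c (w * g k) * de + c be) + be * c (w * g k).
    by rewrite /hform /nrm /= (up_c1 H); ring.
  have hw : vg 1 (w * g k) := vg1w (gO k).
  have hw' := vg_c H hw.
  have hs : vg (A + 1) ((w * g k) * (c (w * g k) * de + c be) + be * c (w * g k)).
    apply: (vgD H); last exact: (vgM H).
    rewrite addrC; apply: (vgM H) => //; apply: (vgD H); last exact: (vg_c H).
    by rewrite mulrC; apply: (vgMr H) => //; apply: (up_cO H); apply/vgE0; apply: (vg_le H _ hw); lia.
  have [s0 vs] := vg_cancel H hs al0 va; rewrite -addrA => /(vgP H _ s0).
  by rewrite vs; lia.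
have Obe : O (c be / al).
  apply/vgE0; have := vgM H (vg_c H hb) (_ : vg (- A) al^-1); rewrite subrr; apply.
  by apply/(vgP H); rewrite ?invr_eq0 // (valV H) // va.
pose a : L := - (al * de - nm be) / (al * al).
have a0 : a != 0 by rewrite mulf_neq0 ?oppr_eq0 ?invr_eq0 ?mulf_neq0.
have vaE : v a = r.
  rewrite /a (valM H) ?oppr_eq0 ?invr_eq0 ?mulf_neq0 // (valN H) (valV H) ?mulf_neq0 // (valM H) //.
  by rewrite vD va; lia.
have oa : Ok a.
  split; first by apply/vgE0/(vgP H); rewrite ?vaE.
  by rewrite /a (up_cM H) (c_opp H) (up_cD H) (up_cM H) ca cd (c_nrm H) (c_inv H) (up_cM H) ca.
have hf' := residue_system_add (lattice_O H) hf Obe.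
rewrite -(norm_cnt H hf' oa a0 vaE jN); apply: eq_cnt => i.
have -> : hform al be de (lines2 f g (inl i)) = al * (nm (f i + c be / al) - a).
  rewrite /hform /a /nrm /= (c_add H) (up_cM H) (c_inv H) (up_cK H) ca (up_c1 H).
  by field.
by rewrite lE; apply: (vg_mull H).
Qed.
End Herm.

Lemma hform_swap al be de x : hform al be de (swap2 x) = hform de (c be) al x.
Proof. by rewrite /hform /swap2 /nrm /= (up_cK H); ring. Qed.
Lemma hform_shear al be de t x : c al = al -> c de = de ->
  hform al be de (shear2 t x) = hform (al + c t * be + t * c be + nm t * de) (be + t * de) de x.
Proof.
by move=> ca cd; rewrite /hform /shear2 /nrm /= !(c_add H) !(up_cM H) cd; ring.
Qed.

(** A is the minimal valuation of the coefficients. If it is attained on the diagonal, the square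
    can be completed, possibly after exchanging the coordinates. Otherwise a shear creates a
    diagonal coefficient of that valuation. Swaps and shears permute the points of the projective
    line, so the count is unchanged. *)
Lemma hform_cnt al be de : c al = al -> c de = de -> al * de - nm be != 0 ->
  exists (A : int) (r : nat), [/\ v (al * de - nm be) = A + A + r,
    forall B, vg B al -> vg B be -> vg B de -> B <= A &
    forall N (I J : finType) (f : I -> L) (g : J -> L) (l : int),
      residue_system O w O N.+1 f -> residue_system O w O N g -> l <= A + N.+1 ->
      cnt (fun s => vg l (hform al be de (lines2 f g s))) = hform_count N.+1 r (l - A)].
Proof.
move=> ca cd D0.
match goal with |- ?g => set goal := g end.
have main al' be' de' A (phi : L * L -> L * L) :
    c al' = al' -> c de' = de' -> al' != 0 -> v al' = A -> vg A be' -> vg A de' ->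
    al' * de' - nm be' = al * de - nm be ->
    vg A al -> vg A be -> vg A de ->
    (forall B, vg B al -> vg B be -> vg B de -> B <= A) ->
    (forall x, hform al be de (phi x) = hform al' be' de' x) ->
    (forall N (I : finType) (f : I -> L * L), transversal (prim2 O) (proj_eq2 N) f ->
       transversal (prim2 O) (proj_eq2 N) (fun i => phi (f i))) ->
    goal.
  move=> ca' cd' al0' va' hb' hd' DE ha hb hd hB hphi tphi.
  have hD : vg (A + A) (al * de - nm be).
    by apply: (vgB H); [exact: (vgM H)|apply: (vgM H) => //; exact: (vg_c H)].
  pose r := absz (v (al * de - nm be) - (A + A))%R.
  have vD : v (al * de - nm be) = A + A + r.
    by move/(vgP H _ D0): hD => h; rewrite /r; lia.
  exists A, r; split => // N I J f g l hf hg lN.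
  have tl : transversal (prim2 O) (proj_eq2 N.+1) (lines2 f g).
    by apply: lines2_transversal => //; [exact: (lattice_O H)|move=> t []].
  rewrite -(hform_cnt_case1 hf hg ca' cd' al0' va' hb' hd' _ _ lN) ?DE //.
  rewrite (cnt_transversal (P := fun x => vg l (hform al be de x))
    (@proj_eq2_sym N.+1) (@proj_eq2_trans N.+1) tl (tphi _ _ _ tl)) //; last first.
    by move=> x y hx hy; apply: hform_inv ha hb hd lN _ _; [case: hx|case: hy].
  by apply: eq_cnt => s; rewrite hphi.
have le_of (x : L) (B : int) : x != 0 -> vg B x -> B <= v x by move=> x0 /(vgP H _ x0).
have vgv (x : L) : vg (v x) x.
  have [->|x0] := eqVneq x 0; [exact: (vg_zero H)|exact/(vgP H)].
have case1 : al != 0 -> (vg (v al) be) -> vg (v al) de -> goal := fun a0 hb hd =>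
  main al be de (v al) id ca cd a0 erefl hb hd erefl (vgv al) hb hd
    (fun B h _ _ => le_of al B a0 h) (fun x => erefl) (fun N I f t => t).
have case2 : de != 0 -> vg (v de) be -> vg (v de) al -> goal.
  move=> d0 hb ha.
  apply: (main de (c be) al (v de) swap2) => //; first exact: (vg_c H).
  - by rewrite /nrm (up_cK H); ring.
  - by move=> B _ _; apply: le_of.
  - by move=> x; rewrite hform_swap.
  - by move=> N I f; apply: transversal_swap2.
have [b0|b0] := eqVneq be 0.
  have [a0 d0] : al != 0 /\ de != 0.
    by apply/andP; move: D0; rewrite b0 /nrm mul0r subr0 mulf_eq0 negb_or.
  case: (leP (v al) (v de)) => h.
    by apply: case1 => //; [rewrite b0; exact: (vg_zero H)|apply: (vg_le H h)].
  by apply: case2 => //; [rewrite b0; exact: (vg_zero H)|apply: (vg_le H (ltW h))].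
have [h1|h1] := pselect (al != 0 /\ vg (v al) be /\ vg (v al) de).
  by case: h1 => a0 [hb hd]; apply: case1.
have [h2|h2] := pselect (de != 0 /\ vg (v de) be /\ vg (v de) al).
  by case: h2 => d0 [hb ha]; apply: case2.
have ha : vg (v be + 1) al.
  have [->|a0] := eqVneq al 0; first exact: (vg_zero H).
  apply/(vgP H) => //; case: (ltP (v be) (v al)) => [h|h]; first lia.
  have hb : vg (v al) be by apply/(vgP H).
  exfalso; have [d0|d0] := eqVneq de 0.
    by apply: h1; split => //; split => //; rewrite d0; exact: (vg_zero H).
  case: (leP (v al) (v de)) => hd; first by apply: h1; split => //; split => //; apply/(vgP H).
  by apply: h2; split => //; split; apply/(vgP H) => //; lia.
have hd : vg (v be + 1) de.
  have [->|d0] := eqVneq de 0; first exact: (vg_zero H).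
  apply/(vgP H) => //; case: (ltP (v be) (v de)) => [h|h]; first lia.
  exfalso; apply: h2; split => //; split; first exact/(vgP H).
  by apply: (vg_le H _ ha); lia.
pose b := v be.
(* Chosen so that c(t) be has trace w^b: the new diagonal coefficient is w^b plus terms of larger
   valuation. A trace-1 element is used since twice a well-chosen real part would fail when 2 is not
   a unit. *)
pose t := c (th1 * (w ^ b / be)).
have Ot : O t.
  apply: (up_cO H); apply: (up_mul H); first exact: (th1_O H).
  apply/vgE0/(vgP H); rewrite ?mulf_neq0 ?invr_eq0 // (valM H) ?invr_eq0 // (val_w H) (valV H) // /b; lia.
have trt : c t * be + t * c be = w ^ b.
  rewrite /t (up_cK H) (up_cM H th1) (up_cM H (w ^ b)) (c_inv H) (c_wexp H).
  rewrite -[RHS]mul1r -(th1_tr H).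
  by field; rewrite (c_eq0 H) b0.
clearbody t.
pose al' := al + c t * be + t * c be + nm t * de.
have al'E : al' = w ^ b + (al + de * nm t) by rewrite /al' -trt; ring.
have hs : vg (b + 1) (al + de * nm t).
  by apply: (vgD H) => //; apply: (vgMr H) => //; exact: (O_nrm H).
have [al0' va'] : al' != 0 /\ v al' = b.
  by rewrite al'E; apply: (vg_cancel H hs (wj0 b)); rewrite (val_w H).
have hd0 : vg b de by apply: (vg_le H _ hd); lia.
apply: (main al' (be + t * de) de b (shear2 t)) => //.
- rewrite /al' (c_add H (al + _ + _)) (c_add H (al + _)) (c_add H al) !(up_cM H) !(up_cK H) ca cd /nrm; ring.
- by apply: (vgD H); [exact: vgv|rewrite mulrC; apply: (vgMr H)].
- by rewrite /al' /nrm (c_add H) (up_cM H) cd; ring.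
- by apply: (vg_le H _ ha); lia.
- exact: vgv.
- by move=> B _ + _; apply: le_of.
- by move=> x; rewrite hform_shear.
- by move=> N I f; apply: transversal_shear2.
Qed.
End LocalCounts2.

(** * Linear forms on the isotropic lines of the hermitian spaces of dimension 2 and 3 *)

Section LocalCountsUnitary.
Variables (L : fieldType) (O : set L) (w : L) (c : L -> L).
Variables (q : nat) (rho : 'I_q -> L) (th : L).
Hypothesis H : unramified_pair O w c rho th.
Notation vg := (vg O w).
Notation v := (valuation O w).
Notation Ok := (Ok O c).
Notation nm := (nrm c).
Notation eta := (th - c th).
Notation th1 := (th1 c th).

Let w0 : w != 0 := up_w0 H.
Let wj0 (j : int) : w ^ j != 0. Proof. exact: expfz_neq0. Qed.
Let eta0 : eta != 0 := unit_neq0 (up_disc H).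
Let Oeta : O eta := unit_O (up_disc H).
Let OetaV : O eta^-1. Proof. by case: (up_disc H). Qed.

Definition Oi (x : L) : Prop := O x /\ c x = - x.

Lemma lattice_Oi : lattice O w Oi.
Proof.
rewrite /Oi; split => [|x y [Ox cx] [Oy cy]|x [Ox cx]|x j [Ox cx]|x j [Ox cx] vx].
- by split=> [|x []//]; split; [exact: (O_zero H)|rewrite (c_zero H) oppr0].
- by split; [exact: (O_add H)|rewrite (c_add H) cx cy opprD].
- by split; [exact: (O_opp H)|rewrite (c_opp H) cx].
- by split; [apply: (up_mul H) => //; apply: (O_wexp H)|rewrite (up_cM H) (c_wexp H) cx mulrN].
- by split => //; rewrite (up_cM H) (c_inv H) (c_wexp H) cx mulNr.
Qed.

Lemma residue_system_Oi N (I : finType) (f : I -> L) :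
  residue_system O w Ok N f -> residue_system O w Oi N (fun i => f i * eta).
Proof.
move=> [fA fex finj]; split => [i|x [Ox cx]|i j].
- have [Of cf] := fA i; split; first exact: (up_mul H).
  by rewrite (up_cM H) cf (c_eta H) mulrN.
- have [|i hi] := fex (x / eta).
    split; first exact: (up_mul H).
    by rewrite (up_cM H) (c_inv H) (c_eta H) cx invrN mulrNN.
  exists i; move: (vgMr H hi Oeta); rewrite /eqmod; congr (vg _ _); by field.
- rewrite /eqmod -mulrBl => h; apply: finj; have := vgMr H h OetaV.
  by rewrite mulfK.
Qed.

Definition lin2 (xi1 xi2 : L) (x : L * L) : L := x.1 * xi1 + x.2 * xi2.
(** The number of isotropic lines (x1 : x2) modulo w^N with w^j dividing x1 xi1 + x2 xi2, for a
    primitive xi whose norm for the hyperbolic form has valuation r. *)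
Definition lin2_count N (r j : nat) : nat :=
  if j == 0%N then (q ^ N + q ^ N.-1)%N else if (j <= r)%N then (q ^ (N - j))%N else 0%N.

Lemma lin2_inv N (j : nat) xi1 xi2 x y : O xi1 -> O xi2 -> (j <= N)%N ->
  proj_eq2 O w N x y -> vg j (lin2 xi1 xi2 x) -> vg j (lin2 xi1 xi2 y).
Proof.
move=> Ox1 Ox2 jN [m [um h1 h2]] h; apply/(vg_unit H j _ um).
have -> : m * lin2 xi1 xi2 y = lin2 xi1 xi2 x - ((x.1 - m * y.1) * xi1 + (x.2 - m * y.2) * xi2).
  by rewrite /lin2; ring.
apply: (vgB H) => //.
by apply: (vgD H); apply: (vgMr H) => //; [apply: (vg_le H _ h1)|apply: (vg_le H _ h2)]; lia.
Qed.

Section Lin2.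
Variables (N : nat) (I J : finType) (f : I -> L) (g : J -> L).
Hypothesis hf : residue_system O w Ok N.+1 f.
Hypothesis hg : residue_system O w Ok N g.
Notation ll := (lines2 w (fun i => f i * eta) (fun j => g j * eta)).

Lemma lines2_Oi : transversal (prim2 O Oi) (proj_eq2 O w N.+1) ll.
Proof.
apply: (lines2_transversal H lattice_Oi); try exact: residue_system_Oi.
move=> t ut [Ot ct]; split; first by case: ut.
by rewrite (c_inv H) ct invrN.
Qed.

(** On the line (f eta, 1) the form is a unit times (f + p1) + p2 th with f, p1, p2 fixed by [c].
    The component p2 does not depend on the line and has valuation r, so it decides whether there
    are solutions; f is then determined modulo w^j. *)
Lemma lin2_cnt_case1 (r j : nat) xi1 xi2 : unit_set O xi1 -> O xi2 ->
  xi1 * c xi2 + c xi1 * xi2 != 0 -> v (xi1 * c xi2 + c xi1 * xi2) = r -> (j <= N.+1)%N ->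
  cnt (fun s => vg j (lin2 xi1 xi2 (ll s))) = lin2_count N.+1 r j.
Proof.
move=> u1 Ox2 a0 va jN; have x10 := unit_neq0 u1; have Ox1 := unit_O u1.
have [fO _ _] := hf; have [gO _ _] := hg; rewrite /lin2_count.
have [->|j0] := eqVneq j 0%N.
  rewrite cnt_true => [|s]; first by rewrite card_sum (card_Ok H hf) (card_Ok H hg).
  have [/(_ s)[[k1 k2] _ _ _] _ _] := lines2_Oi.
  by apply/vgE0; apply: (O_add H); apply: (up_mul H).
rewrite cnt_sum [X in (_ + X)%N]cnt_false ?addn0; last first.
  move=> k h; apply: (unit_not_vg H u1).
  have -> : xi1 = lin2 xi1 xi2 (ll (inr k)) - (w * (g k * eta)) * xi2.
    by rewrite /lin2 /=; ring.
  apply: (vgB H); first by apply: (vg_le H _ h); lia.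
  by apply: (vgMr H) => //; apply: (vg1w H); apply: (up_mul H) => //; case: (gO k).
pose p := xi2 / (eta * xi1).
have Op : O p.
  rewrite /p invfM mulrA; apply: (up_mul H); last by case: u1.
  exact: (up_mul H).
have -> : cnt (fun i => vg j (lin2 xi1 xi2 (ll (inl i)))) =
    cnt (fun i => vg j (f i - - coef_1 c th p) /\ vg j (coef_th c th p)).
  apply: eq_cnt => i.
  have -> : lin2 xi1 xi2 (ll (inl i)) = (eta * xi1) * ((f i + coef_1 c th p) + coef_th c th p * th).
    rewrite -addrA -(coefE c th p) /p /lin2 /=; by field; rewrite ?x10 ?eta0.
  rewrite opprK; split.
    move/(vg_unit H j _ (unitM H (up_disc H) u1)); apply: (vg_coef H).
      by rewrite (c_add H) (c_coef_1 H); case: (fO i) => _ ->.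
    exact: (c_coef_th H).
  move=> [h1 h2]; apply/(vg_unit H j _ (unitM H (up_disc H) u1)).
  by apply: (vgD H) => //; apply: (vgMr H) => //; exact: (up_th H).
have bE : coef_th c th p = (- (eta * eta * (xi1 * c xi1)))^-1 * - (xi1 * c xi2 + c xi1 * xi2).
  rewrite /coef_th /p (up_cM H) (c_inv H) (up_cM H) (c_eta H).
  by field; rewrite !oppr_eq0 !mulf_neq0 ?(c_eq0 H) ?x10 ?eta0.
have ub : unit_set O ((- (eta * eta * (xi1 * c xi1)))^-1).
  apply: unitV; rewrite -mulN1r; apply: (unitM H).
    by split; rewrite ?oppr_eq0 ?oner_neq0 ?invrN ?invr1 //; apply: (O_opp H); exact: (up_one H).
  apply: (unitM H); first exact: (unitM H (up_disc H) (up_disc H)).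
  exact: (unit_nrm H u1).
have hb : vg j (coef_th c th p) <-> (j <= r)%N.
  rewrite bE (vg_unit H) // (vgP H) ?oppr_eq0 // (valN H) va; lia.
case: (boolP (j <= r)%N) => jr.
  rewrite -(cnt_vg_Ok H hf (t := - coef_1 c th p) _ jN).
    by apply: eq_cnt => i; split => [[]//|h]; split => //; apply/hb.
  split; last by rewrite (c_opp H) (c_coef_1 H).
  by apply: (O_opp H); apply/vgE0/(vg_coef_1 H)/vgE0.
by rewrite cnt_false // => i [_ /hb]; rewrite (negPf jr).
Qed.

Lemma lin2_cnt (r j : nat) xi1 xi2 : O xi1 -> O xi2 -> unit_set O xi1 \/ unit_set O xi2 ->
  xi1 * c xi2 + c xi1 * xi2 != 0 -> v (xi1 * c xi2 + c xi1 * xi2) = r -> (j <= N.+1)%N ->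
  cnt (fun s => vg j (lin2 xi1 xi2 (ll s))) = lin2_count N.+1 r j.
Proof.
move=> Ox1 Ox2 hu a0 va jN; have [u1|n1] := pselect (unit_set O xi1).
  exact: lin2_cnt_case1.
have u2 : unit_set O xi2 by case: hu.
rewrite -(@lin2_cnt_case1 r j xi2 xi1) //; try by rewrite addrC [xi2 * _]mulrC [c xi2 * _]mulrC.
rewrite (cnt_transversal (P := fun x => vg j (lin2 xi1 xi2 x))
    (@proj_eq2_sym _ _ _ _ _ _ _ H N.+1) (@proj_eq2_trans _ _ _ _ _ _ _ H N.+1)
    lines2_Oi (transversal_swap2 H lines2_Oi)) //; last first.
  by move=> x y _ _; apply: lin2_inv.
by apply: eq_cnt => s; rewrite /lin2 /swap2 /= addrC.
Qed.
End Lin2.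

Record vec3 : Type := Vec3 { x1 : L; x2 : L; x3 : L }.
Implicit Types x y : vec3.

Definition proj_eq3 N x y : Prop :=
  exists l, [/\ unit_set O l, vg N (x1 x - l * x1 y), vg N (x2 x - l * x2 y)
     & vg N (x3 x - l * x3 y)].

Definition iso3 x : Prop := x1 x * c (x3 x) + nm (x2 x) + c (x1 x) * x3 x = 0.
Definition prim3 x : Prop :=
  [/\ iso3 x, O (x1 x), O (x2 x), O (x3 x)
    & [\/ unit_set O (x1 x), unit_set O (x2 x) | unit_set O (x3 x)]].

Lemma proj_eq3_sym N x y : proj_eq3 N x y -> proj_eq3 N y x.
Proof.
move=> [l [ul h1 h2 h3]]; have l0 := unit_neq0 ul; exists l^-1; split; first exact: unitV.
- by apply/(vg_unit H N _ ul); move/(vgN H): h1; congr (vg _ _); field.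
- by apply/(vg_unit H N _ ul); move/(vgN H): h2; congr (vg _ _); field.
- by apply/(vg_unit H N _ ul); move/(vgN H): h3; congr (vg _ _); field.
Qed.

Lemma proj_eq3_trans N x y z : proj_eq3 N x y -> proj_eq3 N y z -> proj_eq3 N x z.
Proof.
move=> [l [ul h1 h2 h3]] [m [um k1 k2 k3]]; exists (l * m); split; first exact: (unitM H).
- by have := vgD H h1 ((vg_unit H N _ ul).2 k1); congr (vg _ _); ring.
- by have := vgD H h2 ((vg_unit H N _ ul).2 k2); congr (vg _ _); ring.
- by have := vgD H h3 ((vg_unit H N _ ul).2 k3); congr (vg _ _); ring.
Qed.

(** The general solution p of p + c(p) = -N(s): a particular one is -N(s) th1, and the homogeneous
    solutions are the multiples of eta by elements fixed by [c]. Hence (p, s, 1) is isotropic for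
    the antidiagonal form. *)
Definition iso_pt (s t : L) : L := - (nm s) * th1 + t * eta.

Lemma iso_pt_tr s t : c t = t -> iso_pt s t + c (iso_pt s t) = - nm s.
Proof.
move=> ct; rewrite /iso_pt (c_add H) (up_cM H (- _)) (up_cM H t) (c_opp H) (c_nrm H) (c_eta H) ct.
have -> : c th1 = 1 - th1 by rewrite -(th1_tr H) addrAC subrr add0r.
ring.
Qed.
Lemma iso_pt_O s t : O s -> O t -> O (iso_pt s t).
Proof.
move=> Os Ot; apply: (O_add H); last exact: (up_mul H).
by apply: (up_mul H); [apply: (O_opp H); exact: (O_nrm H)|exact: (th1_O H)].
Qed.
Lemma iso_ptE s p : p + c p = - nm s ->
  iso_pt s ((p + nm s * th1) / eta) = p /\ c ((p + nm s * th1) / eta) = (p + nm s * th1) / eta.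
Proof.
move=> e; split; first by rewrite /iso_pt; field.
rewrite (up_cM H) (c_inv H) (c_eta H) invrN mulrN -mulNr; congr (_ / _).
rewrite (c_add H) (up_cM H) (c_nrm H).
have -> : c th1 = 1 - th1 by rewrite -(th1_tr H) addrAC subrr add0r.
have -> : c p = - nm s - p by rewrite -e addrC addKr.
ring.
Qed.

(** Modulo w there are q^3 isotropic lines (p : s : 1) and the line (1 : 0 : 0); the second chart
    lists the lifts of the latter. *)
Definition lines3 (I K J M : finType) (f : I -> L) (g : K -> L) (f' : J -> L) (g' : M -> L)
    (s : (I * K) + (J * M)) : vec3 :=
  match s with
  | inl t => Vec3 (iso_pt (f t.1) (g t.2)) (f t.1) 1
  | inr t => Vec3 1 (w * f' t.1) (iso_pt (w * f' t.1) (w * g' t.2))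
  end.

Let hw : vg 1 w. Proof. by rewrite -{2}[w]expr1z; apply/(vg_wexp H). Qed.

(* If the last coordinate is not a unit then neither is the middle one. *)
Lemma prim3_unit x : prim3 x -> ~ unit_set O (x3 x) ->
  unit_set O (x1 x) /\ vg 1 (x2 x).
Proof.
move=> [iso Ox1 Ox2 Ox3 hu] n3; have v3 : vg 1 (x3 x) by apply/(unit_setN H).
have vn : vg 1 (nm (x2 x)).
  have -> : nm (x2 x) = - (c (x3 x) * x1 x + x3 x * c (x1 x)).
    by apply/eqP; rewrite -addr_eq0 -iso; apply/eqP; ring.
  apply: (vgN H); apply: (vgD H); apply: (vgMr H) => //; first exact: (vg_c H).
  exact: (up_cO H).
have n2 : ~ unit_set O (x2 x) by move=> u; apply: (unit_not_vg H (unit_nrm H u)).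
by split; [case: hu|apply/(unit_setN H)].
Qed.

Lemma vg_iso_pt (N : nat) s t s' t' : O s -> O s' -> c t = t -> c t' = t' ->
  vg N (s - s') -> vg N (iso_pt s t - iso_pt s' t') <-> vg N (t - t').
Proof.
move=> Os Os' ct ct' hs.
have hn : vg N (- (nm s - nm s') * th1).
  apply: (vgMr H); last exact: (th1_O H).
  by apply: (vgN H); apply: (eqmod_nrm H).
have -> : iso_pt s t - iso_pt s' t' = - (nm s - nm s') * th1 + eta * (t - t').
  by rewrite /iso_pt; ring.
rewrite -(vg_unit H N (t - t') (up_disc H)); split => h; last exact: (vgD H).
by have := vgB H h hn; rewrite addrC addKr.
Qed.

Lemma lines3_transversal N (I K J M : finType) (f : I -> L) (g : K -> L)
    (f' : J -> L) (g' : M -> L) :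
  residue_system O w O N.+1 f -> residue_system O w Ok N.+1 g ->
  residue_system O w O N f' -> residue_system O w Ok N g' ->
  transversal prim3 (proj_eq3 N.+1) (lines3 f g f' g').
Proof.
move=> [fO fex finj] [gO gex ginj] [fO' fex' finj'] [gO' gex' ginj'].
have O1 := up_one H; have u1 := unit1 H; have Ow := up_w H.
have vw : v w = 1 by rewrite -[X in v X]expr1z (val_w H).
have cgw m : c (w * g' m) = w * g' m by rewrite (up_cM H) (up_cw H); case: (gO' m) => _ ->.
have cg k : c (g k) = g k by case: (gO k).
have NE : Posz N.+1 = 1 + Posz N by lia.
split => [[[i k]|[j m]]|x hx|[[i k]|[j m]] [[i' k']|[j' m']] [l [ul /= h1 h2 h3]]].
- split; rewrite /iso3 /=; last by constructor 3.
  + by rewrite (up_c1 H) !mulr1 addrAC (iso_pt_tr _ (cg k)) addNr.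
  + by apply: iso_pt_O => //; case: (gO k).
  + exact: fO.
  + exact: O1.
- split; rewrite /iso3 /=; last by constructor 1.
  + by rewrite (up_c1 H) !mul1r addrAC [c _ + _]addrC (iso_pt_tr _ (cgw m)) addNr.
  + exact: O1.
  + exact: (up_mul H).
  + by apply: iso_pt_O => //; apply: (up_mul H) => //; case: (gO' m).
- have [iso Ox1 Ox2 Ox3 hu] := hx.
  have [u3|n3] := pselect (unit_set O (x3 x)).
    have x30 := unit_neq0 u3; have cx30 : c (x3 x) != 0 by rewrite (c_eq0 H).
    have O3V : O (x3 x)^-1 by case: u3.
    pose p := x1 x / x3 x; pose s := x2 x / x3 x.
    have Os : O s by exact: (up_mul H).
    have e : p + c p = - nm s.
      apply/eqP; rewrite -addr_eq0 /p /s /nrm !(up_cM H) !(c_inv H); apply/eqP.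
      move: iso; rewrite /iso3 /nrm => iso.
      transitivity ((x1 x * c (x3 x) + x2 x * c (x2 x) + c (x1 x) * x3 x) / (x3 x * c (x3 x))).
        by field; rewrite cx30.
      by rewrite iso mul0r.
    have [pE tc] := iso_ptE e; set t := (p + nm s * th1) / eta in pE tc.
    have Ot : O t.
      apply: (up_mul H) => //; apply: (O_add H); first exact: (up_mul H).
      by apply: (up_mul H); [exact: (O_nrm H)|exact: (th1_O H)].
    have [i hi] := fex s Os; have [k hk] := gex t (conj Ot tc).
    exists (inl (i, k)), (x3 x); split => //=.
    + have -> : x1 x - x3 x * iso_pt (f i) (g k) = x3 x * (iso_pt s t - iso_pt (f i) (g k)).
        by rewrite pE /p; field.
      by apply/(vg_unit H) => //; apply/vg_iso_pt.
    + have -> : x2 x - x3 x * f i = x3 x * (s - f i) by rewrite /s; field.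
      by apply/(vg_unit H).
    + by rewrite mulr1 subrr; exact: (vg_zero H).
  have [u x2n] := prim3_unit hx n3.
  have x10 := unit_neq0 u; have cx10 : c (x1 x) != 0 by rewrite (c_eq0 H).
  have O1V : O (x1 x)^-1 by case: u.
  have v3 : vg 1 (x3 x) by apply/(unit_setN H).
  pose p := x3 x / x1 x; pose s := x2 x / x1 x.
  have vs : vg 1 s by exact: (vgMr H).
  have Os : O s by exact: (up_mul H).
  have e : p + c p = - nm s.
    apply/eqP; rewrite -addr_eq0 /p /s /nrm !(up_cM H) !(c_inv H); apply/eqP.
    move: iso; rewrite /iso3 /nrm => iso.
    transitivity ((x1 x * c (x3 x) + x2 x * c (x2 x) + c (x1 x) * x3 x) / (x1 x * c (x1 x))).
      by field; rewrite cx10.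
    by rewrite iso mul0r.
  have [pE tc] := iso_ptE e; set t := (p + nm s * th1) / eta in pE tc.
  (* In the second chart both parameters are divisible by w, which is why residues modulo w^N
     suffice there for lines modulo w^(N+1). *)
  have vt : vg 1 t.
    apply: (vgMr H) => //; apply: (vgD H); first exact: (vgMr H).
    apply: (vgMr H); last exact: (th1_O H).
    by apply: (vgMr H) => //; apply: (up_cO H).
  have Osw : O (s / w) by exact/vg1E.
  have Otw : Ok (t / w).
    split; first exact/vg1E.
    by rewrite (up_cM H) tc (c_inv H) (up_cw H).
  have [j hj] := fex' _ Osw; have [m hm] := gex' _ Otw.
  have hs : vg N.+1 (s - w * f' j).
    rewrite NE; have := (vg_mull H N (s / w - f' j) w0 vw).2 hj; congr (vg _ _).
    by field.
  have ht : vg N.+1 (t - w * g' m).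
    rewrite NE; have := (vg_mull H N (t / w - g' m) w0 vw).2 hm; congr (vg _ _).
    by field.
  exists (inr (j, m)), (x1 x); split => //=.
  + by rewrite mulr1 subrr; exact: (vg_zero H).
  + have -> : x2 x - x1 x * (w * f' j) = x1 x * (s - w * f' j) by rewrite /s; field.
    by apply/(vg_unit H).
  + have -> : x3 x - x1 x * iso_pt (w * f' j) (w * g' m) = x1 x * (iso_pt s t - iso_pt (w * f' j) (w * g' m)).
      by rewrite pE /p; field.
    by apply/(vg_unit H) => //; apply/vg_iso_pt => //; apply: (up_mul H).
- have hl : vg N.+1 (1 - l) by move: h3; rewrite mulr1.
  have ii : i = i'.
    apply: finj; rewrite /eqmod.
    have -> : f i - f i' = (f i - l * f i') - (1 - l) * f i' by ring.
    by apply: (vgB H) => //; apply: (vgMr H).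
  rewrite -ii in h1 *; congr (inl (_, _)); apply: ginj; rewrite /eqmod.
  apply/(vg_iso_pt (N := N.+1) (fO i) (fO i)) => //; first by rewrite subrr; exact: (vg_zero H).
  have -> : iso_pt (f i) (g k) - iso_pt (f i) (g k') =
    (iso_pt (f i) (g k) - l * iso_pt (f i) (g k')) - (1 - l) * iso_pt (f i) (g k') by ring.
  apply: (vgB H) => //; apply: (vgMr H) => //; apply: iso_pt_O => //; by case: (gO k').
- exfalso; apply: (unit_not_vg H u1).
  rewrite -[X in vg _ X](subrK (l * iso_pt (w * f' j') (w * g' m'))); apply: (vgD H).
    by apply: (vg_le H _ h3); lia.
  rewrite mulrC; apply: (vgMr H); last by case: ul.
  rewrite /iso_pt; apply: (vgD H); apply: (vgMr H); try exact: (th1_O H); try exact: Oeta.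
    apply: (vgN H); rewrite /nrm; apply: (vgMr H); first exact: (vg1w H).
    by apply: (up_cO H); apply: (up_mul H).
  by apply: (vg1w H); case: (gO' m').
- exfalso; apply: (unit_not_vg H ul).
  have -> : l = iso_pt (w * f' j) (w * g' m) - (iso_pt (w * f' j) (w * g' m) - l * 1) by ring.
  apply: (vgB H); last by apply: (vg_le H _ h3); lia.
  rewrite /iso_pt; apply: (vgD H); apply: (vgMr H); try exact: (th1_O H); try exact: Oeta.
    apply: (vgN H); rewrite /nrm; apply: (vgMr H); first exact: (vg1w H).
    by apply: (up_cO H); apply: (up_mul H).
  by apply: (vg1w H); case: (gO' m).
- have hl : vg N.+1 (1 - l) by move: h1; rewrite mulr1.
  have jj : j = j'.
    apply: finj'; rewrite /eqmod; apply/(vg_mull H N _ w0 vw); rewrite -NE.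
    have -> : w * (f' j - f' j') = (w * f' j - l * (w * f' j')) - (1 - l) * (w * f' j') by ring.
    by apply: (vgB H) => //; apply: (vgMr H) => //; exact: (up_mul H).
  rewrite -jj in h3 *; congr (inr (_, _)); apply: ginj'; rewrite /eqmod.
  apply/(vg_mull H N _ w0 vw); rewrite -NE mulrBr.
  have Owf : O (w * f' j) by exact: (up_mul H).
  apply/(vg_iso_pt (N := N.+1) Owf Owf) => //; first by rewrite subrr; exact: (vg_zero H).
  have -> : iso_pt (w * f' j) (w * g' m) - iso_pt (w * f' j) (w * g' m') =
    (iso_pt (w * f' j) (w * g' m) - l * iso_pt (w * f' j) (w * g' m')) -
    (1 - l) * iso_pt (w * f' j) (w * g' m') by ring.
  apply: (vgB H) => //; apply: (vgMr H) => //; apply: iso_pt_O => //.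
  by apply: (up_mul H) => //; case: (gO' m').
Qed.

Definition lin3 (xi x : vec3) : L := x1 x * x1 xi + x2 x * x2 xi + x3 x * x3 xi.
Definition norm3 (xi : vec3) : L := x1 xi * c (x3 xi) + nm (x2 xi) + c (x1 xi) * x3 xi.
(** The number of isotropic lines modulo w^N on which a primitive linear form, with norm of
    valuation r, is divisible by w^j. For j = 0 all q^(3N) + q^(3N-3) lines are counted. *)
Definition lin3_count N (r j : nat) : nat :=
  if j == 0%N then (q ^ (3 * N) + q ^ (3 * N.-1))%N
  else (norm_count q N r j * q ^ (N - j))%N.

Lemma lin3_inv N (j : nat) xi x y : O (x1 xi) -> O (x2 xi) -> O (x3 xi) -> (j <= N)%N ->
  proj_eq3 N x y -> vg j (lin3 xi x) -> vg j (lin3 xi y).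
Proof.
move=> Ox1 Ox2 Ox3 jN [m [um h1 h2 h3]] h; apply/(vg_unit H j _ um).
have -> : m * lin3 xi y = lin3 xi x - ((x1 x - m * x1 y) * x1 xi +
   (x2 x - m * x2 y) * x2 xi + (x3 x - m * x3 y) * x3 xi) by rewrite /lin3; ring.
apply: (vgB H) => //.
by do ![apply: (vgD H)]; apply: (vgMr H) => //;
  [apply: (vg_le H _ h1)|apply: (vg_le H _ h2)|apply: (vg_le H _ h3)]; lia.
Qed.

Section Lin3.
Variables (N : nat) (I K J M : finType) (f : I -> L) (g : K -> L) (f' : J -> L) (g' : M -> L).
Hypothesis hf : residue_system O w O N.+1 f.
Hypothesis hg : residue_system O w Ok N.+1 g.
Hypothesis hf' : residue_system O w O N f'.
Hypothesis hg' : residue_system O w Ok N g'.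
Notation ll := (lines3 f g f' g').

(** After division by the unit coefficient, the value z on the line (p : s : 1) is the combination
    of its trace, with coefficient [th1], and of a component along eta that contains the free
    parameter t of [iso_pt] linearly. The trace is a - N(s - c(s2)), so w^j divides z exactly if s
    solves a norm congruence and t lies in a prescribed class modulo w^j. *)
Lemma lin3_cnt_case1 (r j : nat) xi : unit_set O (x1 xi) -> O (x2 xi) -> O (x3 xi) ->
  norm3 xi != 0 -> v (norm3 xi) = r -> (j <= N.+1)%N ->
  cnt (fun s => vg j (lin3 xi (ll s))) = lin3_count N.+1 r j.
Proof.
move=> u1 Ox2 Ox3 a0 va jN; have x10 := unit_neq0 u1; have Ox1 := unit_O u1.
have cx10 : c (x1 xi) != 0 by rewrite (c_eq0 H).
have tl := lines3_transversal hf hg hf' hg'.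
have [fO _ _] := hf; have [gO _ _] := hg; have [fO' _ _] := hf'; have [gO' _ _] := hg'.
rewrite /lin3_count; have [->|j0] := eqVneq j 0%N.
  rewrite cnt_true => [|s].
    rewrite card_sum !card_prod (card_O H hf) (card_Ok H hg) (card_O H hf') (card_Ok H hg') -!expnD.
    by congr (q ^ _ + q ^ _)%N; lia.
  have [/(_ s)[_ k1 k2 k3 _] _ _] := tl.
  by apply/vgE0; do ![apply: (O_add H)]; apply: (up_mul H).
rewrite cnt_sum [X in (_ + X)%N]cnt_false ?addn0; last first.
  move=> [k m] h; apply: (unit_not_vg H u1).
  have -> : x1 xi = lin3 xi (ll (inr (k, m))) - ((w * f' k) * x2 xi + iso_pt (w * f' k) (w * g' m) * x3 xi).
    by rewrite /lin3 /=; ring.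
  apply: (vgB H); first by apply: (vg_le H _ h); lia.
  have h1 : vg 1 (w * f' k) by exact: (vg1w H).
  apply: (vgD H); apply: (vgMr H) => //.
  rewrite /iso_pt; apply: (vgD H); apply: (vgMr H); try exact: (th1_O H); try exact: Oeta.
    apply: (vgN H); rewrite /nrm; apply: (vgMr H) => //.
    by apply: (up_cO H); apply: (up_mul H) => //; exact: (up_w H).
  by apply: (vg1w H); case: (gO' m).
have O1V : O (x1 xi)^-1 by case: u1.
pose s2 := x2 xi / x1 xi; pose s3 := x3 xi / x1 xi.
have Os2 : O s2 by exact: (up_mul H).
have Os3 : O s3 by exact: (up_mul H).
pose a : L := norm3 xi / nm (x1 xi).
have aE : a = s3 + nm s2 + c s3.
  by rewrite /a /norm3 /s2 /s3 /nrm !(up_cM H) !(c_inv H); field; rewrite x10 cx10.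
have un := unit_nrm H u1.
have n10 := unit_neq0 un.
have a0' : a != 0 by rewrite mulf_neq0 ?invr_eq0.
have va' : v a = r.
  by rewrite /a (valM H) ?invr_eq0 // (valV H) // (val_unit H un) va subr0.
have oa : Ok a.
  split; first by apply/vgE0/(vgP H); rewrite ?va'.
  by rewrite aE !(c_add H) (c_nrm H) (up_cK H); ring.
have Oc2 : O (- c s2) by apply: (O_opp H); exact: (up_cO H).
have hf2 := residue_system_add (lattice_O H) hf Oc2.
rewrite -(norm_cnt H hf2 oa a0' va' jN).
rewrite -(cnt_pair (Q := fun i k => vg j (g k - - ((s3 + f i * s2 - nm (f i) * th1 - (a - nm (f i - c s2)) * th1) / eta)))).
  apply: eq_cnt => -[i k] /=; set z := s3 + f i * s2 + iso_pt (f i) (g k).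
  have -> : lin3 xi (ll (inl (i, k))) = x1 xi * z.
    by rewrite /lin3 /z /s2 /s3 /=; field.
  rewrite (vg_unit H _ _ u1).
  have cg : c (g k) = g k by case: (gO k).
  have trz : z + c z = a - nm (f i - c s2).
    have -> : z + c z = s3 + c s3 + (f i * s2 + c (f i * s2)) + (iso_pt (f i) (g k) + c (iso_pt (f i) (g k))).
      by rewrite /z !(c_add H); ring.
    rewrite iso_pt_tr // aE /nrm (up_cD H (f i)) (up_cK H) (up_cM H (f i) s2); ring.
  set t := (_ / eta : L); have zE : z = (z + c z) * th1 + (g k + t) * eta.
    by rewrite trz /t /z /iso_pt; field.
  rewrite opprK; split => [hz|[h1 h2]].
    have h1 : vg j (z + c z) by apply: (vgD H) => //; exact: (vg_c H).
    split; first by rewrite -opprB -trz; apply: (vgN H).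
    apply/(vg_unit H j _ (up_disc H)).
    have -> : eta * (g k + t) = z - (z + c z) * th1 by rewrite {1}zE; ring.
    by apply: (vgB H) => //; apply: (vgMr H) => //; exact: (th1_O H).
  rewrite zE; apply: (vgD H); apply: (vgMr H) => //; last exact: (th1_O H).
  by rewrite trz -opprB; apply: (vgN H).
move=> i _; apply: (cnt_vg_Ok H hg) => //.
set n := nm (f i - c s2).
have On : O n by apply: (O_nrm H); apply: (O_add H).
have Oth := th1_O H.
split.
  apply: (O_opp H); apply: (up_mul H) => //; case: oa => Oa _.
  have On2 := O_nrm H (fO i); have Of2 := up_mul H (fO i) Os2.
  apply: (up_sub H); last by apply: (up_mul H) => //; apply: (up_sub H).
  by apply: (up_sub H); [exact: (O_add H)|exact: (up_mul H)].
rewrite (c_opp H) (up_cM H _ eta^-1) (c_inv H) (c_eta H) invrN mulrN opprK.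
rewrite -[RHS]mulNr; congr (_ / _).
rewrite !(up_cD H) (c_add H) (up_cM H (f i)) (up_cM H (nm _)) (up_cM H (a - n)) (up_cD H) !(c_nrm H).
have -> : c th1 = 1 - th1 by rewrite -(th1_tr H) addrAC subrr add0r.
have -> : c a = a by case: oa.
rewrite /n aE /nrm (up_cD H (f i)) (up_cK H); ring.
Qed.

Definition rev3 x : vec3 := Vec3 (x3 x) (x2 x) (x1 x).
Definition shift3 x : vec3 := Vec3 (x1 x - x2 x - th1 * x3 x) (x2 x + x3 x) (x3 x).
Definition unshift3 x : vec3 := Vec3 (x1 x + x2 x - c th1 * x3 x) (x2 x - x3 x) (x3 x).

Lemma transversal_rev3 (S : finType) (h : S -> vec3) :
  transversal prim3 (proj_eq3 N.+1) h -> transversal prim3 (proj_eq3 N.+1) (fun s => rev3 (h s)).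
Proof.
have A x : prim3 x -> prim3 (rev3 x).
  move=> [iso Ox1 Ox2 Ox3 hu]; split => //=.
    by move: iso; rewrite /iso3 /= => <-; ring.
  by case: hu; [constructor 3|constructor 2|constructor 1].
apply: (transversal_map (phi := rev3)) => [x y z|x|x hx|x y|x y].
- exact: proj_eq3_trans.
- exact: A.
- by exists (rev3 x); [exact: A|case: (x)].
- by move=> [l [ul h1 h2 h3]]; exists l.
- by move=> [l [ul h1 h2 h3]]; exists l.
Qed.

Let cth1 : c th1 = 1 - th1. Proof. by rewrite -(th1_tr H) addrAC subrr add0r. Qed.

(** These are unipotent isometries of the ternary form: the conditions N(e) = 1 and trace of t equal
    to -1 cancel the terms in N(x3). *)
Lemma prim3_shift (e t : L) x : O t -> O e -> e * c e = 1 -> t + c t = -1 ->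
  prim3 x -> prim3 (Vec3 (x1 x - c e * x2 x + t * x3 x) (x2 x + e * x3 x) (x3 x)).
Proof.
move=> Ot Oe ee tt hx; have [iso Ox1 Ox2 Ox3 hu] := hx.
have Oce : O (c e) by exact: (up_cO H).
split => //=.
- move: iso; rewrite /iso3 /= /nrm !(c_add H) (c_opp H) !(up_cM H) (up_cK H) => iso.
  rewrite -[RHS]iso.
  have -> : (x1 x - c e * x2 x + t * x3 x) * c (x3 x) + (x2 x + e * x3 x) * (c (x2 x) + c e * c (x3 x)) +
    (c (x1 x) - e * c (x2 x) + c t * c (x3 x)) * x3 x =
    (x1 x * c (x3 x) + x2 x * c (x2 x) + c (x1 x) * x3 x) +
    (e * c e + (t + c t)) * (x3 x * c (x3 x)) by ring.
  by rewrite ee tt subrr mul0r addr0.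
- by do ![apply: (O_add H)]; rewrite ?mulNr //; [apply: (O_opp H)|]; apply: (up_mul H).
- by apply: (O_add H) => //; apply: (up_mul H).
- have [u3|n3] := pselect (unit_set O (x3 x)); first by constructor 3.
  have [u1 v2] := prim3_unit hx n3; have v3 : vg 1 (x3 x) by apply/(unit_setN H).
  constructor 1; apply: (unit_eqmod H u1).
    have -> : x1 x - c e * x2 x + t * x3 x - x1 x = x3 x * t - x2 x * c e by ring.
    by apply: (vgB H); apply: (vgMr H).
  by do ![apply: (O_add H)] => //; rewrite ?mulNr //; [apply: (O_opp H)|]; apply: (up_mul H).
Qed.

Lemma transversal_shift3 (S : finType) (h : S -> vec3) :
  transversal prim3 (proj_eq3 N.+1) h -> transversal prim3 (proj_eq3 N.+1) (fun s => shift3 (h s)).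
Proof.
have Ot := th1_O H; have Oct : O (c th1) by exact: (up_cO H).
have A x : prim3 x -> prim3 (shift3 x).
  move=> hx; have := prim3_shift (e := 1) (t := - th1) (O_opp H Ot) (up_one H) _ _ hx.
  rewrite (up_c1 H) mulr1 => /(_ erefl); rewrite (c_opp H) cth1.
  have -> : - th1 - (1 - th1) = -1 :> L by ring.
  by move/(_ erefl); rewrite /shift3 !mul1r mulNr.
have B x : prim3 x -> prim3 (unshift3 x).
  move=> hx; have := prim3_shift (e := -1) (t := - c th1) (O_opp H Oct) (O_opp H (up_one H)) _ _ hx.
  rewrite (c_opp H 1) (up_c1 H) mulrNN mulr1 => /(_ erefl); rewrite (c_opp H) (up_cK H) cth1.
  have -> : - (1 - th1) - th1 = -1 :> L by ring.
  by move/(_ erefl); rewrite /unshift3 !mulN1r opprK mulNr cth1.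
have E1 x y : proj_eq3 N.+1 x y -> proj_eq3 N.+1 (shift3 x) (shift3 y).
  move=> [l [ul h1 h2 h3]]; exists l; split => //=.
    have -> : x1 x - x2 x - th1 * x3 x - l * (x1 y - x2 y - th1 * x3 y) =
      (x1 x - l * x1 y) - (x2 x - l * x2 y) - (x3 x - l * x3 y) * th1 by ring.
    by apply: (vgB H); [exact: (vgB H)|exact: (vgMr H)].
  have -> : x2 x + x3 x - l * (x2 y + x3 y) = (x2 x - l * x2 y) + (x3 x - l * x3 y) by ring.
  exact: (vgD H).
have E2 x y : proj_eq3 N.+1 x y -> proj_eq3 N.+1 (unshift3 x) (unshift3 y).
  move=> [l [ul h1 h2 h3]]; exists l; split => //=.
    have -> : x1 x + x2 x - c th1 * x3 x - l * (x1 y + x2 y - c th1 * x3 y) =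
      (x1 x - l * x1 y) + (x2 x - l * x2 y) - (x3 x - l * x3 y) * c th1 by ring.
    by apply: (vgB H); [exact: (vgD H)|exact: (vgMr H)].
  have -> : x2 x - x3 x - l * (x2 y - x3 y) = (x2 x - l * x2 y) - (x3 x - l * x3 y) by ring.
  exact: (vgB H).
have K1 x : unshift3 (shift3 x) = x.
  by case: x => a b d; rewrite /unshift3 /shift3 /= cth1; congr Vec3; ring.
have K2 x : shift3 (unshift3 x) = x.
  by case: x => a b d; rewrite /unshift3 /shift3 /= cth1; congr Vec3; ring.
apply: (transversal_map (phi := shift3)) => [x y z|x|x hx|x y|x y].
- exact: proj_eq3_trans.
- exact: A.
- by exists (unshift3 x); [exact: B|].
- exact: E1.
- by move/E2; rewrite !K1.
Qed.

Lemma lin3_cnt (r j : nat) xi : O (x1 xi) -> O (x2 xi) -> O (x3 xi) ->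
  [\/ unit_set O (x1 xi), unit_set O (x2 xi) | unit_set O (x3 xi)] ->
  norm3 xi != 0 -> v (norm3 xi) = r -> (j <= N.+1)%N ->
  cnt (fun s => vg j (lin3 xi (ll s))) = lin3_count N.+1 r j.
Proof.
move=> Ox1 Ox2 Ox3 hu a0 va jN.
have tl := lines3_transversal hf hg hf' hg'.
have change phi (h := fun s => phi (ll s)) : transversal prim3 (proj_eq3 N.+1) h ->
    cnt (fun s => vg j (lin3 xi (ll s))) = cnt (fun s => vg j (lin3 xi (h s))).
  move=> trh; apply: (cnt_transversal (P := fun x => vg j (lin3 xi x))
    (@proj_eq3_sym N.+1) (@proj_eq3_trans N.+1) tl trh) => //.
  by move=> x y _ _; apply: lin3_inv.
have [u1|n1] := pselect (unit_set O (x1 xi)); first exact: lin3_cnt_case1.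
have [u3|n3] := pselect (unit_set O (x3 xi)).
  rewrite (change rev3 (transversal_rev3 tl)) -(@lin3_cnt_case1 r j (rev3 xi)) //.
  - by apply: eq_cnt => s; rewrite /lin3 /=; have -> : forall a b d : L, a + b + d = d + b + a by move=> *; ring.
  - by move: a0; rewrite /norm3 /=; apply: contra_neq => <-; ring.
  - by move: va; rewrite /norm3 /= => <-; congr (v _); ring.
have u2 : unit_set O (x2 xi) by case: hu.
(* When the middle coefficient is the only unit, a reversal and a shift of the lines turn the form
   into one whose first coefficient is congruent to it, with the same norm. *)
pose xi' := Vec3 (x3 xi + x2 xi - th1 * x1 xi) (x2 xi - x1 xi) (x1 xi).
have Ot := th1_O H.
have nE : norm3 xi' = norm3 xi.
  rewrite /norm3 /= /nrm !(up_cD H) (c_add H) (up_cM H th1) cth1; ring.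
rewrite (change (fun x => shift3 (rev3 x)) (transversal_shift3 (transversal_rev3 tl))) -(@lin3_cnt_case1 r j xi') ?nE //=.
- by apply: eq_cnt => s; have -> // : lin3 xi (shift3 (rev3 (ll s))) = lin3 xi' (ll s)
    by rewrite /lin3 /=; ring.
- apply: (unit_eqmod H u2).
    have -> : x3 xi + x2 xi - th1 * x1 xi - x2 xi = x3 xi - x1 xi * th1 by ring.
    apply: (vgB H); first exact/(unit_setN H).
    by apply: (vgMr H) => //; apply/(unit_setN H).
  by apply: (up_sub H); [exact: (O_add H)|exact: (up_mul H)].
- exact: (up_sub H).
Qed.
End Lin3.
End LocalCountsUnitary.

(** * Generating functions of local densities *)

(* [phi] is the coefficient sequence of the power series [G / (1 - d X^m)] *)
Definition ser (F : fieldType) (m : nat) (d : F) (phi : nat -> F) (G : {poly F}) : Prop :=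
  forall j, phi j - d * (if (m <= j)%N then phi (j - m)%N else 0) = G`_j.

Section Series.
Variable F : fieldType.
Implicit Types (x d e : F) (phi psi : nat -> F) (G P : {poly F}).

Lemma ser_shift m d phi G A : ser m d phi G ->
  ser m d (fun j => if (A <= j)%N then phi (j - A)%N else 0) ('X^A * G).
Proof.
move=> h j; rewrite coefXnM ltnNge; have [Aj|Aj] := leqP A j => /=; last first.
  by case: ifP => mj; rewrite ?ifF ?mulr0 ?subr0 //; lia.
rewrite -h; congr (_ - _ * _).
have [mj|mj] := leqP m (j - A)%N.
  have -> : (m <= j)%N by lia.
  have -> : (A <= j - m)%N by lia.
  by congr phi; lia.
by case: ifP => // mj'; rewrite ifF //; lia.
Qed.

Lemma ser_double m d phi G : ser m d phi G ->
  ser m.*2 d (fun j => if odd j then 0 else phi j./2) (G \Po 'X^2).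
Proof.
move=> h j; rewrite coef_comp_poly_Xn // dvdn2.
have -> : (j %/ 2)%N = j./2 by rewrite divn2.
have [oj|ej] := boolP (odd j) => /=.
  by case: ifP => mj; rewrite ?oddB ?odd_double ?oj ?mulr0 ?subr0.
rewrite -h; congr (_ - _ * _).
have jE : j = j./2.*2 by rewrite -[LHS]odd_double_half (negPf ej).
have [mj|mj] := leqP m j./2.
  have -> : (m.*2 <= j)%N by lia.
  rewrite oddB ?odd_double ?(negPf ej) //; last lia.
  by congr phi; lia.
by rewrite ifF //; lia.
Qed.

Lemma ser_rec m d phi psi G P e s : ser m d phi G ->
  (forall j, psi j = P`_j + e * (if (s <= j)%N then phi (j - s)%N else 0)) ->
  ser m d psi ((1 - d *: 'X^m) * P + e *: ('X^s * G)).
Proof.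
move=> h hpsi j; have hs := ser_shift s h j; rewrite coefD coefZ -hs mulrBl mul1r coefB.
rewrite -scalerAl coefZ coefXnM ltnNge hpsi.
have [mj|mj] := leqP m j => /=; last by rewrite !mulr0 !subr0.
by rewrite hpsi; ring.
Qed.

(** From the frequency of valuation at least j to that of valuation exactly j. *)
Definition tails (W : nat -> F) (j : nat) : F := W j - W j.+1.

(** [norm_count] divided by q^(2N), with x = 1/q. The densities below normalise the other counts in
    the same way, by q^(2N), q^N and q^(3N). *)
Definition norm_dens x (r j : nat) : F :=
  if (j <= r)%N then x ^+ (uphalf j).*2 else if odd r then 0 else (1 + x) * x ^+ j.

Lemma norm_dens_rec x r j : norm_dens x r.+2 j.+2 = x ^+ 2 * norm_dens x r j.
Proof.
rewrite /norm_dens !ltnS /= negbK; case: ifP => _; first by rewrite doubleS -addn2 exprD mulrC.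
by case: ifP => _; [rewrite mulr0|rewrite -addn2 exprD; ring].
Qed.

Definition herm_dens x r j : F := if j == 0%N then 1 + x ^+ 2 else norm_dens x r j.
(** Both terms contain the factor 1 + x^2 X. Once it is removed, the substitution X -> 1/(x^2 X)
    exchanges them up to sign and a monomial; the closed form is written so as to show this. *)
Definition herm_poly x r : {poly F} :=
  1 - x ^+ 4 *: 'X^2 - (- x) ^+ r *: ('X^r * (x%:P - (x * (1 - x ^+ 2)) *: 'X - x ^+ 3 *: 'X^2)).

(** Adding 2 to both r and j multiplies the norm densities by x^2, so that in the induction from r
    to r + 2 only the first coefficients are new. *)
Lemma herm_ser x r : ser 2 (x ^+ 2) (tails (herm_dens x r)) (herm_poly x r).
Proof.
elim/ltn_ind: r => -[|[|r]] IH.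
- move=> j; rewrite /herm_poly expr0 scale1r expr0 mul1r !(coefB, coefZ, coef1, coefC, coefX, coefXn).
  case: j => [|[|[|j]]]; rewrite /tails /herm_dens /norm_dens /=; rewrite ?subSS ?subn0 /=; rewrite ?exprS ?expr0; ring.
- move=> j; have -> : herm_poly x 1 = 1 + x ^+ 2 *: 'X - x ^+ 2 *: 'X^2 - x ^+ 4 *: 'X^3.
    rewrite /herm_poly expr1 -!mul_polyC !(rmorphM, rmorphB, rmorphN, rmorphXn, rmorph1) /=; ring.
  rewrite !(coefD, coefN, coefZ, coef1, coefC, coefX, coefXn).
  case: j => [|[|[|[|[|j]]]]]; rewrite /tails /herm_dens /norm_dens /=; rewrite ?subSS ?subn0 /=; rewrite ?exprS ?expr0; ring.
- have -> : herm_poly x r.+2 = (1 - x ^+ 2 *: 'X^2) * (1 - x ^+ 4 *: 'X^2) +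
      x ^+ 2 *: ('X^2 * herm_poly x r).
    rewrite /herm_poly -!mul_polyC !rmorphXn /= !(rmorphM, rmorphB, rmorphN, rmorphXn, rmorph1) /=.
    rewrite -[r.+2]addn2 !exprD; ring.
  apply: ser_rec; first by apply: IH; lia.
  move=> j; rewrite coefB coef1 coefZ coefXn /tails /herm_dens.
  case: j => [|[|[|j]]] /=; try by rewrite /norm_dens /=; rewrite ?subSS ?subn0 /=; rewrite ?exprS ?expr0; ring.
    rewrite !norm_dens_rec /norm_dens /=; rewrite ?subSS ?subn0 /=; rewrite ?exprS ?expr0; ring.
  rewrite !norm_dens_rec ?subSS ?subn0; ring.
Qed.

Definition lin2_dens x r j : F :=
  if j == 0%N then 1 + x else if (j <= r)%N then x ^+ j else 0.
Definition lin2_poly x r : {poly F} :=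
  1 - x ^+ 2 *: 'X + x ^+ r.+1 *: ('X^r * (1 - 'X)).

Lemma lin2_ser x r : ser 1 x (tails (lin2_dens x r)) (lin2_poly x r).
Proof.
elim: r => [|r IH].
  move=> j; rewrite /lin2_poly expr1 expr0 mul1r !(coefD, coefN, coefZ, coef1, coefC, coefX, coefXn).
  case: j => [|[|j]]; rewrite /tails /lin2_dens /=; rewrite ?subSS ?subn0 /=; rewrite ?exprS ?expr0; ring.
have -> : lin2_poly x r.+1 = (1 - x *: 'X^1) * (1 - x ^+ 2 *: 'X) + x *: ('X^1 * lin2_poly x r).
  rewrite /lin2_poly -!mul_polyC !rmorphXn /= !exprS expr0 mulr1; ring.
apply: ser_rec IH _ => j; rewrite coefB coef1 coefZ coefX /tails /lin2_dens.
case: j => [|[|j]] /=; try by rewrite /=; ring.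
  by case: r => [|r] /=; rewrite ?subSS ?subn0 /=; ring.
rewrite !ltnS subSS subn0 /=; case: ifP => h1; case: ifP => h2; rewrite ?exprS ?expr0; ring.
Qed.

Definition lin3_dens x r j : F :=
  if j == 0%N then 1 + x ^+ 3 else norm_dens x r j * x ^+ j.
Definition lin3_poly x r : {poly F} :=
  (1 + x ^+ 3 *: 'X) * (1 - x ^+ 4 *: 'X - (- x ^+ 2) ^+ r *: ('X^r * (x ^+ 2 *: (1 - 'X)))).

Lemma lin3_ser x r : ser 2 (x ^+ 4) (tails (lin3_dens x r)) (lin3_poly x r).
Proof.
elim/ltn_ind: r => -[|[|r]] IH.
- move=> j; have -> : lin3_poly x 0 = (1 - x ^+ 2)%:P + (x ^+ 2 - x ^+ 4) *: 'X + (x ^+ 3 - x ^+ 5) *: 'X + (x ^+ 5 - x ^+ 7) *: 'X^2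
      - (x ^+ 2 - x ^+ 4) *: 'X + (x ^+ 2 - x ^+ 4) *: 'X.
    rewrite /lin3_poly !expr0 scale1r mul1r -!mul_polyC !(rmorphB, rmorphXn, rmorph1) /=; ring.
  rewrite !(coefD, coefN, coefZ, coef1, coefC, coefX, coefXn).
  case: j => [|[|[|j]]]; rewrite /tails /lin3_dens /norm_dens /=; rewrite ?subSS ?subn0 /=; rewrite ?exprS ?expr0; ring.
- move=> j; have -> : lin3_poly x 1 = 1 + x ^+ 3 *: 'X - x ^+ 4 *: 'X^2 - x ^+ 7 *: 'X^3.
    rewrite /lin3_poly expr1 -!mul_polyC !(rmorphN, rmorphXn) /=; ring.
  rewrite !(coefD, coefN, coefZ, coef1, coefC, coefX, coefXn).
  case: j => [|[|[|[|j]]]]; rewrite /tails /lin3_dens /norm_dens /=; rewrite ?subSS ?subn0 /=; rewrite ?exprS ?expr0; ring.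
- have -> : lin3_poly x r.+2 = (1 - x ^+ 4 *: 'X^2) * ((1 + x ^+ 3 *: 'X) * (1 - x ^+ 4 *: 'X)) +
      x ^+ 4 *: ('X^2 * lin3_poly x r).
    rewrite /lin3_poly -[r.+2]addn2 !exprD -!mul_polyC !(rmorphM, rmorphN, rmorphXn); ring.
  apply: ser_rec; first by apply: IH; lia.
  have -> : (1 + x ^+ 3 *: 'X) * (1 - x ^+ 4 *: 'X) = 1 + (x ^+ 3 - x ^+ 4) *: 'X - x ^+ 7 *: 'X^2 :> {poly F}.
    rewrite -!mul_polyC !(rmorphB, rmorphXn) /=; ring.
  move=> j; rewrite !(coefD, coefN, coefZ, coef1, coefC, coefX, coefXn) /tails /lin3_dens.
  case: j => [|[|[|j]]] /=; try by rewrite /norm_dens /=; rewrite ?subSS ?subn0 /=; rewrite ?exprS ?expr0; ring.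
    rewrite !norm_dens_rec /norm_dens /=; rewrite ?subSS ?subn0 /=; rewrite ?exprS ?expr0; ring.
  rewrite !norm_dens_rec ?subSS ?subn0 !exprS; ring.
Qed.
End Series.

Section CountsToDensities.
Variables (F : numFieldType) (q : nat).
Hypothesis q1 : (1 < q)%N.
Notation x := ((q%:R)^-1 : F).

Let q0 : q%:R != 0 :> F. Proof. by rewrite pnatr_eq0; lia. Qed.
Lemma expr_sub_nat (a b : nat) : (b <= a)%N -> (q ^ (a - b))%:R = q%:R ^+ a * x ^+ b :> F.
Proof.
move=> ba; rewrite natrX exprVn; apply: (mulIf (expf_neq0 b q0)).
by rewrite -exprD subnK // mulfVK // expf_neq0.
Qed.

Lemma norm_count_dens N r j : (j <= N)%N -> (0 < N)%N ->
  (norm_count q N r j)%:R = q%:R ^+ N.*2 * norm_dens x r j.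
Proof.
move=> jN N0; rewrite /norm_count /norm_dens.
case: ifP => _; first by rewrite doubleB expr_sub_nat // leq_double leq_uphalf_double; lia.
case: ifP => _; first by rewrite mulr0.
rewrite natrM expr_sub_nat; last by lia.
by rewrite exprS -[q.+1]addn1 natrD; field.
Qed.

Lemma hform_count_dens N r (j : nat) : (j <= N)%N -> (0 < N)%N ->
  (hform_count q N r j)%:R = q%:R ^+ N.*2 * herm_dens x r j.
Proof.
move=> jN N0; rewrite /hform_count /herm_dens lez_nat leqn0; case: eqP => [_|_]; last exact: norm_count_dens.
have -> : (N.-1.*2 = N.*2 - 2)%N by lia.
by rewrite natrD expr_sub_nat ?natrX ?mulrDr ?mulr1 //; lia.
Qed.

Lemma lin2_count_dens N r (j : nat) : (j <= N)%N -> (0 < N)%N ->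
  (lin2_count q N r j)%:R = q%:R ^+ N * lin2_dens x r j.
Proof.
move=> jN N0; rewrite /lin2_count /lin2_dens; case: eqP => [_|_].
  have -> : (N.-1 = N - 1)%N by lia.
  by rewrite natrD expr_sub_nat ?natrX ?mulrDr ?mulr1.
by case: ifP => _; rewrite ?mulr0 // expr_sub_nat.
Qed.

Lemma lin3_count_dens N r (j : nat) : (j <= N)%N -> (0 < N)%N ->
  (lin3_count q N r j)%:R = q%:R ^+ (3 * N) * lin3_dens x r j.
Proof.
move=> jN N0; rewrite /lin3_count /lin3_dens; case: eqP => [_|_].
  have -> : (3 * N.-1 = 3 * N - 3)%N by lia.
  by rewrite natrD expr_sub_nat ?natrX ?mulrDr ?mulr1 //; lia.
rewrite natrM norm_count_dens // expr_sub_nat //.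
by have -> : (3 * N = N.*2 + N)%N by [lia]; rewrite exprD; ring.
Qed.
End CountsToDensities.

(** * Unitary matrices and corner minors *)

Section ConjTranspose.
Variables (L : fieldType) (c : {rmorphism L -> L}).
Hypothesis cK : forall x, c (c x) = x.
Definition cjm (m n : nat) (A : 'M[L]_(m, n)) : 'M[L]_(n, m) := map_mx c A^T.

Lemma cjmE m (A : 'M[L]_m) : conj_trmx c A = cjm A. Proof. by []. Qed.
Lemma cjm_mul m n p (A : 'M[L]_(m, n)) (B : 'M[L]_(n, p)) : cjm (A *m B) = cjm B *m cjm A.
Proof. by rewrite /cjm trmx_mul map_mxM. Qed.
Lemma cjmK m n (A : 'M[L]_(m, n)) : cjm (cjm A) = A.
Proof. by apply/matrixP => i j; rewrite !mxE cK. Qed.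
Lemma cjm1 m : cjm (1%:M : 'M[L]_m) = 1%:M.
Proof. by rewrite /cjm trmx1 map_mx1. Qed.
Lemma cjm0 m n : cjm (0 : 'M[L]_(m, n)) = 0.
Proof. by rewrite /cjm trmx0 map_mx0. Qed.
Lemma cjmD m n (A B : 'M[L]_(m, n)) : cjm (A + B) = cjm A + cjm B.
Proof. by apply/matrixP => i j; rewrite !mxE rmorphD. Qed.
Lemma cjmN m n (A : 'M[L]_(m, n)) : cjm (- A) = - cjm A.
Proof. by apply/matrixP => i j; rewrite !mxE rmorphN. Qed.
Lemma cjmZ m n a (A : 'M[L]_(m, n)) : cjm (a *: A) = c a *: cjm A.
Proof. by apply/matrixP => i j; rewrite !mxE rmorphM. Qed.
Lemma cjm_block m1 m2 n1 n2 (A : 'M[L]_(m1, n1)) (B : 'M[L]_(m1, n2)) (C : 'M[L]_(m2, n1)) (D : 'M[L]_(m2, n2)) :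
  cjm (block_mx A B C D) = block_mx (cjm A) (cjm C) (cjm B) (cjm D).
Proof. by rewrite /cjm tr_block_mx map_block_mx. Qed.
Lemma cjm_mxsub m n p r (f : 'I_p -> 'I_m) (g : 'I_r -> 'I_n) (A : 'M[L]_(m, n)) :
  cjm (mxsub f g A) = mxsub g f (cjm A).
Proof. by apply/matrixP => i j; rewrite !mxE. Qed.
Lemma det_cjm m (A : 'M[L]_m) : \det (cjm A) = c (\det A).
Proof. by rewrite /cjm det_map_mx det_tr. Qed.
Lemma cjm_inv m (A : 'M[L]_m) : cjm (invmx A) = invmx (cjm A).
Proof. by rewrite /cjm trmx_inv map_invmx. Qed.
Lemma cjm_antidiag m : cjm (antidiag L m) = antidiag L m.
Proof.
apply/matrixP => i j; rewrite !mxE rmorph_nat; congr (GRing.natmul 1 (nat_of_bool _)).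
by apply/eqP/eqP => ->; rewrite rev_ordK.
Qed.
Lemma antidiag_sq m : antidiag L m *m antidiag L m = 1%:M.
Proof.
apply/matrixP => i j; rewrite !mxE (bigD1 (rev_ord i)) //= !mxE eqxx mul1r rev_ordK.
rewrite big1 ?addr0 => [|k /negPf nk]; first by rewrite eq_sym.
by rewrite mxE nk mul0r.
Qed.

(** If the rows [f] of h are combinations, through U, of the rows [g] of the identity, the block of
    h y h* at [f] is congruent by U to the block of y at [g]. *)
Lemma mxsub_congr m p (f : 'I_p -> 'I_m) d (g : 'I_d -> 'I_m) (U : 'M[L]_(p, d))
    (h y : 'M[L]_m) :
  rowsub f h = U *m rowsub g 1%:M ->
  mxsub f f (h *m y *m cjm h) = U *m mxsub g g y *m cjm U.
Proof.
move=> e.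
have -> : mxsub f f (h *m y *m cjm h) = rowsub f h *m y *m cjm (rowsub f h).
  apply/matrixP => i j; rewrite !mxE; apply: eq_bigr => k _; rewrite !mxE.
  by congr (_ * _); apply: eq_bigr => k' _; rewrite !mxE.
rewrite e cjm_mul !mulmxA; congr (_ *m _); rewrite -!mulmxA; congr (_ *m _).
rewrite mulmxA -rowsubE; apply/matrixP => i j; rewrite !mxE (bigD1 (g j)) //= !mxE eqxx rmorph1 mulr1.
by rewrite big1 ?addr0 // => k /negPf nk; rewrite !mxE eq_sym nk rmorph0 mulr0.
Qed.

Lemma det_schur a b (E : 'M[L]_a) (F : 'M[L]_(a, b)) (G : 'M[L]_(b, a)) (D : 'M[L]_b) :
  D \in unitmx -> \det (block_mx E F G D) = \det D * \det (E - F *m invmx D *m G).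
Proof.
move=> uD.
have -> : block_mx E F G D = block_mx 1%:M (F *m invmx D) 0 1%:M *m
    block_mx (E - F *m invmx D *m G) 0 G D.
  by rewrite mulmx_block !mul1mx !mul0mx !add0r subrK mulmxKV.
by rewrite det_mulmx det_ublock det_lblock !det1 !mul1r mulrC.
Qed.
End ConjTranspose.

(* Position [t] in the lower right block of size [a] of a matrix of size [s]. *)
Definition lrx (a s : nat) (le : (a <= s)%N) (t : 'I_a) : 'I_s :=
  rev_ord (widen_ord le (rev_ord t)).

Lemma lrxE a s (le : (a <= s)%N) (t : 'I_a) : lrx le t = (s - a + t)%N :> nat.
Proof. by rewrite /lrx /=; have := ltn_ord t; lia. Qed.

Lemma lrx_trans a b s (le1 : (a <= b)%N) (le2 : (b <= s)%N) (le : (a <= s)%N) :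
  lrx le =1 lrx le2 \o lrx le1.
Proof.
move=> t; apply/val_inj; change (lrx le t = lrx le2 (lrx le1 t) :> nat).
by rewrite !lrxE; have := ltn_ord t; lia. Qed.

Lemma lrx_rshift a b (le : (a <= b + a)%N) : lrx le =1 @rshift b a.
Proof. by move=> t; apply/val_inj; change (lrx le t = b + t :> nat)%N; rewrite lrxE; lia. Qed.

Definition lrsub (L : fieldType) a s (le : (a <= s)%N) (y : 'M[L]_s) : 'M[L]_a :=
  mxsub (lrx le) (lrx le) y.

Lemma corner_detE (L : fieldType) m (y : 'M[L]_m) (i : 'I_m./2) :
  corner_det y i = \det (lrsub (half_ord_lt i) y).
Proof. by []. Qed.

(** Block triangular with respect to the last [a] coordinates. Such an h multiplies the minor of
    size [a] by the norm of a determinant, which is a unit for h in K. *)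
Definition par (L : fieldType) (s : nat) (a : nat) (h : 'M[L]_s) : Prop :=
  forall i j : 'I_s, (s - a <= i)%N -> (j < s - a)%N -> h i j = 0.

Section Corners.
Variables (L : fieldType) (O : set L) (w : L) (c : {rmorphism L -> L}).
Variables (q : nat) (rho : 'I_q -> L) (th : L).
Hypothesis H : unramified_pair O w c rho th.
Notation vg := (vg O w).
Notation v := (valuation O w).
Notation cjm := (cjm c).
Let cK := up_cK H.

Definition integral_mx (m n : nat) (A : 'M[L]_(m, n)) : Prop := forall i j, O (A i j).

Lemma O_sum (I : finType) (P : pred I) (F : I -> L) : (forall i, P i -> O (F i)) -> O (\sum_(i | P i) F i).
Proof. by move=> h; apply/vgE0; apply: (vg_sum H) => i Pi; apply/vgE0/h. Qed.
Lemma O_prod (I : finType) (P : pred I) (F : I -> L) : (forall i, P i -> O (F i)) -> O (\prod_(i | P i) F i).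
Proof. by move=> h; elim/big_ind: _ => //; [exact: (up_one H)|exact: (up_mul H)]. Qed.
Lemma O_det m (A : 'M[L]_m) : integral_mx A -> O (\det A).
Proof.
move=> hA; apply: O_sum => s _; apply: (up_mul H); last exact: O_prod.
by case: (odd_perm s); rewrite ?expr1 ?expr0; [apply: (O_opp H)|]; exact: (up_one H).
Qed.
Lemma integral_mulmx m n p (A : 'M[L]_(m, n)) (B : 'M[L]_(n, p)) :
  integral_mx A -> integral_mx B -> integral_mx (A *m B).
Proof. by move=> hA hB i j; rewrite mxE; apply: O_sum => k _; exact: (up_mul H). Qed.
Lemma integral_cjm m n (A : 'M[L]_(m, n)) : integral_mx A -> integral_mx (cjm A).
Proof. by move=> hA i j; rewrite !mxE; exact: (up_cO H). Qed.
Lemma integral_1 m : integral_mx (1%:M : 'M[L]_m).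
Proof. by move=> i j; rewrite mxE; case: eqP => _; [exact: (up_one H)|exact: (O_zero H)]. Qed.
Lemma integral_0 m n : integral_mx (0 : 'M[L]_(m, n)).
Proof. by move=> i j; rewrite mxE; exact: (O_zero H). Qed.
Lemma integral_antidiag m : integral_mx (antidiag L m).
Proof. by move=> i j; rewrite mxE; case: eqP => _; [exact: (up_one H)|exact: (O_zero H)]. Qed.
Lemma integral_block m1 m2 n1 n2 (A : 'M[L]_(m1, n1)) (B : 'M[L]_(m1, n2)) (C : 'M[L]_(m2, n1)) (D : 'M[L]_(m2, n2)) :
  integral_mx A -> integral_mx B -> integral_mx C -> integral_mx D -> integral_mx (block_mx A B C D).
Proof.
move=> hA hB hC hD k l; rewrite -[k]splitK -[l]splitK.
case: (fintype.split k) => k'; case: (fintype.split l) => l' /=.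
- by rewrite block_mxEul.
- by rewrite block_mxEur.
- by rewrite block_mxEdl.
- by rewrite block_mxEdr.
Qed.

Notation K := (max_compact O c).

Lemma unitary_inv m (g : 'M[L]_m) : unitary_group c g ->
  g *m (antidiag L m *m cjm g *m antidiag L m) = 1%:M.
Proof.
move=> [ug e]; have e2 : antidiag L m *m cjm g *m antidiag L m *m g = 1%:M.
  by rewrite -mulmxA -mulmxA [cjm g *m _]mulmxA (_ : cjm g *m _ *m g = antidiag L m) ?antidiag_sq.
by rewrite (mulmx1C e2).
Qed.

Lemma unitary_r m (g : 'M[L]_m) : unitary_group c g -> g *m antidiag L m *m cjm g = antidiag L m.
Proof.
move=> hg; have := unitary_inv hg; rewrite !mulmxA => e.
by rewrite -[LHS]mulmx1 -(antidiag_sq L m) !mulmxA e mul1mx.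
Qed.

Lemma unitaryP m (g : 'M[L]_m) : g *m antidiag L m *m cjm g = antidiag L m -> unitary_group c g.
Proof.
move=> e; have e1 : g *m (antidiag L m *m cjm g *m antidiag L m) = 1%:M.
  by rewrite !mulmxA e antidiag_sq.
split; first by case/mulmx1_unit: e1.
have e2 := mulmx1C e1; rewrite cjmE.
have -> : cjm g *m antidiag L m *m g = antidiag L m *m (antidiag L m *m cjm g *m antidiag L m *m g).
  by rewrite !mulmxA antidiag_sq mul1mx.
by rewrite e2 mulmx1.
Qed.

Lemma unitary_mul m (g h : 'M[L]_m) : unitary_group c g -> unitary_group c h -> unitary_group c (g *m h).
Proof.
move=> hg hh; apply: unitaryP; rewrite cjm_mul.
have := unitary_r hh; rewrite !mulmxA => e.
by rewrite -[g *m h *m _ *m _]mulmxA -[g *m h *m _]mulmxA [h *m (_ *m _)]mulmxA e; apply: unitary_r.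
Qed.
Lemma unitary_cjm m (g : 'M[L]_m) : unitary_group c g -> unitary_group c (cjm g).
Proof. by move=> [ug e]; apply: unitaryP; rewrite (cjmK cK). Qed.
Lemma unitary_antidiag m : unitary_group c (antidiag L m).
Proof. by apply: unitaryP; rewrite cjm_antidiag antidiag_sq mul1mx. Qed.
Lemma max_compact_mul m (g h : 'M[L]_m) : K m g -> K m h -> K m (g *m h).
Proof. by move=> [ug ig] [uh ih]; split; [exact: unitary_mul|exact: integral_mulmx]. Qed.
Lemma max_compact_inv m (g : 'M[L]_m) : K m g -> exists2 h, K m h & h *m g = 1%:M /\ g *m h = 1%:M.
Proof.
move=> [ug ig]; exists (antidiag L m *m cjm g *m antidiag L m).
  split.
    by apply: unitary_mul; [apply: unitary_mul|]; try exact: unitary_antidiag; apply: unitary_cjm.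
  apply: integral_mulmx; [apply: integral_mulmx|]; try exact: integral_antidiag.
  exact: integral_cjm.
by have e := unitary_inv ug; split; [exact: mulmx1C|].
Qed.
Lemma max_compact_det m (g : 'M[L]_m) : K m g -> unit_set O (\det g).
Proof.
move=> hg; have [h hh [e _]] := max_compact_inv hg.
have e1 : \det h * \det g = 1 by rewrite -det_mulmx e det1.
have g0 : \det g != 0 by apply/eqP => g0; move/eqP: e1; rewrite g0 mulr0 eq_sym oner_eq0.
split => //; first by case: hg => _; exact: O_det.
have -> : (\det g)^-1 = \det h by apply: (mulIf g0); rewrite mulVf.
by case: hh => _; exact: O_det.
Qed.

Lemma act_mxM m (g h x : 'M[L]_m) : act_mx c (g *m h) x = act_mx c g (act_mx c h x).
Proof. by rewrite /act_mx !cjmE cjm_mul !mulmxA. Qed.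

(** The condition on the characteristic polynomial is kept in the form of the trace, which is
    invariant under the action and passes to Schur complements. *)
Definition herm_inv m (x : 'M[L]_m) : Prop :=
  [/\ unitary_group c x, cjm x = x & \tr (x *m antidiag L m) = \tr (antidiag L m)].

Lemma hermitian_herm_inv m (x : 'M[L]_m) : (0 < m)%N -> hermitian_space c x -> herm_inv x.
Proof.
move=> m0 [ux hx e]; split => //; apply: oppr_inj.
by rewrite -!char_poly_trace // e.
Qed.

Lemma act_herm_inv m (g x : 'M[L]_m) : unitary_group c g -> herm_inv x -> herm_inv (act_mx c g x).
Proof.
move=> hg [ux hx tx]; split.
- by rewrite /act_mx; apply: unitary_mul; [apply: unitary_mul|apply: unitary_cjm].
- by rewrite /act_mx !cjmE !cjm_mul (cjmK cK) hx mulmxA.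
- rewrite -tx /act_mx cjmE.
  have e := mulmx1C (unitary_inv hg).
  transitivity (\tr (g *m (x *m antidiag L m *m (antidiag L m *m cjm g *m antidiag L m)))).
    by rewrite !mulmxA -(mulmxA (g *m x) (antidiag L m)) antidiag_sq mulmx1.
  by rewrite mxtrace_mulC -(mulmxA (x *m _)) e mulmx1.
Qed.

Lemma corner_par s a (le : (a <= s)%N) (h y : 'M[L]_s) :
  integral_mx h -> unit_set O (\det h) -> par a h ->
  exists2 t, unit_set O t & \det (lrsub le (h *m y *m cjm h)) = t * \det (lrsub le y).
Proof.
have [b sE] : exists b, s = (b + a)%N by exists (s - a)%N; rewrite subnK.
move: le h y; rewrite {}sE => le h y ih uh ph.
have h0 : dlsubmx h = 0.
  apply/matrixP => i j; rewrite !mxE; apply: ph => /=; have := ltn_ord j; lia.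
have hE : h = block_mx (ulsubmx h) (ursubmx h) 0 (drsubmx h) by rewrite -h0 submxK.
have idr : integral_mx (drsubmx h) by move=> i j; rewrite !mxE.
have iul : integral_mx (ulsubmx h) by move=> i j; rewrite !mxE.
have udr : unit_set O (\det (drsubmx h)).
  have detE : \det h = \det (ulsubmx h) * \det (drsubmx h) by rewrite {1}hE det_ublock.
  have [n0 _ OV] := uh; rewrite detE in n0 OV.
  have [n1 n2] : \det (ulsubmx h) != 0 /\ \det (drsubmx h) != 0 by apply/andP; rewrite -negb_or -mulf_eq0.
  split; [exact: n2|exact: O_det|].
  have -> : (\det (drsubmx h))^-1 = \det (ulsubmx h) * (\det (ulsubmx h) * \det (drsubmx h))^-1.
    by field; rewrite n1 n2.
  by apply: (up_mul H) => //; exact: O_det.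
exists (\det (drsubmx h) * c (\det (drsubmx h))).
  by apply: (unitM H) => //; apply: (unit_c H).
have lrE (z : 'M[L]_(b + a)) : lrsub le z = drsubmx z.
  by apply/matrixP => i j; rewrite !mxE !lrx_rshift.
have -> : lrsub le (h *m y *m cjm h) = drsubmx h *m lrsub le y *m cjm (drsubmx h).
  rewrite !lrE {1 2}hE cjm_block -{1}[y]submxK !mulmx_block block_mxKdr cjm0.
  by rewrite !mul0mx !add0r mulmx0 add0r.
by rewrite !det_mulmx det_cjm; ring.
Qed.
End Corners.

(** * Schur complements and elements of K built from small blocks *)

Definition schur (L : fieldType) d b (Z : 'M[L]_(d + b)) : 'M[L]_d :=
  ulsubmx Z - ursubmx Z *m invmx (drsubmx Z) *m dlsubmx Z.

Lemma rowsub_rshift (L : fieldType) m1 m2 n1 n2 (A : 'M[L]_(m1, n1)) (B : 'M[L]_(m1, n2))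
    (C : 'M[L]_(m2, n1)) (D : 'M[L]_(m2, n2)) :
  rowsub (@rshift m1 m2) (block_mx A B C D) = row_mx C D.
Proof. by apply/matrixP => i j; rewrite mxE block_mxEv col_mxEd. Qed.

Lemma rowsub_row_mx (L : fieldType) m p n1 n2 (f : 'I_p -> 'I_m) (A : 'M[L]_(m, n1)) (B : 'M[L]_(m, n2)) :
  rowsub f (row_mx A B) = row_mx (rowsub f A) (rowsub f B).
Proof. by apply/matrixP => i j; rewrite !mxE; case: fintype.split => k; rewrite mxE. Qed.

Lemma rowsub_zero (L : fieldType) m p n (f : 'I_p -> 'I_m) : rowsub f (0 : 'M[L]_(m, n)) = 0.
Proof. by apply/matrixP => i j; rewrite !mxE. Qed.

Lemma antidiag_block (L : fieldType) b d :
  antidiag L (b + (d + b)) =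
  block_mx 0 (row_mx 0 (antidiag L b)) (col_mx 0 (antidiag L b)) (block_mx (antidiag L d) 0 0 0).
Proof.
apply/matrixP => k l; rewrite -[k]splitK -[l]splitK.
case: (fintype.split k) => k'; case: (fintype.split l) => l' /=.
- rewrite block_mxEul !mxE; case: eqP => // /(congr1 val) /=.
  by have := ltn_ord k'; have := ltn_ord l'; lia.
- rewrite block_mxEur -[l']splitK; case: (fintype.split l') => l'' /=.
    rewrite row_mxEl !mxE; case: eqP => // /(congr1 val) /=.
    by have := ltn_ord k'; have := ltn_ord l''; lia.
  rewrite row_mxEr !mxE; congr (GRing.natmul 1 (nat_of_bool _)).
  by rewrite -!val_eqE /=; have := ltn_ord k'; have := ltn_ord l''; lia.
- rewrite block_mxEdl -[k']splitK; case: (fintype.split k') => k'' /=.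
    rewrite col_mxEu !mxE; case: eqP => // /(congr1 val) /=.
    by have := ltn_ord l'; have := ltn_ord k''; lia.
  rewrite col_mxEd !mxE; congr (GRing.natmul 1 (nat_of_bool _)).
  by rewrite -!val_eqE /=; have := ltn_ord l'; have := ltn_ord k''; lia.
- rewrite block_mxEdr -[k']splitK -[l']splitK.
  case: (fintype.split k') => k''; case: (fintype.split l') => l'' /=.
  + rewrite block_mxEul !mxE; congr (GRing.natmul 1 (nat_of_bool _)).
    by rewrite -!val_eqE /=; have := ltn_ord l''; have := ltn_ord k''; lia.
  + rewrite block_mxEur !mxE; case: eqP => // /(congr1 val) /=.
    by have := ltn_ord l''; have := ltn_ord k''; lia.
  + rewrite block_mxEdl !mxE; case: eqP => // /(congr1 val) /=.
    by have := ltn_ord l''; have := ltn_ord k''; lia.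
  + rewrite block_mxEdr !mxE; case: eqP => // /(congr1 val) /=.
    by have := ltn_ord l''; have := ltn_ord k''; lia.
Qed.

Section Embeddings.
Variables (L : fieldType) (O : set L) (w : L) (c : {rmorphism L -> L}).
Variables (q : nat) (rho : 'I_q -> L) (th : L).
Hypothesis H : unramified_pair O w c rho th.
Notation vg := (vg O w).
Notation v := (valuation O w).
Notation cjm := (cjm c).
Notation K := (max_compact O c).
Notation integral_mx := (integral_mx O).
Notation J := (antidiag L).
Let cK := up_cK H.

(* The last [d + b] rows of [h] are those of [diag(1, g, 1)]. *)
Definition emb d b m (le : (d + b <= m)%N) (g : 'M[L]_d) (h : 'M[L]_m) : Prop :=
  rowsub (lrx le) h = block_mx g 0 0 1%:M *m rowsub (lrx le) 1%:M.

Lemma emb_par d b m (le : (d + b <= m)%N) g (h : 'M[L]_m) a :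
  emb le g h -> (a <= b)%N -> par a h.
Proof.
move=> e ab i j hi hj.
have ti : (i - (m - b) < b)%N by have := ltn_ord i; lia.
pose t : 'I_b := Ordinal ti.
have iE : i = lrx le (rshift d t).
  by apply/val_inj; change (i = lrx le (rshift d t) :> nat); rewrite lrxE /=; lia.
have := congr1 (fun M : 'M[L]_(d + b, m) => M (rshift d t) j) e.
rewrite [LHS]mxE -iE => ->; rewrite block_mxEv mul_col_mx col_mxEd.
rewrite -[rowsub _ _]vsubmxK mul_row_col mul0mx add0r mul1mx !mxE -iE.
by case: eqP => // ij; move: hj; rewrite -ij; lia.
Qed.

(** Only the last row u of [g] enters the block of size b + 1. Splitting off the unchanged block of
    size b leaves, by the determinant formula of Schur, the value at u of the hermitian form given
    by the Schur complement of the block of size d + 1 + b. *)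
Lemma emb_corner d b m (le : (d.+1 + b <= m)%N) (le1 : (b.+1 <= m)%N) (leb : (b <= m)%N)
    g (h y : 'M[L]_m) :
  emb le g h -> \det (lrsub leb y) != 0 ->
  \det (lrsub le1 (h *m y *m cjm h)) = \det (lrsub leb y) *
    (row ord_max g *m schur (lrsub le y) *m cjm (row ord_max g)) 0 0.
Proof.
move=> e D0; set u := row ord_max g; set Z := lrsub le y.
have l2 : (1 + b <= d.+1 + b)%N by lia.
pose U : 'M[L]_(1 + b, d.+1 + b) := block_mx u 0 0 1%:M.
have eU : rowsub (lrx le1) h = U *m rowsub (lrx le) 1%:M.
  have -> : rowsub (lrx le1) h = rowsub (lrx l2) (rowsub (lrx le) h).
    by apply/matrixP => i j; rewrite !mxE (lrx_trans l2 le le1).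
  rewrite e rowsubE mulmxA -rowsubE; congr (_ *m _); rewrite /U.
  apply/matrixP => k l; rewrite mxE; case: (fintype.splitP (k : 'I_(1 + b))) => k' kE.
    have -> : k = lshift b k' by apply/val_inj.
    have -> : lrx l2 (lshift b k') = lshift b ord_max.
      by apply/val_inj; change (lrx l2 (lshift b k') = d :> nat); rewrite lrxE /= (ord1 k') /=; lia.
    rewrite -[l]splitK; case: (fintype.split l) => l' /=.
      by rewrite block_mxEul (@block_mxEul L 1 b) mxE.
    by rewrite block_mxEur (@block_mxEur L 1 b) !mxE.
  have -> : k = rshift 1 k' by apply/val_inj.
  have -> : lrx l2 (rshift 1 k') = rshift d.+1 k'.
    by apply/val_inj; change (lrx l2 (rshift 1 k') = d.+1 + k' :> nat)%N; rewrite lrxE /=; lia.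
  rewrite -[l]splitK; case: (fintype.split l) => l' /=.
    by rewrite block_mxEdl (@block_mxEdl L 1 b) !mxE.
  by rewrite block_mxEdr (@block_mxEdr L 1 b).
have DE : drsubmx Z = lrsub leb y.
  apply/matrixP => i j; rewrite !mxE; congr (y _ _); apply/val_inj.
    by change (lrx le (rshift d.+1 i) = lrx leb i :> nat); rewrite !lrxE /=; lia.
  by change (lrx le (rshift d.+1 j) = lrx leb j :> nat); rewrite !lrxE /=; lia.
have uD : drsubmx Z \in unitmx by rewrite DE unitmxE unitfE.
rewrite /lrsub (mxsub_congr c y eU) -/(lrsub le y) -/Z.
have -> : U *m Z *m cjm U = block_mx (u *m ulsubmx Z *m cjm u) (u *m ursubmx Z)
    (dlsubmx Z *m cjm u) (drsubmx Z) :> 'M[L]_(1 + b).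
  rewrite /U cjm_block !cjm0 cjm1 -{1}[Z]submxK !mulmx_block.
  by rewrite !mul0mx !mulmx0 !mul1mx !mulmx1 ?add0r ?addr0.
rewrite (@det_schur L 1 b) // DE det_mx11 /schur DE; congr (_ * _).
by rewrite mulmxBr mulmxBl !mulmxA.
Qed.

Lemma schur_det d b (Z : 'M[L]_(d + b)) : \det (drsubmx Z) != 0 ->
  \det Z = \det (drsubmx Z) * \det (schur Z).
Proof. by move=> D0; rewrite -{1}[Z]submxK det_schur // unitmxE unitfE. Qed.

Lemma schur_herm d b (Z : 'M[L]_(d + b)) : cjm Z = Z -> cjm (schur Z) = schur Z.
Proof.
move=> hZ; have := hZ; rewrite -{1}[Z]submxK cjm_block -[RHS]submxK => /eq_block_mx[h1 h2 h3 h4].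
by rewrite /schur cjmD cjmN !cjm_mul cjm_inv h1 h4 h3 h2 mulmxA.
Qed.

Lemma un_elt d b (le : (d + b <= b + (d + b))%N) (g : 'M[L]_d) : K d g ->
  exists2 h : 'M[L]_(b + (d + b)), K (b + (d + b))%N h & emb le g h.
Proof.
move=> [ug ig]; exists (block_mx 1%:M 0 0 (block_mx g 0 0 1%:M)).
  split; last first.
    by apply: (integral_block) => //; try exact: (integral_1 H); try exact: (integral_0 H);
      apply: (integral_block) => //; try exact: (integral_1 H); exact: (integral_0 H).
  apply: unitaryP; rewrite antidiag_block !cjm_block !cjm0 !cjm1 !mulmx_block.
  rewrite !mul0mx !mulmx0 !mul1mx !mulmx1 ?add0r ?addr0 mul_row_block mul_block_col.
  by rewrite !mulmx_block !mul0mx !mulmx0 !mul1mx ?add0r ?addr0 !mulmx1 ?mul0mx ?mulmx0 ?add0r ?addr0 unitary_r.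
have e : lrx le =1 @rshift b (d + b) by exact: lrx_rshift.
rewrite /emb; have eS (M : 'M[L]_(b + (d + b))) : rowsub (lrx le) M = rowsub (@rshift b (d + b)) M.
  by apply/matrixP => i j; rewrite !mxE e.
by rewrite !eS [in RHS](scalar_mx_block b (d + b)) !rowsub_rshift mul_mx_row mulmx0 mulmx1.
Qed.

Lemma levi_unitary n e0 (G Gh : 'M[L]_n) :
  Gh *m J n *m cjm G = J n -> G *m J n *m cjm Gh = J n ->
  unitary_group c (block_mx Gh 0 0 (block_mx 1%:M 0 0 G) : 'M[L]_(n + (e0 + n))).
Proof.
move=> e1 e2; apply: unitaryP; rewrite (antidiag_block L n e0) !cjm_block !cjm0 !cjm1 !mulmx_block.
rewrite !mul0mx !mulmx0 ?add0r ?addr0 !mul_mx_row !mul_block_col !mulmx0 !mul0mx ?add0r ?addr0.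
rewrite !mul_row_block !mul_col_mx !mul0mx !mulmx0 ?add0r ?addr0 !mul1mx.
rewrite !mul_mx_row !mulmx1 !mulmx0 ?add0r ?addr0 e1 e2; congr block_mx.
by rewrite /block_mx row_mx0.
Qed.

(** The Levi subgroup: an invertible block placed in the lower right corner is compensated in the
    upper left one by its inverse conjugate transpose, reflected by the antidiagonal matrix. *)
Lemma gl_elt a0 d b e0 (le : (d + b <= (a0 + (d + b)) + (e0 + (a0 + (d + b))))%N)
    (g g' : 'M[L]_d) : integral_mx g -> integral_mx g' -> g *m g' = 1%:M ->
  exists h : 'M[L]_((a0 + (d + b)) + (e0 + (a0 + (d + b)))),
   [/\ K _ h, emb le g h & forall a, (d + b <= a <= a0 + (d + b))%N -> par a h].
Proof.
move=> ig ig' gg; set n := (a0 + (d + b))%N in le *.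
pose G : 'M[L]_n := block_mx 1%:M 0 0 (block_mx g 0 0 1%:M).
pose G' : 'M[L]_n := block_mx 1%:M 0 0 (block_mx g' 0 0 1%:M).
have iblock p r s t (A : 'M[L]_(p, r)) (D : 'M[L]_(s, t)) : integral_mx A -> integral_mx D ->
    integral_mx (block_mx A 0 0 D).
  by move=> hA hD; apply: (integral_block) => //; exact: (integral_0 H).
have iG : integral_mx G by apply: (iblock); [exact: (integral_1 H)|apply: (iblock) => //; exact: (integral_1 H)].
have iG' : integral_mx G' by apply: (iblock); [exact: (integral_1 H)|apply: (iblock) => //; exact: (integral_1 H)].
have GG : G *m G' = 1%:M.
  rewrite /G /G' !mulmx_block !mul0mx !mulmx0 !mul1mx ?add0r ?addr0 gg.
  by rewrite ?mulmx0 ?mul0mx ?addr0 -!scalar_mx_block.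
pose Gh := J n *m cjm G' *m J n.
exists (block_mx Gh 0 0 (block_mx 1%:M 0 0 G)); split.
- split; last first.
    apply: (iblock); last by apply: (iblock) => //; exact: (integral_1 H).
    apply: (integral_mulmx H); last exact: (integral_antidiag H).
    by apply: (integral_mulmx H); [exact: (integral_antidiag H)|exact: (integral_cjm H)].
  have e1 : Gh *m J n *m cjm G = J n.
    by rewrite /Gh -(mulmxA (J n *m _)) antidiag_sq mulmx1 -mulmxA -cjm_mul GG cjm1 mulmx1.
  have e2 : G *m J n *m cjm Gh = J n.
    rewrite /Gh !cjm_mul (cjmK cK) cjm_antidiag !mulmxA -(mulmxA G) antidiag_sq mulmx1 GG mul1mx //.
  exact: levi_unitary.
- have eS p (M : 'M[L]_(n + (e0 + n), p)) : rowsub (lrx le) M =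
      rowsub (@rshift a0 (d + b)) (rowsub (@rshift e0 n) (rowsub (@rshift n (e0 + n)) M)).
    apply/matrixP => i j; rewrite !mxE; congr (M _ _); apply/val_inj.
    by change (lrx le i = n + (e0 + (a0 + i)) :> nat)%N; rewrite lrxE; rewrite /n; lia.
  rewrite /emb !eS [in RHS](scalar_mx_block n (e0 + n)) [in RHS](scalar_mx_block e0 n).
  rewrite !rowsub_rshift !rowsub_row_mx !rowsub_zero !rowsub_rshift !rowsub_row_mx !rowsub_zero.
  rewrite /G [X in _ = _ *m row_mx _ (row_mx _ (rowsub _ X))](scalar_mx_block a0 (d + b)) !rowsub_rshift.
  by rewrite !mul_mx_row !mulmx0 mulmx1.
- move=> a ha i j hi hj; have hn : (n + (e0 + n) - a = n + (e0 + (n - a)))%N by lia.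
  rewrite hn in hi hj.
  have ti : (i - (n + e0) < n)%N by have := ltn_ord i; lia.
  have iE : i = rshift n (rshift e0 (Ordinal ti)) by apply/val_inj => /=; lia.
  rewrite iE -[j]splitK; case: (fintype.splitP j) => j' jE /=; first by rewrite block_mxEdl mxE.
  rewrite block_mxEdr; case: (fintype.splitP j') => j'' jE' /=.
    have -> : j' = lshift n j'' by apply/val_inj.
    by rewrite block_mxEdl mxE.
  have -> : j' = rshift e0 j'' by apply/val_inj.
  rewrite block_mxEdr /G.
  have jl : (j'' < a0)%N by lia.
  have -> : j'' = lshift (d + b) (Ordinal jl) by apply/val_inj.
  case: (fintype.splitP (Ordinal ti)) => k kE.
    have -> : Ordinal ti = lshift (d + b) k by apply/val_inj.
    rewrite block_mxEul mxE; case: eqP => // ke.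
    have : nat_of_ord k = j'' by rewrite ke.
    by rewrite -kE /=; lia.
  have -> : Ordinal ti = rshift a0 k by apply/val_inj.
  by rewrite block_mxEdl mxE.
Qed.
End Embeddings.

Section UnitarySchur.
Variables (L : fieldType) (O : set L) (w : L) (c : {rmorphism L -> L}).
Variables (q : nat) (rho : 'I_q -> L) (th : L).
Hypothesis H : unramified_pair O w c rho th.
Notation cjm := (cjm c).
Notation J := (antidiag L).
Let cK := up_cK H.

(** With Z split into E, F, F', D, the block equations of y J y = J express E J F, F' J E and F' J F
    through the outer blocks B, C, B', C' of y. In Y J Y the outer terms cancel, and in the trace of
    Y J they restore the diagonal contributions that distinguish it from the trace of y J. *)
Lemma schur_unitary d b (y : 'M[L]_(b + (d + b))) : herm_inv c y ->
  \det (drsubmx (drsubmx y)) != 0 ->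
  [/\ schur (drsubmx y) *m J d *m schur (drsubmx y) = J d,
      cjm (schur (drsubmx y)) = schur (drsubmx y)
    & \tr (schur (drsubmx y) *m J d) = \tr (J d)].
Proof.
move=> [uy hy ty] D0; set Z := drsubmx y.
have hZ : cjm Z = Z.
  by move: (hy); rewrite -{1}[y]submxK cjm_block -[RHS]submxK => /eq_block_mx[].
have uD : drsubmx Z \in unitmx by rewrite unitmxE unitfE.
set E := ulsubmx Z; set F := ursubmx Z; set F' := dlsubmx Z; set D := drsubmx Z in uD.
have ZE : Z = block_mx E F F' D by rewrite submxK.
set B := lsubmx (ursubmx y); set C := rsubmx (ursubmx y).
set B' := usubmx (dlsubmx y); set C' := dsubmx (dlsubmx y).
have yE : y = block_mx (ulsubmx y) (row_mx B C) (col_mx B' C') (block_mx E F F' D).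
  by rewrite -ZE /B /C /B' /C' hsubmxK vsubmxK submxK.
have yJ : y *m J (b + (d + b)) = block_mx (C *m J b) (ulsubmx y *m row_mx 0 (J b) + row_mx B C *m block_mx (J d) 0 0 0)
    (col_mx (F *m J b) (D *m J b)) (block_mx (E *m J d) (B' *m J b) (F' *m J d) (C' *m J b)).
  rewrite antidiag_block {1}yE !mulmx_block !mulmx0 !add0r mul_row_col mulmx0 add0r.
  rewrite mul_block_col !mulmx0 !add0r; congr block_mx.
  by rewrite mul_col_row !mulmx0 !addr0 add_block_mx ?add0r ?addr0.
have := unitary_r uy; rewrite hy yJ [X in _ *m X = _]yE mulmx_block [RHS]antidiag_block.
move=> /eq_block_mx[_ _ _]; rewrite mul_col_row mulmx_block add_block_mx.
move=> /eq_block_mx[h1 h2 h3 h4].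
have tyE : \tr (C *m J b) + (\tr (E *m J d) + \tr (C' *m J b)) = \tr (J d).
  move: ty; rewrite yJ antidiag_block !mxtrace_block !mxtrace0 add0r addr0 //.
set Di := invmx D.
have DDi : D *m Di = 1%:M by rewrite mulmxV.
have DiD : Di *m D = 1%:M by rewrite mulVmx.
have SE : schur Z = E - F *m Di *m F' by [].
have e2 : E *m J d *m F = - (F *m J b *m C) - B' *m J b *m D.
  by apply/eqP; rewrite -opprD -addr_eq0 -h2; apply/eqP; rewrite addrCA addrA addrC.
have e3 : F' *m J d *m E = - (D *m J b *m B) - C' *m J b *m F'.
  by apply/eqP; rewrite -opprD -addr_eq0 -h3; apply/eqP; rewrite addrCA addrA addrC.
have e4 : F' *m J d *m F = - (D *m J b *m C) - C' *m J b *m D.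
  by apply/eqP; rewrite -opprD -addr_eq0 -h4; apply/eqP; rewrite addrCA addrA addrC.
split.
- rewrite SE mulmxBl mulmxBr !mulmxBl.
  have t1 : E *m J d *m (F *m Di *m F') = - (F *m J b *m C *m Di *m F') - B' *m J b *m F'.
    rewrite !mulmxA e2 !mulmxBl !mulNmx; congr (_ - _).
    by rewrite -(mulmxA (B' *m J b) D) DDi mulmx1.
  have t2 : F *m Di *m F' *m J d *m E = - (F *m J b *m B) - F *m Di *m C' *m J b *m F'.
    have -> : F *m Di *m F' *m J d *m E = F *m Di *m (F' *m J d *m E) by rewrite !mulmxA.
    rewrite e3 mulmxBr mulmxN !mulmxA; congr (- _ - _).
    by rewrite -(mulmxA F Di) DiD mulmx1.
  have t3 : F *m Di *m F' *m J d *m (F *m Di *m F') =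
      - (F *m J b *m C *m Di *m F') - F *m Di *m C' *m J b *m F'.
    have -> : F *m Di *m F' *m J d *m (F *m Di *m F') = F *m Di *m (F' *m J d *m F) *m Di *m F'.
      by rewrite !mulmxA.
    rewrite e4 mulmxBr mulmxN !mulmxBl !mulNmx !mulmxA; congr (- _ - _).
      by rewrite -(mulmxA F Di) DiD mulmx1.
    by rewrite -(mulmxA _ D Di) DDi mulmx1.
  rewrite t1 t2 t3 -[RHS]h1.
  apply/matrixP => i j; rewrite !mxE; ring.
- exact: schur_herm.
- rewrite SE mulmxBl linearB /=.
  have -> : \tr (F *m Di *m F' *m J d) = \tr (Di *m (F' *m J d *m F)).
    by rewrite -!mulmxA mxtrace_mulC !mulmxA.
  rewrite e4 mulmxBr mulmxN linearB linearN /= -tyE.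
  have -> : \tr (Di *m (D *m J b *m C)) = \tr (C *m J b).
    by rewrite !mulmxA DiD mul1mx mxtrace_mulC.
  have -> : \tr (Di *m (C' *m J b *m D)) = \tr (C' *m J b).
    by rewrite [LHS]mxtrace_mulC -(mulmxA _ D Di) DDi mulmx1.
  ring.
Qed.

Hypothesis char0 : forall n, n.+1%:R != 0 :> L.

Lemma natr_inj_char0 (a b : nat) : a%:R = b%:R :> L -> a = b.
Proof.
wlog ab : a b / (a <= b)%N => [hw e|].
  by case: (leqP a b) => h; [exact: hw|apply/esym/hw => //; exact: ltnW].
move=> e; have : (b - a)%:R = 0 :> L by rewrite natrB // e subrr.
case E : (b - a)%N => [|n]; first by move=> _; lia.
by move/eqP; rewrite (negPf (char0 n)).
Qed.

Lemma idempotent_base d (P : 'M[L]_d) : P *m P = P -> row_base P *m col_base P = 1%:M.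
Proof.
move: (row_base_free P) (col_base_full P) (mulmx_base P).
move: (row_base P) (col_base P) => rb cb fr fu PE PP.
apply: (row_full_inj fu); apply: (row_free_inj fr); rewrite /= mulmx1 !mulmxA PE.
by rewrite -mulmxA PE PP.
Qed.

Lemma idempotent_trace d (P : 'M[L]_d) : P *m P = P -> \tr P = (\rank P)%:R.
Proof.
by move=> PP; rewrite -{1}(mulmx_base P) mxtrace_mulC idempotent_base // mxtrace1.
Qed.

(** Since (Y J)^2 = 1, the matrix P = (1 - Y J)/2 is idempotent, and its trace 1 is its rank in
    characteristic 0. So J - Y = 2 P J has rank one; being hermitian, it is a multiple of xi xi*,
    and the idempotence of P fixes the multiple as 2/a. *)
Lemma unitary_rank_one d (Y : 'M[L]_d) : Y *m J d *m Y = J d -> cjm Y = Y ->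
  \tr (Y *m J d) = d%:R - 2%:R ->
  exists (xi : 'M[L]_(d, 1)) (a : L),
    [/\ a != 0, c a = a, cjm xi *m J d *m xi = a%:M & Y = J d - (2%:R / a) *: (xi *m cjm xi)].
Proof.
move=> YJY hY tY.
have n2 : 2%:R != 0 :> L := char0 1.
pose P := 2%:R^-1 *: (1%:M - Y *m J d).
have YY : Y *m J d *m (Y *m J d) = 1%:M by rewrite mulmxA YJY antidiag_sq.
have PP : P *m P = P.
  rewrite /P -scalemxAl -scalemxAr scalerA mulmxBr !mulmxBl mul1mx mulmx1 YY mul1mx.
  apply/matrixP => i j; rewrite !mxE; by field.
have tP : \tr P = 1%:R.
  by rewrite /P linearZ /= linearB /= mxtrace1 tY; field.
have r1 : \rank P = 1%N by apply: natr_inj_char0; rewrite -idempotent_trace.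
(* A rank factorisation of P; for an idempotent the factors multiply to the identity in the other
   order. *)
have [xi [ze [Pxz zx]]] : exists (xi : 'M[L]_(d, 1)) (ze : 'M[L]_(1, d)), P = xi *m ze /\ ze *m xi = 1%:M.
  have e := idempotent_base PP.
  move: (row_base P) (col_base P) (mulmx_base P) e; rewrite r1 => rb cb PE e.
  by exists cb, rb; split.
have HE : J d - Y = 2%:R *: (xi *m (ze *m J d)).
  rewrite mulmxA -Pxz /P -scalemxAl scalerA divff // scale1r mulmxBl mul1mx.
  by rewrite -mulmxA antidiag_sq mulmx1.
have hH : cjm (J d - Y) = J d - Y by rewrite cjmD cjmN cjm_antidiag hY.
set et := ze *m J d in HE.
have hxe : cjm et *m cjm xi = xi *m et.
  move: hH; rewrite HE cjmZ cjm_mul rmorph_nat => /(congr1 (fun M => 2%:R^-1 *: M)).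
  by rewrite !scalerA mulVf // !scale1r.
pose a := (cjm xi *m J d *m xi) 0 0.
have aE : cjm xi *m J d *m xi = a%:M by rewrite [LHS]mx11_scalar.
have xE : xi = a *: cjm et.
  have : xi *m et *m (J d *m xi) = xi.
    by rewrite /et -!mulmxA (mulmxA (J d)) antidiag_sq mul1mx zx mulmx1.
  by rewrite -hxe -mulmxA [cjm xi *m _]mulmxA aE mul_mx_scalar => {1}<-.
have a0 : a != 0.
  apply/eqP => a0; move: zx; rewrite xE a0 scale0r mulmx0 => /matrixP /(_ 0 0).
  by rewrite !mxE => /eqP; rewrite eq_sym oner_eq0.
have ca : c a = a.
  have : cjm (a%:M : 'M[L]_1) = a%:M by rewrite -aE !cjm_mul (cjmK cK) cjm_antidiag mulmxA.
  by move/matrixP/(_ 0 0); rewrite !mxE /=.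
exists xi, a; split => //.
have -> : cjm xi = a *: et by rewrite {1}xE cjmZ ca (cjmK cK).
by rewrite -scalemxAr scalerA divfK // -HE opprB addrC subrK.
Qed.
End UnitarySchur.

(** * Local averages over a rank-one subgroup *)

Definition mx2 (L : fieldType) (a b d e : L) : 'M[L]_2 :=
  \matrix_(i, j) (if i == 0 then (if j == 0 then a else b) else (if j == 0 then d else e)).

Lemma mx2_mul (L : fieldType) (a b d e a' b' d' e' : L) :
  mx2 a b d e *m mx2 a' b' d' e' =
  mx2 (a * a' + b * d') (a * b' + b * e') (d * a' + e * d') (d * b' + e * e').
Proof.
apply/matrixP => i j; rewrite !mxE !big_ord_recl big_ord0 !mxE /= addr0.
by case: (i == 0); case: (j == 0).
Qed.

Lemma mx2_1 (L : fieldType) : mx2 1 0 0 1 = 1%:M :> 'M[L]_2.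
Proof.
apply/matrixP => i j; rewrite !mxE.
by case: i => [[|[|k]] hi] //; case: j => [[|[|k']] hj].
Qed.

Lemma det_mx2 (L : fieldType) (Y : 'M[L]_2) : \det Y = Y 0 0 * Y 1 1 - Y 0 1 * Y 1 0.
Proof.
rewrite (expand_det_row _ 0) !big_ord_recl big_ord0 /cofactor !det_mx11 !mxE /=.
have e1 : lift 0 0 = 1 :> 'I_2 by apply/val_inj.
have e2 : lift 1 0 = 0 :> 'I_2 by apply/val_inj.
by rewrite !e1 ?e2 /= !addn0 addn1 expr0 expr1; ring.
Qed.

Section OrbitCounts.
Variables (L : fieldType) (O : set L) (w : L) (c : {rmorphism L -> L}).
Variables (q : nat) (rho : 'I_q -> L) (th : L).
Hypothesis H : unramified_pair O w c rho th.
Notation vg := (vg O w).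
Notation v := (valuation O w).
Notation cjm := (cjm c).
Notation nm := (nrm c).
Notation K := (max_compact O c).
Notation J := (antidiag L).
Let cK := up_cK H.
Variable F : numFieldType.
Notation x := ((q%:R)^-1 : F).

(* The number of [s] with [z s] of valuation [k - B]. *)
Definition loc_count (S : finType) (z : S -> L) (B k : nat) : F :=
  (cnt (fun s => vg (k%:Z - B%:Z) (z s)))%:R - (cnt (fun s => vg (k.+1%:Z - B%:Z) (z s)))%:R.

Definition shifted (A : nat) (phi : nat -> F) (k : nat) : F :=
  if (A <= k)%N then phi (k - A)%N else 0.

Lemma gl_elt_half m d b (le : (d + b <= m)%N) (g g' : 'M[L]_d) :
  (d + b <= m./2)%N -> integral_mx O g -> integral_mx O g' -> g *m g' = 1%:M ->
  exists h : 'M[L]_m,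
   [/\ K m h, emb le g h & forall a, (d + b <= a <= m./2)%N -> par a h].
Proof.
move=> hn ig ig' gg.
have [a0 [e0 [mE nE]]] : exists a0 e0, m = ((a0 + (d + b)) + (e0 + (a0 + (d + b))))%N /\ m./2 = (a0 + (d + b))%N.
  exists (m./2 - (d + b))%N, (odd m : nat); have := odd_double_half m; rewrite -addnn; lia.
rewrite nE; move: le {nE hn}; rewrite {}mE => le; exact: (gl_elt H le ig ig' gg).
Qed.

Lemma gl_elt_unit m (h : 'M[L]_m) y a (le : (a <= m)%N) : K m h -> par a h ->
  \det (lrsub le y) != 0 ->
  \det (lrsub le (act_mx c h y)) != 0 /\ v (\det (lrsub le (act_mx c h y))) = v (\det (lrsub le y)).
Proof.
move=> Kh ph d0; have [_ ih] := Kh.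
have [t ut e] := corner_par H le y ih (max_compact_det H Kh) ph.
rewrite /act_mx cjmE e; have t0 := unit_neq0 ut.
by split; [rewrite mulf_neq0|rewrite (valM H) // (val_unit H ut) add0r].
Qed.

Lemma lrsub_herm a m (le : (a <= m)%N) (y : 'M[L]_m) : cjm y = y -> cjm (lrsub le y) = lrsub le y.
Proof. by move=> hy; rewrite /lrsub cjm_mxsub hy. Qed.

Lemma det_herm m (y : 'M[L]_m) : cjm y = y -> c (\det y) = \det y.
Proof. by move=> hy; rewrite -{2}hy det_cjm. Qed.

(** The minor that precedes [corner_det y i], equal to the empty determinant 1 for i = 0. *)
Definition below m (i : 'I_m./2) (y : 'M[L]_m) : L := \det (lrsub (ltnW (half_ord_lt i)) y).

Lemma below_neq0 m (i : 'I_m./2) (y : 'M[L]_m) :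
  (forall j, j != i -> corner_det y j != 0) -> below i y != 0.
Proof.
move=> hy; rewrite /below; case: i hy => [[|i] hi] hy.
  by rewrite det_mx00 oner_neq0.
have hi' : (i < m./2)%N by lia.
have := hy (Ordinal hi') _; rewrite corner_detE; set l1 := half_ord_lt _; set l2 := ltnW _.
by rewrite (_ : l1 = l2) ?(bool_irrelevance l1 l2) //; apply; rewrite -val_eqE /=; lia.
Qed.

Lemma belowE m (i j : 'I_m./2) (y : 'M[L]_m) : i = j.+1 :> nat -> below i y = corner_det y j.
Proof.
move=> e; rewrite /below corner_detE; move: (ltnW (half_ord_lt i)) (half_ord_lt j); rewrite e => l1 l2.
by rewrite (bool_irrelevance l1 l2).
Qed.
Lemma below0 m (i : 'I_m./2) (y : 'M[L]_m) : i = 0%N :> nat -> below i y = 1.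
Proof. by move=> e; rewrite /below; move: (ltnW _); rewrite e => l; rewrite det_mx00. Qed.

Lemma emb_corners m (i : 'I_m./2) d (le : (d.+1 + i <= m)%N) g (h y : 'M[L]_m) :
  K m h -> emb le g h -> (forall a, (d.+1 + i <= a <= m./2)%N -> par a h) -> (d <= 1)%N || (i.+1 == m./2) ->
  (forall j, j != i -> corner_det y j != 0) ->
  (forall j, j != i -> corner_det (act_mx c h y) j != 0 /\
      v (corner_det (act_mx c h y) j) = v (corner_det y j)) /\
  corner_det (act_mx c h y) i = below i y *
    (row ord_max g *m schur (lrsub le y) *m cjm (row ord_max g)) 0 0.
Proof.
move=> Kh eh ph hd hy; split => [j ji|].
  rewrite !corner_detE; apply: gl_elt_unit => //; last exact: hy.
  have [ij|ij] := ltnP j i; first exact: (emb_par eh).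
  have jn := ltn_ord j; have jin : nat_of_ord j <> i by move=> e; move/eqP: ji; apply; apply/val_inj.
  by apply: ph; case/orP: hd => hd; [|move/eqP in hd]; lia.
rewrite corner_detE /act_mx cjmE (emb_corner c (half_ord_lt i) (leb := ltnW (half_ord_lt i)) eh) //.
exact: below_neq0.
Qed.

(** Passage from levels in Z to exponents in N. All valuations are at least -B; if A + B were
    negative, every point would reach level A + 1 and the first two counts would agree, against W 0
    != W 1. *)
Lemma cnt_shift (S : finType) (z : S -> L) (B : nat) (A : int) n0 (W : nat -> F) M tot :
  (forall l, l <= A -> cnt (fun s => vg l (z s)) = tot) -> tot%:R = n0 * W 0%N ->
  n0 != 0 -> W 0%N != W 1%N -> (0 < M)%N ->
  (forall j : nat, (j <= M)%N -> (cnt (fun s => vg (A + j) (z s)))%:R = n0 * W j) ->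
  (forall s, vg (- B%:Z) (z s)) ->
  exists2 A0 : nat, A0%:Z = A + B & forall k, (k < M)%N ->
    loc_count z B k = n0 * shifted A0 (tails W) k.
Proof.
move=> htot tE n00 W01 M0 hW hB.
have AB : 0 <= A + B.
  case: (leP 0 (A + B)) => // AB; exfalso; move/eqP: W01; apply; apply: (mulfI n00).
  rewrite -(hW 1%N) // -tE -(htot A (lexx _)); congr (GRing.natmul 1 _).
  rewrite !cnt_true // => s; apply: (vg_le H _ (hB s)); lia.
have [A0 A0E] : exists A0 : nat, A0%:Z = A + B by exists (absz (A + B%:Z)%R); lia.
exists A0 => // k kM; rewrite /loc_count /shifted.
have [Ak|Ak] := leqP A0 k.
  have -> : k%:Z - B%:Z = A + (k - A0)%N by lia.
  have -> : k.+1%:Z - B%:Z = A + (k - A0).+1 by lia.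
  by rewrite !hW ?mulrBr //; lia.
by rewrite !htot ?subrr ?mulr0 //; lia.
Qed.

Lemma hform_schur2 (D : L) (Y : 'M[L]_2) (u : 'M[L]_(1, 2)) : c D = D -> cjm Y = Y ->
  D * (u *m Y *m cjm u) 0 0 = hform c (D * Y 0 0) (D * Y 0 1) (D * Y 1 1) (u 0 0, u 0 1).
Proof.
move=> cD hY; have e10 : Y 1 0 = c (Y 0 1) by rewrite -{1}hY !mxE.
rewrite !mxE !big_ord_recl big_ord0 !mxE !big_ord_recl !big_ord0 /hform /nrm /=.
have -> : lift 0 0 = 1 :> 'I_2 by apply/val_inj.
rewrite e10 rmorphM cD; ring.
Qed.

Lemma x_bounds : 0 < x /\ x < 1.
Proof.
have q1 := q_gt1 H; split; first by rewrite invr_gt0 ltr0n; lia.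
by rewrite invf_lt1 ?ltr1n ?ltr0n //; lia.
Qed.

Lemma herm_dens_neq r : herm_dens x r 0 != herm_dens x r 1.
Proof.
have [x0 x1] := x_bounds; rewrite eq_sym lt_eqF // /herm_dens /norm_dens /= -subr_gt0.
case: r => [|r] /=; first by have -> : 1 + x ^+ 2 - (1 + x) * x ^+ 1 = 1 - x by [ring]; rewrite subr_gt0.
by have -> : 1 + x ^+ 2 - x ^+ 2 = 1 by ring.
Qed.

(** The form attached to y is d Y with d = [below i y] and Y a Schur complement of size 2; its
    discriminant is d times the minor that follows [corner_det y i]. Hence 2A + r is known from the
    two neighbouring minors although A and r are not. The family [h] is chosen before y, as
    averaging over K requires. *)
Lemma short_local m (i : 'I_m./2) N : (i.+1 < m./2)%N ->
  exists (S : finType) (h : S -> 'M[L]_m), inhabited S /\ (forall s, K m (h s)) /\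
  forall y : 'M[L]_m, cjm y = y -> (forall j, j != i -> corner_det y j != 0) ->
   (forall s j, j != i -> corner_det (act_mx c (h s) y) j != 0 /\
      v (corner_det (act_mx c (h s) y) j) = v (corner_det y j)) /\
   forall B : nat, (forall s, vg (- B%:Z) (corner_det (act_mx c (h s) y) i)) ->
   exists (A r : nat), [/\ (A + A + r)%:Z = v (below i y) + v (corner_det y (ordS i)) + (B + B)%:Z &
     forall k, (k < N)%N ->
     loc_count (fun s => corner_det (act_mx c (h s) y) i) B k =
     q%:R ^+ N.+1.*2 * shifted A (tails (herm_dens x r)) k].
Proof.
move=> im.
have [I [f hf]] := residue_system_O_ex H N.+1.
have [I' [g hg]] := residue_system_O_ex H N.
have le : (2 + i <= m)%N by have := odd_double_half m; lia.
have fO k : O (f k) by case: hf.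
have gO k : O (g k) by case: hg.
have O1 := up_one H; have O0 := O_zero H; have ON := O_opp H.
have i2 a b d e : O a -> O b -> O d -> O e -> integral_mx O (mx2 a b d e).
  by move=> ? ? ? ? k l; rewrite mxE; case: eqP => _; case: eqP => _.
(* The last rows run through the points of the projective line modulo w^(N+1). *)
pose gs (s : I + I') : 'M[L]_2 := match s with inl k => mx2 1 0 (f k) 1 | inr k => mx2 0 1 1 (w * g k) end.
have hs s : exists h : 'M[L]_m,
    [/\ K m h, emb le (gs s) h & forall a, (2 + i <= a <= m./2)%N -> par a h].
  have wg k : O (w * g k) by apply: (up_mul H) => //; exact: (up_w H).
  case: s => k /=.
    apply: (@gl_elt_half _ _ _ _ _ (mx2 1 0 (- f k) 1)); try exact: i2 => //; try lia.
    - by apply: i2 => //; exact: ON.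
    - by rewrite mx2_mul -mx2_1; congr mx2; ring.
  apply: (@gl_elt_half _ _ _ _ _ (mx2 (- (w * g k)) 1 1 0)); try exact: i2 => //; try lia.
  - by apply: i2 => //; exact: ON.
  - by rewrite mx2_mul -mx2_1; congr mx2; ring.
have [h hP] := choice hs.
exists (I + I')%type, h; split.
  by have [_ /(_ 1 O1)[k _] _] := hf; exact: (inhabits (inl k)).
split; first by move=> s; case: (hP s).
move=> y hy dy.
have corners s := emb_corners (d := 1) (le := le) (and3_rect (fun a _ _ => a) (hP s))
  (and3_rect (fun _ b _ => b) (hP s)) (and3_rect (fun _ _ e => e) (hP s)) isT dy.
split => [s|B hB]; first by case: (corners s).
have D0 := below_neq0 dy; set D := below i y in D0.
have cD : c D = D by apply: det_herm; apply: lrsub_herm.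
set Z := lrsub le y in corners.
have hZ : cjm Z = Z by apply: lrsub_herm.
have hY := schur_herm hZ; set Y := schur Z in hY corners.
have DE : \det (drsubmx Z) = D.
  congr (\det _); apply/matrixP => k l; rewrite !mxE; congr (y _ _); apply/val_inj.
    by change (lrx le (rshift 2 k) = lrx (ltnW (half_ord_lt i)) k :> nat); rewrite !lrxE /=; lia.
  by change (lrx le (rshift 2 l) = lrx (ltnW (half_ord_lt i)) l :> nat); rewrite !lrxE /=; lia.
have ordSi : ordS i = i.+1 :> nat by rewrite /= modn_small.
have dZ : \det Z = corner_det y (ordS i).
  rewrite corner_detE /Z; move: (half_ord_lt (ordS i)) (le); rewrite ordSi => l1 l2.
  by rewrite (bool_irrelevance l1 l2).
have detY : \det Z = D * \det Y by rewrite schur_det DE.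
have dZ0 : \det Z != 0.
  by rewrite dZ; apply: dy; apply/eqP => e; move: ordSi; rewrite e; lia.
have discE : D * Y 0 0 * (D * Y 1 1) - nm (D * Y 0 1) = D * corner_det y (ordS i).
  have e10 : Y 1 0 = c (Y 0 1) by rewrite -{1}hY !mxE.
  by rewrite -dZ detY det_mx2 e10 /nrm rmorphM cD; ring.
have cY k : c (Y k k) = Y k k by rewrite -{2}hY !mxE.
have [|||A [r [vD _ hcnt]]] := hform_cnt H (al := D * Y 0 0) (be := D * Y 0 1) (de := D * Y 1 1).
- by rewrite rmorphM cD cY.
- by rewrite rmorphM cD cY.
- by rewrite discE mulf_neq0 // -dZ.
rewrite discE (valM H) -?dZ // in vD.
have zE s : corner_det (act_mx c (h s) y) i =
    hform c (D * Y 0 0) (D * Y 0 1) (D * Y 1 1) (lines2 w f g s).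
  case: (corners s) => _ ->; rewrite hform_schur2 //; congr (hform _ _ _ _ _).
  by case: s => k; rewrite /= !mxE.
have hc l : l <= A + N.+1 -> cnt (fun s => vg l (corner_det (act_mx c (h s) y) i)) = hform_count q N.+1 r (l - A).
  by move=> lN; rewrite -(hcnt N _ _ f g l hf hg lN); apply: eq_cnt => s; rewrite zE.
have q1 := q_gt1 H.
have [||||||A0 A0E hA0] := @cnt_shift _ (fun s => corner_det (act_mx c (h s) y) i) B A
    (q%:R ^+ N.+1.*2) (herm_dens x r) N.+1 (q ^ N.+1.*2 + q ^ N.*2)%N _ _ _ _ _ _ hB.
- by move=> l lA; rewrite hc; [rewrite /hform_count ifT //; lia|lia].
- have := @hform_count_dens F q q1 N.+1 r 0 isT isT; rewrite /hform_count lexx.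
  by move=> ->.
- by rewrite expf_neq0 // pnatr_eq0; lia.
- exact: herm_dens_neq.
- by [].
- move=> j jN; rewrite hc; last lia.
  have -> : A + j - A = j by rewrite addrC addKr.
  by apply: hform_count_dens.
exists A0, r; split => [|k kN]; last by rewrite hA0 //; lia.
by rewrite -dZ -/D; move: vD A0E; lia.
Qed.
End OrbitCounts.

(** * The last minor: unitary groups in two and three variables *)

Section LongOrbitCounts.
Variables (L : fieldType) (O : set L) (w : L) (c : {rmorphism L -> L}).
Variables (q : nat) (rho : 'I_q -> L) (th : L).
Hypothesis H : unramified_pair O w c rho th.
Hypothesis char0 : forall n, n.+1%:R != 0 :> L.
Notation vg := (vg O w).
Notation v := (valuation O w).
Notation cjm := (cjm c).
Notation nm := (nrm c).
Notation K := (max_compact O c).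
Notation J := (antidiag L).
Notation eta := (th - c th).
Let cK := up_cK H.
Variable F : numFieldType.
Notation x := ((q%:R)^-1 : F).
Let w0 : w != 0 := up_w0 H.

Lemma un_elt_eq m d b (le : (d + b <= m)%N) (g : 'M[L]_d) : m = (b + (d + b))%N -> K d g ->
  exists2 h : 'M[L]_m, K m h & emb le g h.
Proof. by move=> e; move: le; rewrite {}e => le; apply: (un_elt H). Qed.

Lemma schur_unitary_eq m d b (le : (d + b <= m)%N) (leb : (b <= m)%N) (y : 'M[L]_m) :
  m = (b + (d + b))%N -> herm_inv c y -> \det (lrsub leb y) != 0 ->
  [/\ schur (lrsub le y) *m J d *m schur (lrsub le y) = J d,
      cjm (schur (lrsub le y)) = schur (lrsub le y)
    & \tr (schur (lrsub le y) *m J d) = \tr (J d)].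
Proof.
move=> e; move: le leb y; rewrite {}e => le leb y hy D0.
have -> : lrsub le y = drsubmx y.
  by apply/matrixP => i j; rewrite !mxE !lrx_rshift.
apply: (schur_unitary hy); move: D0; congr (\det _ != 0).
apply/matrixP => i j; rewrite !mxE; congr (y _ _); apply/val_inj.
  by change (lrx leb i = b + (d + i) :> nat)%N; rewrite lrxE; lia.
by change (lrx leb j = b + (d + j) :> nat)%N; rewrite lrxE; lia.
Qed.

Lemma primitive_vector d (xi : 'M[L]_(d, 1)) : xi != 0 ->
  exists (j : int) (xi' : 'M[L]_(d, 1)), [/\ xi = w ^ j *: xi', integral_mx O xi'
    & exists k, unit_set O (xi' k 0)].
Proof.
move=> xi0; have [k0 hk0] : exists k0, xi k0 0 != 0.
  apply: contrapT => h; move/eqP: xi0; apply; apply/matrixP => k l; rewrite (ord1 l) mxE.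
  by apply: contrapT => hk; apply: h; exists k; apply/eqP.
have [k1 hk1 kmin] : exists2 k, xi k 0 != 0 & forall l, xi l 0 != 0 -> v (xi k 0) <= v (xi l 0).
  have := @arg_minP _ _ _ k0 (fun k => xi k 0 != 0) (fun k => v (xi k 0)) hk0.
  by case=> k hk hmin; exists k.
have wj := expfz_neq0 (v (xi k1 0)) w0.
exists (v (xi k1 0)), ((w ^ (v (xi k1 0)))^-1 *: xi); split.
- by rewrite scalerA divff // scale1r.
- move=> l l'; rewrite mxE mulrC (ord1 l'); have [->|n0] := eqVneq (xi l 0) 0.
    by rewrite mul0r; exact: (O_zero H).
  by apply/(vgP H) => //; apply: kmin.
- by exists k1; rewrite mxE mulrC; exact: (valuation_unit H hk1).
Qed.

Definition doubled (phi : nat -> F) (k : nat) : F := if odd k then 0 else phi k./2.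

(** The valuations of t N(l) have the parity of v(t), so every other exact level is empty; this is
    the effect of [doubled]. The inequality A + B >= 0 comes from the first two counts as in
    [cnt_shift]. *)
Lemma cnt_shift_norm (S : finType) (z l : S -> L) (t : L) (B : nat) (n0 : F) (W : nat -> F) M :
  (forall s, z s = t * nm (l s)) -> t != 0 -> (forall s, O (l s)) ->
  n0 != 0 -> W 0%N != W 1%N -> (0 < M)%N ->
  (forall j : nat, (j <= M)%N -> (cnt (fun s => vg j (l s)))%:R = n0 * W j) ->
  (forall s, vg (- B%:Z) (z s)) ->
  exists2 A0 : nat, A0%:Z = v t + B & forall k, (k < M)%N ->
    loc_count O w F z B k = n0 * shifted A0 (doubled (tails W)) k.
Proof.
move=> zE t0 Ol n00 W01 M0 hW hB.
have lvl (k : nat) (j : nat) s : (k.+1 = j.*2 \/ k = j.*2)%N -> vg (v t + k) (z s) <-> vg j (l s).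
  move=> kj; rewrite zE (vg_mull H _ _ t0 erefl).
  have [->|l0] := eqVneq (l s) 0.
    by rewrite /nrm mul0r; split=> _; exact: (vg_zero H).
  have n0' : nm (l s) != 0 by rewrite (nrm_eq0 H).
  by rewrite !(vgP H) // (val_nrm H) //; lia.
have all0 (k : int) s : k <= v t -> vg k (z s).
  move=> kt; rewrite zE; apply: (vgMr H); last exact: (O_nrm H).
  by apply/(vgP H).
have AB : 0 <= v t + B.
  case: (leP 0 (v t + B%:Z)) => // AB; exfalso; move/eqP: W01; apply; apply: (mulfI n00).
  rewrite -!hW //; congr (GRing.natmul 1 _); rewrite !cnt_true // => s.
    by apply/(lvl 1%N 1%N s); [left|apply: (vg_le H _ (hB s)); lia].
  by apply/vgE0.
have [A0 A0E] : exists A0 : nat, A0%:Z = v t + B by exists (absz (v t + B%:Z)%R); lia.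
exists A0 => // k kM; rewrite /loc_count /shifted.
have [Ak|Ak] := leqP A0 k; last first.
  by rewrite !cnt_true ?subrr ?mulr0 // => s; apply: all0; lia.
have -> : k%:Z - B%:Z = v t + (k - A0)%N by lia.
have -> : k.+1%:Z - B%:Z = v t + (k - A0).+1 by lia.
set k' := (k - A0)%N; have k'M : (k' < M)%N by rewrite /k'; lia.
have := odd_double_half k'; rewrite /doubled; case: (odd k') => /= ke.
  rewrite (@eq_cnt _ (fun s => vg (v t + k') (z s)) (fun s => vg (v t + k'.+1) (z s))) ?subrr ?mulr0 //.
  by move=> s; rewrite (lvl k' k'./2.+1) ?(lvl k'.+1 k'./2.+1) //; [right|left]; rewrite doubleS; lia.
rewrite /tails mulrBr -!hW; try (by rewrite -divn2; lia).
congr (_%:R - _%:R); apply: eq_cnt => s; apply: lvl; [right|left]; rewrite ?doubleS; lia.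
Qed.

(** The last row u of an element of the unitary group is isotropic for J, so Y = J - (2/a) xi xi*
    takes at u the value -(2/a) N(u xi). After making xi primitive, r = v(a) is a natural number and
    the coefficient t = -2d/a, with d = [below i y], gives A + r = v(d) + v(2) + B. *)
Lemma long_generic m (i : 'I_m./2) d N (S : finType) (g : S -> 'M[L]_d.+2) (n0 : F)
    (W : nat -> nat -> F) :
  m = (i + (d.+2 + i))%N -> i.+1 == m./2 -> (0 < N)%N -> (forall s, K d.+2 (g s)) ->
  (forall (xi : 'M[L]_(d.+2, 1)) (a : L) r, integral_mx O xi -> (exists k, unit_set O (xi k 0)) ->
    a != 0 -> cjm xi *m J d.+2 *m xi = a%:M -> v a = r%:Z ->
    forall j : nat, (j <= N)%N ->
      (cnt (fun s => vg j ((row ord_max (g s) *m xi) 0 0)))%:R = n0 * W r j) ->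
  (forall r, W r 0%N != W r 1%N) -> n0 != 0 -> \tr (J d.+2) = d%:R ->
  exists h : S -> 'M[L]_m, (forall s, K m (h s)) /\
  forall y : 'M[L]_m, herm_inv c y -> (forall j, j != i -> corner_det y j != 0) ->
   (forall s j, j != i -> corner_det (act_mx c (h s) y) j != 0 /\
      v (corner_det (act_mx c (h s) y) j) = v (corner_det y j)) /\
   forall B : nat, (forall s, vg (- B%:Z) (corner_det (act_mx c (h s) y) i)) ->
   exists A r : nat, A%:Z + r%:Z = v (below i y) + v 2%:R + B%:Z /\
     forall k, (k < N)%N ->
     loc_count O w F (fun s => corner_det (act_mx c (h s) y) i) B k =
     n0 * shifted A (doubled (tails (W r))) k.
Proof.
move=> mE mh N0 Kg hcnt W01 n00 trJ.
have le : (d.+2 + i <= m)%N by move: mE; lia.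
have hs s : exists h : 'M[L]_m, K m h /\ emb le (g s) h.
  by have [h Kh eh] := un_elt_eq le mE (Kg s); exists h.
have [h hP] := choice hs.
exists h; split; first by move=> s; case: (hP s).
move=> y hy dy; have [uy cy ty] := hy.
have hpar s a : (d.+2 + i <= a <= m./2)%N -> par a (h s).
  by have := odd_double_half m; rewrite -addnn; move/eqP: mh; lia.
have corners s := emb_corners H (proj1 (hP s)) (proj2 (hP s)) (hpar s) (introT orP (or_intror mh)) dy.
split => [s|B hB]; first by case: (corners s).
have D0 := below_neq0 dy; set D := below i y in D0.
have cD : c D = D by apply: det_herm; apply: lrsub_herm.
have [YJY hY tY] := schur_unitary_eq le mE hy D0.
set Y := schur (lrsub le y) in YJY hY tY corners.
(* In the sizes 2 and 3 that occur, the trace of J is the size minus 2, which is the condition for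
   rank one. *)
have [|xi0 [a0 [a00 ca0 a0E YE]]] := unitary_rank_one H char0 YJY hY.
  by rewrite tY trJ -addn2 natrD addrK.
have xi00 : xi0 != 0.
  apply/eqP => e; move: a0E; rewrite e mulmx0 => /matrixP /(_ 0 0).
  by rewrite !mxE => /eqP; rewrite eq_sym (negPf a00).
have [mu [xi [xiE ixi [k uk]]]] := primitive_vector xi00.
have wm := expfz_neq0 mu w0.
pose a := a0 / (w ^ mu * w ^ mu).
have an0 : a != 0 by rewrite mulf_neq0 ?invr_eq0 ?mulf_neq0.
have aE : cjm xi *m J d.+2 *m xi = a%:M.
  have -> : xi = (w ^ mu)^-1 *: xi0 by rewrite xiE scalerA mulVf // scale1r.
  rewrite cjmZ (c_inv H) (c_wexp H) -scalemxAr -!scalemxAl a0E scalerA scale_scalar_mx /a invfM.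
  by congr (_%:M); rewrite mulrC.
have Oa : O a.
  have -> : a = (cjm xi *m J d.+2 *m xi) 0 0 by rewrite aE mxE.
  apply: (integral_mulmx H) => //; apply: (integral_mulmx H); first exact: (integral_cjm H).
  exact: (integral_antidiag H).
have [r vr] : exists r : nat, v a = r%:Z.
  have : 0 <= v a by apply/(vgP H _ an0)/vgE0.
  by case: (v a) => // r _; exists r.
pose t := D * - (2%:R / a).
have n2 : 2%:R != 0 :> L := char0 1.
have t0 : t != 0 by rewrite mulf_neq0 // oppr_eq0 mulf_neq0 // invr_eq0.
have zE s : corner_det (act_mx c (h s) y) i = t * nm ((row ord_max (g s) *m xi) 0 0).
  case: (corners s) => _ ->; set u := row ord_max (g s).
  have uJu : u *m J d.+2 *m cjm u = 0.
    have [ug _] := Kg s; have e := congr1 (fun M : 'M[L]_d.+2 => M ord_max ord_max) (unitary_r ug).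
    apply/matrixP => i0 j0; rewrite (ord1 i0) (ord1 j0) [RHS]mxE.
    have -> : u *m J d.+2 *m cjm u = row ord_max (g s *m J d.+2) *m cjm u by rewrite row_mul.
    transitivity ((g s *m J d.+2 *m cjm (g s)) ord_max ord_max).
      by rewrite !mxE; apply: eq_bigr => k1 _; rewrite !mxE.
    by rewrite e mxE; case: eqP => // /(congr1 val) /=; rewrite subnn.
  have -> : u *m Y *m cjm u = - (2%:R / a) *: ((u *m xi) *m cjm (u *m xi)).
    rewrite YE mulmxBr mulmxBl uJu sub0r xiE cjmZ (c_wexp H) -!scalemxAl -!scalemxAr !scalerA.
    rewrite -!scalemxAl scaleNr cjm_mul !mulmxA; congr (- (_ *: _)).
    by rewrite /a; field; rewrite wm a00.
  by move: (u *m xi) => z; rewrite /t /D !mxE big_ord1 !mxE /nrm; ring.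
have Ol s : O ((row ord_max (g s) *m xi) 0 0).
  apply: (integral_mulmx H) => // i0 j0; rewrite mxE.
  by have [_ ig] := Kg s; exact: ig.
have [A AE hA] := cnt_shift_norm zE t0 Ol n00 (W01 r) N0 (hcnt xi a r ixi (ex_intro _ k uk) an0 aE vr) hB.
exists A, r; split => //.
rewrite AE /t (valM H) ?oppr_eq0 ?mulf_neq0 ?invr_eq0 // (valN H) (valM H) ?invr_eq0 // (valV H) // vr -/D.
ring.
Qed.

Lemma antidiag2 : J 2 = mx2 0 1 1 0.
Proof.
apply/matrixP => i j; rewrite !mxE -val_eqE /=.
by case: i => [[|[|k]] hi] //; case: j => [[|[|k']] hj].
Qed.

Lemma cjm_mx2 (a b d e : L) : cjm (mx2 a b d e) = mx2 (c a) (c d) (c b) (c e).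
Proof.
apply/matrixP => i j; rewrite !mxE.
by case: (i == 0); case: (j == 0).
Qed.

Lemma long_local_even m (i : 'I_m./2) N : i.+1 == m./2 -> ~~ odd m ->
  exists (S : finType) (h : S -> 'M[L]_m), inhabited S /\ (forall s, K m (h s)) /\
  forall y : 'M[L]_m, herm_inv c y -> (forall j, j != i -> corner_det y j != 0) ->
   (forall s j, j != i -> corner_det (act_mx c (h s) y) j != 0 /\
      v (corner_det (act_mx c (h s) y) j) = v (corner_det y j)) /\
   forall B : nat, (forall s, vg (- B%:Z) (corner_det (act_mx c (h s) y) i)) ->
   exists A r : nat, A%:Z + r%:Z = v (below i y) + v 2%:R + B%:Z /\
     forall k, (k < N)%N ->
     loc_count O w F (fun s => corner_det (act_mx c (h s) y) i) B k =
     q%:R ^+ N.+1 * shifted A (doubled (tails (lin2_dens x r))) k.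
Proof.
move=> mh mo.
have [I [f [hf _]]] := residue_system_Ok H N.+1.
have [I' [g [hg _]]] := residue_system_Ok H N.
have [fO _ _] := hf; have [gO _ _] := hg.
have O1 := up_one H; have O0 := O_zero H; have [_ Oeta _] := up_disc H.
have i2 a b d e : O a -> O b -> O d -> O e -> integral_mx O (mx2 a b d e).
  by move=> ? ? ? ? k l; rewrite mxE; case: eqP => _; case: eqP => _.
pose gs (s : I + I') : 'M[L]_2 :=
  match s with inl k => mx2 1 0 (f k * eta) 1 | inr k => mx2 0 1 1 (w * (g k * eta)) end.
have Kg s : K 2 (gs s).
  case: s => k /=.
    have [Of cf] := fO k; split; last by apply: i2 => //; exact: (up_mul H).
    apply: unitaryP; rewrite antidiag2 cjm_mx2 !mx2_mul rmorph0 rmorph1 (up_cM H) cf (c_eta H).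
    by congr mx2; ring.
  have [Og cg] := gO k; split; last first.
    by apply: i2 => //; apply: (up_mul H); [exact: (up_w H)|exact: (up_mul H)].
  apply: unitaryP; rewrite antidiag2 cjm_mx2 !mx2_mul rmorph0 rmorph1 !(up_cM H) cg (up_cw H) (c_eta H).
  by congr mx2; ring.
have q1 := q_gt1 H.
have [x0 xlt1] := x_bounds H F.
have [|||||h [Kh hh]] := @long_generic m i 0 N.+1 _ gs (q%:R ^+ N.+1) (lin2_dens x) _ mh isT Kg.
- by have := odd_double_half m; have /eqP := mh; rewrite (negPf mo) -addnn; lia.
- move=> xi a r ixi hu a0 aE va j jN.
  have lE s : (row ord_max (gs s) *m xi) 0 0 =
      lin2 (xi 0 0) (xi 1 0) (lines2 w (fun k => f k * eta) (fun k => g k * eta) s).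
    rewrite !mxE !big_ord_recl big_ord0 /lin2 addr0.
    have -> : lift ord0 ord0 = 1 :> 'I_2 by apply/val_inj.
    by case: s => k; rewrite /= !mxE.
  have aE' : xi 0 0 * c (xi 1 0) + c (xi 0 0) * xi 1 0 = a.
    move/matrixP: aE => /(_ 0 0); rewrite antidiag2 !mxE !big_ord_recl !big_ord0 !mxE !big_ord_recl !big_ord0 !mxE /=.
    have -> : lift ord0 ord0 = 1 :> 'I_2 by apply/val_inj.
    by rewrite ?mulr1n => <-; ring.
  rewrite -(lin2_count_dens F q1) // -(@lin2_cnt _ _ _ _ _ _ _ H N _ _ f g hf hg r j (xi 0 0) (xi 1 0)) ?aE' //.
    by congr (GRing.natmul 1 _); apply: eq_cnt => s; rewrite lE.
  case: hu => -[[|[|k]] hk] // uk; [left|right].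
    by move: uk; congr (unit_set O (xi _ _)); apply/val_inj.
  by move: uk; congr (unit_set O (xi _ _)); apply/val_inj.
- move=> r; rewrite eq_sym lt_eqF // /lin2_dens /= -subr_gt0; case: r => [|r] /=.
    by rewrite subr0 ltr_wpDr // ltW.
  by rewrite expr1 addrK.
- by rewrite expf_neq0 // pnatr_eq0; lia.
- by rewrite antidiag2 /mxtrace !big_ord_recl big_ord0 !mxE /= !addr0.
exists (I + I')%type, h; split.
  by have [_ /(_ 1 (conj O1 (up_c1 H)))[k _] _] := hf; exact: (inhabits (inl k)).
split => // y hy dy; have [h1 h2] := hh y hy dy; split => // B hB.
have [A [r [AE hA]]] := h2 B hB; exists A, r; split => // k kN; apply: hA; lia.
Qed.

Definition mx3 (a b d a' b' d' a'' b'' d'' : L) : 'M[L]_3 :=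
  \matrix_(i, j) nth 0 (nth [::] [:: [:: a; b; d]; [:: a'; b'; d']; [:: a''; b''; d'']] i) j.

Lemma mx3_mul a b d a' b' d' a'' b'' d'' p r s p' r' s' p'' r'' s'' :
  mx3 a b d a' b' d' a'' b'' d'' *m mx3 p r s p' r' s' p'' r'' s'' =
  mx3 (a * p + b * p' + d * p'') (a * r + b * r' + d * r'') (a * s + b * s' + d * s'')
      (a' * p + b' * p' + d' * p'') (a' * r + b' * r' + d' * r'') (a' * s + b' * s' + d' * s'')
      (a'' * p + b'' * p' + d'' * p'') (a'' * r + b'' * r' + d'' * r'') (a'' * s + b'' * s' + d'' * s'').
Proof.
apply/matrixP => i j; rewrite !mxE !big_ord_recl big_ord0 !mxE /= addr0 addrA.
by case: i => [[|[|[|k]]] hi] //; case: j => [[|[|[|k']]] hj].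
Qed.

Lemma antidiag3 : J 3 = mx3 0 0 1 0 1 0 1 0 0.
Proof.
apply/matrixP => i j; rewrite !mxE -val_eqE /=.
by case: i => [[|[|[|k]]] hi] //; case: j => [[|[|[|k']]] hj].
Qed.

Lemma cjm_mx3 a b d a' b' d' a'' b'' d'' :
  cjm (mx3 a b d a' b' d' a'' b'' d'') = mx3 (c a) (c a') (c a'') (c b) (c b') (c b'') (c d) (c d') (c d'').
Proof.
apply/matrixP => i j; rewrite !mxE.
by case: i => [[|[|[|k]]] hi] //; case: j => [[|[|[|k']]] hj].
Qed.

Lemma integral_mx3 a b d a' b' d' a'' b'' d'' : O a -> O b -> O d -> O a' -> O b' -> O d' ->
  O a'' -> O b'' -> O d'' -> integral_mx O (mx3 a b d a' b' d' a'' b'' d'').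
Proof.
move=> ? ? ? ? ? ? ? ? ? i j; rewrite mxE.
by case: i => [[|[|[|k]]] hi] //; case: j => [[|[|[|k']]] hj].
Qed.

(** An isotropic row (p, s, 1) is completed to a lower unipotent unitary matrix. *)
Lemma unitary_iso_row (s t : L) : c t = t ->
  unitary_group c (mx3 1 0 0 (- c s) 1 0 (iso_pt c th s t) s 1).
Proof.
move=> ct; apply: unitaryP; rewrite antidiag3 cjm_mx3 !mx3_mul !rmorph0 !rmorph1 rmorphN (up_cK H).
have e := iso_pt_tr H s ct; set p := iso_pt c th s t in e *.
have -> : c p = - nm s - p by rewrite -e addrC addKr.
by rewrite /nrm; congr mx3; ring.
Qed.

Lemma long_local_odd m (i : 'I_m./2) N : i.+1 == m./2 -> odd m ->
  exists (S : finType) (h : S -> 'M[L]_m), inhabited S /\ (forall s, K m (h s)) /\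
  forall y : 'M[L]_m, herm_inv c y -> (forall j, j != i -> corner_det y j != 0) ->
   (forall s j, j != i -> corner_det (act_mx c (h s) y) j != 0 /\
      v (corner_det (act_mx c (h s) y) j) = v (corner_det y j)) /\
   forall B : nat, (forall s, vg (- B%:Z) (corner_det (act_mx c (h s) y) i)) ->
   exists A r : nat, A%:Z + r%:Z = v (below i y) + v 2%:R + B%:Z /\
     forall k, (k < N)%N ->
     loc_count O w F (fun s => corner_det (act_mx c (h s) y) i) B k =
     q%:R ^+ (3 * N.+1) * shifted A (doubled (tails (lin3_dens x r))) k.
Proof.
move=> mh mo.
have [I1 [f hf]] := residue_system_O_ex H N.+1.
have [I2 [g [hg _]]] := residue_system_Ok H N.+1.
have [I3 [f' hf']] := residue_system_O_ex H N.
have [I4 [g' [hg' _]]] := residue_system_Ok H N.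
have [fO _ _] := hf; have [gO _ _] := hg; have [fO' _ _] := hf'; have [gO' _ _] := hg'.
have O1 := up_one H; have O0 := O_zero H; have Ow := up_w H.
pose S := ((I1 * I2) + (I3 * I4))%type.
(* Multiplication by J reverses the last row, which yields the lines (1 : w s : p) of the second
   chart. *)
pose gs (s : S) : 'M[L]_3 :=
  match s with
  | inl t => mx3 1 0 0 (- c (f t.1)) 1 0 (iso_pt c th (f t.1) (g t.2)) (f t.1) 1
  | inr t => mx3 1 0 0 (- c (w * f' t.1)) 1 0 (iso_pt c th (w * f' t.1) (w * g' t.2)) (w * f' t.1) 1 *m J 3
  end.
have base (s t : L) : O s -> O t -> c t = t -> K 3 (mx3 1 0 0 (- c s) 1 0 (iso_pt c th s t) s 1).
  move=> Os Ot ct; split; first exact: unitary_iso_row.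
  apply: integral_mx3 => //; last exact: (iso_pt_O H).
  by apply: (O_opp H); apply: (up_cO H).
have Kg s : K 3 (gs s).
  case: s => -[k l] /=; first by have [Og cg] := gO l; apply: base.
  have [Og cg] := gO' l.
  apply: (max_compact_mul H); last by split; [exact: unitary_antidiag|exact: (integral_antidiag H)].
  by apply: base; try exact: (up_mul H); rewrite (up_cM H) (up_cw H) cg.
have q1 := q_gt1 H.
have [x0 xlt1] := x_bounds H F.
have [|||||h [Kh hh]] := @long_generic m i 1 N.+1 S gs (q%:R ^+ (3 * N.+1)) (lin3_dens x) _ mh isT Kg.
- by have := odd_double_half m; have /eqP := mh; rewrite mo -addnn; lia.
- move=> xi a r ixi hu a0 aE va j jN.
  pose X := Vec3 (xi 0 0) (xi 1 0) (xi (inord 2) 0).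
  have o1 : lift ord0 ord0 = 1 :> 'I_3 by apply/val_inj.
  have o2 : lift ord0 (lift ord0 ord0) = inord 2 :> 'I_3 by apply/val_inj; rewrite /= inordK.
  have lE s : (row ord_max (gs s) *m xi) 0 0 = lin3 X (lines3 w c th f g f' g' s).
    rewrite !mxE !big_ord_recl big_ord0 /lin3 addr0 addrA o1 o2.
    by case: s => -[k l]; rewrite /= ?antidiag3 ?mx3_mul !mxE /= ?inordK //=; ring.
  have aE' : norm3 c X = a.
    move/matrixP: aE => /(_ 0 0); rewrite antidiag3 !mxE !big_ord_recl !big_ord0 !mxE !big_ord_recl !big_ord0 !mxE /=.
    by rewrite o2 o1 /norm3 /nrm /= ?mulr1n => <-; ring.
  rewrite -(lin3_count_dens F q1) // -(@lin3_cnt _ _ _ _ _ _ _ H N _ _ _ _ f g f' g' hf hg hf' hg' r j X) ?aE' //; try exact: ixi.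
    by congr (GRing.natmul 1 _); apply: eq_cnt => s; rewrite lE.
  case: hu => -[[|[|[|k]]] hk] // uk; [constructor 1|constructor 2|constructor 3].
  + by move: uk; congr (unit_set O (xi _ _)); apply/val_inj.
  + by move: uk; congr (unit_set O (xi _ _)); apply/val_inj.
  + by move: uk; congr (unit_set O (xi _ _)); apply/val_inj; rewrite /= inordK.
- move=> r; rewrite eq_sym lt_eqF // /lin3_dens /norm_dens /= -subr_gt0; case: r => [|r] /=.
    have -> : 1 + x ^+ 3 - (1 + x) * x ^+ 1 * x ^+ 1 = 1 - x ^+ 2 by ring.
    by rewrite subr_gt0 expr_lt1 // ltW.
  by have -> : 1 + x ^+ 3 - x ^+ 2 * x ^+ 1 = 1 by ring.
- by rewrite expf_neq0 // pnatr_eq0; lia.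
- by rewrite antidiag3 /mxtrace !big_ord_recl big_ord0 !mxE /= !addr0 add0r.
exists S, h; split.
  have [_ /(_ 1 O1)[k1 _] _] := hf; have [_ /(_ 1 (conj O1 (up_c1 H)))[k2 _] _] := hg.
  exact: (inhabits (inl (k1, k2))).
split => // y hy dy; have [h1 h2] := hh y hy dy; split => // B hB.
have [A [r [AE hA]]] := h2 B hB; exists A, r; split => // k kN; apply: hA; lia.
Qed.
End LongOrbitCounts.

(** * Integral closures of discrete valuation rings *)

Section IntegralClosureRing.
Variables (F : fieldType) (A : set F) (L : fieldExtType F).
Hypothesis A1 : A 1.
Hypothesis AB : forall x y, A x -> A y -> A (x - y).
Hypothesis AM : forall x y, A x -> A y -> A (x * y).

(** The set is packaged as a ring so that the closure properties of [integralOver] become available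
    for it. *)
Definition in_ring : {pred F} := fun x => `[< A x >].
Lemma in_ring_closed : subring_closed in_ring.
Proof.
by split=> [|x y /asboolP hx /asboolP hy|x y /asboolP hx /asboolP hy];
  apply/asboolP => //; [exact: AB|exact: AM].
Qed.
HB.instance Definition _ := GRing.isSubringClosed.Build F in_ring in_ring_closed.
Record subring_type : predArgType := SubringElt { subring_val : F; _ : in_ring subring_val }.
HB.instance Definition _ := [isSub for subring_val].
HB.instance Definition _ := [Choice of subring_type by <:].
HB.instance Definition _ := [SubChoice_isSubComNzRing of subring_type by <:].

Definition subring_incl : subring_type -> L := in_alg L \o \val.
HB.instance Definition _ := GRing.RMorphism.on subring_incl.

Lemma integral_closureE (x : L) :
  integral_closure A L x <-> integralOver subring_incl x.
Proof.
split=> [[P [mP hP rP]]|[p mp rp]].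
  have hv i : in_ring P`_i by apply/asboolP.
  pose p : {poly subring_type} := \poly_(i < size P) SubringElt (hv i).
  have pE : map_poly (\val : subring_type -> F) p = P.
    apply/polyP => i; rewrite coef_map_id0 // coef_poly; by case: ltnP => //= h; rewrite ?nth_default.
  exists p.
    have e : lead_coef P = \val (lead_coef p).
      by rewrite -pE; apply: lead_coef_map_inj => //; exact: val_inj.
    by rewrite monicE; apply/eqP/val_inj; rewrite -e (monicP mP).
  by rewrite /subring_incl map_poly_comp pE.
exists (map_poly (\val : subring_type -> F) p); split.
- by rewrite monic_map.
- by move=> i; rewrite coef_map /=; have := valP (p`_i) => /asboolP.
- by rewrite -map_poly_comp.
Qed.

Lemma integral_closure_sub (x y : L) : integral_closure A L x -> integral_closure A L y ->
  integral_closure A L (x - y).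
Proof. by rewrite !integral_closureE; apply: integral_sub. Qed.
Lemma integral_closure_mul (x y : L) : integral_closure A L x -> integral_closure A L y ->
  integral_closure A L (x * y).
Proof. by rewrite !integral_closureE; apply: integral_mul. Qed.
Lemma integral_closure_alg (a : F) : A a -> integral_closure A L a%:A.
Proof.
move=> Aa; have ha : in_ring a by apply/asboolP.
rewrite integral_closureE; exact: (integral_id subring_incl (SubringElt ha)).
Qed.
End IntegralClosureRing.
Section DvrClosure.
Variables (F : fieldType) (A : set F) (p0 : F) (L : fieldExtType F).
Hypothesis A1 : A 1.
Hypothesis AB : forall x y, A x -> A y -> A (x - y).
Hypothesis AM : forall x y, A x -> A y -> A (x * y).
Hypothesis Ap : A p0.
Hypothesis p00 : p0 != 0.
Hypothesis pV : ~ A p0^-1.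
Hypothesis Advd : forall a, A a -> a != 0 -> exists n b, A b /\ a * b = p0 ^+ n.
Hypothesis Aval : forall f, A f \/ A (f^-1 / p0).
Notation B := (integral_closure A L).

Let BB x y : B x -> B y -> B (x - y). Proof. exact: integral_closure_sub. Qed.
Let BM x y : B x -> B y -> B (x * y). Proof. exact: integral_closure_mul. Qed.
Let Balg a : A a -> B a%:A. Proof. exact: integral_closure_alg. Qed.
Let B1 : B 1. Proof. by rewrite -(scale1r 1); apply: Balg. Qed.
Let B0 : B 0. Proof. by rewrite -(subrr 1); apply: BB. Qed.
Let BN x : B x -> B (- x). Proof. by move=> h; rewrite -sub0r; apply: BB. Qed.
Let BD x y : B x -> B y -> B (x + y). Proof. by move=> hx hy; rewrite -[y]opprK; apply: BB => //; apply: BN. Qed.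
Let BX x n : B x -> B (x ^+ n).
Proof. by move=> h; elim: n => [|n IH]; rewrite ?expr0 // exprS; apply: BM. Qed.
Let Bsum (I : finType) (P : pred I) (G : I -> L) : (forall i, P i -> B (G i)) -> B (\sum_(i | P i) G i).
Proof. by move=> h; elim/big_ind: _. Qed.
Let A0 : A 0. Proof. by rewrite -(subrr 1); apply: AB. Qed.
Let AN x : A x -> A (- x). Proof. by move=> h; rewrite -sub0r; apply: AB. Qed.
Let AD x y : A x -> A y -> A (x + y). Proof. by move=> hx hy; rewrite -[y]opprK; apply: AB => //; apply: AN. Qed.
Let AX x n : A x -> A (x ^+ n).
Proof. by move=> h; elim: n => [|n IH]; rewrite ?expr0 // exprS; apply: AM. Qed.
Let Asum (I : finType) (P : pred I) (G : I -> F) : (forall i, P i -> A (G i)) -> A (\sum_(i | P i) G i).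
Proof. by move=> h; elim/big_ind: _. Qed.

Let alg_eq0 (a : F) : (a%:A == 0 :> L) = (a == 0).
Proof. by rewrite scaler_eq0 oner_eq0 orbF. Qed.

Let Afrac f : exists n, A (p0 ^+ n * f).
Proof.
have [h|h] := Aval f; first by exists 0%N; rewrite expr0 mul1r.
have [->|f0] := eqVneq f 0; first by exists 0%N; rewrite mulr0.
have [|n [b [Ab e]]] := Advd h; first by rewrite mulf_neq0 ?invr_eq0.
exists n.+1; rewrite exprSr -e.
have -> : f^-1 / p0 * b * p0 * f = b by field; rewrite p00 f0.
exact: Ab.
Qed.

Lemma integral_root_sum (P : {poly F}) (x : L) : root (map_poly (in_alg L) P) x ->
  \sum_(i < size P) (P`_i)%:A * x ^+ i = 0.
Proof.
move/rootP; rewrite horner_coef size_map_poly => e; rewrite -[RHS]e.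
by apply: eq_bigr => i _; rewrite coef_map.
Qed.

Lemma monic_root_top (P : {poly F}) (x : L) : P \is monic -> root (map_poly (in_alg L) P) x ->
  exists n, size P = n.+1 /\ x ^+ n = - \sum_(i < n) (P`_i)%:A * x ^+ i.
Proof.
move=> mP /integral_root_sum; have := monic_neq0 mP; rewrite -size_poly_gt0.
case E : (size P) => [//|n] _; rewrite big_ord_recr /= => e; exists n; split => //.
have : P`_n = 1 by move/monicP: mP; rewrite lead_coefE E.
by move=> e1; rewrite e1 scale1r mul1r in e; apply/eqP; rewrite -addr_eq0 addrC e.
Qed.

(** If a is not in [A], then 1/a is in p0 A, and the monic equation of a divided by a^n exhibits 1
    as a multiple of p0. *)
Lemma integrally_closed (a : F) : B a%:A -> A a.
Proof.
move=> [P [mP hP rP]]; have [//|h] := Aval a.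
have [->//|a0] := eqVneq a 0.
have [n [sP e]] := monic_root_top mP rP.
have e' : a ^+ n = - \sum_(i < n) P`_i * a ^+ i.
  apply: (fmorph_inj (in_alg L)); rewrite rmorphN rmorph_sum rmorphXn /= e; congr (- _).
  by apply: eq_bigr => i _; rewrite -(rmorphXn (in_alg L)) -(rmorphM (in_alg L)).
exfalso; apply: pV.
have -> : p0^-1 = - \sum_(i < n) P`_i * (a^-1 / p0) * (a^-1) ^+ (n - i.+1).
  have : 1 = - \sum_(i < n) P`_i * a ^+ i * a ^- n.
    by rewrite -mulr_suml -mulNr -e' divff // expf_neq0.
  move/(congr1 (fun z => z / p0)); rewrite mul1r mulNr mulr_suml => e1; rewrite [LHS]e1; congr (- _).
  apply: eq_bigr => i _.
  have -> : a ^- n = a^-1 ^+ (n - i.+1) * a^-1 * a ^- i.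
    by rewrite -exprVn -exprVn -exprSr -exprD; congr (_ ^+ _); have := ltn_ord i; lia.
  have : a ^+ i * a ^- i = 1 by rewrite divff // expf_neq0.
  move=> ei; transitivity (P`_i * (a ^+ i * a ^- i) * (a^-1 / p0) * a^-1 ^+ (n - i.+1)); first ring.
  by rewrite ei mulr1.
have AaV : A a^-1 by have := AM h Ap; rewrite mulfVK.
by apply: AN; apply: Asum => i _; apply: AM; [apply: AM|apply: AX].
Qed.

(** Replacing x by p0^n x multiplies the coefficient of degree i of its minimal polynomial, of
    degree d, by p0^(n(d - i)), which clears the denominators for n large. *)
Lemma integral_frac (x : L) : exists n, B ((p0 ^+ n)%:A * x).
Proof.
have /polyOver1P[Q QE] := minPolyOver 1 x.
have mQ : Q \is monic.
  have : map_poly (in_alg L) Q \is monic by rewrite -QE monic_minPoly.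
  by rewrite map_monic.
have rQ : root (map_poly (in_alg L) Q) x by rewrite -QE; exact: root_minPoly.
have [d [sQ e]] := monic_root_top mQ rQ.
have [n hn] : exists n, forall i, (i < d)%N -> A (p0 ^+ n * Q`_i).
  elim: d {e sQ} => [|d [n hn]]; first by exists 0%N.
  have [m hm] := Afrac Q`_d; exists (n + m)%N => i.
  rewrite ltnS leq_eqVlt => /orP[/eqP->|lt].
    by rewrite exprD -mulrA; apply: AM => //; apply: AX.
  by rewrite exprD mulrAC; apply: AM; [apply: hn|apply: AX].
exists n; pose t := p0 ^+ n; have At : A t by exact: AX.
pose P : {poly F} := 'X^d + \poly_(i < d) (t ^+ (d - i) * Q`_i).
have szp : (size (\poly_(i < d) (t ^+ (d - i) * Q`_i))%R < size ('X^d : {poly F})%R)%N.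
  by rewrite size_polyXn ltnS size_poly.
exists P; split.
- by rewrite monicE lead_coefDl // lead_coefXn.
- move=> i; rewrite coefD coefXn coef_poly; apply: AD; first by case: eqP.
  case: ltnP => // id; have -> : (d - i = (d - i).-1.+1)%N by lia.
  by rewrite exprSr -mulrA; apply: AM; [apply: AX|apply: hn].
- rewrite rmorphD /= map_polyXn rootE hornerD hornerXn exprMn.
  have -> : map_poly (in_alg L) (\poly_(i < d) (t ^+ (d - i) * Q`_i)) =
      \poly_(i < d) (t ^+ (d - i) * Q`_i)%:A.
    by apply/polyP => i; rewrite coef_map !coef_poly; case: ifP => _ //; rewrite /= scale0r.
  rewrite horner_poly e mulrN addrC subr_eq0; apply/eqP.
  rewrite mulr_sumr; apply: eq_bigr => i _.
  rewrite -(rmorphXn (in_alg L)) /= !mulr_algl exprZn !scalerA; congr (_ *: _).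
  have -> : t ^+ d = t ^+ (d - i) * t ^+ i by rewrite -exprD; congr (_ ^+ _); have := ltn_ord i; lia.
  by ring.
Qed.

Section Prime.
Variable w : L.
Hypothesis hw : prime_element B w.

Let w0 : w != 0. Proof. by case: hw. Qed.
Let nonunitP x : nonunit_set B x <-> exists2 y, B y & w * y = x.
Proof. by case: hw => _ ->. Qed.
Let Bw : B w.
Proof. by have [] := (nonunitP w).2 (ex_intro2 _ _ 1 B1 (mulr1 w)). Qed.
Lemma prime_not_inv : ~ B w^-1.
Proof. by have [_ h] := (nonunitP w).2 (ex_intro2 _ _ 1 B1 (mulr1 w)) => hV; apply: h. Qed.

Let unit_add u x : unit_set B u -> B x -> unit_set B (u + w * x).
Proof.
move=> [u0 Bu BuV] Bx; apply: contrapT => nu.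
have [|y By e] := (nonunitP (u + w * x)).1; first by split => //; apply: BD => //; apply: BM.
have : nonunit_set B u.
  by apply/nonunitP; exists (y - x); [exact: BB|rewrite mulrBr e addrK].
by case=> _; apply.
Qed.

Let p0_nonunit : ~ B (p0%:A^-1 : L).
Proof.
move=> h; apply: pV; apply: integrally_closed.
by move: h; rewrite -(fmorphV (in_alg L)).
Qed.

(** In a monic integral equation of w let i be the least index of a unit coefficient. The terms of
    index below i are divisible by p0, and the others add up to w^i times an element of the form
    unit plus multiple of w, which is a unit. *)
Let w_pow : exists j y, B y /\ w ^+ j = p0%:A * y.
Proof.
have [P [mP hP rP]] := Bw.
have ex : exists i, `[< unit_set A P`_i >].
  exists (size P).-1; apply/asboolP; move/monicP: mP; rewrite lead_coefE => ->.
  by split; rewrite ?oner_neq0 ?invr1.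
pose i := ex_minn ex.
have [ui imin] : unit_set A P`_i /\ forall k, unit_set A P`_k -> (i <= k)%N.
  by rewrite /i; case: ex_minnP => k /asboolP hk hmin; split=> // l hl; apply/hmin/asboolP.
have isz : (i < size P)%N.
  by rewrite ltnNge; apply/negP => h; case: ui => /eqP[]; rewrite nth_default.
have := integral_root_sum rP.
pose G (l : nat) := (P`_l)%:A * w ^+ l.
rewrite -(big_mkord xpredT G) (big_cat_nat (n := i)) //=; last exact: ltnW.
rewrite (big_ltn isz) => e.
pose T := \sum_(i.+1 <= l < size P) (P`_l)%:A * w ^+ (l - i.+1).
have BT : B T by apply: (big_ind (fun z => B z)) => // l _; apply: BM; [exact: Balg|exact: BX].
have uu : unit_set B ((P`_i)%:A + w * T).
  apply: unit_add => //; have [u0 Au AuV] := ui.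
  split; [by rewrite alg_eq0|exact: Balg|].
  by rewrite -(fmorphV (in_alg L)); exact: Balg.
have e1 : \sum_(i.+1 <= l < size P) G l = w ^+ i * (w * T).
  rewrite /T !mulr_sumr; apply: eq_big_nat => l /andP[il _].
  rewrite /G; have -> : w ^+ l = w ^+ i * w * w ^+ (l - i.+1).
    by rewrite -exprSr -exprD; congr (_ ^+ _); lia.
  by ring.
have [S BS SE] : exists2 S, B S & \sum_(0 <= l < i) G l = p0%:A * S.
  exists (\sum_(0 <= l < i) (P`_l / p0)%:A * w ^+ l).
    rewrite big_nat; apply: (big_ind (fun z => B z)) => // l /andP[_ li]; apply: BM; last exact: BX.
    apply: Balg; have [h|h] := Aval (P`_l)^-1; last by move: h; rewrite invrK.
    have [->|l0] := eqVneq P`_l 0; first by rewrite mul0r.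
    have : (i <= l)%N by apply: imin; split.
    by lia.
  rewrite mulr_sumr; apply: eq_bigr => l _; rewrite /G mulrA; congr (_ * _).
  by rewrite -(rmorphM (in_alg L)) /= mulrCA divff // mulr1.
have [u0 Bu BuV] := uu.
exists i, (- S / ((P`_i)%:A + w * T)); split; first by apply: BM => //; exact: BN.
apply: (mulIf u0); rewrite -[RHS]mulrA divfK // mulrN -SE; apply/eqP.
rewrite -addr_eq0; apply/eqP; rewrite -[RHS]e e1 /G; ring.
Qed.

(** An integral equation of x with nonzero constant term, obtained by dividing out powers of X,
    shows that x divides this term, which in turn divides a power of p0. *)
Let dvd_p0 x : B x -> x != 0 -> exists n y, B y /\ x * y = (p0 ^+ n)%:A.
Proof.
move=> [P [mP hP rP]] x0.
suff [Q [hQ rQ Q0]] : exists Q : {poly F}, [/\ forall i, A Q`_i, root (map_poly (in_alg L) Q) x & Q`_0 != 0].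
  have [n [b [Ab e]]] := Advd (hQ 0%N) Q0.
  have := integral_root_sum rQ.
  have : (0 < size Q)%N by rewrite size_poly_gt0; apply: contraNneq Q0 => ->; rewrite coef0.
  case: (size Q) => [//|d] _; rewrite big_ord_recl expr0 mulr1 => e'.
  exists n, (- \sum_(i < d) (Q`_i.+1)%:A * x ^+ i * b%:A); split.
    apply: BN; apply: Bsum => i _; apply: BM; last exact: Balg.
    by apply: BM; [exact: Balg|apply: BX; exists P].
  rewrite -e (rmorphM (in_alg L) (Q`_0) b : (Q`_0 * b)%:A = _) /= mulrN mulr_sumr.
  have -> : (Q`_0)%:A = - \sum_(i < d) (Q`_(lift ord0 i))%:A * x ^+ (lift ord0 i).
    by apply/eqP; rewrite -addr_eq0 e'.
  rewrite mulNr mulr_suml; congr (- _); apply: eq_bigr => i _ /=.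
  by rewrite /bump /= add1n exprS; ring.
have P0 := monic_neq0 mP.
elim: (size P) {-2}P (leqnn (size P)) P0 hP rP => [|d IH] {mP}Q sQ Q0 hQ rQ.
  by move: sQ; rewrite leqn0 size_poly_eq0 (negPf Q0).
have [q0|q0] := eqVneq Q`_0 0; last by exists Q.
have /factor_theorem[Q' QE] : root Q 0 by rewrite rootE horner_coef0 q0.
rewrite subr0 in QE.
have Q'0 : Q' != 0 by apply: contraNneq Q0 => e; rewrite QE e mul0r.
apply: (IH Q') => //.
- by move: sQ; rewrite QE size_mulX.
- by move=> i; have := hQ i.+1; rewrite QE coefMX.
- move: rQ; rewrite QE rmorphM /= map_polyX rootM rootX => /orP[//|].
  by rewrite (negPf x0).
Qed.

Let p0E (n : nat) : (p0 ^+ n)%:A = p0%:A ^+ n :> L.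
Proof. by rewrite -(rmorphXn (in_alg L)). Qed.

(** Division by w stops: x divides a power of p0, and a power of w is a multiple of p0, so unlimited
    divisibility of x by w would make p0 invertible. *)
Let val_int x : B x -> x != 0 -> exists n : nat, unit_set B (x / w ^+ n).
Proof.
move=> Bx x0.
have [N hN] : exists N, ~ B (x / w ^+ N).
  apply: contrapT => h; have [n [y [By e]]] := dvd_p0 Bx x0.
  have [j [z [Bz ez]]] := w_pow.
  apply: p0_nonunit.
  have hx : B (x / w ^+ (j * n.+1)) by apply: contrapT => h'; apply: h; eexists; exact: h'.
  have -> : p0%:A^-1 = x / w ^+ (j * n.+1) * y * z ^+ n.+1.
    have pA0 : p0%:A != 0 :> L by rewrite alg_eq0.
    have wn0 : w ^+ (j * n.+1) != 0 by rewrite expf_neq0.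
    have ee : w ^+ (j * n.+1) = p0%:A ^+ n.+1 * z ^+ n.+1 by rewrite exprM ez exprMn.
    have z0 : z ^+ n.+1 != 0.
      by apply: contraNneq wn0 => z0; rewrite ee z0 mulr0.
    have -> : x / w ^+ (j * n.+1) * y = (x * y) / w ^+ (j * n.+1) by rewrite mulrAC.
    rewrite e p0E ee exprS; field.
    by rewrite z0 pA0 expf_neq0.
  by apply: BM; [apply: BM|apply: BX].
have [M MP] := ex_minnP (ex_intro (fun n => `[< ~ B (x / w ^+ n) >]) N (asboolT hN)).
move=> Mmin; have {MP} hM := asboolW MP.
case: M hM Mmin => [|M] hM Mmin; first by case: hM; rewrite expr0 divr1.
exists M; have BMx : B (x / w ^+ M).
  by apply: contrapT => h; have := Mmin M (asboolT h); rewrite ltnn.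
apply: contrapT => nu; have [|y By e] := (nonunitP (x / w ^+ M)).1; first by split.
apply: hM; rewrite exprSr invfM mulrA -e; have -> // : w * y / w = y by field.
Qed.

Lemma dvr_closure_val x : x != 0 -> exists j : int, unit_set B (x / w ^ j).
Proof.
move=> x0; have [n hn] := integral_frac x.
have pn0 : (p0 ^+ n)%:A != 0 :> L by rewrite alg_eq0 expf_neq0.
have [a ua] := val_int hn (mulf_neq0 pn0 x0).
have [b ub] := val_int (Balg (AX n Ap)) pn0.
exists (a%:Z - b%:Z); have wa : w ^+ a != 0 by rewrite expf_neq0.
have wb : w ^+ b != 0 by rewrite expf_neq0.
have -> : x / w ^ (a%:Z - b%:Z) = ((p0 ^+ n)%:A * x / w ^+ a) / ((p0 ^+ n)%:A / w ^+ b).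
  rewrite expfzDr // -!exprnP -exprnN; field.
  by rewrite pn0 wa wb.
move: ua ub => [u0 Bu BuV] [t0 Bt BtV]; split; first by rewrite mulf_neq0 ?invr_eq0.
  exact: BM.
by rewrite invfM invrK; apply: BM.
Qed.
End Prime.
End DvrClosure.

(** * The p-adic integers *)

Section PadicIntegers.
Variables (R : realType) (p : nat) (F : fieldType) (absF : F -> R).
Hypothesis hF : is_padic_field p absF.
Let p_gt1 : (1 < p)%N. Proof. exact: prime_gt1 (padic_prime hF). Qed.
Let pR1 : 1 < p%:R :> R. Proof. by rewrite ltr1n. Qed.
Let pR0 : 0 < p%:R :> R. Proof. by rewrite ltr0n; lia. Qed.

Lemma padic_nat (n : nat) : (0 < n)%N -> absF n%:R = p%:R ^ (- (logn p n)%:Z).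
Proof.
move=> n0; have := padic_rat hF n%:R; rewrite ratr_nat /padic_abs pnatr_eq0 eqn0Ngt n0 /=.
have -> : (n%:R : rat) = n%:~R by rewrite pmulrn.
by rewrite numq_int denq_int /= logn1 sub0r => ->.
Qed.

Lemma padic_abs1 : absF 1 = 1.
Proof. by rewrite (padic_nat (n := 1)) // logn1 oppr0 expr0z. Qed.

Lemma padic_abs_gt0 x : x != 0 -> 0 < absF x.
Proof.
move=> x0; rewrite lt_neqAle (padic_ge0 hF) andbT eq_sym; apply/eqP => /(padic_eq0 hF) e.
by move: x0; rewrite e eqxx.
Qed.

Lemma padic_absN x : absF (- x) = absF x.
Proof.
suff e : absF (-1) = 1 by rewrite -mulN1r (padicM hF) e mul1r.
have h : absF (-1) * absF (-1) = 1 by rewrite -(padicM hF) mulrNN mulr1 padic_abs1.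
have h0 := padic_ge0 hF (-1); nra.
Qed.

Lemma padic_absX x n : absF (x ^+ n) = absF x ^+ n.
Proof. by elim: n => [|n IH]; rewrite ?expr0 ?padic_abs1 // !exprS (padicM hF) IH. Qed.

Lemma padic_absV x : x != 0 -> absF x^-1 = (absF x)^-1.
Proof.
move=> x0; have a0 := padic_abs_gt0 x0.
apply: (mulIf (lt0r_neq0 a0)); rewrite -(padicM hF) !mulVf ?padic_abs1 //.
exact: lt0r_neq0.
Qed.

Lemma padic_char0 n : n.+1%:R != 0 :> F.
Proof.
apply/eqP => e; have := padic_nat (n := n.+1) isT; rewrite e.
have -> : absF 0 = 0 by apply/(padic_eq0 hF).
by move/eqP; rewrite eq_sym expfz_eq0 (negPf (lt0r_neq0 pR0)) andbF.
Qed.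

Lemma padic_nat_le1 n : absF n%:R <= 1.
Proof.
case: n => [|n]; first by have -> : absF 0%:R = 0 by [apply/(padic_eq0 hF)]; exact: ler01.
rewrite padic_nat // -exprnN invf_le1 ?exprn_gt0 // exprn_ege1 // ltW //.
Qed.

Lemma le1_of_pow_le (t : R) : 0 <= t -> (forall n, t ^+ n <= n.+1%:R) -> t <= 1.
Proof.
move=> t0 h; rewrite leNgt; apply/negP => t1.
pose d := t - 1; have d0 : 0 < d by rewrite subr_gt0.
have bern n : 1 + n%:R * d <= t ^+ n.
  elim: n => [|n IH]; first by rewrite mul0r addr0 expr0.
  rewrite exprS (_ : t * t ^+ n = (1 + d) * t ^+ n); last by congr (_ * _); rewrite /d; ring.
  set P := t ^+ n in IH *.
  have : 0 <= (1 + d) * (P - (1 + n%:R * d)).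
    by apply: mulr_ge0; rewrite ?subr_ge0 ?IH //; lra.
  have n0 : 0 <= n%:R :> R by rewrite ler0n.
  have : 0 <= n%:R * d * d :> R by rewrite mulr_ge0 ?mulr_ge0 ?(ltW d0).
  rewrite -natr1; nra.
(* Bernoulli's bound for t^n, squared, is quadratic in n, while the bound assumed for t^(2n) is
   linear. *)
have key n : (0 < n)%N -> n%:R * (d * d) <= 3%:R.
  move=> n0; have nR : 0 < n%:R :> R by rewrite ltr0n.
  have b1 := bern n; have b2 := h (n * 2)%N; rewrite exprM expr2 in b2.
  have : (n%:R * d) * (n%:R * d) <= (n * 2).+1%:R.
    apply: le_trans b2; apply: ler_pM => //; try by rewrite mulr_ge0 // ltW.
      by apply: le_trans b1; rewrite lerDr.
    by apply: le_trans b1; rewrite lerDr.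
  have : (n * 2).+1%:R <= n%:R * 3%:R :> R by rewrite -natrM ler_nat; lia.
  move=> b3 b4; rewrite -(ler_pM2l nR); nra.
have dd : 0 < d * d by exact: mulr_gt0.
have := key (Num.Def.archi_bound (3%:R / (d * d))).+1 isT.
rewrite -ler_pdivlMr // => h3.
have := archi_boundP (x := 3%:R / (d * d)) (ltW (divr_gt0 (ltr0n _ 3) dd)).
set N := Num.Def.archi_bound _ in h3 *; move=> h4.
have : N%:R <= N.+1%:R :> R by rewrite ler_nat.
by move=> h5; move: (lt_le_trans h4 (le_trans h5 h3)); rewrite ltxx.
Qed.

(** The ultrametric inequality from the triangle inequality: binomial coefficients have absolute
    value at most 1, so the expansion of (x + y)^n gives |x + y|^n <= n + 1 for every n. *)
Lemma padic_add_le1 x y : absF x <= 1 -> absF y <= 1 -> absF (x + y) <= 1.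
Proof.
move=> hx hy; apply: le1_of_pow_le => [|n]; first exact: (padic_ge0 hF).
rewrite -padic_absX exprDn.
have sumle (I : finType) (G : I -> F) : absF (\sum_i G i) <= \sum_i absF (G i).
  elim/big_ind2: _ => // [|a b a' b' h1 h2].
    by have -> : absF 0 = 0 by apply/(padic_eq0 hF).
  by apply: le_trans (padicD hF _ _) _; apply: lerD.
apply: le_trans (sumle _ _) _.
rewrite -[X in _ <= X%:R]card_ord -sum1_card natr_sum; apply: ler_sum => i _.
rewrite -mulr_natr !(padicM hF) !padic_absX.
have e1 (t : R) k : 0 <= t -> t <= 1 -> 0 <= t ^+ k <= 1.
  by move=> h0 h1; rewrite exprn_ge0 // exprn_ile1.
have /andP[a0 a1] := e1 _ (n - i)%N (padic_ge0 hF x) hx.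
have /andP[b0 b1] := e1 _ i (padic_ge0 hF y) hy.
have c1 := padic_nat_le1 'C(n, i); have c0 := padic_ge0 hF ('C(n, i)%:R).
apply: mulr_ile1 => //; [exact: mulr_ge0|exact: mulr_ile1].
Qed.

Definition Zp : set F := [set a | absF a <= 1].

Lemma Zp_one : Zp 1. Proof. by rewrite /Zp /= padic_abs1. Qed.
Lemma Zp_sub x y : Zp x -> Zp y -> Zp (x - y).
Proof. by move=> hx hy; apply: padic_add_le1 => //; rewrite padic_absN. Qed.
Lemma Zp_mul x y : Zp x -> Zp y -> Zp (x * y).
Proof. by rewrite /Zp /= => hx hy; rewrite (padicM hF); apply: mulr_ile1 => //; exact: (padic_ge0 hF). Qed.
Lemma abs_p : absF p%:R = p%:R^-1.
Proof.
have pp := padic_prime hF; have e := pfactorK 1 pp; rewrite expn1 in e.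
by rewrite padic_nat ?prime_gt0 // e -exprnN expr1.
Qed.
Lemma Zp_p : Zp p%:R.
Proof. by rewrite /Zp /= padic_nat_le1. Qed.
Lemma p_neq0 : p%:R != 0 :> F.
Proof. by case: p p_gt1 => // n _; exact: padic_char0. Qed.
Lemma Zp_pV : ~ Zp (p%:R)^-1.
Proof. by rewrite /Zp /= padic_absV ?p_neq0 // abs_p invrK leNgt pR1. Qed.

Lemma Zp_dvd a : Zp a -> a != 0 -> exists n b, Zp b /\ a * b = p%:R ^+ n.
Proof.
move=> _ a0; have aa := padic_abs_gt0 a0.
have [n hn] : exists n, (p%:R ^+ n)^-1 <= absF a.
  exists (Num.Def.archi_bound (absF a)^-1).
  set N := Num.Def.archi_bound _.
  have h := archi_boundP (x := (absF a)^-1) (ltW (_ : 0 < _)).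
  rewrite -[leRHS]invrK lef_pV2 ?posrE ?exprn_gt0 ?invr_gt0 //.
  apply: le_trans (ltW (h _)) _; first by rewrite invr_gt0.
  rewrite -natrX ler_nat; apply: ltnW; exact: ltn_expl.
exists n, (p%:R ^+ n / a); split; last by rewrite mulrC divfK.
by rewrite /Zp /= (padicM hF) padic_absX abs_p padic_absV // ler_pdivrMr // mul1r exprVn.
Qed.

(** The absolute values of rationals are powers of p; by density an absolute value above 1 is
    therefore at least p. *)
Lemma Zp_val f : Zp f \/ Zp (f^-1 / p%:R).
Proof.
case: (leP (absF f) 1) => f1; [by left|right].
have f0 : f != 0.
  apply/eqP => e; move: f1; rewrite e; have -> : absF 0 = 0 by apply/(padic_eq0 hF).
  by rewrite ltNge ler01.
suff : p%:R <= absF f.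
  move=> h; rewrite /Zp /= (padicM hF) !padic_absV ?p_neq0 // abs_p invrK.
  by rewrite mulrC ler_pdivrMr ?mul1r // padic_abs_gt0.
apply/ler_addgt0Pr => eps eps0.
pose e := Num.min eps (absF f - 1).
have e0 : 0 < e by rewrite lt_min eps0 subr_gt0.
have [r hr] := padic_dense hF f e0.
have hr1 : absF f - absF (ratr r) < e.
  apply: le_lt_trans hr; rewrite lerBlDr; apply: le_trans (padicD hF _ _).
  by rewrite subrK.
have hr2 : absF (ratr r) - absF f < e.
  apply: le_lt_trans hr; rewrite -(padic_absN (f - _)) opprB lerBlDr; apply: le_trans (padicD hF _ _).
  by rewrite subrK.
have e1 : e <= eps by rewrite ge_min lexx.
have e2 : e <= absF f - 1 by rewrite ge_min lexx orbT.
have r1 : 1 < absF (ratr r) by lra.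
suff : p%:R <= absF (ratr r) by lra.
move: r1; rewrite (padic_rat hF) /padic_abs; case: ifP => _; first by rewrite ltNge ler01.
move: (_ - _)%R => z; case: (leP z 0) => z0.
  have -> : z = - (absz z)%:Z by lia.
  by rewrite -exprnN invf_gt1 ?exprn_gt0 // ltNge exprn_ege1 // ltW.
have -> : z = (absz z)%:Z by lia.
move=> _; rewrite -exprnP; apply: ler_eXnr; [by lia|exact: ltW].
Qed.
End PadicIntegers.

(** * The unramified quadratic extension *)

Section QuadraticPair.
Variables (k : fieldType) (A : set k) (w : k).
Hypothesis A1 : A 1.
Hypothesis AB : forall x y, A x -> A y -> A (x - y).
Hypothesis AM : forall x y, A x -> A y -> A (x * y).
Hypothesis hw : prime_element A w.
Hypothesis wV : ~ A w^-1.
Hypothesis Aval : forall x, x != 0 -> exists j : int, unit_set A (x / w ^ j).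

Let w0 : w != 0 := hw.1.
Let A0 : A 0. Proof. by rewrite -(subrr 1); apply: AB. Qed.
Let AN x : A x -> A (- x). Proof. by move=> h; rewrite -sub0r; apply: AB. Qed.
Let AD x y : A x -> A y -> A (x + y). Proof. by move=> hx hy; rewrite -[y]opprK; apply: AB => //; apply: AN. Qed.
Let Aw : A w.
Proof. have [_ e] := hw; have : nonunit_set A w by rewrite e; exists 1; rewrite ?mulr1. by case. Qed.
Let AX n : A (w ^+ n).
Proof. by elim: n => [|n IH]; rewrite ?expr0 // exprS; apply: AM. Qed.

Lemma dvr_int a : A a -> a != 0 -> exists n : nat, unit_set A (a / w ^+ n).
Proof.
move=> Aa a0; have [[n|n] u] := Aval a0; first by exists n.
case: u => u0 u1 u2; case: wV.
have -> : w^-1 = a * (a / w ^ Negz n)^-1 * w ^+ n.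
  rewrite NegzE -exprnN invrK invfM mulrA divff // mul1r exprS invfM -mulrA mulVf ?mulr1 //.
  by rewrite expf_neq0.
by apply: AM => //; apply: AM.
Qed.

Lemma dvr_dvd a : A a -> a != 0 -> exists n b, A b /\ a * b = w ^+ n.
Proof.
move=> Aa a0; have [n [u0 u1 u2]] := dvr_int Aa a0; exists n, (a / w ^+ n)^-1; split => //.
by field; rewrite a0 expf_neq0.
Qed.

Lemma dvr_dichotomy f : A f \/ A (f^-1 / w).
Proof.
have [->|f0] := eqVneq f 0; first by left.
have [[n|n] [u0 u1 u2]] := Aval f0; [left|right].
  by rewrite -(divfK (expf_neq0 n w0) f); apply: AM.
have -> : f^-1 / w = (f / w ^ Negz n)^-1 * w ^+ n.
  by rewrite NegzE -exprnN invrK exprS !invfM -!mulrA mulVf ?mulr1 // expf_neq0.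
by apply: AM.
Qed.

Lemma nonunit_div y : nonunit_set A y <-> A (y / w).
Proof.
have [_ e] := hw; rewrite e; split => [[z Az <-]|h]; first by rewrite mulrAC divff // mul1r.
by exists (y / w) => //; rewrite mulrC divfK.
Qed.

Lemma residue_reps q : (residue_field A #= `I_q)%card ->
  exists r : 'I_q -> k, [/\ forall i, A (r i), forall a, A a -> exists i, A ((a - r i) / w)
    & forall i j, A ((r i - r j) / w) -> i = j].
Proof.
move=> /card_set_bijP[f [fi finj fsurj]].
pose S x := [set y | A y /\ nonunit_set A (y - x)].
have hs (i : 'I_q) : exists x, A x /\ f (S x) = i.
  have [X [x Ax <-] e] := fsurj i (ltn_ord i); by exists x.
have [r hr] := choice hs.
exists r; split=> [i|a Aa|i j h]; first by case: (hr i).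
  have lt : (f (S a) < q)%N by apply: fi; exists a.
  exists (Ordinal lt); apply/nonunit_div; have [Ar e] := hr (Ordinal lt).
  have eS : S (r (Ordinal lt)) = S a.
    by apply: finj; rewrite ?inE //; [exists (r (Ordinal lt))|exists a].
  have : S (r (Ordinal lt)) a by rewrite eS; split=> //; apply/nonunit_div; rewrite subrr mul0r.
  by case.
have [Ari ei] := hr i; have [Arj ej] := hr j; apply/val_inj; rewrite /= -ei -ej; congr f.
apply/seteqP; split=> y [Ay /nonunit_div hy]; split=> //; apply/nonunit_div.
  have -> : (y - r j) / w = (y - r i) / w + (r i - r j) / w by ring.
  exact: AD.
have -> : (y - r i) / w = (y - r j) / w - (r i - r j) / w by ring.
exact: AB.
Qed.

(** When 2 is divisible by w, squaring is injective on the residue field, and hence surjective since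
    this field is finite. *)
Lemma residue_sqrt q (r : 'I_q -> k) : (forall i, A (r i)) ->
    (forall a, A a -> exists i, A ((a - r i) / w)) ->
    (forall i j, A ((r i - r j) / w) -> i = j) -> A (2%:R / w) ->
  forall n, A n -> exists2 a, A a & A ((a * a - n) / w).
Proof.
move=> Ar rex rinj h2 n An.
have hs' i : exists j, A ((r i * r i - r j) / w) by apply: rex; apply: AM.
have [s hs] := choice hs'.
have sq x : A x -> A (x * x / w) -> A (x / w).
  move=> Ax h; have [->|x0] := eqVneq x 0; first by rewrite mul0r.
  have [[|j] [u0 u1 u2]] := dvr_int Ax x0.
    case: wV; have -> : w^-1 = (x * x / w) * (x / w ^+ 0)^-1 * (x / w ^+ 0)^-1.
      by rewrite expr0 divr1; field; rewrite w0 x0.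
    by apply: AM => //; apply: AM.
  have -> : x / w = x / w ^+ j.+1 * w ^+ j by rewrite exprS; field; rewrite w0 expf_neq0.
  exact: AM.
have sinj : injective s.
  move=> i j e; apply: rinj; apply: sq; first exact: AB.
  have -> : (r i - r j) * (r i - r j) / w = (r i * r i - r (s i)) / w
      - (r j * r j - r (s j)) / w - 2%:R / w * (r j * (r i - r j)) by rewrite e; ring.
  by apply: AB; [apply: AB|apply: AM => //; apply: AM => //; apply: AB].
have [j hj] := rex _ An.
have [i ei] : exists i, s i = j by have [g _ gK] := injF_bij sinj; exists (g j).
exists (r i) => //.
have -> : (r i * r i - n) / w = (r i * r i - r (s i)) / w - (n - r j) / w by rewrite ei; ring.
exact: AB.
Qed.

Variables (k' : fieldExtType k) (c : {lrmorphism k' -> k'}).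
Hypothesis hk' : unramified_quadratic A w k'.
Hypothesis hc : ~ (c =1 id).
Local Notation B := (integral_closure A k').

Let B_sub x y : B x -> B y -> B (x - y). Proof. exact: integral_closure_sub. Qed.
Let B_mul x y : B x -> B y -> B (x * y). Proof. exact: integral_closure_mul. Qed.
Let B_alg a : A a -> B a%:A. Proof. exact: integral_closure_alg. Qed.
Let B_alg' a : B a%:A -> A a.
Proof. exact: (integrally_closed A1 AB AM Aw w0 wV dvr_dichotomy). Qed.
Let B_val x : x != 0 -> exists j : int, unit_set B (x / w%:A ^ j).
Proof. exact: (dvr_closure_val A1 AB AM Aw w0 wV dvr_dvd dvr_dichotomy hk'.2). Qed.
Let B_wV : ~ B (w%:A)^-1.
Proof. exact: (prime_not_inv A1 AB AM hk'.2). Qed.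
Let B1 : B 1. Proof. by rewrite -[1]scale1r; exact: B_alg. Qed.
Let wA0 : w%:A != 0 :> k' := hk'.2.1.

Lemma lrmorph_alg (a : k) : c a%:A = a%:A.
Proof. by rewrite linearZ /= rmorph1. Qed.

Let cD x y : c (x + y) = c x + c y. Proof. exact: rmorphD. Qed.
Let cB x y : c (x - y) = c x - c y. Proof. exact: rmorphB. Qed.
Let cM x y : c (x * y) = c x * c y. Proof. exact: rmorphM. Qed.
Let cZ a x : c (a *: x) = a *: c x. Proof. exact: linearZ. Qed.

Lemma quadratic_basis : exists t : k', c t != t /\ forall x, exists a b : k, x = a%:A + b *: t.
Proof.
have [t ht] : exists t, c t != t.
  apply: contrapT => h; apply: hc => x; apply/eqP; apply: contrapT => /negP h'; apply: h; by exists x.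
exists t; split=> // x.
have tn : t \notin <[1%R : k']>%VS.
  by apply/negP => /vlineP[a e]; move: ht; rewrite e lrmorph_alg eqxx.
have fr : free [:: t; 1 : k'].
  by rewrite free_cons span_seq1 tn seq1_free oner_neq0.
have sp : <<[:: t; (1%R : k')]>>%VS = (fullv : {vspace k'}).
  apply/eqP; rewrite eqEdim subvf /= (eqP fr) /=.
  by have := hk'.1 => ->.
have : x \in <<[:: t; (1%R : k')]>>%VS by rewrite sp memvf.
rewrite span_cons span_seq1 => /memv_addP[u /vlineP[b ->] [v /vlineP[a ->] ->]].
by exists a, b; rewrite addrC.
Qed.

(** c(t) is a root of the quadratic equation t^2 = a + b t different from t, hence equal to b -
    t. *)
Lemma quadratic_involutive : involutive c.
Proof.
have [t [ht sp]] := quadratic_basis.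
have [a [b e]] := sp (t * t).
have ct : c t = b%:A - t.
  have e2 : c t * c t = a%:A + b *: c t by rewrite -cM e cD lrmorph_alg cZ.
  apply/eqP; rewrite -subr_eq0; have : (c t - t) * (c t - (b%:A - t)) = 0.
    have -> : (c t - t) * (c t - (b%:A - t)) = (c t * c t - b%:A * c t) - (t * t - b%:A * t) by ring.
    by rewrite e e2 !mulr_algl !addrK subrr.
  move/eqP; rewrite mulf_eq0 => /orP[/eqP/subr0_eq h|//]; by move: ht; rewrite h eqxx.
move=> x; have [a' [b' ->]] := sp x.
rewrite !cD !lrmorph_alg !cZ ct cB lrmorph_alg ct.
by congr (_ + _ *: _); ring.
Qed.

Lemma quadratic_fixed x : c x = x -> exists a : k, x = a%:A.
Proof.
have [t [ht sp]] := quadratic_basis; have [a [b ->]] := sp x.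
rewrite cD lrmorph_alg cZ => /addrI /eqP; rewrite -subr_eq0 -scalerBr scaler_eq0 subr_eq0 (negPf ht) orbF.
by move=> /eqP ->; exists a; rewrite scale0r addr0.
Qed.

Lemma conj_integral x : B x -> B (c x).
Proof.
move=> [P [mP cP rP]]; exists P; split=> //.
move: rP; rewrite /root => /eqP e.
have -> : map_poly (in_alg k') P = map_poly c (map_poly (in_alg k') P).
  by rewrite -map_poly_comp; apply: eq_map_poly => a; rewrite /= lrmorph_alg.
by rewrite horner_map e rmorph0.
Qed.

Let Bval_int x : B x -> x != 0 -> exists n : nat, unit_set B (x / w%:A ^+ n).
Proof.
move=> Aa a0; have [[n|n] u] := B_val a0; first by exists n.
case: u => u0 u1 u2; case: B_wV.
have -> : w%:A^-1 = x * (x / w%:A ^ Negz n)^-1 * w%:A ^+ n.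
  rewrite NegzE -exprnN invrK invfM mulrA divff // mul1r exprS invfM -mulrA mulVf ?mulr1 //.
  by rewrite expf_neq0.
apply: B_mul => //; first exact: B_mul.
by elim: (n) => [|i IH]; rewrite ?expr0 // exprS; apply: B_mul => //; exact: B_alg.
Qed.

Let B_sqr x : B x -> B (x * x / w%:A) -> B (x / w%:A).
Proof.
move=> Bx h; have [->|x0] := eqVneq x 0; first by rewrite mul0r -(scale0r (1 : k')); exact: B_alg.
have [[|j] [u0 u1 u2]] := Bval_int Bx x0.
  case: B_wV; have -> : w%:A^-1 = (x * x / w%:A) * (x / w%:A ^+ 0)^-1 * (x / w%:A ^+ 0)^-1.
    by rewrite expr0 divr1; field; rewrite wA0 x0.
  by apply: B_mul => //; apply: B_mul.
have -> : x / w%:A = x / w%:A ^+ j.+1 * w%:A ^+ j by rewrite exprS; field; rewrite wA0 expf_neq0.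
apply: B_mul => //.
by elim: (j) => [|i IH]; rewrite ?expr0 // exprS; apply: B_mul => //; exact: B_alg.
Qed.

(** As w stays prime, x - c(x) is a unit times some w^N for any integral x not fixed by [c]. The
    exponent is lowered to 0: if w divides x - c(x), then x is congruent modulo w to some a in [A],
    and (x - a)/w has exponent N - 1. *)
Lemma quadratic_generator q : (residue_field A #= `I_q)%card ->
  exists2 th, B th & unit_set B (th - c th).
Proof.
move=> /residue_reps[r [Ar rex rinj]].
have step N : forall x, B x -> unit_set B ((x - c x) / w%:A ^+ N) ->
    exists2 th, B th & unit_set B (th - c th).
  elim: N => [|N IH] x Bx; first by rewrite expr0 divr1; exists x.
  move=> ux; have [u0 u1 u2] := ux.
  have Bxc : B ((x - c x) / w%:A).
    have -> : (x - c x) / w%:A = (x - c x) / w%:A ^+ N.+1 * w%:A ^+ N.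
      by rewrite exprS; field; rewrite wA0 expf_neq0.
    apply: B_mul => //.
    by elim: (N) => [|i IHi]; rewrite ?expr0 // exprS; apply: B_mul => //; exact: B_alg.
  suff [a Aa ha] : exists2 a, A a & B ((x - a%:A) / w%:A).
    apply: (IH _ ha).
    have -> : (x - a%:A) / w%:A - c ((x - a%:A) / w%:A) = (x - c x) / w%:A.
      by rewrite fmorph_div /= cB !lrmorph_alg; ring.
    by rewrite -mulrA -invfM -exprS.
  have cx := conj_integral Bx.
  have [[t0 th]|h2] : (2%:R != 0 :> k /\ A (2%:R)^-1) \/ A (2%:R / w).
    have A2 : A 2%:R by exact: AD.
    have [->|t0] := eqVneq (2%:R : k) 0; first by right; rewrite mul0r.
    have [[|n] [v0 v1 v2]] := dvr_int A2 t0; [left|right].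
      by split=> //; move: v2; rewrite expr0 divr1.
    have -> : 2%:R / w = 2%:R / w ^+ n.+1 * w ^+ n by rewrite exprS; field; rewrite w0 expf_neq0.
    exact: AM.
  (* If 2 is a unit, half the trace of x serves as a. *)
  - have t0' : 2%:R != 0 :> k' by rewrite -scaler_nat scaler_eq0 negb_or t0 oner_neq0.
    have [a ea] : exists a : k, (2%:R^-1)%:A * (x + c x) = a%:A.
      apply: quadratic_fixed; rewrite cM cD lrmorph_alg quadratic_involutive.
      by rewrite addrC.
    have e2 : (2%:R^-1)%:A = 2%:R^-1 :> k'.
      by apply: (mulfI t0'); rewrite divff // mulr_natl -scaler_nat scalerA divff // scale1r.
    have Ba : B a%:A.
      rewrite -ea; apply: B_mul; first exact: B_alg.
      by rewrite -[c x]opprK; apply: B_sub => //; rewrite -sub0r; apply: B_sub => //; rewrite -(scale0r (1 : k')); exact: B_alg.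
    exists a; first exact: B_alg'.
    rewrite -ea e2.
    have -> : (x - 2%:R^-1 * (x + c x)) / w%:A = (2%:R^-1)%:A * ((x - c x) / w%:A).
      by rewrite e2; field; rewrite t0' wA0.
    by apply: B_mul => //; exact: B_alg.
  (* If w divides 2, a square root a of N(x) modulo w serves: (x - a)^2 = x(x - c(x)) + (a^2 - N(x))
     - 2(a x - N(x)) is divisible by w, hence so is x - a. *)
  - have [n en] : exists n : k, x * c x = n%:A.
      by apply: quadratic_fixed; rewrite cM quadratic_involutive mulrC.
    have An : A n by apply: B_alg'; rewrite -en; exact: B_mul.
    have [a Aa ha] := residue_sqrt Ar rex rinj h2 An.
    exists a => //; apply: B_sqr; first by apply: B_sub => //; exact: B_alg.
    have -> : (x - a%:A) * (x - a%:A) / w%:A = x * ((x - c x) / w%:A)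
        + ((a * a - n) / w)%:A - (2%:R / w)%:A * (a%:A * x - x * c x).
      have -> : ((a * a - n) / w)%:A = (a%:A * a%:A - x * c x) / w%:A :> k'.
        rewrite en -(rmorphM (in_alg k')) -(rmorphB (in_alg k')); exact: (fmorph_div (in_alg k')).
      have -> : (2%:R / w)%:A = 2%:R / w%:A :> k'.
        apply: (mulIf wA0); rewrite divfK //.
        by rewrite -scalerAl mul1r scalerA divfK // scaler_nat.
      by field; rewrite wA0.
    apply: B_sub; last by apply: B_mul; [exact: B_alg|apply: B_sub; apply: B_mul => //; exact: B_alg].
    rewrite -[X in _ + X]opprK; apply: B_sub; first exact: B_mul.
    rewrite -scaleNr; apply: B_alg; exact: AN.
have [x hx] : exists x, c x != x by have [t [ht _]] := quadratic_basis; exists t.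
have [n Bn] := integral_frac A1 AB AM Aw w0 dvr_dvd dvr_dichotomy x.
have d0 : (w ^+ n)%:A * x - c ((w ^+ n)%:A * x) != 0.
  rewrite cM lrmorph_alg -mulrBr mulf_neq0 //; last by rewrite subr_eq0 eq_sym.
  by rewrite scaler_eq0 negb_or expf_neq0 ?oner_neq0.
have [N hN] := Bval_int (B_sub Bn (conj_integral Bn)) d0.
exact: step Bn hN.
Qed.

Lemma quadratic_unramified_pair q : (residue_field A #= `I_q)%card ->
  exists rho th, @unramified_pair k' B w%:A c q rho th.
Proof.
move=> hq; have [r [Ar rex rinj]] := residue_reps hq; have [th Bth uth] := quadratic_generator hq.
have divA a : (a / w)%:A = a%:A / w%:A :> k'.
  by apply: (mulIf wA0); rewrite divfK // -scalerAl mul1r scalerA divfK.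
exists (fun i => (r i)%:A), th; split=> //; try solve [exact: B_alg | exact: B_sub | exact: B_mul
  | exact: B_val | exact: B_wV | exact: cB | exact: cM | exact: rmorph1 | exact: quadratic_involutive
  | exact: lrmorph_alg | exact: conj_integral | move=> i; exact: B_alg | move=> i; exact: lrmorph_alg].
- move=> x Bx /quadratic_fixed[a ea]; rewrite ea in Bx *.
  have [i hi] := rex _ (B_alg' Bx); exists i.
  by rewrite -scalerBl -divA; exact: B_alg.
- by move=> i j; rewrite -scalerBl -divA => /B_alg' /rinj.
Qed.

Lemma quadratic_unit_set a : unit_set A a -> unit_set B a%:A.
Proof.
move=> [a0 a1 a2]; split; [|exact: B_alg|].
  by rewrite scaler_eq0 negb_or a0 oner_neq0.
have -> : (a%:A)^-1 = (a^-1)%:A :> k'; last exact: B_alg.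
have a0' : a%:A != 0 :> k' by rewrite scaler_eq0 negb_or a0 oner_neq0.
by apply: (mulfI a0'); rewrite divff // -scalerAl mul1r scalerA divff // scale1r.
Qed.
End QuadraticPair.

Section PadicExtension.
Variables (R : realType) (p : nat) (Qp : fieldType) (absQp : Qp -> R).
Hypothesis hQp : is_padic_field p absQp.
Variables (k : fieldExtType Qp) (w : k).
Hypothesis hw : prime_element (ring_of_integers absQp k) w.
Let Z1 := Zp_one hQp.
Let ZB := Zp_sub hQp.
Let ZM := Zp_mul hQp.
Local Notation Ok := (ring_of_integers absQp k).
Let O1 : Ok 1.
Proof. by rewrite -(scale1r (1 : k)); exact: (integral_closure_alg _ Z1). Qed.
Let OB x y : Ok x -> Ok y -> Ok (x - y).
Proof. exact: (integral_closure_sub Z1 ZB ZM). Qed.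
Let OM x y : Ok x -> Ok y -> Ok (x * y).
Proof. exact: (integral_closure_mul Z1 ZB ZM). Qed.
Let wV : ~ Ok w^-1.
Proof. exact: (prime_not_inv Z1 ZB ZM hw). Qed.
Let Oval x : x != 0 -> exists j : int, unit_set Ok (x / w ^ j).
Proof.
exact: (dvr_closure_val Z1 ZB ZM (Zp_p hQp) (p_neq0 hQp) (Zp_pV hQp) (Zp_dvd hQp) (Zp_val hQp) hw).
Qed.

Lemma extension_char0 n : n.+1%:R != 0 :> k.
Proof.
by rewrite -scaler_nat scaler_eq0 negb_or oner_neq0 (padic_char0 hQp).
Qed.

Lemma padic_unramified_pair (k' : fieldExtType k) (c : {lrmorphism k' -> k'}) q :
  unramified_quadratic Ok w k' -> ~ (c =1 id) -> (residue_field Ok #= `I_q)%card ->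
  exists rho th, @unramified_pair k' (integral_closure Ok k') w%:A c q rho th.
Proof. move=> hk' hc hq; exact: quadratic_unramified_pair. Qed.

Lemma padic_valuation2 (k' : fieldExtType k) (c : {lrmorphism k' -> k'}) q rho th e :
  @unramified_pair k' (integral_closure Ok k') w%:A c q rho th ->
  valuation Ok w 2%:R = e -> valuation (integral_closure Ok k') w%:A 2%:R = e.
Proof.
move=> H he; have t0 : 2%:R != 0 :> k by exact: extension_char0.
have [j hj] := Oval t0.
have : unit_set Ok (2%:R / w ^ e).
  by rewrite -he /valuation; case: xgetP => [y _ //|/(_ j)].
move/(quadratic_unit_set O1 OB OM k').
have -> : (2%:R / w ^ e)%:A = 2%:R / w%:A ^ e :> k'.
  rewrite [LHS](fmorph_div (in_alg k')) /=; congr (_ / _).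
    exact: (rmorph_nat (in_alg k')).
  exact: (fmorphXz (in_alg k')).
move=> u; have u0 : 2%:R / w%:A ^ e != 0 :> k' by case: u.
have w0 : w%:A ^ e != 0 :> k' by rewrite expfz_neq0 // (up_w0 H).
by rewrite -(divfK w0 2%:R) (valM H) // (val_unit H) // (val_w H) add0r.
Qed.
End PadicExtension.

(** * Haar measure *)

Section SimpleApproximation.
Import measurable_realfun.
Variables (R : realType) (d : measure_display) (T : measurableType d).
Variables (mu : {measure set T -> \bar R}) (K : set T).
Hypothesis mK : measurable K.
Hypothesis muK : mu K = 1%E.

Let bounded_int (f : T -> R) (M : R) : measurable_fun K f -> (forall h, K h -> `|f h| <= M) ->
  mu.-integrable K (EFin \o f).
Proof.
move=> mf hM; apply: measurable_bounded_integrable => //; first by rewrite muK ltry.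
by exists M; split; rewrite ?num_real // => x Mx y Ky /=; apply: le_trans (ltW Mx); exact: hM.
Qed.

Lemma Rintegral_simple_approx (f : T -> R) (I : Type) (s : seq I) (b : I -> R) (E : I -> set T) (delta : R) :
  measurable_fun K f -> (forall i, measurable (E i)) -> (forall i, E i `<=` K) ->
  (forall h, K h -> `|f h - \sum_(i <- s) b i * \1_(E i) h| <= delta) ->
  `|Rintegral mu K f - \sum_(i <- s) b i * fine (mu (E i))| <= delta.
Proof.
move=> mf mE EK hd.
have ind i : measurable_fun K (fun h => b i * \1_(E i) h).
  by apply: measurable_funM; [exact: measurable_cst|exact: measurable_indic].
have ind_int i : mu.-integrable K (EFin \o (fun h => b i * \1_(E i) h)).
  apply: (bounded_int (M := `|b i|)) => // h _; rewrite normrM indicE.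
  by case: (h \in E i); rewrite ?normr1 ?normr0 ?mulr1 ?mulr0.
have one_int i : mu.-integrable K (EFin \o (\1_(E i) : T -> R)).
  apply: (bounded_int (M := 1)) => [|h _]; first exact: measurable_indic.
  by rewrite indicE; case: (h \in E i); rewrite ?normr1 ?normr0 ?ler01.
have [mg [ig eg]] : [/\ measurable_fun K (fun h => \sum_(i <- s) b i * \1_(E i) h),
    mu.-integrable K (EFin \o (fun h => \sum_(i <- s) b i * \1_(E i) h)) &
    Rintegral mu K (fun h => \sum_(i <- s) b i * \1_(E i) h) = \sum_(i <- s) b i * fine (mu (E i))].
  elim: (s) => [|i r [m1 i1 e1]].
    have -> : (fun h : T => \sum_(i <- [::]) b i * \1_(E i) h) = (fun=> 0) by apply: funext => h; rewrite big_nil.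
    rewrite big_nil; split; first exact: measurable_cst.
      by apply: (bounded_int (M := 0)) => [|h _]; [exact: measurable_cst|rewrite normr0].
    by rewrite Rintegral_cst // mul0r.
  have -> : (fun h : T => \sum_(j <- i :: r) b j * \1_(E j) h) =
      (fun h => b i * \1_(E i) h + \sum_(j <- r) b j * \1_(E j) h).
    by apply: funext => h; rewrite big_cons.
  rewrite big_cons; split; first exact: measurable_funD.
    by have := integrableD mK (ind_int i) i1; apply: eq_integrable => // h _; rewrite /= EFinD.
  rewrite RintegralD // e1 RintegralZl //; congr (_ * _ + _).
  by rewrite /Rintegral integral_indic // setIidl //; exact: EK.
set g := (fun h => \sum_(i <- s) b i * \1_(E i) h) in mg ig eg.
have mr : measurable_fun K (fun h => f h - g h) by exact: measurable_funB.
have ir : mu.-integrable K (EFin \o (fun h => f h - g h)) by apply: (bounded_int (M := delta)).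
have -> : Rintegral mu K f = Rintegral mu K (fun h => f h - g h) + Rintegral mu K g.
  rewrite -RintegralD //; apply: eq_Rintegral => h _; by rewrite subrK.
rewrite eg addrK; apply: le_trans (le_normr_Rintegral mK ir) _.
have := @Rintegral_cst _ _ _ mu K mK delta; rewrite muK /= mulr1 => <-.
apply: le_Rintegral => //.
  apply: (bounded_int (M := delta)) => [|h Kh]; last by rewrite normr_id; exact: hd.
  by apply: measurableT_comp => //; exact: normr_measurable.
by apply: (bounded_int (M := `|delta|)) => [|h Kh]; [exact: measurable_cst|].
Qed.
End SimpleApproximation.

(** * Continuity and measurability on the space of matrices *)

Section ContinuousEntries.
Variables (L : fieldType) (O : set L) (w : L) (c : {rmorphism L -> L}).
Variables (q : nat) (rho : 'I_q -> L) (th : L).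
Hypothesis H : unramified_pair O w c rho th.
Notation v := (valuation O w).
Notation vg := (vg O w).
Variable m : nat.
Local Notation T := (borel_mx O w m).

Definition continuous_mx (f : 'M[L]_m -> L) : Prop :=
  forall (h : 'M[L]_m) (M : nat), exists N : nat, forall h' : 'M[L]_m,
    (forall i j, vg N (h' i j - h i j)) -> vg M (f h' - f h).

Lemma vg_lower y : exists a : nat, vg (- a%:Z) y.
Proof.
have [->|y0] := eqVneq y 0; first by exists 0%N; exact: (vg_zero H).
by exists (absz (v y)); apply/(vgP H _ y0); lia.
Qed.

Lemma continuous_cst a : continuous_mx (fun=> a).
Proof. by move=> h M; exists 0%N => h' _; rewrite subrr; exact: (vg_zero H). Qed.
Lemma continuous_entry i j : continuous_mx (fun h => h i j).
Proof. by move=> h M; exists M. Qed.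
Lemma continuous_cj f : continuous_mx f -> continuous_mx (fun h => c (f h)).
Proof.
by move=> hf h M; have [N hN] := hf h M; exists N => h' /hN /(vg_c H); rewrite rmorphB.
Qed.
Lemma continuous_both f g (P : nat) (h : 'M[L]_m) : continuous_mx f -> continuous_mx g ->
  exists N : nat, forall h' : 'M[L]_m, (forall i j, vg N (h' i j - h i j)) ->
    vg P (f h' - f h) /\ vg P (g h' - g h).
Proof.
move=> hf hg; have [N hN] := hf h P; have [N' hN'] := hg h P; exists (maxn N N') => h' hh.
split; [apply: hN|apply: hN'] => i j; apply: (vg_le H) (hh i j); lia.
Qed.
Lemma continuousD f g : continuous_mx f -> continuous_mx g -> continuous_mx (fun h => f h + g h).
Proof.
move=> hf hg h M; have [N hN] := continuous_both M h hf hg; exists N => h' /hN[h1 h2].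
have -> : f h' + g h' - (f h + g h) = (f h' - f h) + (g h' - g h) by ring.
exact: (vgD H).
Qed.
Lemma continuousM f g : continuous_mx f -> continuous_mx g -> continuous_mx (fun h => f h * g h).
Proof.
move=> hf hg h M; have [a ha] := vg_lower (f h); have [b hb] := vg_lower (g h).
have [N hN] := continuous_both (M + a + b) h hf hg; exists N => h' /hN[h1 h2].
have -> : f h' * g h' - (f h * g h) = (f h' - f h) * (g h' - g h) + f h * (g h' - g h) + (f h' - f h) * g h by ring.
apply: (vgD H); [apply: (vgD H)|].
- by apply: (vg_le H) (vgM H h1 h2); lia.
- by apply: (vg_le H) (vgM H ha h2); lia.
- by apply: (vg_le H) (vgM H h1 hb); lia.
Qed.
Lemma continuous_sum (I : Type) (s : seq I) (P : pred I) (F : I -> 'M[L]_m -> L) :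
  (forall i, continuous_mx (F i)) -> continuous_mx (fun h => \sum_(i <- s | P i) F i h).
Proof.
move=> hF; elim: s => [|i s IH].
  by rewrite (_ : (fun _ => _) = (fun=> 0)); [exact: continuous_cst|apply: funext => h; rewrite big_nil].
rewrite (_ : (fun _ => _) = (fun h => (if P i then F i h else 0) + \sum_(j <- s | P j) F j h)).
  by apply: continuousD => //; case: (P i) => //; exact: continuous_cst.
by apply: funext => h; rewrite big_cons; case: (P i); rewrite ?add0r.
Qed.
Lemma continuous_prod (I : Type) (s : seq I) (F : I -> 'M[L]_m -> L) :
  (forall i, continuous_mx (F i)) -> continuous_mx (fun h => \prod_(i <- s) F i h).
Proof.
move=> hF; elim: s => [|i s IH].
  by rewrite (_ : (fun _ => _) = (fun=> 1)); [exact: continuous_cst|apply: funext => h; rewrite big_nil].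
rewrite (_ : (fun _ => _) = (fun h => F i h * \prod_(j <- s) F j h)); first exact: continuousM.
by apply: funext => h; rewrite big_cons.
Qed.
Lemma continuous_mulmx p r t (F : 'M[L]_m -> 'M[L]_(p, r)) (G : 'M[L]_m -> 'M[L]_(r, t)) :
  (forall i j, continuous_mx (fun h => F h i j)) -> (forall i j, continuous_mx (fun h => G h i j)) ->
  forall i j, continuous_mx (fun h => (F h *m G h) i j).
Proof.
move=> hF hG i j.
rewrite (_ : (fun _ => _) = (fun h => \sum_k F h i k * G h k j)); last by apply: funext => h; rewrite mxE.
by apply: continuous_sum => k; exact: continuousM.
Qed.
Lemma continuous_det p (F : 'M[L]_m -> 'M[L]_p) :
  (forall i j, continuous_mx (fun h => F h i j)) -> continuous_mx (fun h => \det (F h)).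
Proof.
move=> hF; apply: continuous_sum => s; apply: continuousM; first exact: continuous_cst.
exact: continuous_prod.
Qed.
Lemma continuous_conj_trmx i j : continuous_mx (fun h => conj_trmx c h i j).
Proof.
rewrite (_ : (fun _ => _) = (fun h : 'M[L]_m => c (h j i))); last by apply: funext => h; rewrite !mxE.
exact: continuous_cj (continuous_entry _ _).
Qed.
Lemma continuous_corner (x : 'M[L]_m) i : continuous_mx (fun h => corner_det (act_mx c h x) i).
Proof.
apply: continuous_det => a b.
rewrite (_ : (fun _ => _) = (fun h => act_mx c h x (corner_ord a) (corner_ord b))); last first.
  by apply: funext => h; rewrite mxE.
apply: continuous_mulmx => [k l|k l]; last exact: continuous_conj_trmx.
apply: continuous_mulmx => k' l'; [exact: continuous_entry|exact: continuous_cst].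
Qed.

Lemma vg_measurable f l : continuous_mx f -> measurable ([set h | vg l (f h)] : set T).
Proof.
move=> hf; apply: sub_sigma_algebra => h hl.
have [N hN] := hf h (absz l); exists N => h' hh.
rewrite /= -(subrK (f h) (f h')); apply: (vgD H) => //.
by apply: (vg_le H) (hN _ hh); lia.
Qed.
Lemma eq0_measurable f : continuous_mx f -> measurable ([set h | f h = 0] : set T).
Proof.
move=> hf; rewrite (_ : [set h | f h = 0] = \bigcap_(n in [set: nat]) [set h | vg n (f h)]).
  by apply: bigcapT_measurable => n; exact: vg_measurable.
apply/seteqP; split=> h /=; first by move=> e n _; rewrite /= e; exact: (vg_zero H).
by move=> hh; apply: (vg_all H) => n; exact: hh.
Qed.

(** A countable set of values, with [None] for 0. The integrand factors through these data, and its
    measurability reduces to that of the fibres. *)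
Definition opt_val (y : L) : option int := if y == 0 then None else Some (v y).

Lemma opt_val_measurable f t : continuous_mx f -> measurable ([set h | opt_val (f h) = t] : set T).
Proof.
move=> hf; case: t => [l|].
  rewrite (_ : mkset _ = [set h | vg l (f h)] `\` [set h | vg (l + 1) (f h)]).
    by apply: measurableD; exact: vg_measurable.
  apply/seteqP; split=> h /=; rewrite /opt_val; have [->|f0] := eqVneq (f h) 0 => //.
  - by move=> [<-]; split; [apply/(vgP H _ f0)|move/(vgP H _ f0); lia].
  - by move=> [_ []]; exact: (vg_zero H).
  - by move=> [h1 h2]; rewrite (val_unique H f0 h1 h2).
rewrite (_ : mkset _ = [set h | f h = 0]); first exact: eq0_measurable.
apply/seteqP; split=> h /=; rewrite /opt_val; first by case: eqVneq.
by move=> ->; rewrite eqxx.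
Qed.

Lemma max_compact_measurable : measurable (max_compact O c m : set T).
Proof.
pose U := \bigcap_(t in [set: 'I_m * 'I_m]) [set h : 'M[L]_m | vg 0 (h t.1 t.2)].
pose V := \bigcap_(t in [set: 'I_m * 'I_m])
  [set h : 'M[L]_m | (conj_trmx c h *m antidiag L m *m h) t.1 t.2 - antidiag L m t.1 t.2 = 0].
rewrite (_ : max_compact O c m = U `&` V).
  apply: measurableI; apply: fin_bigcap_measurable => // t _.
    by apply: vg_measurable; exact: continuous_entry.
  apply: eq0_measurable; apply: continuousD; last exact: continuous_cst.
  apply: continuous_mulmx => [k l|k l]; last exact: continuous_entry.
  apply: continuous_mulmx => k' l'; [exact: continuous_conj_trmx|exact: continuous_cst].
apply/seteqP; split=> h /=.
  move=> [[_ e] hO]; split=> t _ /=; first by apply/vgE0.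
  by rewrite e subrr.
move=> [hU hV].
have e : conj_trmx c h *m antidiag L m *m h = antidiag L m.
  by apply/matrixP => i j; apply/subr0_eq/(hV (i, j)).
split; last by move=> i j; apply/(vgE0 (w := w))/(hU (i, j)).
split=> //; rewrite unitmxE unitfE; apply/eqP => d0.
have := congr1 determinant e; rewrite !det_mulmx d0 mulr0.
have := congr1 determinant (antidiag_sq L m); rewrite det_mulmx det1 => e1 e2.
by move: e1; rewrite -e2 mul0r => /eqP; rewrite eq_sym oner_eq0.
Qed.

Lemma opt_val_fiber (I : finType) (f : I -> 'M[L]_m -> L) (t : {ffun I -> option int}) :
  (forall i, continuous_mx (f i)) -> measurable ([set h | [ffun i => opt_val (f i h)] = t] : set T).
Proof.
move=> hf; rewrite (_ : mkset _ = \bigcap_(i in [set: I]) [set h | opt_val (f i h) = t i]).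
  by apply: fin_bigcap_measurable => // i _; exact: opt_val_measurable.
apply/seteqP; split=> h /=; first by move=> <- i _; rewrite /= ffunE.
by move=> hh; apply/ffunP => i; rewrite ffunE; exact: hh.
Qed.

Lemma opt_val_fun_measurable (R : realType) (I : finType) (f : I -> 'M[L]_m -> L)
    (F : {ffun I -> option int} -> R) (D : set T) :
  (forall i, continuous_mx (f i)) ->
  measurable_fun D ((fun h : 'M[L]_m => F [ffun i => opt_val (f i h)]) : T -> R).
Proof.
move=> hf mD Y _; apply: measurableI => //.
rewrite (_ : _ @^-1` _ = \bigcup_(k in [set: nat]) [set h : 'M[L]_m |
    if (unpickle k : option {ffun I -> option int}) is Some t
    then [ffun i => opt_val (f i h)] = t /\ Y (F t) else False]).
  apply: bigcup_measurable => k _; case: (unpickle k) => [t|]; last exact: measurable0.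
  have [y|ny] := pselect (Y (F t)).
    by rewrite (_ : mkset _ = [set h | [ffun i => opt_val (f i h)] = t]);
      [exact: opt_val_fiber|apply/seteqP; split=> h //= -[]].
  by rewrite (_ : mkset _ = set0); [exact: measurable0|apply/seteqP; split=> h //= -[]].
apply/seteqP; split=> h /=.
  by move=> hh; exists (pickle [ffun i => opt_val (f i h)]) => //; rewrite pickleK.
by move=> [k _]; case: (unpickle k) => //= t [-> ].
Qed.
End ContinuousEntries.

(** * Complex powers *)

Section ComplexExponential.
Variable R : realType.
Implicit Types (s t z : R[i]).

Lemma complex_ext s t : complex.Re s = complex.Re t -> complex.Im s = complex.Im t -> s = t.
Proof. by case: s => a b; case: t => a' b' /= -> ->. Qed.

Lemma cexpD s t : cexp (s + t) = cexp s * cexp t.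
Proof.
case: s => a b; case: t => a' b'; rewrite /cexp.
have -> : complex.Re ((a +i* b) + (a' +i* b')) = a + a' by [].
have -> : complex.Im ((a +i* b) + (a' +i* b')) = b + b' by [].
rewrite expRD cosD sinD; apply: complex_ext => /=; ring.
Qed.

Lemma cexp0 : cexp (0 : R[i]) = 1.
Proof. by rewrite /cexp /= expR0 cos0 sin0 !mul1r. Qed.

Lemma cexp_neq0 s : cexp s != 0.
Proof.
apply/eqP => e; have := cexpD s (- s); rewrite subrr cexp0 e mul0r => /eqP.
by rewrite oner_eq0.
Qed.

Lemma cexpN s : cexp (- s) = (cexp s)^-1.
Proof. by apply: (mulIf (cexp_neq0 s)); rewrite -cexpD addNr cexp0 mulVf // cexp_neq0. Qed.

Lemma cexpMn s n : cexp (n%:R * s) = cexp s ^+ n.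
Proof.
elim: n => [|n IH]; first by rewrite mul0r cexp0 expr0.
by rewrite -natr1 mulrDl mul1r cexpD IH exprSr.
Qed.

Lemma cexpMz s (j : int) : cexp (j%:~R * s) = cexp s ^ j.
Proof.
case: j => n; first exact: cexpMn.
by rewrite NegzE mulrNz mulNr cexpN -exprnN; congr (_ ^-1); exact: cexpMn.
Qed.

Lemma norm_cexp s : `|cexp s| = (expR (complex.Re s))%:C.
Proof.
rewrite normc_def /=; congr (_%:C); rewrite !exprMn -mulrDr cos2Dsin2 mulr1 sqrtr_sqr.
by rewrite ger0_norm // expR_ge0.
Qed.

Variable q : nat.
Hypothesis q1 : (1 < q)%N.
Let lnq : 0 < ln (q%:R : R). Proof. by rewrite ln_gt0 // ltr1n. Qed.

Lemma cpowD (a : R) s t : cpow a (s + t) = cpow a s * cpow a t.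
Proof. by rewrite /cpow mulrDr cexpD. Qed.
Lemma cpowN (a : R) s : cpow a (- s) = (cpow a s)^-1.
Proof. by rewrite /cpow mulrN cexpN. Qed.
Lemma cpow0 (a : R) : cpow a 0 = 1.
Proof. by rewrite /cpow mulr0 cexp0. Qed.
Lemma cpowMz (a : R) s (j : int) : cpow a (j%:~R * s) = cpow a s ^ j.
Proof. by rewrite /cpow -cexpMz; congr cexp; rewrite mulrCA. Qed.
Lemma cpow_neq0 (a : R) s : cpow a s != 0.
Proof. exact: cexp_neq0. Qed.
Lemma cpow_sum (a : R) (I : Type) (r : seq I) (P : pred I) (F : I -> R[i]) :
  cpow a (\sum_(i <- r | P i) F i) = \prod_(i <- r | P i) cpow a (F i).
Proof. by elim/big_rec2: _ => [|i y1 y2 _ <-]; rewrite ?cpow0 ?cpowD. Qed.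

Lemma cpow_real (j : int) : cpow (q%:R : R) j%:~R = (q%:R : R[i]) ^ j.
Proof.
rewrite -[j%:~R]mulr1 cpowMz; congr (_ ^ j).
rewrite /cpow mulr1 /cexp /= sin0 cos0 mulr0 mulr1 lnK ?posrE ?ltr0n; last lia.
by rewrite -[RHS](rmorph_nat (real_complex R)).
Qed.

Lemma cpow_exprz s (j : int) : cpow ((q%:R : R) ^ j) s = cpow q%:R s ^ j.
Proof.
have qp : 0 < q%:R :> R by rewrite ltr0n; lia.
have e : ln ((q%:R : R) ^ j) = j%:~R * ln q%:R.
  case: j => n; first by rewrite -exprnP lnXn // mulr_natl.
  rewrite NegzE -exprnN lnV ?posrE ?exprn_gt0 // lnXn // mulrNz mulNr; congr (- _).
  by rewrite -[LHS]mulr_natl.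
have eC : ((j%:~R * ln q%:R)%:C : R[i]) = j%:~R * (ln q%:R)%:C.
  by rewrite (rmorphM (real_complex R)) (rmorph_int (real_complex R)).
by rewrite /cpow e eC -mulrA cexpMz.
Qed.

Lemma cpow_surj z : z != 0 -> exists s, cpow (q%:R : R) s = z.
Proof.
case: z => a b z0; pose r := Num.sqrt (a ^+ 2 + b ^+ 2).
have ab0 : 0 < a ^+ 2 + b ^+ 2.
  rewrite lt_neqAle addr_ge0 ?sqr_ge0 // andbT eq_sym paddr_eq0 ?sqr_ge0 // !sqrf_eq0.
  by move: z0; rewrite eq_complex.
have r0 : 0 < r by rewrite sqrtr_gt0.
have rr : r ^+ 2 = a ^+ 2 + b ^+ 2 by rewrite sqr_sqrtr // ltW.
pose u := a / r; pose t := b / r.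
have ut : u ^+ 2 + t ^+ 2 = 1.
  rewrite /u /t !exprMn !exprVn -mulrDl -rr divff // expf_neq0 // lt0r_neq0 //.
have u1 : -1 <= u <= 1 by have := sqr_ge0 t; nra.
have [y [cy sy]] : exists y, cos y = u /\ sin y = t.
  have tE : Num.sqrt (1 - u ^+ 2) = `|t| by rewrite -ut addrC addKr sqrtr_sqr.
  have sE : sin (acos u) = `|t| by rewrite sin_acos.
  case: (lerP 0 t) => ht.
    by exists (acos u); rewrite sE ger0_norm // acosK.
  by exists (- acos u); rewrite cosN sinN sE ltr0_norm // opprK acosK.
exists ((ln r / ln q%:R) +i* (y / ln q%:R)).
have l0 := lt0r_neq0 lnq.
rewrite /cpow; have -> : (ln q%:R)%:C * ((ln r / ln q%:R) +i* (y / ln q%:R)) = ln r +i* y.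
  by apply: complex_ext => /=; field.
rewrite /cexp /= cy sy lnK ?posrE // /u /t.
by congr (_ +i* _); field; rewrite lt0r_neq0.
Qed.

Lemma cpow_ge1 s : 1 <= `|cpow (q%:R : R) s| -> 0 <= complex.Re s.
Proof.
rewrite /cpow norm_cexp => h.
have : (1 : R) <= expR (complex.Re ((ln q%:R)%:C * s)) by rewrite -lecR.
have -> : complex.Re ((ln q%:R)%:C * s) = ln q%:R * complex.Re s by case: s {h} => a b /=; ring.
by rewrite -[X in X <= _ -> _]expR0 ler_expR (pmulr_rge0 _ lnq).
Qed.
End ComplexExponential.

(** * The masses of the level sets of the minors *)

Section HaarOrbits.
Variables (R : realType) (L : fieldType) (O : set L) (w : L) (c : {rmorphism L -> L}).
Variables (q : nat) (rho : 'I_q -> L) (th : L).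
Hypothesis H : unramified_pair O w c rho th.
Notation v := (valuation O w).
Notation vg := (vg O w).
Variable m : nat.
Local Notation T := (borel_mx O w m).
Local Notation K := (max_compact O c m).
Variable mu : {measure set T -> \bar R}.
Hypothesis hmu : is_haar K mu.
Variable x : 'M[L]_m.
Local Notation n := m./2.
Local Notation D h i := (corner_det (act_mx c h x) i).
Local Notation ov := (opt_val O w).

Let mK : measurable (K : set T). Proof. exact: (max_compact_measurable H). Qed.
Let muK : mu K = 1%E. Proof. by case: hmu. Qed.

Lemma corner_det_scale a (y : 'M[L]_m) (i : 'I_n) : corner_det (a *: y) i = a ^+ i.+1 * corner_det y i.
Proof.
rewrite /corner_det -detZ; congr (\det _); by apply/matrixP => k l; rewrite !mxE.
Qed.

(** K consists of integral matrices, so one power of w clears the denominators of all minors on the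
    orbit. This B shifts all valuations into N. *)
Lemma corner_lower : exists B : nat, forall h (i : 'I_n), K h -> vg (- B%:Z) (D h i).
Proof.
have hx (t : 'I_m * 'I_m) : exists a : nat, vg (- a%:Z) (x t.1 t.2) by exact: (vg_lower H).
have [f hf] := choice hx.
pose b := (\sum_t f t)%N; have w0 := up_w0 H.
have hb i j : O (w ^+ b * x i j).
  have le : (f (i, j) <= b)%N by rewrite /b (bigD1 (i, j)) //= leq_addr.
  have := vg_le H (_ : - b%:Z <= - (f (i, j))%:Z) (hf (i, j)).
  rewrite lerN2 lez_nat le => /(_ isT) /(vgM H ((vg_wexp H b%:Z b%:Z).2 (lexx _))).
  by rewrite subrr => /vgE0.
exists (b * m)%N => h i [_ hO].
have : O (corner_det (w ^+ b *: act_mx c h x) i).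
  apply: (O_det H) => k l; rewrite mxE.
  have -> : w ^+ b *: act_mx c h x = h *m (w ^+ b *: x) *m cjm c h.
    by rewrite /act_mx cjmE -scalemxAr -scalemxAl.
  apply: (integral_mulmx H) => [|?]; last exact: (integral_cjm H).
  by apply: (integral_mulmx H) => [//|k' l']; rewrite mxE.
rewrite corner_det_scale -exprM => hO'.
have im : (b * i.+1 <= b * m)%N by rewrite leq_mul2l half_ord_lt orbT.
have -> : D h i = w ^ (- (b * i.+1)%:Z) * (w ^+ (b * i.+1) * D h i).
  by rewrite mulrA -exprnN mulVf ?mul1r // expf_neq0.
rewrite -[- _]addr0; apply: (vgM H); last exact/vgE0.
by apply/(vg_wexp H); rewrite lerN2 lez_nat.
Qed.

Variable B : nat.
Hypothesis hB : forall h (i : 'I_n), K h -> vg (- B%:Z) (D h i).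

Definition shift_val (k : nat) : option int := Some (k%:Z - B%:Z).
Definition cell (kap : {ffun 'I_n -> nat}) : set T :=
  [set h | K h /\ forall i, ov (D h i) = shift_val (kap i)].
Definition mass (kap : {ffun 'I_n -> nat}) : R := fine (mu (cell kap)).
Definition upd (kap : {ffun 'I_n -> nat}) (i : 'I_n) (l : nat) : {ffun 'I_n -> nat} :=
  [ffun j => if j == i then l else kap j].

Lemma continuous_corner_mul (g : 'M[L]_m) i :
  continuous_mx O w (fun h => corner_det (act_mx c (g *m h) x) i).
Proof.
rewrite (_ : (fun _ => _) = (fun h : 'M[L]_m => corner_det (act_mx c g (act_mx c h x)) i)); last first.
  by apply: funext => h; rewrite act_mxM.
apply: (continuous_det H) => a b.
rewrite (_ : (fun _ => _) = (fun h => (g *m (h *m x *m conj_trmx c h) *m conj_trmx c g)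
    (corner_ord a) (corner_ord b))); last by apply: funext => h; rewrite mxE.
apply: (continuous_mulmx H) => [k l|k l]; last exact: (continuous_cst H).
apply: (continuous_mulmx H) => [k' l'|k' l']; first exact: (continuous_cst H).
apply: (continuous_mulmx H) => [k2 l2|k2 l2]; last exact: (continuous_conj_trmx H).
by apply: (continuous_mulmx H) => k3 l3; [exact: continuous_entry|exact: (continuous_cst H)].
Qed.

Lemma partial_cell_measurable (g : 'M[L]_m) (kap : {ffun 'I_n -> nat}) (P : pred 'I_n) :
  measurable ([set h | K h /\ forall j, P j ->
    ov (corner_det (act_mx c (g *m h) x) j) = shift_val (kap j)] : set T).
Proof.
rewrite (_ : mkset _ = K `&` \bigcap_(j in [set j | P j])
    [set h | ov (corner_det (act_mx c (g *m h) x) j) = shift_val (kap j)]).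
  apply: measurableI => //; apply: fin_bigcap_measurable => // j _.
  exact: (opt_val_measurable H _ (continuous_corner_mul _ _)).
by apply/seteqP; split=> h [Kh hh]; split.
Qed.

Lemma cell_measurable kap : measurable (cell kap).
Proof.
have := partial_cell_measurable 1%:M kap predT; congr (measurable _).
by apply/seteqP; split=> h [Kh hh]; split=> // i; rewrite -?(hh i) ?mul1mx // -{1}[h]mul1mx hh.
Qed.

Let mu_fin (A : set T) : measurable A -> A `<=` K -> (mu A < +oo)%E.
Proof.
move=> mA AK; have : (mu A <= mu K)%E by apply: le_measure; rewrite ?inE.
by rewrite muK => /le_lt_trans; apply; rewrite ltry.
Qed.

Section Transfer.
Variables (i : 'I_n) (kap : {ffun 'I_n -> nat}) (S : finType) (h : S -> 'M[L]_m).
Hypothesis S0 : inhabited S.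
Hypothesis hK : forall s, K (h s).
Hypothesis hpres : forall k, K k -> (forall j, j != i -> D k j != 0) ->
  forall s j, j != i -> D (h s *m k) j != 0 /\ v (D (h s *m k) j) = v (D k j).

Let ovE y l : ov y = shift_val l <-> y != 0 /\ v y = l%:Z - B%:Z.
Proof.
rewrite /opt_val /shift_val; case: eqP => _; first by split=> [//|[]//].
by split=> [[->]//|[_ ->]].
Qed.

Let Om (g : 'M[L]_m) : set T :=
  [set k | K k /\ forall j, j != i -> ov (corner_det (act_mx c (g *m k) x) j) = shift_val (kap j)].
Let mOm g : measurable (Om g). Proof. exact: partial_cell_measurable. Qed.
Let F s l : set T := Om 1%:M `&` [set k | ov (D (h s *m k) i) = shift_val l].
Let mF s l : measurable (F s l).
Proof. by apply: measurableI => //; exact: (opt_val_measurable H _ (continuous_corner_mul _ _)). Qed.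
Let OmF s k : Om 1%:M k -> Om (h s) k.
Proof.
move=> [Kk hk]; split=> // j ji; apply/ovE.
have hk' j' : j' != i -> D k j' != 0 /\ v (D k j') = (kap j')%:Z - B%:Z.
  by move=> ji'; apply/ovE; have := hk _ ji'; rewrite mul1mx.
have [d0 dv] := hpres Kk (fun j' e => (hk' j' e).1) s ji.
by split=> //; rewrite dv (hk' _ ji).2.
Qed.

(** [Om 1] is the set where the minors other than the i-th have the prescribed valuations.
    Translation by h_s maps it into itself and preserves its finite measure, so the image fills it
    up to a null set; hence the translate of [F s l] is the whole cell up to a null set. *)
Let transl s l : mu (F s l) = mu (cell (upd kap i l)).
Proof.
have [_ _ inv] := hmu.
have [g Kg [gh hg]] := max_compact_inv H (hK s).
have KM a b : K a -> K b -> K (a *m b) := @max_compact_mul _ _ _ _ _ _ _ H m a b.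
have eOm : [set h s *m k | k in Om 1%:M] = Om g.
  apply/seteqP; split=> [_ [k [Kk hk] <-]|k [Kk hk]].
    by split; [exact: KM|move=> j ji; rewrite mulmxA gh; exact: hk].
  exists (g *m k); last by rewrite mulmxA hg mul1mx.
  by split; [exact: KM|move=> j ji; rewrite mul1mx; exact: hk].
set E := cell _.
have eF : [set h s *m k | k in F s l] = E `&` Om g.
  apply/seteqP; split=> [_ [k [Ok ek] <-]|k [[Kk ek] Ok]].
    have [Kk hk] := Ok; split; last by rewrite -eOm; exists k.
    split; first exact: KM.
    move=> j; rewrite ffunE; case: eqP => [->//|/eqP ji].
    by have [_ ->] := OmF s Ok.
  exists (g *m k); last by rewrite mulmxA hg mul1mx.
  move: Ok; rewrite -eOm => -[k' Ok' ek']; split.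
    by rewrite -ek' mulmxA gh mul1mx.
  by have := ek i; rewrite /= mulmxA hg mul1mx ffunE eqxx.
have m1 : mu (Om g) = mu (Om 1%:M) by rewrite -eOm; exact: inv.
have gO : Om g `<=` Om 1%:M.
  rewrite -eOm => _ [k Ok <-]; have [Kk hk] := OmF s Ok.
  by split; [exact: KM|move=> j ji; rewrite mul1mx; exact: hk].
have EO : E `<=` Om 1%:M.
  move=> k [Kk ek]; split=> // j ji; rewrite mul1mx ek ffunE (negPf ji) //.
have OK g' : Om g' `<=` K by move=> k [].
have mE : measurable E := cell_measurable _.
have d0 : mu (Om 1%:M `\` Om g) = 0%E.
  have eI : Om 1%:M `&` Om g = Om g by apply/seteqP; split=> k; [case|move=> Ok; split=> //; exact: gO].
  have -> : mu (Om 1%:M `\` Om g) = (mu (Om 1%:M) - mu (Om g))%E.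
    by rewrite -[in RHS]eI; apply: measureD => //; exact: mu_fin.
  rewrite m1 subee // ge0_fin_numE //; exact: mu_fin.
have e0 : mu (E `\` Om g) = 0%E.
  apply/eqP; rewrite eq_le measure_ge0 andbT -d0; apply: le_measure; rewrite ?inE.
  - exact: measurableD.
  - exact: measurableD.
  - exact: setSD.
have dE : mu E = (mu (E `\` Om g) + mu (E `&` Om g))%E by exact: (measureDI mu mE (mOm g)).
by rewrite -(inv (h s)) // eF dE e0 add0e.
Qed.

(** Averaging over the h_s: a linear relation that holds for the local counts at every k with the
    prescribed other minors holds for the masses. This expresses that the masses lie in the span of
    the local count sequences, without any knowledge of how often each of these occurs. *)
Lemma mass_transfer (W : nat) (a : nat -> R) :
  (forall k, K k -> (forall j, j != i -> ov (D k j) = shift_val (kap j)) ->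
    \sum_(l < W) a l * loc_count O w R (fun s => D (h s *m k) i) B l = 0) ->
  \sum_(l < W) a l * mass (upd kap i l) = 0.
Proof.
move=> ha.
have key : `|Rintegral mu K (fun=> 0) - \sum_(t : S * 'I_W) a t.2 * fine (mu (F t.1 t.2))| <= 0.
  apply: (@Rintegral_simple_approx _ _ _ mu K mK muK (fun=> 0) _ (index_enum (S * 'I_W)%type) (fun t => a t.2)
    (fun t => F t.1 t.2) 0).
  - exact: measurable_cst.
  - by move=> t; exact: mF.
  - by move=> t k [[]].
  move=> k Kk; rewrite sub0r normrN.
  have [Ok|nO] := pselect (Om 1%:M k); last first.
    rewrite big1 ?normr0 // => t _; rewrite indicE memNset ?mulr0 //; by case.
  have <- : \sum_(l < W) a l * loc_count O w R (fun s => D (h s *m k) i) B l =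
      \sum_(t : S * 'I_W) a t.2 * \1_(F t.1 t.2) k.
    rewrite -(pair_big predT predT (fun s (l : 'I_W) => a l * \1_(F s l) k)) exchange_big /=.
    apply: eq_bigr => l _; rewrite -big_distrr /=; congr (_ * _).
    rewrite /loc_count /cnt !natr_sum -sumrB; apply: eq_bigr => s _.
    have Ks : K (h s *m k) by apply: (max_compact_mul H).
    rewrite indicE; set y := D (h s *m k) i.
    have -> : (k \in F s l) = `[< ov y = shift_val l >].
      by apply/idP/asboolP => [|e]; rewrite inE; [case|split].
    case: (asboolP (ov y = _)) => [/ovE[y0 vy]|ny].
      rewrite asboolT; last by apply/(vgP H); rewrite ?vy.
      by rewrite asboolF ?subr0 // => /(vgP H _ y0); rewrite vy; lia.
    (* A vanishing value is counted at both levels, so it cancels in the difference. *)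
    have [y0|y0] := eqVneq y 0.
      by rewrite y0 !asboolT ?subrr //; exact: (vg_zero H).
    case: (asboolP (vg (l.+1%:Z - B%:Z) y)) => h1.
      by rewrite asboolT ?subrr //; apply: (vg_le H) h1; lia.
    rewrite asboolF ?subrr // => h2; apply: ny; apply/ovE; split=> //.
    by apply: (val_unique H) => // h3; apply: h1; apply: (vg_le H) h3; lia.
  by rewrite ha ?normr0 // => j ji; have [_ /(_ j ji)] := Ok; rewrite mul1mx.
move: key; rewrite Rintegral_cst // mul0r sub0r normrN normr_le0.
rewrite -(pair_big predT predT (fun s (l : 'I_W) => a l * fine (mu (F s l)))) /=.
under eq_bigr => s _ do under eq_bigr => l _ do rewrite transl.
rewrite sumr_const -mulr_natr mulf_eq0 pnatr_eq0 => /orP[/eqP//|/eqP e0].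
by case: S0 => s; have := cardT S => _; have /card0_eq/(_ s) : #|S| = 0%N by [].
Qed.
End Transfer.

Definition monomial (T : 'I_n -> R[i]) (kap : {ffun 'I_n -> nat}) : R[i] :=
  \prod_i T i ^ ((kap i)%:Z - B%:Z).

(** The integrand is constant on each cell, with value a monomial in the q^(-s_i), and K has mass 1.
    The factor 2 in the error comes from bounding real and imaginary parts separately. *)
Lemma omega_approx (s : 'rV[R[i]]_n) (X : seq {ffun 'I_n -> nat}) (delta : R) : uniq X -> 0 <= delta ->
  (forall kap, kap \notin X -> `|monomial (fun i => (cpow q%:R (s 0 i))^-1) kap| <= delta%:C) ->
  `|omega_integral c q mu x s -
     \sum_(kap <- X) (mass kap)%:C * monomial (fun i => (cpow q%:R (s 0 i))^-1) kap| <= (delta + delta)%:C.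
Proof.
move=> uX d0 hX; set t := fun i => _ in hX *.
have q1 := q_gt1 H.
pose Fc (o : {ffun 'I_n -> option int}) : R[i] :=
  if [forall i, o i != None] then \prod_i t i ^ (if o i is Some l then l else 0) else 0.
have intE h : omega_integrand O w q (act_mx c h x) s = Fc [ffun i => ov (D h i)].
  rewrite /omega_integrand /Fc.
  have -> : [forall i, corner_det (act_mx c h x) i != 0] =
      [forall i, [ffun i => ov (D h i)] i != None].
    by apply: eq_forallb => i; rewrite ffunE /opt_val; case: eqP.
  case: ifP => // /forallP hh; apply: eq_bigr => i _.
  move: (hh i); rewrite !ffunE /opt_val /nabs; have [//|d _] := eqVneq (corner_det (act_mx c h x) i) 0.
  by rewrite cpow_exprz // /t exprz_inv.
have bound h : K h -> `|omega_integrand O w q (act_mx c h x) s -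
    \sum_(kap <- X) monomial t kap * (\1_(cell kap) h)%:C| <= delta%:C.
  move=> Kh; have [hh|nh] := boolP [forall i, corner_det (act_mx c h x) i != 0]; last first.
    rewrite /omega_integrand (negPf nh) big1_seq ?subrr ?normr0 ?ler0c // => kap _.
    rewrite indicE memNset ?mulr0 // => -[_ hc]; move: nh; rewrite negb_forall => /existsP [j].
    by rewrite negbK => /eqP e; have := hc j; rewrite e /opt_val eqxx.
  pose kap : {ffun 'I_n -> nat} := [ffun i => absz (v (D h i) + B%:Z)].
  have kapE i : ov (D h i) = shift_val (kap i).
    have /forallP/(_ i) d := hh; rewrite /opt_val (negPf d) /shift_val ffunE; congr Some.
    by have /(vgP H _ d) := hB i Kh; lia.
  have cellE kap' : (h \in cell kap') = (kap' == kap).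
    apply/idP/eqP => [|->]; rewrite inE; last by split.
    by move=> [_ hc]; apply/ffunP => i; have := hc i; rewrite kapE => -[] /addIr [->].
  have eI : omega_integrand O w q (act_mx c h x) s = monomial t kap.
    rewrite intE /Fc; case: ifP => [_|/negP[]]; last by apply/forallP => i; rewrite ffunE kapE.
    by apply: eq_bigr => i _; rewrite ffunE kapE.
  rewrite eI; have [kX|kX] := boolP (kap \in X).
    rewrite (bigD1_seq kap) //= indicE cellE eqxx mulr1 big1 ?addr0 ?subrr ?normr0 ?ler0c // => k' nk.
    by rewrite indicE cellE (negPf nk) mulr0.
  rewrite big1_seq ?subr0; first exact: hX.
  move=> k' /andP[_ k'X]; rewrite indicE cellE; case: eqP => [e|_]; last by rewrite mulr0.
  by move: kX; rewrite -e k'X.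
have part (p : R[i] -> R) : p 0 = 0 -> (forall z z', p (z + z') = p z + p z') ->
    (forall z z', p (z - z') = p z - p z') -> (forall z, `|p z|%:C <= `|z|) -> (forall z (r : R), p (z * r%:C) = p z * r) ->
  `|Rintegral mu K (fun h => p (omega_integrand O w q (act_mx c h x) s)) -
    p (\sum_(kap <- X) (mass kap)%:C * monomial t kap)| <= delta.
  move=> p0 pD pB pn pr.
  rewrite (big_morph p pD p0); under eq_bigr => kap _ do rewrite mulrC pr.
  apply: (Rintegral_simple_approx mK muK (E := cell) (b := fun kap => p (monomial t kap))).
  - under eq_fun => h do rewrite intE.
    exact: (opt_val_fun_measurable H (fun o => p (Fc o)) (continuous_corner H x)).
  - exact: cell_measurable.
  - by move=> kap h [].
  move=> h Kh.
  have -> : p (omega_integrand O w q (act_mx c h x) s) - \sum_(kap <- X) p (monomial t kap) * \1_(cell kap) h =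
      p (omega_integrand O w q (act_mx c h x) s - \sum_(kap <- X) monomial t kap * (\1_(cell kap) h)%:C).
    rewrite pB; congr (_ - _); rewrite (big_morph p pD p0); by apply: eq_bigr => kap _; rewrite pr.
  by rewrite -lecR; apply: le_trans (pn _) (bound h Kh).
have nrm (z : R[i]) (r : R) : `|complex.Re z| <= r -> `|complex.Im z| <= r -> `|z| <= (r + r)%:C.
  move=> h1 h2; rewrite {1}[z]complexE; apply: le_trans (ler_normD _ _) _.
  have nC (y : R) : `|y%:C| = `|y|%:C by rewrite normc_def /= expr0n addr0 sqrtr_sqr.
  have nI : `|'i%C| = 1 :> R[i] by rewrite normc_def /= expr0n expr1n add0r sqrtr1.
  by rewrite normrM nI mul1r !nC -rmorphD lecR lerD.
rewrite /omega_integral /cintegral; apply: nrm.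
  have -> (z z' : R[i]) : complex.Re (z - z') = complex.Re z - complex.Re z' by case: z; case: z'.
  apply: part => [|[? ?] [? ?]|[? ?] [? ?]|z|[a b] r] //=; first exact: normc_ge_Re.
  by ring.
have -> (z z' : R[i]) : complex.Im (z - z') = complex.Im z - complex.Im z' by case: z; case: z'.
apply: part => [|[? ?] [? ?]|[? ?] [? ?]|[a b]|[a b] r] //=; last by ring.
by rewrite normc_def lecR /= -sqrtr_sqr ler_wsqrtr // lerDr sqr_ge0.
Qed.
End HaarOrbits.

(** * Functional equations on a span of sequences *)

Section MassRecursion.
Variables (F : fieldType) (C : nat -> F) (Phi : (nat -> F) -> {poly F} -> Prop) (m N0 : nat) (d : F).
Hypothesis Phi_ser : forall phi G, Phi phi G -> ser m d phi G.
Hypothesis Phi_size : forall phi G, Phi phi G -> (size G <= N0)%N.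
Hypothesis Phi_span : forall W (a : nat -> F),
  (forall phi G, Phi phi G -> \sum_(l < W) a l * phi l = 0) -> \sum_(l < W) a l * C l = 0.

Let sum_shift (G : nat -> F) W : \sum_(m <= l < W) G l = \sum_(0 <= l < W - m) G (l + m)%N.
Proof. by rewrite -{1}[m]add0n big_addn. Qed.

Let shift_sum (phi : nat -> F) (b : nat -> F) W :
  \sum_(l < W) (b l - d * (if (l + m < W)%N then b (l + m)%N else 0)) * phi l =
  \sum_(l < W) b l * (phi l - d * (if (m <= l)%N then phi (l - m)%N else 0)).
Proof.
under eq_bigr => l _ do rewrite mulrBl.
under [RHS]eq_bigr => l _ do rewrite mulrBr.
rewrite !big_split /= !sumrN; congr (_ - _).
rewrite -(big_mkord predT (fun l => d * (if (l + m < W)%N then b (l + m)%N else 0) * phi l)).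
rewrite -(big_mkord predT (fun l => b l * (d * (if (m <= l)%N then phi (l - m)%N else 0)))).
have [Wm|mW] := leqP W m.
  rewrite !big_nat !big1 // => l /andP[_ hl].
    by rewrite ifN ?mulr0 // -ltnNge; lia.
  by rewrite ifN ?mulr0 ?mul0r // -leqNgt; lia.
rewrite [RHS](big_cat_nat (n := m)) //=; last exact: ltnW.
have z1 : \sum_(0 <= l < m) b l * (d * (if (m <= l)%N then phi (l - m)%N else 0)) = 0.
  by rewrite big_nat big1 // => l /andP[_ hl]; rewrite ifN ?mulr0 // -ltnNge.
rewrite z1 add0r.
rewrite (big_cat_nat (n := (W - m)%N)) //=; last exact: leq_subr.
have z2 : \sum_(W - m <= l < W) d * (if (l + m < W)%N then b (l + m)%N else 0) * phi l = 0.
  by rewrite big_nat big1 // => l /andP[hl _]; rewrite ifN ?mulr0 ?mul0r // -leqNgt; lia.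
rewrite z2 addr0.
rewrite sum_shift big_nat [RHS]big_nat; apply: eq_bigr => l /andP[_ hl].
rewrite ifT; last lia.
by rewrite ifT ?addnK ?leq_addl //; ring.
Qed.

Let span_ser W (b : nat -> F) : (forall phi G, Phi phi G -> \sum_(l < W) b l * G`_l = 0) ->
  \sum_(l < W) b l * (C l - d * (if (m <= l)%N then C (l - m)%N else 0)) = 0.
Proof.
move=> h; rewrite -shift_sum; apply: (Phi_span (a := fun l => b l - d * (if (l + m < W)%N then b (l + m)%N else 0))).
move=> phi G hP; rewrite shift_sum -[RHS](h _ _ hP); apply: eq_bigr => l _.
by rewrite (Phi_ser hP).
Qed.

(** The recursion and the functional equation are linear conditions on coefficients. Transposing the
    recursion, as in [shift_sum], turns a linear form in the coefficients of the numerator into one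
    in the terms of the sequence, where the spanning hypothesis applies. The uniform degree bound
    [N0] makes the numerator attached to [C] a polynomial. *)
Lemma spanned_ser : exists2 G : {poly F}, ser m d C G &
  forall t t' z z', (forall phi H, Phi phi H -> z * H.[t] = z' * H.[t']) -> z * G.[t] = z' * G.[t'].
Proof.
pose g l := C l - d * (if (m <= l)%N then C (l - m)%N else 0).
exists (\poly_(l < N0) g l).
  move=> j; rewrite coef_poly -/(g j); case: ltnP => // hj.
  have := @span_ser j.+1 (fun l => (l == j)%:R).
  rewrite big_ord_recr /= eqxx mul1r big1 ?add0r => [|l _]; last first.
    by rewrite (ltn_eqF (ltn_ord l)) mul0r.
  apply=> phi G hP; rewrite big_ord_recr /= eqxx mul1r big1 ?add0r => [|l _].
    by rewrite nth_default // (leq_trans (Phi_size hP)).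
  by rewrite (ltn_eqF (ltn_ord l)) mul0r.
move=> t t' z z' h; apply/eqP; rewrite -subr_eq0; apply/eqP.
have ev (G : {poly F}) : (size G <= N0)%N ->
    z * G.[t] - z' * G.[t'] = \sum_(l < N0) (z * t ^+ l - z' * t' ^+ l) * G`_l.
  move=> sG; rewrite !(horner_coef_wide _ sG) !mulr_sumr -sumrB; apply: eq_bigr => l _; ring.
rewrite ev ?size_poly //.
rewrite -[RHS](@span_ser N0 (fun l => z * t ^+ l - z' * t' ^+ l)) => [|phi G hP].
  by apply: eq_bigr => l _; rewrite coef_poly ltn_ord.
by rewrite -ev ?(Phi_size hP) // (h _ _ hP) subrr.
Qed.
End MassRecursion.

Section ReflectionPolynomials.
Variables (F : fieldType) (x : F).
Hypothesis x0 : x != 0.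

(** In the variable y the bracket b satisfies b(y) = -y^(r+1) b(1/y), and the leading factor 1 - x
    y, which becomes (y - x)/y, produces the quotient in gamma. The next two polynomials behave in
    the same way, except that [lin2_poly] has no leading factor, whence the pure power for long
    roots when m is even. *)
Lemma herm_poly_eval r t : (herm_poly x r).[t] =
  (1 - x * (- x * t)) * ((1 + x * (- x * t)) - (- x * t) ^+ r * (x + - x * t)).
Proof.
rewrite /herm_poly !hornerE /= -[(- x) ^+ r * t ^+ r]exprMn; move: ((- x * t) ^+ r) => P; ring.
Qed.
Lemma lin2_poly_eval r t : (lin2_poly x r).[t] = 1 - x * (x * t) + (x * t) ^+ r * (x - x * t).
Proof.
rewrite /lin2_poly !hornerE /= [x ^+ r.+1]exprS -[x * x ^+ r * t ^+ r]mulrA -[x ^+ r * t ^+ r]exprMn; move: ((x * t) ^+ r) => P; ring.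
Qed.
Lemma lin3_poly_eval r t : (lin3_poly x r).[t] =
  (1 - x * (- x ^+ 2 * t)) * ((1 + x ^+ 2 * (- x ^+ 2 * t)) - (- x ^+ 2 * t) ^+ r * (x ^+ 2 + - x ^+ 2 * t)).
Proof.
rewrite /lin3_poly !hornerE /= -[(- x ^+ 2) ^+ r * t ^+ r]exprMn; move: ((- x ^+ 2 * t) ^+ r) => P; ring.
Qed.

(** As t = y^2 t', the monomial X^A contributes y^(2A), so the exponent is 2A + r. In the two cases
    with t = y t' it is A + r. *)
Lemma herm_poly_reflect (y t t' : F) A r : y != 0 -> - x * t = y -> - x * t' = y^-1 -> t = y ^+ 2 * t' ->
  (y - x) * ('X^A * herm_poly x r).[t] =
  - (y ^+ 2 * (1 - x * y)) * y ^+ (A + A + r) * ('X^A * herm_poly x r).[t'].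
Proof.
move=> y0 e1 e2 e3; rewrite !hornerM !hornerXn !herm_poly_eval e1 e2 {1}e3 exprMn -exprM mul2n -addnn.
rewrite !exprD exprVn; have := expf_neq0 r y0; have := expf_neq0 A y0.
move: (y ^+ r) (y ^+ A) (t' ^+ A) => P Q U Q0 P0; field; by rewrite ?y0 ?P0.
Qed.

Lemma lin2_poly_reflect (y t t' : F) A r : y != 0 -> x * t ^+ 2 = y -> x * t' ^+ 2 = y^-1 -> t = y * t' ->
  ('X^A * (lin2_poly x r \Po 'X^2)).[t] = - y * y ^+ (A + r) * ('X^A * (lin2_poly x r \Po 'X^2)).[t'].
Proof.
move=> y0 e1 e2 e3; rewrite !hornerM !horner_comp !hornerXn !lin2_poly_eval e1 e2 {1}e3 exprMn.
rewrite !exprD exprVn; have := expf_neq0 r y0; have := expf_neq0 A y0.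
move: (y ^+ r) (y ^+ A) (t' ^+ A) => P Q U Q0 P0; field; by rewrite ?y0 ?P0.
Qed.

Lemma lin3_poly_reflect (y t t' : F) A r : y != 0 -> - x ^+ 2 * t ^+ 2 = y -> - x ^+ 2 * t' ^+ 2 = y^-1 -> t = y * t' ->
  (y - x) * ('X^A * (lin3_poly x r \Po 'X^2)).[t] =
  - (y ^+ 2 * (1 - x * y)) * y ^+ (A + r) * ('X^A * (lin3_poly x r \Po 'X^2)).[t'].
Proof.
move=> y0 e1 e2 e3; rewrite !hornerM !horner_comp !hornerXn !lin3_poly_eval e1 e2 {1}e3 exprMn.
rewrite !exprD exprVn; have := expf_neq0 r y0; have := expf_neq0 A y0.
move: (y ^+ r) (y ^+ A) (t' ^+ A) => P Q U Q0 P0; field; by rewrite ?y0 ?P0.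
Qed.
End ReflectionPolynomials.

(** * Functional equations of the generating series of the masses *)

Section MassReflection.
Variables (R : realType) (L : fieldType) (O : set L) (w : L) (c : {rmorphism L -> L}).
Variables (q : nat) (rho : 'I_q -> L) (th : L).
Hypothesis H : unramified_pair O w c rho th.
Hypothesis char0 : forall n, n.+1%:R != 0 :> L.
Notation v := (valuation O w).
Notation vg := (vg O w).
Variable m : nat.
Local Notation T := (borel_mx O w m).
Local Notation K := (max_compact O c m).
Variable mu : {measure set T -> \bar R}.
Hypothesis hmu : is_haar K mu.
Variable x : 'M[L]_m.
Hypothesis hx : herm_inv c x.
Local Notation n := m./2.
Local Notation D h i := (corner_det (act_mx c h x) i).
Local Notation ov := (opt_val O w).
Variable B : nat.
Hypothesis hB : forall h (i : 'I_n), K h -> vg (- B%:Z) (D h i).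
Variable e : nat.
Hypothesis v2 : v 2%:R = e.
Local Notation C kap i := (fun l => (mass c mu x B (upd kap i l))%:C).
Local Notation xi := ((q%:R)^-1 : R[i]).

Lemma mass_transferC (i : 'I_n) (kap : {ffun 'I_n -> nat}) (S : finType) (h : S -> 'M[L]_m) W (a : nat -> R[i]) :
  inhabited S -> (forall s, K (h s)) ->
  (forall k, K k -> (forall j, j != i -> D k j != 0) ->
    forall s j, j != i -> D (h s *m k) j != 0 /\ v (D (h s *m k) j) = v (D k j)) ->
  (forall k, K k -> (forall j, j != i -> ov (D k j) = shift_val B (kap j)) ->
    \sum_(l < W) a l * loc_count O w R[i] (fun s => D (h s *m k) i) B l = 0) ->
  \sum_(l < W) a l * C kap i l = 0.
Proof.
move=> S0 hK hpres ha.
have key (p : R[i] -> R) : p 0 = 0 -> (forall z z', p (z + z') = p z + p z') ->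
    (forall z (r : R), p (z * r%:C) = p z * r) -> p (\sum_(l < W) a l * C kap i l) = 0.
  move=> p0 pD pr; rewrite (big_morph p pD p0); under eq_bigr => l _ do rewrite pr.
  apply: (mass_transfer H hmu S0 hK hpres (a := fun l => p (a l))) => k Kk hk.
  rewrite -[RHS]p0 -(ha k Kk hk) (big_morph p pD p0); apply: eq_bigr => l _.
  rewrite -pr; congr (p (_ * _)).
  by rewrite /loc_count (rmorphB (real_complex R)) !(rmorph_nat (real_complex R)).
apply: complex_ext.
  by apply: key => // [[? ?] [? ?]|[? ?] r] //=; ring.
by apply: key => // [[? ?] [? ?]|[? ?] r] //=; ring.
Qed.

Lemma prv_proof (i : 'I_n) : (i.-1 < n)%N.
Proof. exact: leq_ltn_trans (leq_pred i) (ltn_ord i). Qed.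
Definition prv (i : 'I_n) : 'I_n := Ordinal (prv_proof i).
(** For i = 0 the preceding minor is 1, of valuation 0, so its shifted exponent is B. *)
Definition prev_exp (kap : {ffun 'I_n -> nat}) (i : 'I_n) : nat := if (0 < i)%N then kap (prv i) else B.

Let ovE y l : ov y = shift_val B l -> y != 0 /\ v y = l%:Z - B%:Z.
Proof. by rewrite /opt_val /shift_val; case: eqP => // _ [->]. Qed.

Let val_below (i : 'I_n) (kap : {ffun 'I_n -> nat}) k :
  (forall j, j != i -> ov (D k j) = shift_val B (kap j)) ->
  v (below i (act_mx c k x)) = (prev_exp kap i)%:Z - B%:Z.
Proof.
move=> hk; rewrite /prev_exp; case: ltnP => i0.
  have e1 : i = (prv i).+1 :> nat by rewrite /= prednK.
  have ne : prv i != i by rewrite -val_eqE /=; lia.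
  by rewrite (belowE _ e1); case: (ovE (hk _ ne)).
by rewrite below0 ?(val1 H) ?subrr //; lia.
Qed.

Let herm_orbit k : K k -> herm_inv c (act_mx c k x).
Proof. by case=> uk _; exact: (act_herm_inv H). Qed.

Let size_bound (G : nat -> nat -> {poly R[i]}) Lam A r : (A <= Lam)%N -> (r <= Lam)%N ->
  (size (G A r) <= \max_(t : 'I_Lam.+1 * 'I_Lam.+1) size (G t.1 t.2))%N.
Proof.
move=> hA hr; have := leq_bigmax (F := fun t : 'I_Lam.+1 * 'I_Lam.+1 => size (G t.1 t.2))
  (Ordinal (hA : (A < Lam.+1)%N), Ordinal (hr : (r < Lam.+1)%N)); exact.
Qed.

(** [Lam] is the common value of 2A + r for all local sequences with the prescribed neighbours. It
    bounds A and r, hence the degrees of the numerators, and it makes the functional equation the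
    same for all of them. *)
Lemma mass_short (i : 'I_n) (kap : {ffun 'I_n -> nat}) : (i.+1 < n)%N ->
  exists2 G, ser 2 (xi ^+ 2) (C kap i) G & forall y t t', y != 0 -> - xi * t = y -> - xi * t' = y^-1 ->
    t = y ^+ 2 * t' -> (y - xi) * G.[t] =
      - (y ^+ 2 * (1 - xi * y)) * y ^+ (prev_exp kap i + kap (ordS i)) * G.[t'].
Proof.
move=> hi; set Lam := (_ + _)%N.
pose GG A r : {poly R[i]} := 'X^A * herm_poly xi r.
pose Phi phi G := exists A r, [/\ (A + A + r)%N = Lam, phi = shifted A (tails (herm_dens xi r)) &
  G = 'X^A * herm_poly xi r].
have [|||G Gs Gr] := @spanned_ser _ (C kap i) Phi 2
   (\max_(t : 'I_Lam.+1 * 'I_Lam.+1) size (GG t.1 t.2)) (xi ^+ 2).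
- move=> phi G [A [r [_ -> ->]]]; apply: ser_shift; exact: herm_ser.
- move=> phi G [A [r [hA _ ->]]]; apply: (size_bound GG); lia.
- move=> W a hP.
  have [S [h [S0 [hK hh]]]] := short_local H R[i] W hi.
  have hn k : K k -> cjm c (act_mx c k x) = act_mx c k x by move/herm_orbit => [].
  apply: (mass_transferC S0 hK) => [k Kk hk s j ji|k Kk hk].
    by rewrite act_mxM; have [h1 _] := hh _ (hn _ Kk) hk; exact: h1.
  have dk j : j != i -> D k j != 0 by move=> ji; have [] := ovE (hk j ji).
  have [_ h2] := hh _ (hn _ Kk) dk.
  have [|A [r [hA hl]]] := h2 B.
    by move=> s; rewrite -act_mxM; apply: hB; exact: (max_compact_mul H).
  have ne : ordS i != i by rewrite -val_eqE /= modn_small; lia.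
  rewrite (val_below hk) (ovE (hk _ ne)).2 in hA.
  have hA' : (A + A + r)%N = Lam by rewrite /Lam; lia.
  have := hP _ _ (ex_intro _ A (ex_intro _ r (And3 hA' erefl erefl))) => hs.
  apply: (etrans (y := q%:R ^+ W.+1.*2 * 0)); last exact: mulr0.
  rewrite -[in RHS]hs mulr_sumr; apply: eq_bigr => l _.
  by under eq_fun => s do rewrite act_mxM; rewrite hl // mulrCA.
exists G => // y t t' y0 e1 e2 e3; apply: Gr => phi G' [A [r [<- _ ->]]].
by apply: herm_poly_reflect.
Qed.

Lemma mass_long_even (i : 'I_n) (kap : {ffun 'I_n -> nat}) : i.+1 == n -> ~~ odd m ->
  exists2 G, ser 2 xi (C kap i) G & forall y t t', y != 0 -> xi * t ^+ 2 = y -> xi * t' ^+ 2 = y^-1 ->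
    t = y * t' -> 1 * G.[t] = - y * y ^+ (prev_exp kap i + e) * G.[t'].
Proof.
move=> hi mo; set Lam := (_ + _)%N.
pose GG A r : {poly R[i]} := 'X^A * (lin2_poly xi r \Po 'X^2).
pose Phi phi G := exists A r, [/\ (A + r)%N = Lam, phi = shifted A (doubled (tails (lin2_dens xi r))) &
  G = 'X^A * (lin2_poly xi r \Po 'X^2)].
have [|||G Gs Gr] := @spanned_ser _ (C kap i) Phi 2
   (\max_(t : 'I_Lam.+1 * 'I_Lam.+1) size (GG t.1 t.2)) xi.
- move=> phi G [A [r [_ -> ->]]]; apply: ser_shift; apply: (@ser_double _ 1); exact: lin2_ser.
- move=> phi G [A [r [hA _ ->]]]; apply: (size_bound GG); lia.
- move=> W a hP.
  have [S [h [S0 [hK hh]]]] := long_local_even H char0 R[i] W hi mo.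
  apply: (mass_transferC S0 hK) => [k Kk hk s j ji|k Kk hk].
    by rewrite act_mxM; have [h1 _] := hh _ (herm_orbit Kk) hk; exact: h1.
  have dk j : j != i -> D k j != 0 by move=> ji; have [] := ovE (hk j ji).
  have [_ h2] := hh _ (herm_orbit Kk) dk.
  have [|A [r [hA hl]]] := h2 B.
    by move=> s; rewrite -act_mxM; apply: hB; exact: (max_compact_mul H).
  rewrite (val_below hk) v2 in hA.
  have hA' : (A + r)%N = Lam by rewrite /Lam; lia.
  have := hP _ _ (ex_intro _ A (ex_intro _ r (And3 hA' erefl erefl))) => hs.
  apply: (etrans (y := q%:R ^+ W.+1 * 0)); last exact: mulr0.
  rewrite -[in RHS]hs mulr_sumr; apply: eq_bigr => l _.
  by under eq_fun => s do rewrite act_mxM; rewrite hl // mulrCA.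
exists G => // y t t' y0 e1 e2 e3; apply: Gr => phi G' [A [r [<- _ ->]]].
by rewrite mul1r; apply: lin2_poly_reflect.
Qed.

Lemma mass_long_odd (i : 'I_n) (kap : {ffun 'I_n -> nat}) : i.+1 == n -> odd m ->
  exists2 G, ser 4 (xi ^+ 4) (C kap i) G & forall y t t', y != 0 -> - xi ^+ 2 * t ^+ 2 = y ->
    - xi ^+ 2 * t' ^+ 2 = y^-1 -> t = y * t' ->
    (y - xi) * G.[t] = - (y ^+ 2 * (1 - xi * y)) * y ^+ (prev_exp kap i + e) * G.[t'].
Proof.
move=> hi mo; set Lam := (_ + _)%N.
pose GG A r : {poly R[i]} := 'X^A * (lin3_poly xi r \Po 'X^2).
pose Phi phi G := exists A r, [/\ (A + r)%N = Lam, phi = shifted A (doubled (tails (lin3_dens xi r))) &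
  G = 'X^A * (lin3_poly xi r \Po 'X^2)].
have [|||G Gs Gr] := @spanned_ser _ (C kap i) Phi 4
   (\max_(t : 'I_Lam.+1 * 'I_Lam.+1) size (GG t.1 t.2)) (xi ^+ 4).
- move=> phi G [A [r [_ -> ->]]]; apply: ser_shift; apply: (@ser_double _ 2); exact: lin3_ser.
- move=> phi G [A [r [hA _ ->]]]; apply: (size_bound GG); lia.
- move=> W a hP.
  have [S [h [S0 [hK hh]]]] := long_local_odd H char0 R[i] W hi mo.
  apply: (mass_transferC S0 hK) => [k Kk hk s j ji|k Kk hk].
    by rewrite act_mxM; have [h1 _] := hh _ (herm_orbit Kk) hk; exact: h1.
  have dk j : j != i -> D k j != 0 by move=> ji; have [] := ovE (hk j ji).
  have [_ h2] := hh _ (herm_orbit Kk) dk.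
  have [|A [r [hA hl]]] := h2 B.
    by move=> s; rewrite -act_mxM; apply: hB; exact: (max_compact_mul H).
  rewrite (val_below hk) v2 in hA.
  have hA' : (A + r)%N = Lam by rewrite /Lam; lia.
  have := hP _ _ (ex_intro _ A (ex_intro _ r (And3 hA' erefl erefl))) => hs.
  apply: (etrans (y := q%:R ^+ (3 * W.+1) * 0)); last exact: mulr0.
  rewrite -[in RHS]hs mulr_sumr; apply: eq_bigr => l _.
  by under eq_fun => s do rewrite act_mxM; rewrite hl // mulrCA.
exists G => // y t t' y0 e1 e2 e3; apply: Gr => phi G' [A [r [<- _ ->]]].
by apply: lin3_poly_reflect.
Qed.
End MassReflection.

(** * Reflection of the rational function *)

Section PolynomialVanishing.
Variable F : fieldType.
Implicit Types p : {poly F}.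

Definition vanishes_to (N : nat) p : Prop := exists r, p = r * 'X^N.

Lemma vanishesP N p : (forall k, (k < N)%N -> p`_k = 0) -> vanishes_to N p.
Proof.
move=> h; exists (drop_poly N p); rewrite -[LHS](poly_take_drop N p).
suff -> : take_poly N p = 0 by rewrite add0r.
by apply/polyP => k; rewrite coef_take_poly coef0; case: ifP => // /h.
Qed.
Lemma vanishes_coef N p k : vanishes_to N p -> (k < N)%N -> p`_k = 0.
Proof. by move=> [r ->] kN; rewrite coefMXn kN. Qed.
Lemma vanishes_mull N p a : vanishes_to N p -> vanishes_to N (a * p).
Proof. by move=> [r ->]; exists (a * r); rewrite mulrA. Qed.
Lemma vanishesB N p p' : vanishes_to N p -> vanishes_to N p' -> vanishes_to N (p - p').
Proof. by move=> [r ->] [r' ->]; exists (r - r'); rewrite mulrBl. Qed.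
Lemma vanishes_all p : (forall N, vanishes_to N p) -> p = 0.
Proof.
move=> h; apply/eqP; rewrite -lead_coef_eq0 lead_coefE; apply/eqP.
by apply: (vanishes_coef (h (size p).+1)); lia.
Qed.
End PolynomialVanishing.

(** * Estimates for polynomials and truncated series *)

Section ComplexBounds.
Variable R : realType.
Implicit Types (p : {poly R[i]}) (z : R[i]).

Lemma norm_complexE z : `|z| = (complex.Re `|z|)%:C.
Proof. by rewrite normc_def. Qed.
Lemma norm_real_complex (y : R) : 0 <= y -> `|y%:C| = y%:C :> R[i].
Proof. by move=> y0; rewrite ger0_norm ?ler0c. Qed.
Lemma Re_norm_ge0 z : 0 <= complex.Re `|z|.
Proof. by rewrite -ler0c -norm_complexE. Qed.

Lemma poly_unit_bound p : exists2 S : R, 0 <= S & forall y, 0 <= y <= 1 -> `|p.[y%:C]| <= S%:C.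
Proof.
exists (\sum_(k < size p) complex.Re `|p`_k|); first by apply: sumr_ge0 => k _; exact: Re_norm_ge0.
move=> y /andP[y0 y1]; rewrite horner_coef; apply: le_trans (ler_norm_sum _ _ _) _.
rewrite (rmorph_sum (real_complex R)) /=; apply: ler_sum => k _.
rewrite normrM -norm_complexE ler_piMr // normrX norm_real_complex //.
by rewrite -(rmorphXn (real_complex R)) lecR exprn_ile1.
Qed.

(** The order of vanishing at 0 is read off along the positive reals. In the induction the quotient
    by X^N is bounded by a multiple of y, so its constant term is 0. *)
Lemma vanishes_of_bound (N : nat) p (K y0 : R) : 0 < y0 ->
  (forall y, 0 < y <= y0 -> `|p.[y%:C]| <= (K * y ^+ N)%:C) -> vanishes_to N p.
Proof.
move=> y00; wlog y01 : y0 y00 / y0 <= 1.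
  move=> h hp; apply: (h (Num.min y0 1)); rewrite ?lt_min ?y00 ?ltr01 ?ge_min ?lexx ?orbT //.
  by move=> y /andP[yp]; rewrite le_min => /andP[h1 _]; apply: hp; rewrite yp.
elim: N K => [|N IH] K hp; first by exists p; rewrite mulr1.
have K0 : 0 <= K.
  have := hp y0; rewrite y00 lexx => /(_ isT) h.
  have := le_trans (normr_ge0 _) h; rewrite ler0c pmulr_lge0 // exprn_gt0 //.
have [r er] : vanishes_to N p.
  apply: (IH K) => y /andP[yp yl]; apply: le_trans (hp y _) _; first by rewrite yp.
  by rewrite lecR ler_wpM2l // exprS ler_piMl ?exprn_ge0 ?(ltW yp) // (le_trans yl).
have hr y : 0 < y <= y0 -> `|r.[y%:C]| <= (K * y)%:C.
  move=> hy; have := hp y hy; have /andP[yp yl] := hy.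
  have yN : 0 < y ^+ N by rewrite exprn_gt0.
  rewrite er hornerM hornerXn normrM -(rmorphXn (real_complex R)) norm_real_complex ?(ltW yN) //.
  have -> : K * y ^+ N.+1 = (K * y) * y ^+ N by rewrite exprS mulrA.
  by rewrite [leRHS](rmorphM (real_complex R) (K * y) (y ^+ N)) ler_pM2r // ltcR.
pose s := drop_poly 1 r.
have es : r = (r`_0)%:P + s * 'X.
  rewrite -[LHS](poly_take_drop 1 r) expr1; congr (_ + _).
  by apply/polyP => k; rewrite coef_take_poly coefC; case: k.
have [S S0 hS] := poly_unit_bound s.
suff r0 : r`_0 = 0 by exists s; rewrite er es r0 add0r -mulrA -exprS.
apply/eqP; rewrite -normr_eq0; apply/negPn/negP => n0.
set t := complex.Re `|r`_0|.
have t0 : 0 < t by rewrite lt_neqAle Re_norm_ge0 andbT eq_sym -(inj_eq (@complexI R)) -norm_complexE.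
have ht y : 0 < y <= y0 -> t <= y * (K + S).
  move=> hy; have /andP[yp yl] := hy.
  rewrite -lecR -norm_complexE.
  have -> : r`_0 = r.[y%:C] - s.[y%:C] * y%:C by rewrite {2}es !hornerE addrK.
  apply: le_trans (ler_normB _ _) _; rewrite mulrDr (rmorphD (real_complex R)) /= lerD //.
    by rewrite mulrC; exact: hr.
  rewrite normrM (norm_real_complex (ltW yp)) (rmorphM (real_complex R)) /= mulrC ler_wpM2l ?ler0c ?(ltW yp) //.
  by apply: hS; rewrite (ltW yp) (le_trans yl).
pose y := Num.min y0 (t / (2 * (K + S) + 1)).
have d0 : 0 < 2 * (K + S) + 1 by lra.
have yp : 0 < y by rewrite lt_min y00 divr_gt0.
have yl : y <= t / (2 * (K + S) + 1) by rewrite ge_min lexx orbT.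
have := ht y; rewrite yp ge_min lexx => /(_ isT).
rewrite ler_pdivlMr // in yl; nra.
Qed.

Lemma le_of_pow_le (a b U t : R) (M0 : nat) : 0 <= t < 1 ->
  (forall M, (M0 <= M)%N -> a <= b + U * t ^+ M) -> a <= b.
Proof.
move=> /andP[t0 t1] h; rewrite leNgt; apply/negP => ab.
have u1 : 0 < `|U| + 1 by rewrite ltr_wpDl.
have e0 : 0 < (a - b) / (`|U| + 1) by rewrite divr_gt0 ?subr_gt0.
have := @cvg_expr R t; rewrite ger0_norm // => /(_ t1) /cvgrPdist_lt /(_ _ e0) [N _ hN].
have := hN (maxn N M0) (leq_maxl _ _); rewrite /= sub0r normrN.
have := h (maxn N M0) (leq_maxr _ _); set s := t ^+ _.
have s0 : 0 <= s by rewrite exprn_ge0.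
rewrite (ger0_norm s0) ltr_pdivlMr // => h1 h2.
have : U * s <= `|U| * s by rewrite ler_wpM2r // ler_norm.
nra.
Qed.

(** Multiplying the truncated series by 1 - d t^m reproduces the numerator up to the last m
    terms. *)
Lemma geometric_tail (m M : nat) (d t : R[i]) (c : nat -> R[i]) (G : {poly R[i]}) :
  ser m d c G -> (forall l, `|c l| <= 1) -> `|t| <= 1 -> (m <= M)%N -> (size G <= M)%N ->
  `|(1 - d * t ^+ m) * (\sum_(l < M) c l * t ^+ l) - G.[t]| <= `|d| * m%:R * `|t| ^+ M.
Proof.
move=> hs hc ht mM sG; rewrite (horner_coef_wide _ sG).
have eG : \sum_(l < M) G`_l * t ^+ l = \sum_(l < M) c l * t ^+ l - d * t ^+ m * \sum_(l < M - m) c l * t ^+ l.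
  under eq_bigr => l _ do rewrite -hs mulrBl.
  rewrite big_split /= sumrN; congr (_ - _); rewrite mulr_sumr.
  rewrite -(big_mkord predT (fun l => d * (if (m <= l)%N then c (l - m)%N else 0) * t ^+ l)).
  rewrite (big_cat_nat (n := m)) //= big_nat big1 ?add0r => [|l /andP[_ hl]]; last first.
    by rewrite ifN ?mulr0 ?mul0r // -ltnNge.
  rewrite -{1}[m]add0n big_addn big_mkord; apply: eq_bigr => l _.
  by rewrite leq_addl addnK exprD; ring.
have eS : \sum_(l < M) c l * t ^+ l = \sum_(l < M - m) c l * t ^+ l + \sum_(M - m <= l < M) c l * t ^+ l.
  rewrite -!(big_mkord predT (fun l => c l * t ^+ l)) (big_cat_nat (n := (M - m)%N)) //=; exact: leq_subr.
have -> : (1 - d * t ^+ m) * (\sum_(l < M) c l * t ^+ l) - \sum_(l < M) G`_l * t ^+ l =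
    - (d * (t ^+ m * \sum_(M - m <= l < M) c l * t ^+ l)) by rewrite eG eS; ring.
rewrite normrN normrM -mulrA ler_wpM2l // mulr_sumr.
apply: le_trans (ler_norm_sum _ _ _) _.
rewrite big_nat; apply: le_trans (ler_sum _ (G := fun=> `|t| ^+ M) _) _.
  move=> l /andP[hl _]; rewrite mulrCA -exprD normrM normrX.
  apply: le_trans (_ : `|t| ^+ (m + l) <= _); first by rewrite ler_piMl ?exprn_ge0.
  by apply: ler_wiXn2l => //; lia.
by rewrite -big_nat sumr_const_nat subKn // mulr_natl.
Qed.
End ComplexBounds.

Section ReversedPolynomial.
Variables (F : fieldType) (n : nat) (i : 'I_n).

(** The variable of index i stays fixed and the others are scaled by y: the coefficients of the
    expansion in y are sums of the series that satisfy the functional equation in the i-th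
    variable. *)
Definition line_point (t y : F) (b : 'I_n -> F) (j : 'I_n) : F := if j == i then t else y * b j.

(** The polynomials P and Q are in the q^(s_j), whereas T stands for the q^(-s_j); the factor t^N
    y^N clears the denominators of P(1/T) along the line. *)
Definition rev_eval (N : nat) (b : 'I_n -> F) (P : mpoly n F) : {poly {poly F}} :=
  \sum_(mm <- msupp P)
    ((mcoeff mm P * \prod_(j | j != i) (b j)^-1 ^+ mm j) *: 'X^(N - mm i))%:P * 'X^(N - \sum_(j | j != i) mm j).

Lemma rev_evalE N b P t y : (msize P <= N)%N -> t != 0 -> y != 0 ->
  (rev_eval N b P).[y%:P].[t] = t ^+ N * y ^+ N * meval (fun j => (line_point t y b j)^-1) P.
Proof.
move=> sN t0 y0; rewrite /rev_eval !horner_sum mevalE mulr_sumr big_seq [RHS]big_seq.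
apply: eq_bigr => mm hm; have dm := leq_trans (msize_mdeg_lt hm) sN.
rewrite mdegE (bigD1 i) //= in dm.
rewrite hornerM hornerC hornerXn hornerM hornerZ hornerXn horner_exp hornerC.
rewrite [X in _ = _ * (_ * X)](bigD1 i) //= {1}/line_point eqxx.
have -> : \prod_(j < n | j != i) (line_point t y b j)^-1 ^+ mm j =
    (y^-1) ^+ (\sum_(j | j != i) mm j) * \prod_(j | j != i) (b j)^-1 ^+ mm j.
  rewrite -prodrXr -big_split /=; apply: eq_bigr => j ji.
  by rewrite /line_point (negPf ji) invfM exprMn.
set s := (\sum_(j | _) _)%N in dm *; set p := \prod_(j | _) _.
have -> : t ^+ N = t ^+ (N - mm i) * t ^+ mm i by rewrite -exprD subnK //; lia.
have -> : y ^+ N = y ^+ (N - s) * y ^+ s by rewrite -exprD subnK //; lia.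
by rewrite !exprVn; field; rewrite !expf_neq0.
Qed.
End ReversedPolynomial.

(** * Transfer of the functional equation beyond the domain of convergence *)

Section ReflectionEngine.
Variables (R : realType) (n B : nat) (C : {ffun 'I_n -> nat} -> R) (P Q : mpoly n R[i]).
Local Notation ev P T := (meval (fun j => (T j)^-1) P).
Hypothesis C01 : forall kap, 0 <= C kap <= 1.
Hypothesis approx : forall T : 'I_n -> R[i], (forall j, T j != 0) -> (forall j, `|T j| <= 1) ->
  ev Q T != 0 -> forall (X : seq {ffun 'I_n -> nat}) (delta : R), uniq X -> 0 <= delta ->
  (forall kap, kap \notin X -> `|\prod_j T j ^+ kap j| <= delta%:C) ->
  `|ev P T * \prod_j T j ^+ B - ev Q T * \sum_(kap <- X) (C kap)%:C * \prod_j T j ^+ kap j| <=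
    `|ev Q T| * (delta + delta)%:C.
Variables (i : 'I_n) (m : nat) (d : R[i]) (G : {ffun 'I_n -> nat} -> {poly R[i]}).
Definition set_exp (kap : {ffun 'I_n -> nat}) (l : nat) : {ffun 'I_n -> nat} :=
  [ffun j => if j == i then l else kap j].
Hypothesis hG : forall kap, ser m d (fun l => (C (set_exp kap l))%:C) (G kap).

Let D (t : R[i]) := 1 - d * t ^+ m.
Let mono (T : 'I_n -> R[i]) (kap : {ffun 'I_n -> nat}) := \prod_(j | j != i) T j ^+ kap j.

(** Exponents at most N in the variables other than i; the exponent 0 at i is a placeholder for the
    summation index. *)
Definition box (N : nat) : seq {ffun 'I_n -> nat} :=
  undup [seq [ffun j => if j == i then 0%N else nat_of_ord (g j)] | g : {ffun 'I_n -> 'I_N.+1}].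

Let box_i N (kap : {ffun 'I_n -> nat}) : kap \in box N -> kap i = 0%N.
Proof. by rewrite mem_undup => /mapP[g _ ->]; rewrite ffunE eqxx. Qed.

Let notin_box N (kap : {ffun 'I_n -> nat}) : kap i = 0%N -> kap \notin box N -> exists2 j, j != i & (N < kap j)%N.
Proof.
move=> k0 hk; apply: contrapT => h; move/negP: hk; apply.
have hN j : (kap j < N.+1)%N.
  by rewrite ltnS leqNgt; apply/negP => hj; apply: h; exists j => //; apply/eqP => e; move: hj; rewrite e k0.
rewrite mem_undup; apply/mapP; exists [ffun j => Ordinal (hN j)]; first by rewrite mem_enum.
by apply/ffunP => j; rewrite !ffunE; case: eqP => [->|].
Qed.

Let set_exp_prod (T : 'I_n -> R[i]) kap l : \prod_j T j ^+ set_exp kap l j = T i ^+ l * mono T kap.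
Proof.
rewrite (bigD1 i) //= ffunE eqxx; congr (_ * _); apply: eq_bigr => j /negPf ji.
by rewrite ffunE ji.
Qed.

Let mono_le1 (T : 'I_n -> R[i]) kap : (forall j, `|T j| <= 1) -> `|mono T kap| <= 1.
Proof.
move=> hT; rewrite /mono normr_prod; apply: prodr_ile1 => j _.
by rewrite normr_ge0 normrX exprn_ile1.
Qed.

Let ge0_complexE (z : R[i]) : 0 <= z -> z = (complex.Re z)%:C.
Proof. by move=> z0; rewrite -{1 2}(ger0_norm z0) norm_complexE. Qed.

(** The expansion is summed over i-th exponents below M and over the box. As M tends to infinity,
    the inner sums times 1 - d T_i^m tend to the numerators G(T_i), and only the error from outside
    the box remains. *)
Lemma engine_bound T N (delta : R) : (forall j, T j != 0) -> (forall j, `|T j| <= 1) -> `|T i| < 1 ->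
  ev Q T != 0 -> 0 <= delta ->
  (forall (kap : {ffun 'I_n -> nat}) j, j != i -> (N < kap j)%N -> `|mono T kap| <= delta%:C) ->
  `|D (T i) * (ev P T * \prod_j T j ^+ B) - ev Q T * \sum_(kap <- box N) mono T kap * (G kap).[T i]| <=
    `|D (T i)| * `|ev Q T| * (delta + delta)%:C.
Proof.
move=> T0 T1 Ti1 Q0 d0 hd; set LHS := (X in `|X|); set t := complex.Re `|T i|.
have tE : `|T i| = t%:C by exact: norm_complexE.
have t01 : 0 <= t < 1 by rewrite Re_norm_ge0 -ltcR -tE.
pose Uc : R[i] := `|D (T i)| * `|ev Q T| * 2%:R + `|ev Q T| * ((size (box N))%:R * (`|d| * m%:R)).
pose bc : R[i] := `|D (T i)| * `|ev Q T| * (delta + delta)%:C.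
have U0 : 0 <= Uc by rewrite addr_ge0 ?mulr_ge0.
have b0 : 0 <= bc by rewrite !mulr_ge0 // ler0c addr_ge0.
rewrite -/bc (norm_complexE LHS) (ge0_complexE b0) lecR.
apply: (@le_of_pow_le _ _ _ (complex.Re Uc) t (maxn m (\max_(kap <- box N) size (G kap)))) => // M hM.
rewrite -lecR (rmorphD (real_complex R)) (rmorphM (real_complex R)) (rmorphXn (real_complex R)) /=.
rewrite -norm_complexE -(ge0_complexE b0) -(ge0_complexE U0) -tE.
have tM : t ^+ M <= 1 by case/andP: t01 => ? ?; rewrite exprn_ile1 // ltW.
have tM0 : 0 <= t ^+ M by case/andP: t01 => ? ?; rewrite exprn_ge0.
(* A monomial omitted here has i-th exponent at least M or another exponent above N; it is bounded
   by t^M or by delta accordingly. *)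
pose X := [seq set_exp kap l | kap <- box N, l <- index_iota 0 M].
have uX : uniq X.
  apply: allpairs_uniq; [exact: undup_uniq|exact: iota_uniq|].
  move=> [k1 l1] [k2 l2] /allpairsP[[a1 a2] [/= h1 _ [-> ->]]] /allpairsP[[c1 c2] [/= h2 _ [-> ->]]] e.
  have e2 : a2 = c2 by have /ffunP/(_ i) := e; rewrite !ffunE eqxx.
  congr (_, _) => //; apply/ffunP => j; have [->|ji] := eqVneq j i; first by rewrite (box_i h1) (box_i h2).
  by have /ffunP/(_ j) := e; rewrite !ffunE (negPf ji).
have hX kap : kap \notin X -> `|\prod_j T j ^+ kap j| <= (delta + t ^+ M)%:C.
  move=> kX; have -> : kap = set_exp (set_exp kap 0) (kap i).
    by apply/ffunP => j; rewrite !ffunE; case: eqP => [->|].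
  rewrite set_exp_prod normrM normrX tE -(rmorphXn (real_complex R)).
  have [kb|kb] := boolP (set_exp kap 0 \in box N).
    have iM : (M <= kap i)%N.
      rewrite leqNgt; apply/negP => iM; move/negP: kX; apply; apply/allpairsP.
      exists (set_exp kap 0, kap i); split => //; first by rewrite mem_index_iota.
      by apply/ffunP => j; rewrite !ffunE; case: eqP => [->|].
    apply: le_trans (_ : (t ^+ kap i)%:C <= _).
      by rewrite ler_piMr ?mono_le1 // ler0c exprn_ge0 //; case/andP: t01.
    rewrite lecR; apply: le_trans (_ : t ^+ M <= _); last by rewrite lerDr.
    by case/andP: t01 => ? ?; apply: ler_wiXn2l => //; exact: ltW.
  have [|j ji jN] := notin_box _ kb; first by rewrite ffunE eqxx.
  apply: le_trans (_ : `|mono T (set_exp kap 0)| <= _).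
    by rewrite ler_piMl // lecR exprn_ile1 //; case/andP: t01 => // ? ?; exact: ltW.
  by apply: le_trans (hd _ _ ji jN) _; rewrite lecR lerDl.
have := approx T0 T1 Q0 uX (addr_ge0 d0 tM0) hX; rewrite big_allpairs_dep.
set A := ev P T * _; set S := (X in ev Q T * X) => hA.
have SE : S = \sum_(kap <- box N) mono T kap * \sum_(l < M) (C (set_exp kap l))%:C * T i ^+ l.
  apply: eq_bigr => kap _; rewrite big_mkord mulr_sumr; apply: eq_bigr => l _.
  by rewrite set_exp_prod mulrA mulrC.
have -> : LHS = D (T i) * (A - ev Q T * S) + ev Q T * \sum_(kap <- box N)
    mono T kap * (D (T i) * (\sum_(l < M) (C (set_exp kap l))%:C * T i ^+ l) - (G kap).[T i]).
  have -> : \sum_(kap <- box N) mono T kap * (D (T i) * (\sum_(l < M) (C (set_exp kap l))%:C * T i ^+ l) - (G kap).[T i]) =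
      D (T i) * S - \sum_(kap <- box N) mono T kap * (G kap).[T i].
    by rewrite SE mulr_sumr -sumrB; apply: eq_bigr => kap _; ring.
  by rewrite /LHS /A; ring.
apply: le_trans (ler_normD _ _) _; rewrite !normrM.
have -> : bc + Uc * `|T i| ^+ M = `|D (T i)| * (`|ev Q T| * ((delta + t ^+ M) + (delta + t ^+ M))%:C) +
    `|ev Q T| * ((size (box N))%:R * (`|d| * m%:R * `|T i| ^+ M)).
  by rewrite /bc /Uc tE !(rmorphD (real_complex R)) /= (rmorphXn (real_complex R)) /=; ring.
apply: lerD; first by rewrite ler_wpM2l.
rewrite ler_wpM2l //; apply: le_trans (ler_norm_sum _ _ _) _.
rewrite big_seq; apply: le_trans (ler_sum _ (G := fun=> `|d| * m%:R * `|T i| ^+ M) _) _.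
  move=> kap hk; rewrite normrM; apply: le_trans (_ : 1 * _ <= _); last first.
    rewrite mul1r; apply: (geometric_tail (hG kap)) => [l| | |]; last 3 first.
    - exact: T1.
    - exact: leq_trans (leq_maxl _ _) hM.
    - apply: leq_trans (leq_trans (leq_maxr m _) hM).
      by rewrite (big_rem kap hk) /= leq_maxl.
    by have /andP[c0 c1] := C01 (set_exp kap l); rewrite norm_real_complex // lecR.
  by rewrite ler_wpM2r // mono_le1.
by rewrite -big_seq big_const_seq count_predT iter_addr_0 mulr_natl.
Qed.

Let fiber (N : nat) (b : 'I_n -> R[i]) : {poly {poly R[i]}} :=
  ((1 - d *: 'X^m) * ((\prod_(j | j != i) b j ^+ B) *: 'X^B))%:P * 'X^(\sum_(j < n | j != i) B) * rev_eval i N b P.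
Let main_sum (N L : nat) (b : 'I_n -> R[i]) : {poly {poly R[i]}} :=
  \sum_(kap <- box L) ((\prod_(j | j != i) b j ^+ kap j) *: G kap)%:P * 'X^(\sum_(j < n | j != i) kap j).

Let horner2 (p : {poly {poly R[i]}}) (t y : R[i]) : (map_poly (horner_eval t) p).[y] = p.[y%:P].[t].
Proof. by have := horner_map (horner_eval t) p y%:P; rewrite /= !horner_evalE hornerC. Qed.

Let horner_combine (a b e : {poly {poly R[i]}}) (t y : R[i]) : (a * (b - a * e)).[y%:P].[t] =
  a.[y%:P].[t] * (b.[y%:P].[t] - a.[y%:P].[t] * e.[y%:P].[t]).
Proof. by rewrite !(hornerM, hornerD, hornerN). Qed.

Let map_combine (a b e : {poly {poly R[i]}}) (t : R[i]) : map_poly (horner_eval t) (a * (b - a * e)) =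
  map_poly (horner_eval t) a *
    (map_poly (horner_eval t) b - map_poly (horner_eval t) a * map_poly (horner_eval t) e).
Proof. by rewrite rmorphM rmorphB rmorphM. Qed.

Let line_mono t y b kap : mono (line_point i t y b) kap =
  y ^+ (\sum_(j < n | j != i) kap j) * \prod_(j | j != i) b j ^+ kap j.
Proof.
rewrite /mono -prodrXr -big_split /=; apply: eq_bigr => j /negPf ji.
by rewrite /line_point ji exprMn.
Qed.

Let fiberE N b t y : (msize P <= N)%N -> t != 0 -> y != 0 ->
  (fiber N b).[y%:P].[t] = (t ^+ N * y ^+ N) *
    (D t * (ev P (line_point i t y b) * \prod_j line_point i t y b j ^+ B)).
Proof.
move=> sN t0 y0; rewrite /fiber !hornerM rev_evalE // !hornerE /=.
have hm : \prod_(j | j != i) line_point i t y b j ^+ B =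
    y ^+ (\sum_(j < n | j != i) B) * \prod_(j | j != i) b j ^+ B.
  rewrite -prodrXr -big_split /=; apply: eq_bigr => j /negPf ji.
  by rewrite /line_point ji exprMn.
have lpi : line_point i t y b i = t by rewrite /line_point eqxx.
have pE : \prod_j line_point i t y b j ^+ B = t ^+ B * (y ^+ (\sum_(j < n | j != i) B) * \prod_(j | j != i) b j ^+ B).
  by rewrite (bigD1 i) //= hm lpi.
by rewrite pE /D; ring.
Qed.

Let cross_combine (z z' p1 p2 q1 q2 s s' : {poly R[i]}) : z * s = z' * s' ->
  q1 * q2 * (z * p1 * q2 - z' * p2 * q1) =
  (z * q2 * q2) * (q1 * (p1 - q1 * s)) - (z' * q1 * q1) * (q2 * (p2 - q2 * s')).
Proof.
move=> e; apply/eqP; rewrite -subr_eq0; apply/eqP.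
rewrite (_ : _ - _ = q1 * q1 * q2 * q2 * (z * s - z' * s')); last by ring.
by rewrite e subrr mulr0.
Qed.

Let eval_cross (z z' : R[i]) (p1 p2 q1 q2 : {poly R[i]}) :
  (q1 * q2 * (z%:P * p1 * q2 - z'%:P * p2 * q1)).[1] =
  q1.[1] * q2.[1] * (z * p1.[1] * q2.[1] - z' * p2.[1] * q1.[1]).
Proof. by rewrite !(hornerM, hornerD, hornerN, hornerC). Qed.

Let main_sumE N L b t y : (main_sum N L b).[y%:P].[t] =
  \sum_(kap <- box L) mono (line_point i t y b) kap * (G kap).[t].
Proof.
rewrite /main_sum !horner_sum; apply: eq_bigr => kap _.
by rewrite hornerM hornerC hornerXn hornerM hornerZ horner_exp hornerC line_mono; ring.
Qed.

(** For 0 < |t| < 1 the estimate for small y shows vanishing to order L in y. The coefficients in y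
    are polynomials in t, so they vanish for every t. This is the point at which T_i may leave the
    unit disc. *)
Lemma engine_vanishing N L b t : (msize P <= N)%N -> (msize Q <= N)%N -> (forall j, b j != 0) -> t != 0 ->
  vanishes_to L (map_poly (horner_eval t)
    (rev_eval i N b Q * (fiber N b - rev_eval i N b Q * main_sum N L b))).
Proof.
move=> sP sQ b0 t0; set H := _ * _; apply: vanishesP => k kL; rewrite coef_map /= horner_evalE.
have key s : s != 0 -> `|s| < 1 -> (H`_k).[s] = 0.
  move=> s0 s1; rewrite -horner_evalE -coef_map; move: k kL => k; apply: vanishes_coef.
  (* For y <= 1/beta all variables other than the i-th have modulus at most y beta <= 1. *)
  pose beta : R := 1 + \sum_j complex.Re `|b j|.
  have beta1 : 1 <= beta by rewrite lerDl sumr_ge0 // => j _; exact: Re_norm_ge0.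
  have betap : 0 < beta by exact: lt_le_trans beta1.
  have bb j : `|b j| <= beta%:C.
    rewrite norm_complexE lecR /beta (bigD1 j) //= addrCA lerDl addr_ge0 // sumr_ge0 // => j' _.
    exact: Re_norm_ge0.
  have [S S0 hS] := poly_unit_bound (map_poly (horner_eval s) (rev_eval i N b Q)).
  apply: (@vanishes_of_bound _ L _ (S * S * complex.Re `|D s| * (beta ^+ L + beta ^+ L)) beta^-1).
    by rewrite invr_gt0.
  move=> y /andP[yp yb].
  have y1 : y <= 1 by apply: le_trans yb _; rewrite invf_le1.
  have ybeta : 0 <= y * beta <= 1 by rewrite mulr_ge0 ?(ltW yp) ?(ltW betap) //= -ler_pdivlMr // mul1r.
  have yC0 : y%:C != 0 :> R[i] by rewrite (inj_eq (@complexI R)) lt0r_neq0.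
  set T := line_point i s y%:C b.
  have TE j : j != i -> T j = y%:C * b j by move=> /negPf ji; rewrite /T /line_point ji.
  have Ti : T i = s by rewrite /T /line_point eqxx.
  have T0 j : T j != 0.
    by have [->|ji] := eqVneq j i; rewrite ?Ti // TE // mulf_neq0.
  have Tb j : j != i -> `|T j| <= (y * beta)%:C.
    move=> ji; rewrite TE // normrM (norm_real_complex (ltW yp)) (rmorphM (real_complex R)) /= ler_wpM2l //.
    by rewrite ler0c ltW.
  have T1 j : `|T j| <= 1.
    have [->|ji] := eqVneq j i; first by rewrite Ti ltW.
    by apply: le_trans (Tb _ ji) _; rewrite lecR; case/andP: ybeta.
  rewrite horner2 /H horner_combine fiberE // main_sumE -/T.
  have qE : (rev_eval i N b Q).[y%:C%:P].[s] = s ^+ N * y%:C ^+ N * ev Q T by exact: rev_evalE.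
  have qS : `|(rev_eval i N b Q).[y%:C%:P].[s]| <= S%:C by rewrite -horner2; apply: hS; rewrite (ltW yp).
  (* Where Q vanishes the integral does not give P/Q; the extra factor [rev_eval] of Q makes the
     estimate trivial there. *)
  have [Q0|Q0] := eqVneq (ev Q T) 0.
    rewrite qE Q0 mulr0 mul0r normr0 ler0c; apply: mulr_ge0; last by rewrite exprn_ge0 // ltW.
    by rewrite !mulr_ge0 ?Re_norm_ge0 // addr_ge0 // exprn_ge0 // ltW.
  have hb : `|D (T i) * (ev P T * \prod_j T j ^+ B) - ev Q T * \sum_(kap <- box L) mono T kap * (G kap).[T i]| <=
    `|D (T i)| * `|ev Q T| * ((y * beta) ^+ L + (y * beta) ^+ L)%:C.
    apply: engine_bound => //; rewrite ?Ti //.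
      by rewrite exprn_ge0 //; case/andP: ybeta.
    move=> kap j ji jL; rewrite /mono (bigD1 j) //= normrM normrX.
    apply: le_trans (_ : `|T j| ^+ kap j <= _).
      rewrite ler_piMr ?exprn_ge0 // normr_prod; apply: prodr_ile1 => j' _.
      by rewrite normr_ge0 normrX exprn_ile1.
    apply: le_trans (_ : `|T j| ^+ L <= _); first by apply: ler_wiXn2l => //; exact: ltnW.
    by rewrite (rmorphXn (real_complex R)) /= lerXn2r ?nnegrE // ?ler0c ?Tb //; case/andP: ybeta.
  rewrite Ti in hb; set h := D s * _ - _ in hb.
  have -> : (rev_eval i N b Q).[y%:C%:P].[s] * (s ^+ N * y%:C ^+ N * (D s * (ev P T * \prod_j T j ^+ B)) -
      (rev_eval i N b Q).[y%:C%:P].[s] * \sum_(kap <- box L) mono T kap * (G kap).[s]) =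
      (rev_eval i N b Q).[y%:C%:P].[s] * (s ^+ N * y%:C ^+ N) * h.
    by rewrite {2}qE /h; ring.
  rewrite normrM; apply: le_trans (ler_wpM2l (normr_ge0 _) hb) _.
  set qv := (rev_eval _ _ _ _).[_].[_] in qE qS *.
  have -> : `|qv * (s ^+ N * y%:C ^+ N)| * (`|D s| * `|ev Q T| * ((y * beta) ^+ L + (y * beta) ^+ L)%:C) =
      `|qv| * `|qv| * (`|D s| * ((y * beta) ^+ L + (y * beta) ^+ L)%:C).
    by rewrite {3}qE !normrM; ring.
  have -> : (S * S * complex.Re `|D s| * (beta ^+ L + beta ^+ L) * y ^+ L)%:C =
      S%:C * S%:C * (`|D s| * ((y * beta) ^+ L + (y * beta) ^+ L)%:C) :> R[i].
    rewrite (norm_complexE (D s)) -!(rmorphM (real_complex R)); congr (real_complex R _).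
    by rewrite exprMn; ring.
  apply: ler_wpM2r; last by apply: ler_pM.
  rewrite mulr_ge0 // ler0c addr_ge0 // exprn_ge0 //; by case/andP: ybeta.
suff -> : H`_k = 0 by rewrite horner0.
set p := H`_k in key *.
(* As many distinct zeros 1/(j + 2) in the punctured unit disc as the size of the polynomial. *)
pose rs := [seq ((j.+2%:R)^-1 : R[i]) | j <- iota 0 (size p)].
apply: (roots_geq_poly_eq0 (rs := rs)); last by rewrite size_map size_iota.
  apply/allP => _ /mapP[j _ ->]; apply/eqP/key.
    by rewrite invr_eq0 pnatr_eq0.
  by rewrite normfV normr_nat invf_lt1 ?ltr1n ?ltr0n.
rewrite map_inj_uniq ?iota_uniq // => j j' /invr_inj /eqP; rewrite eqr_nat => /eqP [] //.
Qed.

(** Expand in y along the lines through T and T'. By the functional equation of the G the two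
    expansions are proportional coefficient by coefficient, so the cross-multiplied difference, a
    polynomial in y, vanishes to every order and is zero. At y = 1 the lines pass through T and
    T'. *)
Theorem reflection_identity (T T' rho : 'I_n -> R[i]) (a a' : R[i]) :
  (forall j, T j != 0) -> (forall j, T' j != 0) -> (forall j, j != i -> T' j = T j * rho j) ->
  (forall kap, a * (G kap).[T i] = a' * mono rho kap * (G kap).[T' i]) ->
  ev Q T != 0 -> ev Q T' != 0 ->
  a * (1 - d * T i ^+ m) * \prod_j T j ^+ B * ev P T * ev Q T' =
  a' * (1 - d * T' i ^+ m) * \prod_j T' j ^+ B * ev P T' * ev Q T.
Proof.
move=> T0 T'0 Trho hfe Q0 Q'0; rewrite -!/(D _).
pose N := maxn (msize P) (msize Q).
have sP : (msize P <= N)%N := leq_maxl _ _.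
have sQ : (msize Q <= N)%N := leq_maxr _ _.
pose f := map_poly (horner_eval (T i)); pose f' := map_poly (horner_eval (T' i)).
pose q1 := f (rev_eval i N T Q); pose q2 := f' (rev_eval i N T' Q).
pose p1 := f (fiber N T); pose p2 := f' (fiber N T').
have line (U : 'I_n -> R[i]) : line_point i (U i) 1 U =1 U.
  by move=> j; rewrite /line_point; case: eqP => [->//|_]; rewrite mul1r.
have evl (U : 'I_n -> R[i]) (W : mpoly n R[i]) : meval (fun j => (line_point i (U i) 1 U j)^-1) W = ev W U.
  by apply: meval_eq => j; rewrite line.
have pl (U : 'I_n -> R[i]) : \prod_j line_point i (U i) 1 U j ^+ B = \prod_j U j ^+ B.
  by apply: eq_bigr => j _; rewrite line.
have o0 : (1 : R[i]) != 0 by exact: oner_neq0.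
have q1E : q1.[1] = T i ^+ N * ev Q T by rewrite /q1 /f horner2 rev_evalE // expr1n mulr1 evl.
have q2E : q2.[1] = T' i ^+ N * ev Q T' by rewrite /q2 /f' horner2 rev_evalE // expr1n mulr1 evl.
have p1E : p1.[1] = T i ^+ N * (D (T i) * (ev P T * \prod_j T j ^+ B)).
  by rewrite /p1 /f horner2 fiberE // expr1n mulr1 evl pl.
have p2E : p2.[1] = T' i ^+ N * (D (T' i) * (ev P T' * \prod_j T' j ^+ B)).
  by rewrite /p2 /f' horner2 fiberE // expr1n mulr1 evl pl.
have z0 : q1 * q2 * (a%:P * p1 * q2 - a'%:P * p2 * q1) = 0.
  apply: vanishes_all => L.
  have v1 := engine_vanishing L sP sQ T0 (T0 i); have v2 := engine_vanishing L sP sQ T'0 (T'0 i).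
  rewrite map_combine -/f -/q1 -/p1 in v1; rewrite map_combine -/f' -/q2 -/p2 in v2.
  have eS : a%:P * f (main_sum N L T) = a'%:P * f' (main_sum N L T').
    rewrite /main_sum /f /f' !rmorph_sum !mulr_sumr /=; apply: eq_bigr => kap _.
    rewrite !rmorphM /= !map_polyXn !map_polyC /= !mulrA -!polyCM /= !horner_evalE !hornerZ; congr (_%:P * _).
    rewrite mulrCA hfe mulrCA !mulrA; congr (_ * _); rewrite -!mulrA; congr (_ * _).
    by rewrite /mono -big_split /=; apply: eq_bigr => j ji; rewrite Trho // exprMn mulrC.
  rewrite (cross_combine p1 p2 q1 q2 eS).
  by apply: vanishesB; exact: vanishes_mull.
have n1 : T i ^+ N != 0 by rewrite expf_neq0.
have n2 : T' i ^+ N != 0 by rewrite expf_neq0.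
have := congr1 (fun p => p.[1]) z0; rewrite horner0 eval_cross.
clear z0; clearbody q1 q2 p1 p2; rewrite q1E q2E p1E p2E => /eqP.
rewrite mulf_eq0 (negPf (mulf_neq0 (mulf_neq0 n1 Q0) (mulf_neq0 n2 Q'0))) /= => /eqP e.
clear -n1 n2 e.
move: (T i ^+ N) (T' i ^+ N) (D (T i)) (D (T' i)) (ev P T) (ev P T') (ev Q T) (ev Q T') n1 n2 e.
move: (\prod_j T j ^+ B) (\prod_j T' j ^+ B) => c1 c2 t1 t2 d1 d2 e1 e2 e3 e4 n1 n2 e.
apply: (mulfI (mulf_neq0 n1 n2)); apply/eqP; rewrite -subr_eq0; apply/eqP; rewrite -[RHS]e; ring.
Qed.
End ReflectionEngine.

(** * The simple reflections of P/Q *)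

Section OmegaReflection.
Variables (R : realType) (L : fieldType) (O : set L) (w : L) (c : {rmorphism L -> L}).
Variables (q : nat) (rho : 'I_q -> L) (th : L).
Hypothesis H : unramified_pair O w c rho th.
Hypothesis char0 : forall n, n.+1%:R != 0 :> L.
Variable m : nat.
Local Notation T := (borel_mx O w m).
Local Notation K := (max_compact O c m).
Variable mu : {measure set T -> \bar R}.
Hypothesis hmu : is_haar K mu.
Variable x : 'M[L]_m.
Hypothesis hx : herm_inv c x.
Local Notation n := m./2.
Variable e : nat.
Hypothesis v2 : valuation O w 2%:R = e.
Variables (P Q : mpoly n R[i]).
Hypothesis hPQ : is_omega c q mu x P Q.
Local Notation ev P T := (meval (fun j => (T j)^-1) P).
Local Notation xi := ((q%:R)^-1 : R[i]).

Lemma mass_bounds B kap : 0 <= mass c mu x B kap <= 1.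
Proof.
have [muK _ _] := hmu; have mK : measurable (K : set T) by exact: (max_compact_measurable H).
have mc := cell_measurable H x B kap.
rewrite /mass; set ce := (X in mu X) in mc *.
have le : (mu ce <= 1)%E by rewrite -muK; apply: le_measure; rewrite ?inE // => h [].
rewrite fine_ge0 ?measure_ge0 //=.
have fin : mu ce \is a fin_num.
  by rewrite ge0_fin_numE ?measure_ge0 //; apply: le_lt_trans le _; rewrite ltry.
by rewrite -lee_fin fineK.
Qed.

Variable B : nat.
Hypothesis hB : forall h (i : 'I_n), K h -> vg O w (- B%:Z) (corner_det (act_mx c h x) i).

Lemma rational_approx (T : 'I_n -> R[i]) : (forall j, T j != 0) -> (forall j, `|T j| <= 1) ->
  ev Q T != 0 -> forall (X : seq {ffun 'I_n -> nat}) (delta : R), uniq X -> 0 <= delta ->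
  (forall kap, kap \notin X -> `|\prod_j T j ^+ kap j| <= delta%:C) ->
  `|ev P T * \prod_j T j ^+ B - ev Q T * \sum_(kap <- X) (mass c mu x B kap)%:C * \prod_j T j ^+ kap j| <=
    `|ev Q T| * (delta + delta)%:C.
Proof.
move=> T0 T1 Q0 X delta uX d0 hX; have q1 := q_gt1 H.
have hs j : exists s : R[i], cpow (q%:R : R) s = (T j)^-1 by apply: cpow_surj; rewrite // invr_neq0.
have [f hf] := choice hs; pose s : 'rV[R[i]]_n := \row_j f j.
have sE j : cpow (q%:R : R) (s 0 j) = (T j)^-1 by rewrite mxE hf.
have evE (W : mpoly n R[i]) : eval_qpow q W s = ev W T by apply: meval_eq => j; rewrite sE.
have [_ hom] := hPQ.
have omE : omega_integral c q mu x s = ev P T / ev Q T.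
  rewrite hom; [by rewrite /ratfun !evE|move=> j|by rewrite evE].
  by apply: (cpow_ge1 q1); rewrite sE normfV invf_ge1 ?T1 // normr_gt0 T0.
set M := \prod_j T j ^+ B; have M0 : M != 0 by apply/prodf_neq0 => j _; rewrite expf_neq0.
have Mp : 0 < `|M| by rewrite normr_gt0.
have rM : 0 < complex.Re `|M| by rewrite -ltcR -norm_complexE.
have monE kap : monomial B (fun i => (cpow (q%:R : R) (s 0 i))^-1) kap = \prod_j T j ^+ kap j / M.
  rewrite /monomial /M -prodf_div; apply: eq_bigr => j _; by rewrite sE invrK expfzDr // -exprnN.
have := omega_approx H hmu hB (s := s) (delta := delta / complex.Re `|M|) uX.
rewrite divr_ge0 ?(ltW rM) // => /(_ isT) h.
rewrite omE in h.
have hk : `|ev P T / ev Q T - \sum_(kap <- X) (mass c mu x B kap)%:C * (\prod_j T j ^+ kap j / M)| <=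
    (delta / complex.Re `|M| + delta / complex.Re `|M|)%:C.
  have eqS : \sum_(kap <- X) (mass c mu x B kap)%:C * (\prod_j T j ^+ kap j / M) =
      \sum_(kap <- X) (mass c mu x B kap)%:C * monomial B (fun i => (cpow (q%:R : R) (s 0 i))^-1) kap.
    by apply: eq_bigr => k' _; rewrite monE.
  rewrite eqS; apply: h => kap kX; rewrite monE normf_div ler_pdivrMr // {2}(norm_complexE M) -(rmorphM (real_complex R)) divfK.
    exact: hX.
  exact: lt0r_neq0.
have -> : ev P T * M - ev Q T * (\sum_(kap <- X) (mass c mu x B kap)%:C * \prod_j T j ^+ kap j) =
    ev Q T * M * (ev P T / ev Q T - \sum_(kap <- X) (mass c mu x B kap)%:C * (\prod_j T j ^+ kap j / M)).
  under [in RHS]eq_bigr => kap _ do rewrite mulrA.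
  by rewrite -mulr_suml; field; rewrite Q0 M0.
rewrite normrM [`|_ * M|]normrM -mulrA ler_wpM2l //; apply: le_trans (ler_wpM2l (normr_ge0 _) hk) _.
rewrite {1}(norm_complexE M) -(rmorphM (real_complex R)) lecR -mulrDl mulrC divfK //.
exact: lt0r_neq0.
Qed.

Let mono (i : 'I_n) (r : 'I_n -> R[i]) (kap : {ffun 'I_n -> nat}) := \prod_(j | j != i) r j ^+ kap j.

(** The ratio of the series denominators 1 - d T_i^k at T and T' is -s2, so they cancel. The ratios
    [r] of the other variables absorb the power y^E of the functional equation, and [Wc] completes
    it when i = 0, where the preceding minor is constant. *)
Lemma reflect_generic (i : 'I_n) (k c0 : nat) (d y s1 s2 a nu Wc : R[i]) (G : {ffun 'I_n -> nat} -> {poly R[i]})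
    (E : {ffun 'I_n -> nat} -> nat) (T T' r : 'I_n -> R[i]) :
  (forall kap, ser k d (fun l => (mass c mu x B (set_exp i kap l))%:C) (G kap)) ->
  (forall j, T j != 0) -> (forall j, T' j != 0) -> (forall j, j != i -> T' j = T j * r j) ->
  T i = s1 * T' i -> - s2 * (1 - d * T' i ^+ k) = 1 - d * T i ^+ k -> 1 - d * T i ^+ k != 0 ->
  (forall kap, a * (G kap).[T i] = - (s2 * nu) * y ^+ (E kap + c0) * (G kap).[T' i]) ->
  (forall kap, mono i r kap * Wc = y ^+ E kap) -> y ^+ E [ffun=> B] = s1 ^+ B ->
  ev Q T != 0 -> ev Q T' != 0 ->
  a * ev P T * ev Q T' = nu * y ^+ c0 * ev P T' * ev Q T.
Proof.
move=> hG T0 T'0 Tr Ti Ds D0 hfe hW hE Q0 Q'0.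
have fe kap : a * (G kap).[T i] = - (s2 * nu) * y ^+ c0 * Wc * \prod_(j | j != i) r j ^+ kap j * (G kap).[T' i].
  by rewrite hfe exprD -hW /mono; ring.
have := reflection_identity (mass_bounds B) rational_approx hG T0 T'0 Tr fe Q0 Q'0.
set D : R[i] := 1 - d * T i ^+ k in Ds D0 *; set D' : R[i] := 1 - d * T' i ^+ k in Ds *.
have pE : \prod_j T' j ^+ B * Wc = \prod_j T j ^+ B.
  rewrite (bigD1 i) //= [in RHS](bigD1 i) //= Ti exprMn -hE -hW /mono.
  rewrite (_ : \prod_(j | j != i) T' j ^+ B = \prod_(j | j != i) T j ^+ B * \prod_(j | j != i) r j ^+ [ffun=> B] j).
    by ring.
  by rewrite -big_split /=; apply: eq_bigr => j ji; rewrite Tr // exprMn ffunE.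
move: pE; have : \prod_j T j ^+ B != 0 by apply/prodf_neq0 => j _; rewrite expf_neq0.
move: (\prod_j T j ^+ B) (\prod_j T' j ^+ B) => M M' M0 pE idn.
apply: (mulfI (mulf_neq0 D0 M0)).
clearbody D D'; transitivity (a * D * M * ev P T * ev Q T'); first by ring.
by rewrite idn -Ds -pE; ring.
Qed.

(** The power of y in the functional equation has as exponent the sum of the two neighbouring
    exponents; multiplying the neighbouring variables by y absorbs it. Exchanging z_i and z_{i+1}
    has exactly this effect on the q^(-s_j). *)
Lemma reflect_short (i : 'I_n) (y : R[i]) (T T' : 'I_n -> R[i]) : (i.+1 < n)%N ->
  (forall j, T j != 0) -> (forall j, T' j != 0) -> y != 0 -> - xi * T i = y -> T i = y ^+ 2 * T' i ->
  (forall j, j != i -> T' j = T j * (if (j == i.+1 :> nat) || (j.+1 == i :> nat) then y else 1)) ->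
  1 - y ^+ 2 != 0 -> ev Q T != 0 -> ev Q T' != 0 ->
  (y - xi) * ev P T * ev Q T' = (1 - xi * y) * ev P T' * ev Q T.
Proof.
move=> hi T0 T'0 y0 yT TT' Tr D0 Q0 Q'0.
have hy' : - xi * T' i = y^-1.
  by apply: (mulfI (expf_neq0 2 y0)); rewrite mulrCA -TT' yT; field.
have yx : xi ^+ 2 * T i ^+ 2 = y ^+ 2 by rewrite -yT exprMn sqrrN.
have yx' : xi ^+ 2 * T' i ^+ 2 = y ^- 2 by rewrite -exprVn -hy' exprMn sqrrN.
have hG kap := mass_short H hmu hx hB v2 kap hi.
pose G kap := s2val (cid2 (hG kap)); have hGs kap := s2valP (cid2 (hG kap)).
have hGf kap := s2valP' (cid2 (hG kap)).
have oS : (i.+1 %% n = i.+1)%N by rewrite modn_small.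
suff : (y - xi) * ev P T * ev Q T' = (1 - xi * y) * y ^+ 0 * ev P T' * ev Q T by rewrite expr0 mulr1.
apply: (@reflect_generic i 2 0 (xi ^+ 2) y (y ^+ 2) (y ^+ 2) _ _ (y ^+ (if (0 < i)%N then 0 else B)) G
  (fun kap => (prev_exp B kap i + kap (ordS i))%N) T T'
  (fun j => if (j == i.+1 :> nat) || (j.+1 == i :> nat) then y else 1)) => //.
- by rewrite yx yx'; field.
- by rewrite yx.
- by move=> kap; rewrite addn0; apply: hGf.
- move=> kap; rewrite /mono (bigD1 (ordS i)) /=; last by rewrite -val_eqE /= oS; lia.
  rewrite oS eqxx /= /prev_exp; case: ltnP => i0.
    rewrite (bigD1 (prv i)) /=; last by rewrite -!val_eqE /= oS; lia.
    rewrite prednK // eqxx orbT big1 => [|j /andP[/andP[j1 j2] j3]].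
      by rewrite expr0 !mulr1 exprD mulrC.
    rewrite ifN ?expr1n //; move: j1 j2 j3; rewrite -!val_eqE /= oS; lia.
  rewrite big1 => [|j /andP[j1 j2]]; first by rewrite mulr1 exprD mulrC.
  rewrite ifN ?expr1n //; move: j1 j2; rewrite -!val_eqE /= oS; lia.
- by rewrite /prev_exp !ffunE if_same -exprM; congr (y ^+ _); lia.
Qed.

Lemma reflect_long_even (i : 'I_n) (y : R[i]) (T T' : 'I_n -> R[i]) : i.+1 == n -> ~~ odd m ->
  (forall j, T j != 0) -> (forall j, T' j != 0) -> y != 0 -> xi * T i ^+ 2 = y -> T i = y * T' i ->
  (forall j, j != i -> T' j = T j * (if j.+1 == i :> nat then y else 1)) ->
  1 - y != 0 -> ev Q T != 0 -> ev Q T' != 0 ->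
  1 * ev P T * ev Q T' = y ^+ e * ev P T' * ev Q T.
Proof.
move=> hi mo T0 T'0 y0 yT TT' Tr D0 Q0 Q'0.
have hy' : xi * T' i ^+ 2 = y^-1.
  by apply: (mulfI (expf_neq0 2 y0)); rewrite mulrCA -exprMn -TT' yT; field.
have hG kap := mass_long_even H char0 hmu hx hB v2 kap hi mo.
pose G kap := s2val (cid2 (hG kap)); have hGs kap := s2valP (cid2 (hG kap)).
have hGf kap := s2valP' (cid2 (hG kap)).
rewrite -[y ^+ e]mul1r.
apply: (@reflect_generic i 2 e xi y y y _ _ (y ^+ (if (0 < i)%N then 0 else B)) G
  (fun kap => prev_exp B kap i) T T' (fun j => if j.+1 == i :> nat then y else 1)) => //.
- by rewrite yT hy'; field.
- by rewrite yT.
- by move=> kap; rewrite mulr1; apply: hGf.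
- move=> kap; rewrite /mono /prev_exp; case: ltnP => i0.
    rewrite (bigD1 (prv i)) /=; last by rewrite -!val_eqE /=; lia.
    rewrite prednK // eqxx big1 => [|j /andP[j2 j3]]; first by rewrite expr0 !mulr1.
    rewrite ifN ?expr1n //; move: j2 j3; rewrite -!val_eqE /=; lia.
  rewrite big1 => [|j j1]; first by rewrite mul1r.
  rewrite ifN ?expr1n //; lia.
- by rewrite /prev_exp !ffunE if_same.
Qed.

Lemma reflect_long_odd (i : 'I_n) (y : R[i]) (T T' : 'I_n -> R[i]) : i.+1 == n -> odd m ->
  (forall j, T j != 0) -> (forall j, T' j != 0) -> y != 0 -> - xi ^+ 2 * T i ^+ 2 = y -> T i = y * T' i ->
  (forall j, j != i -> T' j = T j * (if j.+1 == i :> nat then y else 1)) ->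
  1 - y ^+ 2 != 0 -> ev Q T != 0 -> ev Q T' != 0 ->
  (y - xi) * ev P T * ev Q T' = (1 - xi * y) * y ^+ e * ev P T' * ev Q T.
Proof.
move=> hi mo T0 T'0 y0 yT TT' Tr D0 Q0 Q'0.
have hy' : - xi ^+ 2 * T' i ^+ 2 = y^-1.
  by apply: (mulfI (expf_neq0 2 y0)); rewrite mulrCA -exprMn -TT' yT; field.
have yx : xi ^+ 4 * T i ^+ 4 = y ^+ 2 by rewrite -yT; ring.
have yx' : xi ^+ 4 * T' i ^+ 4 = y ^- 2 by rewrite -exprVn -hy'; ring.
have hG kap := mass_long_odd H char0 hmu hx hB v2 kap hi mo.
pose G kap := s2val (cid2 (hG kap)); have hGs kap := s2valP (cid2 (hG kap)).
have hGf kap := s2valP' (cid2 (hG kap)).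
apply: (@reflect_generic i 4 e (xi ^+ 4) y y (y ^+ 2) _ _ (y ^+ (if (0 < i)%N then 0 else B)) G
  (fun kap => prev_exp B kap i) T T' (fun j => if j.+1 == i :> nat then y else 1)) => //.
- by rewrite yx yx'; field.
- by rewrite yx.
- by move=> kap; apply: hGf.
- move=> kap; rewrite /mono /prev_exp; case: ltnP => i0.
    rewrite (bigD1 (prv i)) /=; last by rewrite -!val_eqE /=; lia.
    rewrite prednK // eqxx big1 => [|j /andP[j2 j3]]; first by rewrite expr0 !mulr1.
    rewrite ifN ?expr1n //; move: j2 j3; rewrite -!val_eqE /=; lia.
  rewrite big1 => [|j j1]; first by rewrite mul1r.
  rewrite ifN ?expr1n //; lia.
- by rewrite /prev_exp !ffunE if_same.
Qed.
End OmegaReflection.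

(** * The torus and its Weyl group *)

Section LaurentFunctions.
Variables (F : numFieldType) (n : nat).
Implicit Types (Z : 'I_n -> F) (f g : ('I_n -> F) -> F).

Definition on_torus Z : Prop := forall j, Z j != 0.
Definition torus_line (Z0 Z1 : 'I_n -> F) (t : F) (j : 'I_n) : F := Z0 j + t * (Z1 j - Z0 j).

(* Only the restrictions to lines are required to be Laurent polynomials; this
   suffices to have an integral domain of functions on the torus. *)
Definition laurent f : Prop := forall Z0 Z1, on_torus Z0 -> on_torus Z1 ->
  exists (p : {poly F}) (N : nat), forall t, on_torus (torus_line Z0 Z1 t) ->
    f (torus_line Z0 Z1 t) * (\prod_j torus_line Z0 Z1 t j) ^+ N = p.[t].

Let coord (Z0 Z1 : 'I_n -> F) (j : 'I_n) : {poly F} := (Z0 j)%:P + (Z1 j - Z0 j) *: 'X.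
Let coordE Z0 Z1 j t : (coord Z0 Z1 j).[t] = torus_line Z0 Z1 t j.
Proof. by rewrite /coord !hornerE /torus_line mulrC. Qed.
Let all_coord (Z0 Z1 : 'I_n -> F) : {poly F} := \prod_j coord Z0 Z1 j.
Let all_coordE Z0 Z1 t : (all_coord Z0 Z1).[t] = \prod_j torus_line Z0 Z1 t j.
Proof. by rewrite /all_coord horner_prod; apply: eq_bigr => j _; rewrite coordE. Qed.

Lemma laurent_ext f g : (forall Z, on_torus Z -> f Z = g Z) -> laurent f -> laurent g.
Proof.
move=> e hf Z0 Z1 h0 h1; have [p [N hp]] := hf _ _ h0 h1; exists p, N => t ht.
by rewrite -e // hp.
Qed.
Lemma laurent_cst a : laurent (fun=> a).
Proof. by move=> Z0 Z1 _ _; exists a%:P, 0%N => t _; rewrite expr0 mulr1 hornerC. Qed.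
Lemma laurentM f g : laurent f -> laurent g -> laurent (fun Z => f Z * g Z).
Proof.
move=> hf hg Z0 Z1 h0 h1; have [p [N hp]] := hf _ _ h0 h1; have [p' [N' hp']] := hg _ _ h0 h1.
by exists (p * p'), (N + N')%N => t ht; rewrite hornerM -hp // -hp' // exprD; ring.
Qed.
Lemma laurentD f g : laurent f -> laurent g -> laurent (fun Z => f Z + g Z).
Proof.
move=> hf hg Z0 Z1 h0 h1; have [p [N hp]] := hf _ _ h0 h1; have [p' [N' hp']] := hg _ _ h0 h1.
exists (p * all_coord Z0 Z1 ^+ N' + p' * all_coord Z0 Z1 ^+ N), (N + N')%N => t ht.
by rewrite hornerD !hornerM !horner_exp all_coordE -hp // -hp' // exprD; ring.
Qed.
Lemma laurentB f g : laurent f -> laurent g -> laurent (fun Z => f Z - g Z).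
Proof.
move=> hf hg; apply: laurentD => //; apply: (@laurent_ext (fun Z => -1 * g Z)) => [Z _|].
  by rewrite mulN1r.
exact: laurentM (laurent_cst _) hg.
Qed.
Lemma laurent_coord j : laurent (fun Z => Z j).
Proof. by move=> Z0 Z1 _ _; exists (coord Z0 Z1 j), 0%N => t _; rewrite expr0 mulr1 coordE. Qed.
Lemma laurent_coordV j : laurent (fun Z => (Z j)^-1).
Proof.
move=> Z0 Z1 _ _; exists (\prod_(k | k != j) coord Z0 Z1 k), 1%N => t ht.
rewrite expr1 (bigD1 j) //= mulKf ?ht // horner_prod; apply: eq_bigr => k _; by rewrite coordE.
Qed.
Lemma laurentX f k : laurent f -> laurent (fun Z => f Z ^+ k).
Proof.
move=> hf; elim: k => [|k IH].
  by apply: laurent_ext (laurent_cst 1) => Z _; rewrite expr0.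
by apply: laurent_ext (laurentM hf IH) => Z _; rewrite exprS.
Qed.
Lemma laurent_sum (I : Type) (r : seq I) (G : I -> ('I_n -> F) -> F) :
  (forall i, laurent (G i)) -> laurent (fun Z => \sum_(i <- r) G i Z).
Proof.
move=> hG; elim: r => [|i r IH].
  by apply: laurent_ext (laurent_cst 0) => Z _; rewrite big_nil.
by apply: laurent_ext (laurentD (hG i) IH) => Z _; rewrite big_cons.
Qed.
Lemma laurent_prod (I : Type) (r : seq I) (G : I -> ('I_n -> F) -> F) :
  (forall i, laurent (G i)) -> laurent (fun Z => \prod_(i <- r) G i Z).
Proof.
move=> hG; elim: r => [|i r IH].
  by apply: laurent_ext (laurent_cst 1) => Z _; rewrite big_nil.
by apply: laurent_ext (laurentM (hG i) IH) => Z _; rewrite big_cons.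
Qed.
Lemma laurent_meval k (h : 'I_k -> ('I_n -> F) -> F) (P : mpoly k F) :
  (forall j, laurent (h j)) -> laurent (fun Z => meval (fun j => h j Z) P).
Proof.
move=> hh; apply: (@laurent_ext (fun Z => \sum_(mm <- msupp P) mcoeff mm P * \prod_j h j Z ^+ mm j)).
  by move=> Z _; rewrite mevalE.
apply: laurent_sum => mm; apply: laurentM; first exact: laurent_cst.
by apply: laurent_prod => j; apply: laurentX.
Qed.

(** On the line joining a point where f is nonzero to one where g is nonzero, both restrict to
    nonzero polynomials up to powers of the coordinates. Their product, multiplied by the
    coordinates so as to vanish also where the line leaves the torus, would be zero everywhere. *)
Lemma laurent_domain f g : laurent f -> laurent g -> (forall Z, on_torus Z -> f Z * g Z = 0) ->
  (exists2 Z, on_torus Z & g Z != 0) -> forall Z, on_torus Z -> f Z = 0.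
Proof.
move=> hf hg fg [Z0 h0 g0] Z1 h1; apply/eqP/negPn/negP => f1.
have [p [N hp]] := hf _ _ h0 h1; have [p' [N' hp']] := hg _ _ h0 h1.
have l0 : torus_line Z0 Z1 0 = Z0 by apply: funext => j; rewrite /torus_line mul0r addr0.
have l1 : torus_line Z0 Z1 1 = Z1 by apply: funext => j; rewrite /torus_line mul1r addrC subrK.
have pr Z : on_torus Z -> \prod_j Z j != 0 by move=> hZ; apply/prodf_neq0 => j _; exact: hZ.
have n1 : p != 0.
  apply/eqP => e; have := hp 1; rewrite l1 => /(_ h1); rewrite e horner0 => /eqP.
  by rewrite mulf_eq0 (negPf f1) expf_eq0 (negPf (pr _ h1)) andbF.
have n2 : p' != 0.
  apply/eqP => e; have := hp' 0; rewrite l0 => /(_ h0); rewrite e horner0 => /eqP.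
  by rewrite mulf_eq0 (negPf g0) expf_eq0 (negPf (pr _ h0)) andbF.
have n3 : all_coord Z0 Z1 != 0.
  by apply/eqP => e; have := all_coordE Z0 Z1 0; rewrite l0 e horner0 => /eqP; rewrite eq_sym (negPf (pr _ h0)).
have := mulf_neq0 (mulf_neq0 n1 n2) n3; set W := _ * _ => /eqP; apply.
have W0 t : W.[t] = 0.
  rewrite /W !hornerM; have [ht|nt] := pselect (on_torus (torus_line Z0 Z1 t)).
    rewrite -hp // -hp' //; have := fg _ ht; set u := f _; set v := g _ => e.
    by rewrite mulrACA e !mul0r.
  rewrite all_coordE; have [j /negP] : exists j, ~ (torus_line Z0 Z1 t j != 0).
    by apply: contrapT => h; apply: nt => j; apply: contrapT => h'; apply: h; exists j.
  by rewrite negbK => /eqP e; rewrite (bigD1 j) //= e mul0r mulr0.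
apply: (@roots_geq_poly_eq0 _ _ [seq (k%:R : F) | k <- iota 0 (size W)]).
- by apply/allP => z _; apply/eqP; exact: W0.
- by rewrite map_inj_uniq ?iota_uniq // => k k' /eqP; rewrite eqr_nat => /eqP.
- by rewrite size_map size_iota.
Qed.
End LaurentFunctions.

Section TorusAction.
Variables (F : numFieldType) (n : nat).
Implicit Types (Z : 'I_n -> F) (u v : signed_perm n).

Definition act_torus u Z (j : 'I_n) : F := if u.2 j then (Z (u.1 j))^-1 else Z (u.1 j).
Definition simple (i : 'I_n) : signed_perm n :=
  if (i.+1 < n)%N then (tperm i (ordS i), [ffun=> false]) else (1%g, [ffun j => j == i]).
Definition comp_signed v u : signed_perm n := ((v.1 * u.1)%g, [ffun j => v.2 j (+) u.2 (v.1 j)]).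

Lemma act_torus_on u Z : on_torus Z -> on_torus (act_torus u Z).
Proof. by move=> h j; rewrite /act_torus; case: ifP; rewrite ?invr_eq0. Qed.

Lemma act_torus_comp v u Z : act_torus (comp_signed v u) Z = act_torus v (act_torus u Z).
Proof.
apply: funext => j; rewrite /act_torus /= ffunE permM.
by case: (v.2 j); case: (u.2 _); rewrite //= invrK.
Qed.

Lemma act_torus_surj u Z : on_torus Z -> exists2 Z', on_torus Z' & act_torus u Z' = Z.
Proof.
move=> h; exists (fun k => let j := (u.1^-1)%g k in if u.2 j then (Z j)^-1 else Z j).
  by move=> k /=; case: ifP; rewrite ?invr_eq0.
by apply: funext => j; rewrite /act_torus /= permK; case: (u.2 j); rewrite ?invrK.
Qed.

Lemma laurent_act u j : laurent (fun Z => act_torus u Z j) /\ laurent (fun Z => (act_torus u Z j)^-1).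
Proof.
rewrite /act_torus; case: (u.2 j); split; try exact: laurent_coord; try exact: laurent_coordV.
by apply: laurent_ext (laurent_coord (u.1 j)) => Z _; rewrite invrK.
Qed.

Variables (xi cst : F).
Hypothesis xi0 : xi != 0.
Hypothesis cst0 : cst != 0.

(* The numbers [q ^ s_i] in terms of the [q ^ z_i]. *)
Definition torus_s Z (j : 'I_n) : F := if (j.+1 < n)%N then - xi * Z (ordS j) / Z j else cst / Z j.

Lemma torus_s_on Z : on_torus Z -> on_torus (torus_s Z).
Proof. by move=> h j; rewrite /torus_s; case: ifP => _; rewrite !mulf_neq0 ?oppr_eq0 ?invr_eq0 ?h. Qed.

Lemma laurent_torus_s u (P : mpoly n F) : laurent (fun Z => meval (torus_s (act_torus u Z)) P).
Proof.
apply: (laurent_meval (h := fun j Z => torus_s (act_torus u Z) j)) => j; rewrite /torus_s; case: (j.+1 < n)%N.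
  apply: laurentM; last exact: (laurent_act u j).2.
  by apply: laurentM; [exact: laurent_cst|exact: (laurent_act u _).1].
by apply: laurentM; [exact: laurent_cst|exact: (laurent_act u j).2].
Qed.

Variables (P Q : mpoly n F) (odd_case : bool) (e : nat).
Hypothesis cst2 : cst ^+ 2 = if odd_case then - xi ^+ 2 else xi.
Local Notation ev P T := (meval (fun j => (T j)^-1) P).
Hypothesis refl_short : forall (i : 'I_n) (y : F) (T T' : 'I_n -> F), (i.+1 < n)%N ->
  (forall j, T j != 0) -> (forall j, T' j != 0) -> y != 0 -> - xi * T i = y -> T i = y ^+ 2 * T' i ->
  (forall j, j != i -> T' j = T j * (if (j == i.+1 :> nat) || (j.+1 == i :> nat) then y else 1)) ->
  1 - y ^+ 2 != 0 -> ev Q T != 0 -> ev Q T' != 0 ->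
  (y - xi) * ev P T * ev Q T' = (1 - xi * y) * ev P T' * ev Q T.
Hypothesis refl_even : forall (i : 'I_n) (y : F) (T T' : 'I_n -> F), i.+1 == n -> ~~ odd_case ->
  (forall j, T j != 0) -> (forall j, T' j != 0) -> y != 0 -> xi * T i ^+ 2 = y -> T i = y * T' i ->
  (forall j, j != i -> T' j = T j * (if j.+1 == i :> nat then y else 1)) ->
  1 - y != 0 -> ev Q T != 0 -> ev Q T' != 0 ->
  1 * ev P T * ev Q T' = y ^+ e * ev P T' * ev Q T.
Hypothesis refl_odd : forall (i : 'I_n) (y : F) (T T' : 'I_n -> F), i.+1 == n -> odd_case ->
  (forall j, T j != 0) -> (forall j, T' j != 0) -> y != 0 -> - xi ^+ 2 * T i ^+ 2 = y -> T i = y * T' i ->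
  (forall j, j != i -> T' j = T j * (if j.+1 == i :> nat then y else 1)) ->
  1 - y ^+ 2 != 0 -> ev Q T != 0 -> ev Q T' != 0 ->
  (y - xi) * ev P T * ev Q T' = (1 - xi * y) * y ^+ e * ev P T' * ev Q T.
Hypothesis Q_nonzero : exists2 Z, on_torus Z & meval (torus_s Z) Q != 0.

Definition root_num (short : bool) (y : F) : F :=
  if short then 1 - xi * y else if odd_case then (1 - xi * y) * y ^+ e else y ^+ e.
Definition root_den (short : bool) (y : F) : F := if short || odd_case then y - xi else 1.
Definition simple_value (i : 'I_n) Z : F := if (i.+1 < n)%N then Z i / Z (ordS i) else Z i ^+ 2.

(** The series denominator 1 - d T_i^k expressed in y. It has cancelled from the identity and
    survives only as an exception, to be removed by [laurent_domain]. *)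
Let pole (i : 'I_n) (y : F) : F := if (i.+1 < n)%N || odd_case then 1 - y ^+ 2 else 1 - y.

Let evT Z (W : mpoly n F) : ev W (fun j => (torus_s Z j)^-1) = meval (torus_s Z) W.
Proof. by apply: meval_eq => j; rewrite invrK. Qed.

Let simple_generic (i : 'I_n) Z : on_torus Z -> pole i (simple_value i Z) != 0 ->
  meval (torus_s Z) Q != 0 -> meval (torus_s (act_torus (simple i) Z)) Q != 0 ->
  root_den (i.+1 < n)%N (simple_value i Z) * meval (torus_s Z) P * meval (torus_s (act_torus (simple i) Z)) Q =
  root_num (i.+1 < n)%N (simple_value i Z) * meval (torus_s (act_torus (simple i) Z)) P * meval (torus_s Z) Q.
Proof.
move=> hZ; rewrite /pole /root_den /root_num /simple_value /simple; case hi: (i.+1 < n)%N => /= D0 Q0 Q'0.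
  have oi : ordS i = i.+1 :> nat := modn_small hi.
  set Z' := act_torus _ _ in Q'0 *; rewrite -!evT.
  have Z'E j : Z' j = Z (tperm i (ordS i) j) by rewrite /Z' /act_torus /= ffunE.
  have Z'0 : on_torus Z' by exact: act_torus_on.
  have T0 := torus_s_on hZ; have T'0 := torus_s_on Z'0.
  apply: (@refl_short i) => //; rewrite ?evT //.
  - by move=> j; rewrite invr_eq0.
  - by move=> j; rewrite invr_eq0.
  - by rewrite mulf_neq0 ?invr_eq0.
  - by rewrite /torus_s hi; field; rewrite xi0 !hZ.
  - by rewrite /torus_s hi !Z'E tpermL tpermR; field; rewrite xi0 !hZ.
  move=> j ji; rewrite /torus_s !Z'E.
  have ne (a b : 'I_n) : nat_of_ord a <> nat_of_ord b -> a != b by move=> h; apply/eqP => e'; apply: h; rewrite e'.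
  have jn : nat_of_ord j <> i by move=> h; move/eqP: ji; apply; exact: val_inj.
  have oj : (j.+1 < n)%N -> ordS j = j.+1 :> nat := @modn_small _ _.
  have [j1|j1] := eqVneq (j : nat) i.+1.
    have -> : j = ordS i by apply: ord_inj; rewrite j1 oi.
    rewrite tpermR /=; case: ifP => h.
      have o2 : ordS (ordS i) = i.+2 :> nat by transitivity ((ordS i).+1); [exact: modn_small h|rewrite oi].
      rewrite tpermD; [by field; rewrite xi0 !hZ|apply: ne; rewrite o2; lia|apply: ne; rewrite o2 oi; lia].
    by field; rewrite cst0 !hZ.
  have [j2|j2] := eqVneq (j.+1 : nat) i.
    have ej : ordS j = i by apply: ord_inj; rewrite oj ?j2.
    have -> : (j.+1 < n)%N by rewrite j2.
    rewrite ej tpermL tpermD /=; [by field; rewrite xi0 !hZ|apply: ne; lia|apply: ne; rewrite oi; lia].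
  rewrite /= mulr1; case: ifP => h.
    rewrite !tpermD //; apply: ne; rewrite ?oj ?oi //; lia.
  by rewrite tpermD //; apply: ne; rewrite ?oi; lia.
have hn : i.+1 == n by rewrite eqn_leq ltn_ord leqNgt hi.
set Z' := act_torus _ _ in Q'0 *.
have Z'E j : Z' j = if j == i then (Z j)^-1 else Z j by rewrite /Z' /act_torus /= ffunE perm1.
have Z'0 : on_torus Z' by exact: act_torus_on.
have T0 j : (torus_s Z j)^-1 != 0 by rewrite invr_eq0; exact: torus_s_on.
have T'0 j : (torus_s Z' j)^-1 != 0 by rewrite invr_eq0; exact: torus_s_on.
have y0 : Z i ^+ 2 != 0 by rewrite expf_neq0.
have TT : (torus_s Z i)^-1 = Z i ^+ 2 * (torus_s Z' i)^-1.
  by rewrite /torus_s hi Z'E eqxx; field; rewrite cst0 !hZ.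
have Tj j : j != i -> (torus_s Z' j)^-1 = (torus_s Z j)^-1 * (if j.+1 == i :> nat then Z i ^+ 2 else 1).
  move=> ji; have jn : nat_of_ord j <> i by move=> h; move/eqP: ji; apply; exact: val_inj.
  have hj : (j.+1 < n)%N by have := ltn_ord j; move/eqP: hn; lia.
  rewrite /torus_s hj !Z'E (negPf ji); have oj : ordS j = j.+1 :> nat by rewrite /= modn_small.
  have -> : (ordS j == i) = (j.+1 == i :> nat) by rewrite -(inj_eq (@ord_inj n)) oj.
  case: ifP => h; last by rewrite mulr1.
  have -> : ordS j = i by apply: ord_inj; rewrite oj; apply/eqP.
  by field; rewrite xi0 !hZ.
case od : odd_case cst2 D0 => c2 D0; rewrite -!evT.
  apply: (@refl_odd i) => //; rewrite ?evT //.
  by rewrite /torus_s hi exprVn exprMn exprVn c2; field; rewrite xi0 hZ.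
apply: (@refl_even i) => //; rewrite ?evT ?od //.
by rewrite /torus_s hi exprVn exprMn exprVn c2; field; rewrite xi0 hZ.
Qed.

Let laurent_value i : laurent (simple_value i).
Proof.
rewrite /simple_value; case: (i.+1 < n)%N; last by apply: laurentX; exact: laurent_coord.
by apply: laurentM; [exact: laurent_coord|exact: laurent_coordV].
Qed.
Lemma laurent_num b (h : ('I_n -> F) -> F) : laurent h -> laurent (fun Z => root_num b (h Z)).
Proof.
move=> hh; have l1 : laurent (fun Z => 1 - xi * h Z).
  by apply: laurentB; [exact: laurent_cst|apply: laurentM => //; exact: laurent_cst].
rewrite /root_num; case: b => //; case: odd_case; last exact: laurentX.
by apply: laurentM => //; exact: laurentX.
Qed.
Lemma laurent_den b (h : ('I_n -> F) -> F) : laurent h -> laurent (fun Z => root_den b (h Z)).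
Proof.
move=> hh; rewrite /root_den; case: (b || odd_case); last exact: laurent_cst.
by apply: laurentB => //; exact: laurent_cst.
Qed.
Lemma laurent_id (W : mpoly n F) : laurent (fun Z => meval (torus_s Z) W).
Proof.
apply: laurent_ext (laurent_torus_s (1%g, [ffun=> false]) W) => Z _; apply: meval_eq => j.
by rewrite /torus_s /act_torus /= !ffunE !perm1.
Qed.
Lemma Q_act u : exists2 Z, on_torus Z & meval (torus_s (act_torus u Z)) Q != 0.
Proof.
have [Z hZ Q0] := Q_nonzero; have [Z' hZ' e'] := act_torus_surj u hZ.
by exists Z'; rewrite // e'.
Qed.

(** Both sides are Laurent functions, and the factors excluded so far, Q at the two points and
    [pole], are not identically zero; so the identity holds on the whole torus. *)
Lemma simple_identity (i : 'I_n) Z : on_torus Z ->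
  root_den (i.+1 < n)%N (simple_value i Z) * meval (torus_s Z) P * meval (torus_s (act_torus (simple i) Z)) Q =
  root_num (i.+1 < n)%N (simple_value i Z) * meval (torus_s (act_torus (simple i) Z)) P * meval (torus_s Z) Q.
Proof.
move: Z; set lhs := (X in forall Z, _ -> X Z = _); set rhs := (X in forall Z, _ -> _ = X Z).
suff h Z : on_torus Z -> root_den (i.+1 < n)%N (simple_value i Z) * meval (torus_s Z) P * meval (torus_s (act_torus (simple i) Z)) Q -
  root_num (i.+1 < n)%N (simple_value i Z) * meval (torus_s (act_torus (simple i) Z)) P * meval (torus_s Z) Q = 0.
  by move=> Z hZ; apply/eqP; rewrite -subr_eq0; apply/eqP; exact: h.
have lv := laurent_value i.
have ld : laurent (fun Z => root_den (i.+1 < n)%N (simple_value i Z) * meval (torus_s Z) P *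
    meval (torus_s (act_torus (simple i) Z)) Q -
  root_num (i.+1 < n)%N (simple_value i Z) * meval (torus_s (act_torus (simple i) Z)) P * meval (torus_s Z) Q).
  apply: laurentB; apply: laurentM; try exact: laurent_torus_s; try exact: laurent_id.
    by apply: laurentM; [exact: laurent_den|exact: laurent_id].
  by apply: laurentM; [exact: laurent_num|exact: laurent_torus_s].
have lp : laurent (fun Z => pole i (simple_value i Z)).
  by rewrite /pole; case: (_ || _); apply: laurentB => //; try exact: laurent_cst; exact: laurentX.
move: Z; apply: (laurent_domain ld (laurent_id Q)) => // Z hZ; move: Z hZ.
apply: (laurent_domain (laurentM ld (laurent_id Q)) (laurent_torus_s (simple i) Q)); last exact: Q_act.
apply: (laurent_domain (laurentM (laurentM ld (laurent_id Q)) (laurent_torus_s (simple i) Q)) lp) => [Z hZ|].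
  have [->|D0] := eqVneq (pole i (simple_value i Z)) 0; first by rewrite mulr0.
  have [->|Q0] := eqVneq (meval (torus_s Z) Q) 0; first by rewrite mulr0 !mul0r.
  have [->|Q'0] := eqVneq (meval (torus_s (act_torus (simple i) Z)) Q) 0; first by rewrite mulr0 mul0r.
  by rewrite simple_generic // subrr !mul0r.
(* At this point y is 2 for a short root and 4 for a long one, so neither 1 - y nor 1 - y^2
   vanishes. *)
exists (fun j => if j == i then 2%:R else 1) => [j|]; first by rewrite /=; case: (j == i); rewrite ?pnatr_eq0 ?oner_eq0.
have one_sub (k : nat) : (1 < k)%N -> (1 - k%:R : F) != 0.
  by move=> hk; rewrite subr_eq0 eq_sym (eqr_nat F k 1); lia.
rewrite /pole /simple_value eqxx; case hi: (i.+1 < n)%N => /=.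
  rewrite ifN; last by rewrite -val_eqE /= modn_small //; lia.
  by rewrite divr1 -natrX; exact: one_sub.
by case: odd_case; rewrite -!natrX; exact: one_sub.
Qed.
End TorusAction.

(** * Roots of type C *)

Section RootCombinatorics.
Variable n : nat.
Implicit Types (u v : signed_perm n) (a b : 'rV[int]_n).
Local Notation uu := (@unit_row n).

Lemma act_signedD u a b : act_signed u (a + b) = act_signed u a + act_signed u b.
Proof. by apply/rowP => j; rewrite !mxE mulrDr. Qed.
Lemma act_signedN u a : act_signed u (- a) = - act_signed u a.
Proof. by apply/rowP => j; rewrite !mxE mulrN. Qed.
Lemma act_signedZ u (t : int) a : act_signed u (t *: a) = t *: act_signed u a.
Proof. by apply/rowP => j; rewrite !mxE mulrCA. Qed.
Lemma act_signed_comp v u a : act_signed (comp_signed v u) a = act_signed v (act_signed u a).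
Proof. by apply/rowP => j; rewrite !mxE /= ffunE permM signr_addb mulrA. Qed.
Lemma act_signed_unit u k : act_signed u (uu (u.1 k)) = (-1) ^+ u.2 k *: uu k.
Proof.
apply/rowP => j; rewrite !mxE !eqxx /= (inj_eq perm_inj).
by case: eqP => [->|]; rewrite ?mulr0 ?mulr1.
Qed.
Lemma act_signed_inj u : injective (act_signed u : 'rV[int]_n -> _).
Proof.
move=> a b e; apply/rowP => j; have /rowP/(_ ((u.1^-1)%g j)) := e; rewrite !mxE permKV.
by move/(mulfI _); apply; rewrite signr_eq0.
Qed.

Definition simple_root (i : 'I_n) : 'rV[int]_n := if (i.+1 < n)%N then uu i - uu (ordS i) else uu i *+ 2.

Lemma act_simple_unit (i t : 'I_n) : act_signed (simple i) (uu t) =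
  if (i.+1 < n)%N then uu (tperm i (ordS i) t) else (-1) ^+ (t == i) *: uu t.
Proof.
rewrite /simple; case: (i.+1 < n)%N.
  have := act_signed_unit (tperm i (ordS i), [ffun=> false]) (tperm i (ordS i) t).
  by rewrite /= tpermK ffunE scale1r.
have := act_signed_unit (1%g, [ffun j => j == i]) t; by rewrite /= perm1 ffunE.
Qed.

Lemma act_simpleK i a : act_signed (simple i) (act_signed (simple i) a) = a.
Proof.
apply/rowP => j; rewrite !mxE /simple; case: (i.+1 < n)%N => /=.
  by rewrite !ffunE !mul1r tpermK.
by rewrite !ffunE !perm1 mulrA -expr2 sqrr_sign mul1r.
Qed.

Lemma short_rootsP a : reflect (exists s t : 'I_n, (s < t)%N /\ (a = uu s + uu t \/ a = uu s - uu t))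
  (a \in short_roots n).
Proof.
have hp (t : 'I_n * 'I_n) : (t \in lt_pairs n) = (t.1 < t.2)%N by rewrite mem_filter mem_enum andbT.
rewrite mem_cat; apply: (iffP orP) => [[]/mapP[t]|[s [t [st [->|->]]]]].
- by rewrite hp => h ->; exists t.1, t.2; split=> //; left.
- by rewrite hp => h ->; exists t.1, t.2; split=> //; right.
- by left; apply/mapP; exists (s, t); rewrite ?hp.
- by right; apply/mapP; exists (s, t); rewrite ?hp.
Qed.
Lemma pos_rootsP a : reflect ((exists s t : 'I_n, (s < t)%N /\ (a = uu s + uu t \/ a = uu s - uu t)) \/
  exists s, a = uu s *+ 2) (a \in pos_roots n).
Proof.
apply: (iffP idP); rewrite mem_cat.
  by case/orP => [/short_rootsP h|/mapP[s _ ->]]; [left|right; exists s].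
case=> [h|[s ->]]; apply/orP; first by left; exact/short_rootsP.
by right; apply/mapP; exists s; rewrite ?mem_enum.
Qed.
Lemma pos_add (s t : 'I_n) : s != t -> uu s + uu t \in pos_roots n.
Proof.
move=> st; apply/pos_rootsP; left.
have /orP[h|h] : (s < t)%N || (t < s)%N by rewrite -neq_ltn.
  by exists s, t; split=> //; left.
by exists t, s; split=> //; left; rewrite addrC.
Qed.
Lemma pos_sub (s t : 'I_n) : (s < t)%N -> uu s - uu t \in pos_roots n.
Proof. by move=> st; apply/pos_rootsP; left; exists s, t; split=> //; right. Qed.
Lemma pos_double (s : 'I_n) : uu s *+ 2 \in pos_roots n.
Proof. by apply/pos_rootsP; right; exists s. Qed.

(** The pairing with the regular dominant vector (n, n-1, ..., 1), positive on all positive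
    roots. *)
Definition weight (a : 'rV[int]_n) : int := \sum_j a 0 j * (n - j)%:Z.
Let weightD a b : weight (a + b) = weight a + weight b.
Proof. by rewrite /weight -big_split /=; apply: eq_bigr => j _; rewrite mxE mulrDl. Qed.
Let weightN a : weight (- a) = - weight a.
Proof. by rewrite /weight -sumrN; apply: eq_bigr => j _; rewrite mxE mulNr. Qed.
Let weight_unit s : weight (uu s) = (n - s)%:Z.
Proof.
rewrite /weight (bigD1 s) //= mxE !eqxx mul1r big1 ?addr0 // => j /negPf js.
by rewrite mxE js andbF mul0r.
Qed.
Lemma weight_pos a : a \in pos_roots n -> 0 < weight a.
Proof.
case/pos_rootsP => [[s [t [st [->|->]]]]|[s ->]]; rewrite ?mulr2n !weightD ?weightN !weight_unit;
  have := ltn_ord s; try have := ltn_ord t; lia.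
Qed.
Lemma pos_rootsN a : a \in pos_roots n -> - a \in pos_roots n -> False.
Proof. by move=> /weight_pos h /weight_pos; rewrite weightN; lia. Qed.

Lemma simple_root_pos i : simple_root i \in pos_roots n.
Proof.
rewrite /simple_root; case hi: (i.+1 < n)%N; last exact: pos_double.
by apply: pos_sub; rewrite /= modn_small.
Qed.

Lemma act_simple_root i : act_signed (simple i) (simple_root i) = - simple_root i.
Proof.
rewrite /simple_root; case hi: (i.+1 < n)%N.
  by rewrite act_signedD act_signedN !act_simple_unit hi tpermL tpermR opprB.
by rewrite mulr2n act_signedD act_simple_unit hi eqxx expr1 scaleN1r opprD.
Qed.

Lemma act_simple_pos (i : 'I_n) b : b \in pos_roots n -> b != simple_root i -> act_signed (simple i) b \in pos_roots n.
Proof.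
case hi: (i.+1 < n)%N; rewrite /simple_root hi.
  have oi : ordS i = i.+1 :> nat := modn_small hi.
  set p := tperm i (ordS i).
  have pv (s : 'I_n) : p s = (if s == i :> nat then i.+1 else if s == i.+1 :> nat then i : nat else s) :> nat.
    rewrite /p; case: tpermP => [->|->|/eqP h1 /eqP h2].
    - by rewrite eqxx oi.
    - by rewrite oi eqxx; case: eqP => // h; lia.
    - by rewrite -oi !(inj_eq (@ord_inj n)) (negPf h1) (negPf h2).
  case/pos_rootsP => [[s [t [st [->|->]]]]|[s ->]] hb.
  - rewrite act_signedD !act_simple_unit hi; apply: pos_add; rewrite (inj_eq perm_inj).
    by apply/eqP => e; move: st; rewrite e ltnn.
  - rewrite act_signedD act_signedN !act_simple_unit hi; apply: pos_sub; rewrite -/p !pv.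
    have ne : ~ ((s : nat) = i /\ (t : nat) = i.+1).
      move=> [e1 e2]; move/eqP: hb; apply; congr (uu _ - uu _); apply: ord_inj => //; by rewrite oi.
    by case: (eqVneq (s : nat) (i : nat)) => h1; case: (eqVneq (s : nat) i.+1) => h2;
      case: (eqVneq (t : nat) (i : nat)) => h3; case: (eqVneq (t : nat) i.+1) => h4; lia.
  - by rewrite mulr2n act_signedD act_simple_unit hi -mulr2n; exact: pos_double.
have last (s t : 'I_n) : (s < t)%N -> (s == i) = false.
  by move=> st; apply/eqP => e; have := ltn_ord t; move: hi st; rewrite -e; lia.
case/pos_rootsP => [[s [t [st [->|->]]]]|[s ->]] hb.
- rewrite act_signedD !act_simple_unit hi (last _ _ st) scale1r; case: (t == i).
    by rewrite scaleN1r; exact: pos_sub.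
  by rewrite scale1r; apply: pos_add; apply/eqP => e; move: st; rewrite e ltnn.
- rewrite act_signedD act_signedN !act_simple_unit hi (last _ _ st) scale1r; case: (t == i).
    by rewrite scaleN1r opprK; apply: pos_add; apply/eqP => e; move: st; rewrite e ltnn.
  by rewrite scale1r; exact: pos_sub.
- have si : (s == i) = false by apply/eqP => e; move: hb; rewrite e eqxx.
  by rewrite mulr2n act_signedD act_simple_unit hi si scale1r -mulr2n; exact: pos_double.
Qed.

Lemma act_simple_posE i b : (act_signed (simple i) b \in pos_roots n) =
  (b \in pos_roots n) && (b != simple_root i) || (b == - simple_root i).
Proof.
apply/idP/idP => [h|/orP[/andP[h1 h2]|/eqP ->]]; last first.
- by rewrite act_signedN act_simple_root opprK simple_root_pos.
- exact: act_simple_pos.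
have [e|ne] := eqVneq (act_signed (simple i) b) (simple_root i).
  by rewrite -(act_simpleK i b) e act_simple_root eqxx orbT.
rewrite -{1}(act_simpleK i b) act_simple_pos //=; apply/orP; left; apply/eqP => e.
by apply: (pos_rootsN (simple_root_pos i)); rewrite -act_simple_root -e.
Qed.

(** Products over the list thereby are products over the set of roots. The coordinate sums 2 and 0
    separate the two kinds of short roots, and the entry 1, against the even entries of 2e_i,
    separates short from long. *)
Lemma uniq_pos_roots : uniq (pos_roots n).
Proof.
have u1 (s j : 'I_n) : uu s 0 j = (j == s)%:Z by rewrite mxE eqxx /=; case: (j == s).
have hp (t : 'I_n * 'I_n) : (t \in lt_pairs n) = (t.1 < t.2)%N by rewrite mem_filter mem_enum andbT.
have ul : uniq (lt_pairs n) by rewrite filter_uniq // enum_uniq.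
have rD (a b : 'rV[int]_n) j : (a + b) 0 j = a 0 j + b 0 j by rewrite mxE.
have rN (a : 'rV[int]_n) j : (- a) 0 j = - a 0 j by rewrite mxE.
have sumu s : \sum_j uu s 0 j = 1.
  by rewrite (bigD1 s) //= u1 eqxx big1 // => j /negPf js; rewrite u1 js.
have sumD a b : \sum_j (a + b) 0 j = \sum_j a 0 j + \sum_j b 0 j.
  by rewrite -big_split; apply: eq_bigr => j _; rewrite mxE.
have sumN a : \sum_j (- a) 0 j = - \sum_j a 0 j.
  by rewrite -sumrN; apply: eq_bigr => j _; rewrite mxE.
rewrite /pos_roots /short_roots cat_uniq cat_uniq; apply/and3P; split; [apply/and3P; split| |].
- rewrite map_inj_in_uniq // => -[s t] [s' t']; rewrite !hp /= => st st' e.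
  have ej (j : 'I_n) : ((j : nat) == s)%:Z + ((j : nat) == t)%:Z = ((j : nat) == s')%:Z + ((j : nat) == t')%:Z.
    by have /rowP/(_ j) := e; rewrite !rD ?rN !u1 -!val_eqE.
  have n1 : ((s : nat) == t) = false by lia.
  have n2 : ((t : nat) == s) = false by lia.
  suff [h1 h2] : (s = s' :> nat) /\ (t = t' :> nat) by congr (_, _); exact: ord_inj.
  move: (ej s) (ej t); rewrite !eqxx n1 n2.
  by have [?|?] := eqVneq (s : nat) s'; have [?|?] := eqVneq (s : nat) t';
    have [?|?] := eqVneq (t : nat) s'; have [?|?] := eqVneq (t : nat) t'; rewrite /=; lia.
- apply/hasPn => _ /mapP[t _ ->]; apply/mapP => -[t' _ e].
  by have := congr1 (fun a : 'rV[int]_n => \sum_j a 0 j) e; rewrite /= !sumD sumN !sumu.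
- rewrite map_inj_in_uniq // => -[s t] [s' t']; rewrite !hp /= => st st' e.
  have ej (j : 'I_n) : ((j : nat) == s)%:Z - ((j : nat) == t)%:Z = ((j : nat) == s')%:Z - ((j : nat) == t')%:Z.
    by have /rowP/(_ j) := e; rewrite !rD ?rN !u1 -!val_eqE.
  have n1 : ((s : nat) == t) = false by lia.
  have n2 : ((t : nat) == s) = false by lia.
  suff [h1 h2] : (s = s' :> nat) /\ (t = t' :> nat) by congr (_, _); exact: ord_inj.
  move: (ej s) (ej t); rewrite !eqxx n1 n2.
  by have [?|?] := eqVneq (s : nat) s'; have [?|?] := eqVneq (s : nat) t';
    have [?|?] := eqVneq (t : nat) s'; have [?|?] := eqVneq (t : nat) t'; rewrite /=; lia.
- apply/hasPn => _ /mapP[r _ ->]; apply/negP => /short_rootsP[s [t [st e]]].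
  have ne : (t == s) = false by apply/eqP => h; move: st; rewrite h ltnn.
  have : (uu r *+ 2) 0 s = 1.
    by case: e => ->; rewrite !mxE !eqxx /= eq_sym ne.
  by rewrite mulr2n !mxE !eqxx /=; case: (s == r).
- rewrite map_inj_uniq ?enum_uniq // => s s' /rowP/(_ s); rewrite !mulr2n !mxE !eqxx /=.
  by case: eqP.
Qed.

(** The coordinates of u applied to (n, n-1, ..., 1); a descent is a simple root that is negative on
    this vector. *)
Let rval u (j : 'I_n) : int := (-1) ^+ u.2 j * (n - u.1 j)%:Z.
Definition descent u (i : 'I_n) : bool :=
  if (i.+1 < n)%N then rval u i < rval u (ordS i) else rval u i < 0.

(** The image of (n, ..., 1) is then strictly decreasing and positive, so its entry in position j is
    at least n - j. As its absolute values are those of 1, ..., n in some order, it is the vector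
    itself. *)
Lemma no_descent u : (forall i, ~~ descent u i) -> forall j, u.1 j = j /\ u.2 j = false.
Proof.
move=> h.
have hlt (j : 'I_n) : (j.+1 < n)%N -> rval u (ordS j) + 1 <= rval u j.
  move=> jn; have := h j; rewrite /descent jn -leNgt => le.
  suff : rval u j <> rval u (ordS j) by lia.
  rewrite /rval => e.
  have oj : ordS j = j.+1 :> nat := modn_small jn.
  have : u.1 j = u.1 (ordS j).
    apply: ord_inj; have := ltn_ord (u.1 j); have := ltn_ord (u.1 (ordS j)).
    by move: e; case: (u.2 j); case: (u.2 (ordS j)); rewrite ?expr0 ?expr1; lia.
  by move/perm_inj/(congr1 (@nat_of_ord n)); rewrite oj; lia.
have hge k : forall j : 'I_n, (n - j)%N = k.+1 -> (n - j)%:Z <= rval u j.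
  elim: k => [|k IH] j jk; have jn := ltn_ord j.
    have := h j; rewrite /descent ifN; last by rewrite -leqNgt; lia.
    rewrite -leNgt /rval; have := ltn_ord (u.1 j).
    by case: (u.2 j); rewrite ?expr0 ?expr1; lia.
  have jn' : (j.+1 < n)%N by lia.
  have oj : ordS j = j.+1 :> nat := modn_small jn'.
  have ek : (n - ordS j)%N = k.+1 by rewrite oj; lia.
  have := IH _ ek; have := hlt j jn'; rewrite oj; lia.
have hj (j : 'I_n) : (n - j)%:Z <= rval u j by apply: (hge (n - j).-1); have := ltn_ord j; lia.
have e2 j : u.2 j = false.
  have := hj j; rewrite /rval; have := ltn_ord j; have := ltn_ord (u.1 j).
  by case: (u.2 j) => //; rewrite expr1; lia.
have e1 (j : 'I_n) : (u.1 j <= j)%N.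
  by have := hj j; rewrite /rval e2 expr0; have := ltn_ord j; have := ltn_ord (u.1 j); lia.
suff e0 k : forall j : 'I_n, (j : nat) = k -> u.1 j = j by move=> j; rewrite (e0 j).
elim/ltn_ind: k => k IH j jk; apply/eqP/negPn/negP => ne.
have lt : (u.1 j < j)%N by rewrite ltn_neqAle e1 andbT.
have := IH _ _ (u.1 j) erefl; rewrite -jk => /(_ lt) /perm_inj e.
by move: ne; rewrite e eqxx.
Qed.

(** Write u as the simple reflection after u'. That reflection changes the sign of no positive root
    other than its own, so the only root gained is the preimage b of the simple root under u'; the
    descent condition says that b is positive. *)
Lemma descent_split u i : descent u i -> let u' := comp_signed (simple i) u in exists b,
  [/\ (b \in short_roots n) = (i.+1 < n)%N, act_signed u' b = simple_root i,
      perm_eq (pos_roots_of u) (b :: pos_roots_of u') & forall a, act_signed u a = act_signed (simple i) (act_signed u' a)].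
Proof.
move=> hd u'.
have hu a : act_signed u a = act_signed (simple i) (act_signed u' a) by rewrite act_signed_comp act_simpleK.
have unit k : act_signed u' ((-1) ^+ u'.2 k *: uu (u'.1 k)) = uu k.
  by rewrite act_signedZ act_signed_unit scalerA -expr2 sqrr_sign scale1r.
have [b [bp bs ba]] : exists b, [/\ b \in pos_roots n, (b \in short_roots n) = (i.+1 < n)%N & act_signed u' b = simple_root i].
  move: hd; rewrite /descent /simple_root; case hi: (i.+1 < n)%N => hd.
    have ne : i != ordS i by rewrite -val_eqE /= modn_small //; lia.
    have e1 : rval u' i = rval u (ordS i).
      by rewrite /rval /u' /comp_signed /simple hi /= !ffunE permM tpermL.
    have e2 : rval u' (ordS i) = rval u i.
      by rewrite /rval /u' /comp_signed /simple hi /= !ffunE permM tpermR.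
    rewrite -e1 -e2 /rval in hd.
    have npi : u'.1 i != u'.1 (ordS i) by rewrite (inj_eq perm_inj).
    exists ((-1) ^+ u'.2 i *: uu (u'.1 i) - (-1) ^+ u'.2 (ordS i) *: uu (u'.1 (ordS i))).
    rewrite act_signedD act_signedN !unit.
    have l1 := ltn_ord (u'.1 i); have l2 := ltn_ord (u'.1 (ordS i)).
    move: hd; case: (u'.2 i); case: (u'.2 (ordS i)); rewrite ?expr0 ?expr1 ?scale1r ?scaleN1r ?mul1r ?mulN1r => hd.
    - have lt : (u'.1 (ordS i) < u'.1 i)%N by lia.
      rewrite addrC opprK pos_sub //; split=> //; apply/short_rootsP.
      by exists (u'.1 (ordS i)), (u'.1 i); split=> //; right.
    - by exfalso; lia.
    - rewrite opprK pos_add //; split=> //; apply/short_rootsP.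
      have /orP[h|h] : (u'.1 i < u'.1 (ordS i))%N || (u'.1 (ordS i) < u'.1 i)%N by rewrite -neq_ltn.
        by exists (u'.1 i), (u'.1 (ordS i)); split=> //; left.
      by exists (u'.1 (ordS i)), (u'.1 i); split=> //; left; rewrite addrC.
    - have lt : (u'.1 i < u'.1 (ordS i))%N by lia.
      rewrite pos_sub //; split=> //; apply/short_rootsP.
      by exists (u'.1 i), (u'.1 (ordS i)); split=> //; right.
  have s2 : u'.2 i = false.
    rewrite /u' /comp_signed /simple hi /= !ffunE perm1 eqxx /=.
    move: hd; rewrite /rval; case: (u.2 i) => //; rewrite expr0 mul1r; lia.
  exists (uu (u'.1 i) *+ 2); rewrite pos_double mulr2n act_signedD.
  have := unit i; rewrite s2 expr0 scale1r => ->; split=> //.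
  apply/negP => /short_rootsP[s [t [st e]]].
  have ne : (t == s) = false by apply/eqP => h; move: st; rewrite h ltnn.
  have : (uu (u'.1 i) + uu (u'.1 i)) 0 s = 1.
    by case: e => ->; rewrite !mxE !eqxx /= eq_sym ne.
  by rewrite !mxE !eqxx /=; case: (s == _).
exists b; split=> //; apply: uniq_perm.
- by rewrite filter_uniq // uniq_pos_roots.
- rewrite /= filter_uniq ?uniq_pos_roots // andbT mem_filter ba bp andbT.
  by apply/negP; exact: pos_rootsN (simple_root_pos i).
move=> a; rewrite in_cons !mem_filter hu -act_signedN act_simple_posE eqr_opp -ba.
rewrite (inj_eq (@act_signed_inj u')); have [->|ab] := eqVneq a b; first by rewrite orbT bp.
rewrite orbF -act_signedN (inj_eq (@act_signed_inj u')).
have [ap|_] := boolP (a \in pos_roots n); last by rewrite !andbF.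
suff -> : (- a != b) by rewrite !andbT.
by apply/eqP => e; apply: (pos_rootsN ap); rewrite e.
Qed.
End RootCombinatorics.

(** * Composition of the simple reflections *)

Section WeylIdentity.
Variables (F : numFieldType) (n : nat).
Implicit Types (Z : 'I_n -> F) (u : signed_perm n).

(** The power q^<a,z> as a function of the q^(z_j). *)
Definition root_value (a : 'rV[int]_n) Z : F := \prod_j Z j ^ a 0 j.

Lemma root_value_act u a b Z : act_signed u b = a -> root_value a (act_torus u Z) = root_value b Z.
Proof.
move=> <-; rewrite /root_value [RHS](reindex_inj (@perm_inj _ u.1)); apply: eq_bigr => j _.
rewrite mxE /act_torus; case: (u.2 j); rewrite ?expr0 ?expr1 ?mul1r ?mulN1r //.
by rewrite exprz_inv opprK.
Qed.

Lemma simple_value_root (i : 'I_n) Z : on_torus Z -> simple_value i Z = root_value (simple_root i) Z.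
Proof.
move=> hZ; rewrite /simple_value /simple_root /root_value; case hi: (i.+1 < n)%N.
  have oi : ordS i = i.+1 :> nat := modn_small hi.
  have ne : (ordS i == i) = false by rewrite -val_eqE /= modn_small //; lia.
  rewrite (bigD1 i) //= (bigD1 (ordS i)) /= ?ne // big1 => [|j /andP[/negPf j1 /negPf j2]].
    by rewrite !mxE !eqxx ne eq_sym ne /= subr0 sub0r mulr1 expr1z exprN1.
  by rewrite !mxE j1 j2 subrr expr0z.
rewrite (bigD1 i) //= big1 => [|j /negPf j1]; first by rewrite mulr2n !mxE !eqxx mulr1.
by rewrite mulr2n !mxE j1 expr0z.
Qed.

Lemma laurent_root a : laurent (root_value a).
Proof.
apply: (@laurent_prod F n _ _ (fun j Z => Z j ^ a 0 j)) => j; case: (a 0 j) => k.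
  by apply: laurentX; exact: laurent_coord.
apply: (@laurent_ext _ _ (fun Z => (Z j)^-1 ^+ k.+1)); last by apply: laurentX; exact: laurent_coordV.
by move=> Z _; rewrite exprVn.
Qed.

Variables (xi cst : F) (P Q : mpoly n F) (odd_case : bool) (e : nat).
Hypothesis Q_nonzero : exists2 Z, on_torus Z & meval (torus_s xi cst Z) Q != 0.
Local Notation num := (root_num xi odd_case e).
Local Notation den := (root_den xi odd_case).
Hypothesis simple_id : forall (i : 'I_n) Z, on_torus Z ->
  den (i.+1 < n)%N (simple_value i Z) * meval (torus_s xi cst Z) P *
    meval (torus_s xi cst (act_torus (simple i) Z)) Q =
  num (i.+1 < n)%N (simple_value i Z) * meval (torus_s xi cst (act_torus (simple i) Z)) P *
    meval (torus_s xi cst Z) Q.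

(** Evaluating on the unit vectors recovers the permutation and the signs. *)
Let act_torus_eq u v Z : (forall a : 'rV[int]_n, act_signed u a = act_signed v a) -> act_torus u Z = act_torus v Z.
Proof.
move=> h; apply: funext => j; have h1 (k : 'I_n) := congr1 (fun a : 'rV[int]_n => a 0 j) (h (unit_row k)).
have e1 : u.1 j = v.1 j.
  have := h1 (u.1 j); rewrite /= !mxE !eqxx /=; case: eqP => // _.
  by case: (u.2 j); case: (v.2 j).
have := h1 (u.1 j); rewrite /act_torus /= !mxE e1 !eqxx /= !mulr1.
by case: (u.2 j); case: (v.2 j).
Qed.

(** Induction on the number of roots in Sigma^+(u), by means of a descent u = s u'. Multiplying the
    simple identity at u'Z with the induction hypothesis introduces the factor Q at u'Z, which is
    not identically zero on the torus and is cancelled by [laurent_domain]. *)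
Lemma weyl_identity u Z : on_torus Z ->
  (\prod_(a <- pos_roots_of u) den (a \in short_roots n) (root_value a Z)) *
    meval (torus_s xi cst Z) P * meval (torus_s xi cst (act_torus u Z)) Q =
  (\prod_(a <- pos_roots_of u) num (a \in short_roots n) (root_value a Z)) *
    meval (torus_s xi cst (act_torus u Z)) P * meval (torus_s xi cst Z) Q.
Proof.
have [N] := ubnP (size (pos_roots_of u)); elim: N u Z => // N IH u Z; rewrite ltnS => hN hZ.
have [[i di]|nd] := pselect (exists i, descent u i); last first.
  have hd : forall j, u.1 j = j /\ u.2 j = false.
    by apply: no_descent => i; apply/negP => di; apply: nd; exists i.
  have -> : act_torus u Z = Z.
    by apply: funext => j; rewrite /act_torus; have [-> ->] := hd j.
  have -> : pos_roots_of u = [::].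
    apply/eqP; rewrite -size_eq0 size_filter -leqn0 leqNgt -has_count; apply/negP => /hasP[a ap].
    have -> : act_signed u a = a by apply/rowP => j; rewrite mxE; have [-> ->] := hd j; rewrite expr0 mul1r.
    exact: pos_rootsN ap.
  by rewrite !big_nil !mul1r mulrC.
have [b [bs ba bp hu]] := descent_split di; set u' := comp_signed _ _ in ba bp hu.
have uE Z' : act_torus u Z' = act_torus (simple i) (act_torus u' Z').
  by rewrite -act_torus_comp; apply: act_torus_eq => a; rewrite act_signed_comp.
have sz : (size (pos_roots_of u') < N)%N by rewrite (perm_size bp) in hN.
have lr := laurent_root.
have ld : laurent (fun Z => (\prod_(a <- pos_roots_of u) den (a \in short_roots n) (root_value a Z)) *
    meval (torus_s xi cst Z) P * meval (torus_s xi cst (act_torus u Z)) Q -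
  (\prod_(a <- pos_roots_of u) num (a \in short_roots n) (root_value a Z)) *
    meval (torus_s xi cst (act_torus u Z)) P * meval (torus_s xi cst Z) Q).
  apply: laurentB; apply: laurentM; try exact: laurent_torus_s; try exact: laurent_id.
    apply: laurentM; last exact: laurent_id.
    apply: (@laurent_prod F n _ _ (fun a Z => den (a \in short_roots n) (root_value a Z))) => a; exact: laurent_den.
  apply: laurentM; last exact: laurent_torus_s.
  apply: (@laurent_prod F n _ _ (fun a Z => num (a \in short_roots n) (root_value a Z))) => a; exact: laurent_num.
apply/eqP; rewrite -subr_eq0; apply/eqP; move: Z hZ.
apply: (laurent_domain ld (laurent_torus_s xi cst u' Q)); last exact: Q_act.
move=> Z hZ.
rewrite !(perm_big _ bp) !big_cons /= bs.
have := IH u' Z sz hZ; have := simple_id i (act_torus_on u' hZ).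
rewrite -uE (simple_value_root i (act_torus_on u' hZ)) (root_value_act Z ba).
set d1 := den _ _; set n1 := num _ _; set d2 := \prod_(_ <- _) _; set n2 := \prod_(_ <- _) _.
set p1 := meval (torus_s xi cst Z) P; set q1 := meval (torus_s xi cst Z) Q.
set p2 := meval (torus_s xi cst (act_torus u' Z)) P; set q2 := meval (torus_s xi cst (act_torus u' Z)) Q.
set p3 := meval (torus_s xi cst (act_torus u Z)) P; set q3 := meval (torus_s xi cst (act_torus u Z)) Q.
move: d1 n1 d2 n2 p1 q1 p2 q2 p3 q3 => d1 n1 d2 n2 p1 q1 p2 q2 p3 q3 e1 e2.
have -> : (d1 * d2 * p1 * q3 - n1 * n2 * p3 * q1) * q2 =
  d1 * q3 * (d2 * p1 * q2) - n2 * q1 * (n1 * p3 * q2) by ring.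
by rewrite e2 -e1; ring.
Qed.
End WeylIdentity.

(** * The theorem *)

Lemma cross_ratio (F : fieldType) (d n p1 p2 q1 q2 : F) : d != 0 -> q1 != 0 -> q2 != 0 ->
  d * p1 * q2 = n * p2 * q1 -> p1 / q1 = n / d * (p2 / q2).
Proof.
move=> d0 q10 q20 e; apply: (mulfI (mulf_neq0 (mulf_neq0 d0 q10) q20)).
transitivity (d * p1 * q2); first by field; rewrite q10.
by rewrite e; field; rewrite d0 q20.
Qed.

Section TorusCoordinates.
Variables (R : realType) (q : nat).
Hypothesis q1 : (1 < q)%N.
Local Notation xi := ((q%:R)^-1 : R[i]).
Let lnq : ln (q%:R : R) != 0. Proof. by rewrite lt0r_neq0 // ln_gt0 // ltr1n. Qed.

(** The imaginary shift of s_i for i < n introduces a sign: q^(-s_i) is -q times q^(z_i - z_{i+1}),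
    so the variable y = -q^(-1) q^(-s_i) of the hermitian series is the value of the simple root. *)
Lemma cpow_pi : cpow (q%:R : R) (0 +i* (pi / ln q%:R)) = -1.
Proof.
rewrite /cpow; have -> : (ln q%:R)%:C * (0 +i* (pi / ln q%:R)) = 0 +i* pi :> R[i].
  by apply: complex_ext => /=; field.
by rewrite /cexp /= expR0 cospi sinpi; apply: complex_ext => /=; ring.
Qed.

Lemma cpowN1 : cpow (q%:R : R) (- 1) = xi.
Proof. by have := cpow_real R q1 (-1); rewrite mulrN1z exprN1. Qed.

Definition long_shift (m : nat) : R[i] :=
  if odd m then - 1 + (0 +i* (pi / (2 * ln q%:R))) else - 2^-1.
Definition torus_point (n : nat) (z : 'rV[R[i]]_n) (j : 'I_n) : R[i] := cpow q%:R (z 0 j).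

(** The last reflection involves the last variable through its square, so only the square of this
    constant matters. The shift by pi i/(2 log q) for odd m supplies the minus sign that turns
    -q^(-2) q^(-2 s_n) into q^(2 z_n). *)
Lemma long_shift_sq m : cpow q%:R (long_shift m) ^+ 2 = if odd m then - xi ^+ 2 else xi.
Proof.
have sq (s : R[i]) : cpow (q%:R : R) s ^+ 2 = cpow q%:R (2%:R * s).
  by rewrite -[2%:R]/((2%:Z)%:~R) cpowMz.
rewrite sq /long_shift; case: (odd m).
  have -> : 2%:R * (- 1 + (0 +i* (pi / (2 * ln q%:R)))) = - 1 + - 1 + (0 +i* (pi / ln q%:R)) :> R[i].
    by apply: complex_ext => /=; field.
  by rewrite !cpowD cpow_pi cpowN1 mulrN1 expr2.
by rewrite mulrN divff ?pnatr_eq0 // cpowN1.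
Qed.

Lemma s_of_zE m (z : 'rV[R[i]]_(m./2)) j :
  cpow q%:R (s_of_z q z 0 j) = torus_s xi (cpow q%:R (long_shift m)) (torus_point z) j.
Proof.
rewrite mxE /torus_s /torus_point /long_shift; case: (j.+1 < m./2)%N.
  by rewrite !cpowD cpowN cpow_pi cpowN1; ring.
case: (odd m); last by rewrite cpowD cpowN mulrC.
by rewrite -addrA cpowD cpowN mulrC.
Qed.

Lemma eval_qpowE m (z : 'rV[R[i]]_(m./2)) (P : mpoly m./2 R[i]) :
  eval_qpow q P (s_of_z q z) = meval (torus_s xi (cpow q%:R (long_shift m)) (torus_point z)) P.
Proof. by apply: meval_eq => j; rewrite s_of_zE. Qed.

Lemma torus_point_act n (u : signed_perm n) (z : 'rV[R[i]]_n) :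
  torus_point (act_signed u z) = act_torus u (torus_point z).
Proof.
apply: funext => j; rewrite /torus_point mxE /act_torus; case: (u.2 j).
  by rewrite expr1 mulN1r cpowN.
by rewrite expr0 mul1r.
Qed.

Lemma root_value_pairing n (a : 'rV[int]_n) (z : 'rV[R[i]]_n) :
  root_value a (torus_point z) = cpow q%:R (pairing a z).
Proof. by rewrite /pairing cpow_sum; apply: eq_bigr => j _; rewrite cpowMz. Qed.

Lemma gamma_factorE e m (a : 'rV[int]_(m./2)) (z : 'rV[R[i]]_(m./2)) :
  gamma_factor q e a z = root_num xi (odd m) e (a \in short_roots m./2) (root_value a (torus_point z)) /
    root_den xi (odd m) (a \in short_roots m./2) (root_value a (torus_point z)).
Proof.
rewrite /gamma_factor /root_num /root_den /gamma_den root_value_pairing cpowD cpowN1.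
have -> : cpow q%:R (e%:R * pairing a z) = cpow q%:R (pairing a z) ^+ e.
  by have := cpowMz q%:R (pairing a z) e%:Z; rewrite -exprnP => <-.
case: (a \in short_roots _) => //=; case: (odd m); last by rewrite divr1.
by rewrite mulrA [_ * (1 - _)]mulrC.
Qed.
End TorusCoordinates.

Theorem theorem2p9 (R : realType)
  (p : nat) (Qp : fieldType) (absQp : Qp -> R) (hQp : is_padic_field p absQp)
  (k : fieldExtType Qp)
  (w : k) (hw : prime_element (ring_of_integers absQp k) w)
  (q : nat) (hq : (residue_field (ring_of_integers absQp k) #= `I_q)%card)
  (e : nat) (he : valuation (ring_of_integers absQp k) w 2%:R = e%:Z)
  (k' : fieldExtType k)
  (hk' : unramified_quadratic (ring_of_integers absQp k) w k')
  (c : {lrmorphism k' -> k'}) (hc : ~ (c =1 id))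
  (m : nat) (hm : (2 <= m)%N)
  (mu : {measure set
    (borel_mx (integral_closure (ring_of_integers absQp k) k') w%:A m) -> \bar R})
  (hmu : is_haar
    (max_compact (integral_closure (ring_of_integers absQp k) k') c m) mu)
  (hme : odd m -> (e <= 1)%N)
  (u : signed_perm m./2)
  (x : 'M[k']_m) (hx : hermitian_space c x)
  (P Q : mpoly m./2 R[i]) (hPQ : is_omega c q mu x P Q)
  (z : 'rV[R[i]]_(m./2))
  (hz : eval_qpow q Q (s_of_z q z) != 0)
  (huz : eval_qpow q Q (s_of_z q (act_signed u z)) != 0)
  (hGamma : Gamma_defined q u z) :
  ratfun q P Q (s_of_z q z) =
  Gamma_factor q e u z * ratfun q P Q (s_of_z q (act_signed u z)).
Proof.
have [rho [th H]] := padic_unramified_pair hQp hw hk' hc hq.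
have char0 j : j.+1%:R != 0 :> k'.
  by rewrite -scaler_nat scaler_eq0 negb_or oner_neq0 (extension_char0 hQp).
have v2 := padic_valuation2 hQp hw H he.
have m0 : (0 < m)%N by exact: ltnW.
have q1 := q_gt1 H.
pose c' : {rmorphism k' -> k'} := c.
have hx' : herm_inv c' x := hermitian_herm_inv m0 hx.
have [B hB] := @corner_lower _ _ _ c' _ _ _ H m x.
have xi0 : (q%:R)^-1 != 0 :> R[i] by rewrite invr_eq0 pnatr_eq0; lia.
have Z0 : on_torus (torus_point q z) by move=> j; exact: cpow_neq0.
have Qz : exists2 Z, on_torus Z &
    meval (torus_s (q%:R)^-1 (cpow q%:R (long_shift R q m)) Z) Q != 0.
  by exists (torus_point q z); [exact: Z0|move: hz; rewrite (eval_qpowE q1)].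
have simple_id := simple_identity xi0 (cpow_neq0 q%:R (long_shift R q m)) (long_shift_sq R q1 m)
  (@reflect_short _ _ _ _ c' _ _ _ H _ _ hmu _ hx' _ v2 _ _ hPQ _ hB)
  (@reflect_long_even _ _ _ _ c' _ _ _ H char0 _ _ hmu _ hx' _ v2 _ _ hPQ _ hB)
  (@reflect_long_odd _ _ _ _ c' _ _ _ H char0 _ _ hmu _ hx' _ v2 _ _ hPQ _ hB) Qz.
have := weyl_identity Qz simple_id u Z0.
rewrite -torus_point_act -!(eval_qpowE q1) => key.
rewrite /ratfun /Gamma_factor (eq_bigr _ (fun a _ => gamma_factorE q1 e a z)) prodf_div.
have den0 : \prod_(a <- pos_roots_of u) root_den (q%:R)^-1 (odd m) (a \in short_roots m./2)
    (root_value a (torus_point q z)) != 0.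
  rewrite prodf_seq_neq0; apply/allP => a ha; rewrite /= /root_den; case: ifP => [ho|_]; last exact: oner_neq0.
  by have := hGamma a ha ho; rewrite /gamma_den root_value_pairing.
exact: cross_ratio den0 hz huz key.
Qed.
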